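(* For every complex number $s$ with $\Re s>0$, $$\int_0^1x^{2s-1}E'(x)^2\,dx=\frac{\pi^3}{8}\,\Gamma(s)\,\Gamma(s+1)^2\,\Gamma(s+2)\;L\!\left(s+2,\,s,\,\tfrac12,\,\tfrac12;\;1;\;s+\tfrac32,\,s+\tfrac32\right).$$
   Context: $E(k)=\int_0^{\pi/2}\sqrt{1-k^2\sin^2\theta}\,d\theta$ is the complete elliptic integral of the second kind and $E'(x):=E(\sqrt{1-x^2})$ (the prime denotes the complementary modulus, not a derivative). ${}_pF_q$ denotes the generalized hypergeometric series ${}_pF_q(a_1,\dots,a_p;b_1,\dots,b_q;z)=\sum_{n\ge0}\frac{(a_1)_n\cdots(a_p)_n}{(b_1)_n\cdots(b_q)_n}\frac{z^n}{n!}$, with $(a)_0=1$, $(a)_n=a(a+1)\cdots(a+n-1)$. Mishev's completed function $L(a,b,c,d;e;f,g)$ is defined on the Saalschützian hyperplane $e+f+g-a-b-c-d=1$ in $\mathbb C^7$; for generic parameters, $$L(a,b,c,d;e;f,g)=\frac{{}_4F_3(a,b,c,d;\,e,f,g;\,1)}{\sin(\pi e)\Gamma(e)\Gamma(f)\Gamma(g)\prod_{\xi\in\{a,b,c,d\}}\Gamma(1+\xi-e)}-\frac{{}_4F_3(1+a-e,1+b-e,1+c-e,1+d-e;\,1+f-e,1+g-e,2-e;\,1)}{\sin(\pi e)\Gamma(a)\Gamma(b)\Gamma(c)\Gamma(d)\Gamma(1+f-e)\Gamma(1+g-e)\Gamma(2-e)},$$ and at parameter values where the individual terms are singular (for instance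 $e=1$), $L$ denotes the meromorphic continuation of this expression along the hyperplane. *)

(* Defs.v *)
From Stdlib Require Import Reals List Factorial.
From Coquelicot Require Import Coquelicot.
Import ListNotations.

Open Scope R_scope.

Definition ellipticE (k : R) : R :=
  RInt (fun theta => sqrt (1 - k ^ 2 * sin theta ^ 2)) 0 (PI / 2).

(* The prime is the complementary modulus, not a derivative. *)
Definition ellipticE' (x : R) : R := ellipticE (sqrt (1 - x ^ 2)).

Open Scope C_scope.

(* Componentwise, hence the usual limit (sum) whenever it exists in C. *)
Definition CLim_seq (u : nat -> C) : C :=
  (real (Lim_seq (fun n => Re (u n))), real (Lim_seq (fun n => Im (u n)))).

Definition CSeries (u : nat -> C) : C :=
  (Series (fun n => Re (u n)), Series (fun n => Im (u n))).

Definition Cexp (z : C) : C :=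
  ((exp (Re z) * cos (Im z))%R, (exp (Re z) * sin (Im z))%R).

Definition Csin (z : C) : C := (Cexp (Ci * z) - Cexp (- (Ci * z))) / (2 * Ci).

(* Principal power of a positive real base; not meaningful for x <= 0. *)
Definition Rcpow (x : R) (w : C) : C := Cexp (w * RtoC (ln x)).

Fixpoint poch (a : C) (n : nat) : C :=
  match n with
  | O => 1
  | S m => poch a m * (a + RtoC (INR m))
  end.

(* Gauss's limit  Gamma(z) = lim n! n^z / (z (z+1) ... (z+n)).
   Since / 0 = 0 in C, the value at a pole z = 0, -1, -2, ... is 0, so that
   / CGamma is everywhere the entire function 1 / Gamma. *)
Definition CGamma (z : C) : C :=
  CLim_seq (fun n => RtoC (INR (fact n)) * Rcpow (INR n) z / poch z (S n)).

Definition poch_prod (l : list C) (n : nat) : C :=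
  fold_right (fun a p => poch a n * p) 1 l.

Definition pFq (la lb : list C) (z : C) : C :=
  CSeries (fun n =>
    poch_prod la n / poch_prod lb n * (z ^ n / RtoC (INR (fact n)))).

Definition L_formula (a b c d e f g : C) : C :=
  pFq [a; b; c; d] [e; f; g] 1 /
    (Csin (RtoC PI * e) * CGamma e * CGamma f * CGamma g *
     (CGamma (1 + a - e) * CGamma (1 + b - e) *
      CGamma (1 + c - e) * CGamma (1 + d - e)))
  - pFq [1 + a - e; 1 + b - e; 1 + c - e; 1 + d - e]
        [1 + f - e; 1 + g - e; 2 - e] 1 /
    (Csin (RtoC PI * e) * CGamma a * CGamma b * CGamma c * CGamma d *
     CGamma (1 + f - e) * CGamma (1 + g - e) * CGamma (2 - e)).

Definition nonpos_integer (z : C) : Prop :=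
  exists n : nat, z = - RtoC (INR n).

(* Neither the sine nor any lower hypergeometric parameter is singular. *)
Definition L_generic (e f g : C) : Prop :=
  (forall n : Z, e <> RtoC (IZR n)) /\
  ~ nonpos_integer f /\ ~ nonpos_integer g /\
  ~ nonpos_integer (1 + f - e) /\ ~ nonpos_integer (1 + g - e).

(* The hyperplane e + f + g - a - b - c - d = 1 is identified with C^6 through
   the global linear chart (a, b, c, d, e, f). *)
Definition C6 : Type := (C * C * C * C * C * C)%type.

Definition hyp_g (a b c d e f : C) : C := 1 + a + b + c + d - e - f.

Definition holomorphic_near (M : C6 -> C) (p : C6) : Prop :=
  locally p (fun q =>
    ex_filterdiff (K := C_AbsRing) (V := C_NormedModule) M (locally q)).

Definition extends_L_formula_at (M : C6 -> C) (q : C6) : Prop :=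
  let '(a, b, c, d, e, f) := q in
  let g := hyp_g a b c d e f in
  L_generic e f g -> M q = L_formula a b c d e f g.

(* The meromorphic continuation of L_formula along the hyperplane is regular
   at the given point and takes the value l there.  Generic points are dense in
   the hyperplane, so l is unique. *)
Definition is_L (a b c d e f g l : C) : Prop :=
  g = hyp_g a b c d e f /\
  exists M : C6 -> C,
    holomorphic_near M (a, b, c, d, e, f) /\
    locally (a, b, c, d, e, f) (extends_L_formula_at M) /\
    M (a, b, c, d, e, f) = l.

Definition L (a b c d e f g : C) : C :=
  iota (T := C_R_CompleteNormedModule) (is_L a b c d e f g).

(* Main.v *)
(* Write H(w) = E'(sqrt w), mu(u) = int_0^1 w^(u-1) H(w) dw and let mu' be its derivative.  Integrating the
   differential equation of H by parts gives a two-term recurrence for mu, which identifies mu(u) with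
   (pi/2) Gamma(u) Gamma(u+1) / (Gamma(u+1/2) Gamma(u+3/2)).

   Left-hand side.  H is proportional to the logarithmic Frobenius solution at w = 0, whose n-th coefficients
   are mu'(n-1/2) and mu(n-1/2) because they satisfy the same recurrence.  Integrating one factor H of
   w^(s-1) H(w)^2 termwise, the integral is -1/pi^2 times the sum of the derivatives at t = 0, 1, 2, ... of
   mu(t-1/2) mu(s+t), suitably interpreted at t = 0.

   Right-hand side.  sin(pi e) L is holomorphic and its two terms agree at e = 1, so it is divisible by e - 1.
   On the line a_i - eps/2, e = 1 - eps the two terms are exchanged by eps -> -eps, hence the value of L is, up
   to Gamma factors, the sum over n of the derivatives at t = n of
   Phi(t) = Gamma(s+2+t) Gamma(s+t) Gamma(1/2+t)^2 / (Gamma(s+3/2+t) Gamma(1+t))^2.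

   By the Gamma formula for mu, (s+1) mu(t-1/2) mu(s+t) - s (pi/2)^2 Phi(t) = 2 (Psi(t) - Psi(t+1)) with
   Psi(t) = t (s+t+1/2) mu(t-1/2) mu(s+t); the derivatives of Psi at the integers tend to 0, so the two sums
   are proportional. *)
Require Import Defs.
From Stdlib Require Import Reals Lra Lia List Cantor FinFun ClassicalEpsilon FunctionalExtensionality Factorial.
From Coquelicot Require Import Coquelicot.
Import ListNotations.
Open Scope R_scope.

(* Exposes an equality in [R] stated in the carrier of a Coquelicot structure, for [ring] and [lra]. *)
Ltac eqR := match goal with |- @eq _ ?a ?b => change (@eq R a b) end.

(** [L] asks for a function complex differentiable in six variables at once, at a point where both
    terms of the formula are singular. That side is therefore carried by the predicate [An]: an
    absolutely convergent expansion on a polydisc with a bound for its l^1-norm. The class is closed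
    under products, inverses, exponentials, summable series and division by e - 1, and its bounds
    justify differentiating series term by term. Gamma enters through its reciprocal, whose Gauss
    products are polynomials times exponentials and have no poles.

    The shift by 1/2 that links H to its own Mellin transform comes from the recurrence: at u = n +
    1/2 the factors u^2 - 1/4 and u (u - 1) become n (n + 1) and n^2 - 1/4, those of the Frobenius
    recurrence at 0. The constants come from the ends of the interval: u mu(u) tends to H(1) = pi/2
    at infinity and to H(0) = 1 at 0, and comparing the two gives Gamma(1/2)^2 = pi. The
    continuation of mu vanishes at -1/2 with slope -4 mu(1/2) = -pi^2; this is the meaning of the
    term t = 0 and the source of the factor -1/pi^2. *)

Lemma sum_n_succ (a : nat -> R) n : sum_n a (S n) = sum_n a n + a (S n).
Proof. exact (sum_Sn a n). Qed.

(** * Double series summed along Cantor's pairing *)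

Fixpoint pair_sum (u : nat -> nat -> R) (l : list (nat * nat)) : R :=
  match l with
  | [] => 0
  | p :: l' => u (fst p) (snd p) + pair_sum u l'
  end.

Lemma pair_sum_app u l1 l2 : pair_sum u (l1 ++ l2) = pair_sum u l1 + pair_sum u l2.
Proof.
  induction l1 as [|p l1 IH]; simpl; [ring | rewrite IH; ring].
Qed.

Lemma pair_sum_pos u l : (forall i j, 0 <= u i j) -> 0 <= pair_sum u l.
Proof.
  intros Hu; induction l as [|p l IH]; simpl; [lra|].
  specialize (Hu (fst p) (snd p)); lra.
Qed.

Lemma pair_sum_incl u l l' : (forall i j, 0 <= u i j) -> NoDup l -> incl l l' ->
  pair_sum u l <= pair_sum u l'.
Proof.
  intros Hu Hl; revert l'; induction Hl as [|p l Hp Hl IH]; intros l' Hi; simpl.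
  - now apply pair_sum_pos.
  - destruct (in_split p l') as (l1 & l2 & ->); [apply Hi; now left|].
    assert (Hl' : incl l (l1 ++ l2)).
    { intros q Hq. assert (Hq' := Hi q (or_intror Hq)).
      apply in_app_or in Hq'; apply in_or_app.
      destruct Hq' as [?|[Heq|?]]; [now left| |now right].
      subst; now elim Hp. }
    specialize (IH _ Hl'). rewrite pair_sum_app in *; simpl. lra.
Qed.

Lemma sum_n_pairing u N :
  sum_n (fun k => u (fst (of_nat k)) (snd (of_nat k))) N = pair_sum u (map of_nat (seq 0 (S N))).
Proof.
  induction N as [|N IH].
  - rewrite sum_O. simpl. lra.
  - rewrite sum_n_succ, IH, (seq_S (S N)), map_app, pair_sum_app.
    change (0 + S N)%nat with (S N). cbn [map pair_sum]. eqR. ring.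
Qed.

Lemma pair_sum_row u i N : pair_sum u (map (fun j => (i, j)) (seq 0 (S N))) = sum_n (u i) N.
Proof.
  induction N as [|N IH].
  - rewrite sum_O; simpl; eqR; ring.
  - rewrite (seq_S (S N)), map_app, pair_sum_app, IH, sum_n_succ. change (0 + S N)%nat with (S N). cbn [map pair_sum fst snd]. eqR. ring.
Qed.

Lemma pair_sum_rectangle u M N :
  pair_sum u (list_prod (seq 0 (S M)) (seq 0 (S N))) = sum_n (fun i => sum_n (u i) N) M.
Proof.
  induction M as [|M IH].
  - rewrite sum_O. change (seq 0 1) with [0%nat]. cbn [list_prod].
    rewrite app_nil_r. apply pair_sum_row.
  - rewrite (seq_S (S M)), sum_n_succ, <- IH.
    assert (Ha : forall l1 l2 : list nat, list_prod (l1 ++ l2) (seq 0 (S N)) =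
       list_prod l1 (seq 0 (S N)) ++ list_prod l2 (seq 0 (S N))).
    { intros l1 l2; induction l1 as [|a l1 IH1]; [reflexivity|].
      cbn [app list_prod]. now rewrite IH1, app_assoc. }
    rewrite Ha, pair_sum_app. f_equal. cbn [list_prod]. rewrite app_nil_r. apply pair_sum_row.
Qed.

Lemma sum_n_le_is_series (a : nat -> R) l N : (forall n, 0 <= a n) -> is_series a l -> sum_n a N <= l.
Proof.
  intros Ha Hl. apply (is_lim_seq_incr_compare (sum_n a) l); [exact Hl|].
  intros n. rewrite sum_n_succ. specialize (Ha (S n)); lra.
Qed.

Lemma list_of_nat_bound (l : list (nat * nat)) :
  exists N, incl l (map of_nat (seq 0 (S N))).
Proof.
  induction l as [|p l (N & HN)].
  - exists 0%nat. intros p [].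
  - exists (Nat.max N (to_nat p)). intros q [<-|Hq].
    + apply in_map_iff. exists (to_nat p). split; [apply cancel_of_to|].
      apply in_seq. lia.
    + apply HN, in_map_iff in Hq. destruct Hq as (k & <- & Hk).
      apply in_map, in_seq. apply in_seq in Hk. lia.
Qed.

(** Tonelli's theorem by sandwiching: both coordinates of [of_nat k] are at most [k], so a partial
    sum of the enumeration lies inside a square; conversely every rectangle is contained in some
    initial segment of the enumeration. *)
Lemma is_series_pairing_pos (u : nat -> nat -> R) (U : nat -> R) (S : R) :
  (forall i j, 0 <= u i j) -> (forall i, is_series (u i) (U i)) -> is_series U S ->
  is_series (fun k => u (fst (of_nat k)) (snd (of_nat k))) S.
Proof.
  intros Hu HU HS.
  assert (HU0 : forall i, 0 <= U i).
  { intros i. eapply Rle_trans; [|apply (sum_n_le_is_series (u i) (U i) 0); auto].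
    rewrite sum_O. apply Hu. }
  assert (Hle : forall N, sum_n (fun k => u (fst (of_nat k)) (snd (of_nat k))) N <= S).
  { intros N. eapply Rle_trans; [|apply (sum_n_le_is_series U S N); auto].
    rewrite sum_n_pairing.
    apply Rle_trans with (pair_sum u (list_prod (seq 0 (Datatypes.S N)) (seq 0 (Datatypes.S N)))).
    - apply pair_sum_incl; auto.
      + apply Injective_map_NoDup; [|apply seq_NoDup].
        intros a b Hab. now apply of_nat_inj.
      + intros p Hp. apply in_map_iff in Hp. destruct Hp as (k & <- & Hk).
        apply in_seq in Hk. assert (Hk2 := cancel_to_of k).
        destruct (of_nat k) as (x, y). assert (H3 := to_nat_non_decreasing x y).
        apply in_prod; apply in_seq; lia.
    - rewrite pair_sum_rectangle. apply sum_n_m_le. intros i. apply sum_n_le_is_series; auto. }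
  change (is_lim_seq (sum_n (fun k => u (fst (of_nat k)) (snd (of_nat k)))) S).
  apply is_lim_seq_spec. intros eps.
  (* Half of [eps] is spent on cutting off the rows, half on truncating the rows that remain. *)
  assert (He2 : 0 < eps / 2) by (destruct eps; simpl; lra).
  assert (HS' : is_lim_seq (sum_n U) S) by exact HS.
  apply is_lim_seq_spec in HS'. destruct (HS' (mkposreal _ He2)) as (I & HI).
  specialize (HI I (le_n _)). simpl in HI.
  assert (Hrow : forall M, is_lim_seq (fun N => sum_n (fun i => sum_n (u i) N) M) (sum_n U M)).
  { induction M as [|M IH].
    - rewrite sum_O. apply is_lim_seq_ext with (sum_n (u 0%nat)); [|apply HU].
      intros n. now rewrite sum_O.
    - rewrite sum_n_succ. eapply is_lim_seq_ext.
      + intros n. symmetry. apply sum_n_succ.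
      + apply is_lim_seq_plus'; [apply IH|apply HU]. }
  specialize (Hrow I). apply is_lim_seq_spec in Hrow.
  destruct (Hrow (mkposreal _ He2)) as (J & HJ). specialize (HJ J (le_n _)). simpl in HJ.
  destruct (list_of_nat_bound (list_prod (seq 0 (Datatypes.S I)) (seq 0 (Datatypes.S J)))) as (N & HN).
  exists N. intros n Hn.
  assert (H1 : pair_sum u (list_prod (seq 0 (Datatypes.S I)) (seq 0 (Datatypes.S J))) <=
     pair_sum u (map of_nat (seq 0 (Datatypes.S n)))).
  { apply pair_sum_incl; auto.
    - assert (Hnd : forall (l1 l2 : list nat), NoDup l1 -> NoDup l2 -> NoDup (list_prod l1 l2)).
      { intros l1 l2 H1 H2. induction H1 as [|a l1 Ha H1 IH]; cbn [list_prod]; [constructor|].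
        apply NoDup_app; [|exact IH|].
        - apply Injective_map_NoDup; [|exact H2]. intros x y Hxy. congruence.
        - intros q Hq Hq'. apply in_map_iff in Hq. destruct Hq as (y & <- & _).
          apply in_prod_iff in Hq'. tauto. }
      apply Hnd; apply seq_NoDup.
    - intros q Hq. apply HN in Hq. apply in_map_iff in Hq. destruct Hq as (k & <- & Hk).
      apply in_map, in_seq. apply in_seq in Hk. lia. }
  rewrite pair_sum_rectangle, <- sum_n_pairing in H1. specialize (Hle n).
  apply Rabs_def2 in HI. apply Rabs_def2 in HJ. apply Rabs_def1; lra.
Qed.

(** Writes u as (|u| + u) - |u| and applies the nonnegative case to both parts. *)
Lemma is_series_pairing (u : nat -> nat -> R) (V : nat -> R) (U : nat -> R) (T S : R) :
  (forall i, is_series (fun j => Rabs (u i j)) (V i)) -> is_series V T ->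
  (forall i, is_series (u i) (U i)) -> is_series U S ->
  is_series (fun k => u (fst (of_nat k)) (snd (of_nat k))) S.
Proof.
  intros HV HT HU HS.
  assert (Hp := is_series_pairing_pos (fun i j => Rabs (u i j)) V T
    (fun i j => Rabs_pos _) HV HT).
  assert (Hq := is_series_pairing_pos (fun i j => Rabs (u i j) + u i j)
    (fun i => V i + U i) (T + S)).
  assert (Hq2 : is_series (fun k => Rabs (u (fst (of_nat k)) (snd (of_nat k)))
     + u (fst (of_nat k)) (snd (of_nat k))) (T + S)).
  { apply Hq.
    - intros i j. assert (H := Rle_abs (- u i j)). rewrite Rabs_Ropp in H. lra.
    - intros i. apply (is_series_plus (V := R_NormedModule)); auto.
    - apply (is_series_plus (V := R_NormedModule)); auto. }
  replace S with ((T + S) - T) by ring.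
  eapply is_series_ext; [|exact (is_series_minus (V := R_NormedModule) _ _ _ _ Hq2 Hp)].
  intros n. unfold minus, plus, opp; simpl. ring.
Qed.

(** * Series of complex numbers *)

Definition is_Cseries (u : nat -> C) (l : C) : Prop :=
  is_series (fun n => Re (u n)) (Re l) /\ is_series (fun n => Im (u n)) (Im l).

Lemma Re_plus (x y : C) : Re (x + y)%C = Re x + Re y.
Proof. reflexivity. Qed.
Lemma Im_plus (x y : C) : Im (x + y)%C = Im x + Im y.
Proof. reflexivity. Qed.
Lemma Re_mult (x y : C) : Re (x * y)%C = Re x * Re y - Im x * Im y.
Proof. reflexivity. Qed.
Lemma Im_mult (x y : C) : Im (x * y)%C = Re x * Im y + Im x * Re y.
Proof. reflexivity. Qed.
Lemma Re_opp (x : C) : Re (- x)%C = - Re x.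
Proof. reflexivity. Qed.
Lemma Im_opp (x : C) : Im (- x)%C = - Im x.
Proof. reflexivity. Qed.
Lemma Re_RtoC (x : R) : Re (RtoC x) = x.
Proof. reflexivity. Qed.
Lemma Im_RtoC (x : R) : Im (RtoC x) = 0.
Proof. reflexivity. Qed.

Lemma C_ext (x y : C) : Re x = Re y -> Im x = Im y -> x = y.
Proof. destruct x, y; simpl; intros -> ->; reflexivity. Qed.

Lemma im_le_Cmod (c : C) : Rabs (Im c) <= Cmod c.
Proof.
  eapply Rle_trans; [apply Rmax_r|apply (Rmax_Cmod c)].
Qed.

Lemma Cmod_le_Re_Im (c : C) : Cmod c <= Rabs (Re c) + Rabs (Im c).
Proof.
  assert (H1 := Rabs_pos (Re c)). assert (H2 := Rabs_pos (Im c)).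
  unfold Cmod. rewrite <- (sqrt_pow2 (Rabs (Re c) + Rabs (Im c))) by lra.
  apply sqrt_le_1_alt. fold (Re c) (Im c).
  rewrite <- (pow2_abs (Re c)), <- (pow2_abs (Im c)). nra.
Qed.

Lemma is_Cseries_ext u v l : (forall n, u n = v n) -> is_Cseries u l -> is_Cseries v l.
Proof.
  intros H [H1 H2]; split.
  - apply is_series_ext with (2 := H1). intros n; now rewrite H.
  - apply is_series_ext with (2 := H2). intros n; now rewrite H.
Qed.

Lemma is_Cseries_unique u l1 l2 : is_Cseries u l1 -> is_Cseries u l2 -> l1 = l2.
Proof.
  intros [A B] [A' B']. apply C_ext.
  - rewrite <- (is_series_unique _ _ A). now apply is_series_unique.
  - rewrite <- (is_series_unique _ _ B). now apply is_series_unique.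
Qed.

Lemma is_Cseries_plus u v l m : is_Cseries u l -> is_Cseries v m ->
  is_Cseries (fun n => u n + v n)%C (l + m)%C.
Proof.
  intros [A B] [A' B']; split.
  - exact (is_series_plus (V := R_NormedModule) _ _ _ _ A A').
  - exact (is_series_plus (V := R_NormedModule) _ _ _ _ B B').
Qed.

Lemma is_Cseries_scal c u l : is_Cseries u l -> is_Cseries (fun n => c * u n)%C (c * l)%C.
Proof.
  intros [A B]; split.
  - exact (is_series_minus (V := R_NormedModule) _ _ _ _
      (is_series_scal (V := R_NormedModule) (Re c) _ _ A)
      (is_series_scal (V := R_NormedModule) (Im c) _ _ B)).
  - exact (is_series_plus (V := R_NormedModule) _ _ _ _
      (is_series_scal (V := R_NormedModule) (Re c) _ _ B)
      (is_series_scal (V := R_NormedModule) (Im c) _ _ A)).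
Qed.

Lemma is_Cseries_scal_r c u l : is_Cseries u l -> is_Cseries (fun n => u n * c)%C (l * c)%C.
Proof.
  intros H. rewrite Cmult_comm. eapply is_Cseries_ext; [|apply (is_Cseries_scal c _ _ H)].
  intros n. apply Cmult_comm.
Qed.

Lemma is_Cseries_abs u : ex_series (fun n => Cmod (u n)) -> is_Cseries u (CSeries u).
Proof.
  intros H; split; apply Series_correct.
  - apply (ex_series_le (V := R_CompleteNormedModule) _ (fun n => Cmod (u n))); [|exact H].
    intros n. apply re_le_Cmod.
  - apply (ex_series_le (V := R_CompleteNormedModule) _ (fun n => Cmod (u n))); [|exact H].
    intros n. apply im_le_Cmod.
Qed.

Lemma Re_conj_mult (l x : C) : Re (Cconj l * x)%C <= Cmod l * Cmod x.
Proof.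
  eapply Rle_trans; [apply Rle_abs|]. eapply Rle_trans; [apply re_le_Cmod|].
  rewrite Cmod_mult. apply Req_le. f_equal.
  destruct l as [a b]. unfold Cmod; simpl. f_equal; ring.
Qed.

Lemma is_series_R_le (a b : nat -> R) (la lb : R) : (forall n, a n <= b n) ->
  is_series a la -> is_series b lb -> la <= lb.
Proof.
  intros H Ha Hb.
  apply (is_lim_seq_le (sum_n a) (sum_n b) la lb); [|exact Ha|exact Hb].
  intros n. now apply sum_n_m_le.
Qed.

(* Re (conj l * u n) <= |l| |u n|, summed, gives |l|^2 <= |l| B. *)
Lemma is_Cseries_bound u l B : is_Cseries u l -> is_series (fun n => Cmod (u n)) B -> Cmod l <= B.
Proof.
  intros Hu HB. destruct (is_Cseries_scal (Cconj l) u l Hu) as [H _].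
  assert (H1 := is_series_R_le _ _ _ _ (fun n => Re_conj_mult l (u n)) H
    (is_series_scal (V := R_NormedModule) (Cmod l) _ _ HB)).
  change (scal (Cmod l) B) with (Cmod l * B) in H1.
  assert (H2 : Re (Cconj l * l)%C = Cmod l * Cmod l).
  { unfold Cmod at 1 2. rewrite sqrt_sqrt by (destruct l; simpl; nra).
    destruct l; simpl; ring. }
  rewrite H2 in H1. destruct (Rle_lt_dec (Cmod l) 0) as [H3|H3].
  - eapply Rle_trans; [exact H3|].
    eapply Rle_trans; [|apply (sum_n_le_is_series _ B 0 (fun n => Cmod_ge_0 (u n)) HB)].
    rewrite sum_O. apply Cmod_ge_0.
  - apply Rmult_le_reg_l with (Cmod l); lra.
Qed.

Lemma is_Cseries_le u l (b : nat -> R) B : is_Cseries u l -> (forall n, Cmod (u n) <= b n) ->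
  is_series b B -> Cmod l <= B.
Proof.
  intros Hu Hb HB.
  assert (He : ex_series (fun n => Cmod (u n))).
  { apply (ex_series_le (V := R_CompleteNormedModule) _ b); [|now exists B].
    intros n. simpl. unfold norm; simpl. unfold abs; simpl.
    rewrite Rabs_pos_eq by apply Cmod_ge_0. apply Hb. }
  apply Rle_trans with (Series (fun n => Cmod (u n))).
  - apply (is_Cseries_bound u); [exact Hu|now apply Series_correct].
  - apply (is_series_R_le _ _ _ _ Hb); [now apply Series_correct|exact HB].
Qed.

Lemma ex_series_le_pos (a b : nat -> R) : (forall n, 0 <= a n <= b n) -> ex_series b -> ex_series a.
Proof.
  intros H Hb. apply (ex_series_le (V := R_CompleteNormedModule) _ b); [|exact Hb].
  intros n. unfold norm; simpl. unfold abs; simpl. rewrite Rabs_pos_eq; apply H.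
Qed.

Lemma is_Cseries_pairing (u : nat -> nat -> C) (b : nat -> nat -> R) (B : nat -> R) (T : R)
  (U : nat -> C) (S : C) :
  (forall i j, Cmod (u i j) <= b i j) -> (forall i, is_series (b i) (B i)) -> is_series B T ->
  (forall i, is_Cseries (u i) (U i)) -> is_Cseries U S ->
  is_Cseries (fun k => u (fst (of_nat k)) (snd (of_nat k))) S.
Proof.
  intros Hb HB HT HU HS.
  assert (Hd : forall a : nat -> nat -> R, (forall i j, Rabs (a i j) <= b i j) ->
    (forall i, is_series (fun j => Rabs (a i j)) (Series (fun j => Rabs (a i j)))) /\
    is_series (fun i => Series (fun j => Rabs (a i j)))
      (Series (fun i => Series (fun j => Rabs (a i j))))).
  { intros a Ha.
    assert (H1 : forall i, is_series (fun j => Rabs (a i j)) (Series (fun j => Rabs (a i j)))).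
    { intros i. apply Series_correct, (ex_series_le_pos _ (b i)); [|now exists (B i)].
      intros j; split; [apply Rabs_pos|apply Ha]. }
    split; [exact H1|]. apply Series_correct, (ex_series_le_pos _ B); [|now exists T].
    intros i; split.
    - eapply Rle_trans; [|apply (sum_n_le_is_series _ _ 0 (fun j => Rabs_pos (a i j)) (H1 i))].
      rewrite sum_O. apply Rabs_pos.
    - apply (is_series_R_le _ _ _ _ (Ha i)); [apply H1|apply HB]. }
  destruct (Hd (fun i j => Re (u i j))) as [R1 R2].
  { intros i j. eapply Rle_trans; [apply re_le_Cmod|apply Hb]. }
  destruct (Hd (fun i j => Im (u i j))) as [I1 I2].
  { intros i j. eapply Rle_trans; [apply im_le_Cmod|apply Hb]. }
  split.
  - exact (is_series_pairing (fun i j => Re (u i j)) _ _ _ _ R1 R2 (fun i => proj1 (HU i)) (proj1 HS)).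
  - exact (is_series_pairing (fun i j => Im (u i j)) _ _ _ _ I1 I2 (fun i => proj2 (HU i)) (proj2 HS)).
Qed.

Lemma is_series_finite (a : nat -> R) (N : nat) : (forall n, (N < n)%nat -> a n = 0) ->
  is_series a (sum_n a N).
Proof.
  intros H. change (is_lim_seq (sum_n a) (sum_n a N)).
  apply is_lim_seq_ext_loc with (fun _ => sum_n a N); [|apply is_lim_seq_const].
  exists N. intros n Hn. induction Hn as [|n Hn IH]; [reflexivity|].
  rewrite sum_n_succ, <- IH, H by lia. lra.
Qed.

Lemma is_Cseries_single (x : C) : is_Cseries (fun n => match n with O => x | _ => 0%C end) x.
Proof.
  split.
  - replace (Re x) with (sum_n (fun n => Re (match n with O => x | _ => 0%C end)) 0)
      by apply sum_O.
    apply is_series_finite. intros [|n] Hn; [lia|reflexivity].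
  - replace (Im x) with (sum_n (fun n => Im (match n with O => x | _ => 0%C end)) 0)
      by apply sum_O.
    apply is_series_finite. intros [|n] Hn; [lia|reflexivity].
Qed.

Lemma is_Cseries_two (x y : C) :
  is_Cseries (fun n => match n with 0%nat => x | 1%nat => y | _ => 0%C end) (x + y)%C.
Proof.
  split.
  - replace (Re (x + y)%C) with
      (sum_n (fun n => Re (match n with 0%nat => x | 1%nat => y | _ => 0%C end)) 1)
      by (rewrite sum_n_succ, sum_O; reflexivity).
    apply is_series_finite. intros [|[|n]] Hn; [lia|lia|reflexivity].
  - replace (Im (x + y)%C) with
      (sum_n (fun n => Im (match n with 0%nat => x | 1%nat => y | _ => 0%C end)) 1)
      by (rewrite sum_n_succ, sum_O; reflexivity).
    apply is_series_finite. intros [|[|n]] Hn; [lia|lia|reflexivity].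
Qed.

Lemma is_Cseries_decr (u : nat -> C) l : is_Cseries (fun n => u (S n)) l ->
  is_Cseries u (u 0%nat + l)%C.
Proof.
  intros [A B]. split; apply is_series_decr_1.
  - match goal with |- is_series _ ?x => replace x with (Re l) end; [exact A|].
    rewrite Re_plus. unfold plus, opp; simpl. eqR. ring.
  - match goal with |- is_series _ ?x => replace x with (Im l) end; [exact B|].
    rewrite Im_plus. unfold plus, opp; simpl. eqR. ring.
Qed.

(** * Absolutely convergent expansions in six variables *)

(** Every index from 5 on names the last coordinate, so that any word of naturals is a legitimate
    monomial. *)
Definition crd (i : nat) (h : C6) : C :=
  let '(a, b, c, d, e, f) := h in
  match i with 0%nat => a | 1%nat => b | 2%nat => c | 3%nat => d | 4%nat => e | _ => f end.

Definition mono (w : list nat) (h : C6) : C := fold_right (fun i p => (crd i h * p)%C) (RtoC 1) w.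

Definition small (R0 : R) (h : C6) : Prop := forall i, Cmod (crd i h) <= R0.

(* A power series on the polydisc of radius [R0], with words in the coordinates as
   (non-commutative) monomials and with l^1-norm at most [K]. *)
Definition An (R0 K : R) (f : C6 -> C) : Prop :=
  exists (c : nat -> C) (w : nat -> list nat) (K' : R), K' <= K /\
    is_series (fun j => Cmod (c j) * R0 ^ length (w j)) K' /\
    forall h, small R0 h -> is_Cseries (fun j => c j * mono (w j) h)%C (f h).

Lemma mono_app w1 w2 h : mono (w1 ++ w2) h = (mono w1 h * mono w2 h)%C.
Proof.
  unfold mono. induction w1 as [|i w1 IH]; cbn [app fold_right]; [ring|rewrite IH; ring].
Qed.

Lemma mono_bound R0 w h : small R0 h -> Cmod (mono w h) <= R0 ^ length w.
Proof.
  intros Hh. induction w as [|i w IH]; cbn [mono fold_right length pow].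
  - rewrite Cmod_1. lra.
  - rewrite Cmod_mult. apply Rmult_le_compat; try apply Cmod_ge_0; [apply Hh|exact IH].
Qed.

Lemma small_pos R0 h : small R0 h -> 0 <= R0.
Proof. intros H. eapply Rle_trans; [apply Cmod_ge_0|apply (H 0%nat)]. Qed.

Lemma An_weaken R0 K K1 f : K <= K1 -> An R0 K f -> An R0 K1 f.
Proof.
  intros H (c & w & K' & H1 & H2). exists c, w, K'; split; [lra|exact H2].
Qed.

Lemma An_ext R0 K f g : (forall h, small R0 h -> f h = g h) -> An R0 K f -> An R0 K g.
Proof.
  intros H (c & w & K' & H1 & H2 & H3). exists c, w, K'; repeat split; auto.
  - rewrite <- H by auto. apply H3; auto.
  - rewrite <- H by auto. apply H3; auto.
Qed.

Lemma An_bound R0 K f h : An R0 K f -> small R0 h -> Cmod (f h) <= K.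
Proof.
  intros (c & w & K' & H1 & H2 & H3) Hh. apply Rle_trans with K'; [|exact H1].
  apply (is_Cseries_le _ _ _ _ (H3 h Hh)) with (2 := H2).
  intros n. rewrite Cmod_mult. apply Rmult_le_compat_l; [apply Cmod_ge_0|now apply mono_bound].
Qed.

Lemma An_nonneg R0 K f : 0 <= R0 -> An R0 K f -> 0 <= K.
Proof.
  intros HR (c & w & K' & H1 & H2 & _). apply Rle_trans with (2 := H1).
  eapply Rle_trans; [|apply (sum_n_le_is_series _ _ 0) with (2 := H2)].
  - rewrite sum_O. apply Rmult_le_pos; [apply Cmod_ge_0|now apply pow_le].
  - intros n. apply Rmult_le_pos; [apply Cmod_ge_0|now apply pow_le].
Qed.

Lemma An_monomial R0 c w : 0 <= R0 -> An R0 (Cmod c * R0 ^ length w) (fun h => c * mono w h)%C.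
Proof.
  intros HR. exists (fun n => match n with O => c | _ => 0%C end),
    (fun n => match n with O => w | _ => [] end), (Cmod c * R0 ^ length w).
  split; [lra|split].
  - replace (Cmod c * R0 ^ length w) with
      (sum_n (fun j => Cmod (match j with O => c | _ => 0%C end) *
         R0 ^ length (match j with O => w | _ => [] end)) 0) by apply sum_O.
    apply is_series_finite. intros [|n] Hn; [lia|]. rewrite Cmod_0. ring.
  - intros h _. eapply is_Cseries_ext; [|apply is_Cseries_single].
    intros [|n]; simpl; ring.
Qed.

Lemma An_const R0 c : 0 <= R0 -> An R0 (Cmod c) (fun _ => c).
Proof.
  intros HR. apply An_ext with (fun h => c * mono [] h)%C.
  - intros h _. unfold mono; simpl. ring.
  - eapply An_weaken; [|now apply An_monomial]. simpl. lra.
Qed.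

Lemma An_crd R0 i : 0 <= R0 -> An R0 R0 (crd i).
Proof.
  intros HR. apply An_ext with (fun h => RtoC 1 * mono [i] h)%C.
  - intros h _. unfold mono; cbn [fold_right]. ring.
  - eapply An_weaken; [|now apply An_monomial]. simpl. rewrite Cmod_1. lra.
Qed.

(** The closure property on which the others rest. Expansions of all terms are chosen at once and
    merged into a single one along Cantor's pairing; the bounds [K n] make the double series
    absolutely convergent. *)
Lemma An_series R0 (K : nat -> R) T (f : nat -> C6 -> C) F : 0 <= R0 ->
  (forall n, An R0 (K n) (f n)) -> is_series K T ->
  (forall h, small R0 h -> is_Cseries (fun n => f n h) (F h)) -> An R0 T F.
Proof.
  intros HR Hf HK HF.
  apply choice in Hf. destruct Hf as (c & Hf). apply choice in Hf. destruct Hf as (w & Hf).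
  apply choice in Hf. destruct Hf as (K' & Hf).
  assert (HK' : ex_series K').
  { apply (ex_series_le_pos _ K); [|now exists T]. intros n.
    destruct (Hf n) as (H1 & H2 & _). split; [|exact H1].
    eapply Rle_trans; [|apply (sum_n_le_is_series _ _ 0) with (2 := H2)].
    - rewrite sum_O. apply Rmult_le_pos; [apply Cmod_ge_0|now apply pow_le].
    - intros k. apply Rmult_le_pos; [apply Cmod_ge_0|now apply pow_le]. }
  destruct HK' as (T' & HT').
  exists (fun k => c (fst (of_nat k)) (snd (of_nat k))),
    (fun k => w (fst (of_nat k)) (snd (of_nat k))), T'.
  split; [|split].
  - apply (is_series_R_le K' K); auto. intros n; apply Hf.
  - apply (is_series_pairing_pos (fun i j => Cmod (c i j) * R0 ^ length (w i j)) K'); auto.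
    + intros i j. apply Rmult_le_pos; [apply Cmod_ge_0|now apply pow_le].
    + intros i; apply Hf.
  - intros h Hh.
    apply (is_Cseries_pairing (fun i j => c i j * mono (w i j) h)%C
      (fun i j => Cmod (c i j) * R0 ^ length (w i j)) K' T' (fun n => f n h)); auto.
    + intros i j. rewrite Cmod_mult.
      apply Rmult_le_compat_l; [apply Cmod_ge_0|now apply mono_bound].
    + intros i; apply Hf.
    + intros i; now apply Hf.
Qed.

Lemma An_plus R0 K1 K2 f g : 0 <= R0 -> An R0 K1 f -> An R0 K2 g ->
  An R0 (K1 + K2) (fun h => f h + g h)%C.
Proof.
  intros HR Hf Hg.
  apply (An_series R0 (fun n => match n with 0%nat => K1 | 1%nat => K2 | _ => 0 end) _
    (fun n => match n with 0%nat => f | 1%nat => g | _ => fun _ => 0%C end)); auto.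
  - intros [|[|n]]; auto. apply An_weaken with (Cmod 0); [rewrite Cmod_0; lra|].
    now apply An_const.
  - replace (K1 + K2) with
      (sum_n (fun n => match n with 0%nat => K1 | 1%nat => K2 | _ => 0 end) 1)
      by (rewrite sum_n_succ, sum_O; reflexivity).
    apply is_series_finite. intros [|[|n]] Hn; [lia|lia|reflexivity].
  - intros h _. eapply is_Cseries_ext; [|apply is_Cseries_two]. intros [|[|n]]; reflexivity.
Qed.

(** Concatenating words multiplies the monomials and adds the lengths, so the norm is
    submultiplicative and the Cauchy product requires no regrouping by multi-indices. One factor is
    split into its monomials, and the products are summed by [An_series]. *)
Lemma An_mult R0 K1 K2 f g : 0 <= R0 -> An R0 K1 f -> An R0 K2 g ->
  An R0 (K1 * K2) (fun h => f h * g h)%C.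
Proof.
  intros HR (c & w & K & H1 & H2 & H3) Hg.
  assert (HK2 := An_nonneg _ _ _ HR Hg).
  assert (Hm : forall i, An R0 (K2 * (Cmod (c i) * R0 ^ length (w i)))
    (fun h => c i * mono (w i) h * g h)%C).
  { intros i. destruct Hg as (c' & w' & K' & G1 & G2 & G3).
    exists (fun j => c i * c' j)%C, (fun j => w i ++ w' j),
      (Cmod (c i) * R0 ^ length (w i) * K'). split; [|split].
    - rewrite Rmult_comm. apply Rmult_le_compat_r; [|exact G1].
      apply Rmult_le_pos; [apply Cmod_ge_0|now apply pow_le].
    - eapply is_series_ext; [|apply (is_series_scal (V := R_NormedModule)
        (Cmod (c i) * R0 ^ length (w i)) _ _ G2)].
      intros n. rewrite length_app, pow_add, Cmod_mult. unfold scal; simpl.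
      unfold mult; simpl. eqR. ring.
    - intros h Hh.
      eapply is_Cseries_ext; [|apply (is_Cseries_scal (c i * mono (w i) h)%C _ _ (G3 h Hh))].
      intros n. rewrite mono_app. ring. }
  apply (An_weaken R0 (K2 * K)).
  { rewrite (Rmult_comm K1). apply Rmult_le_compat_l; [apply HK2|exact H1]. }
  eapply (An_series R0 _ _ _ _ HR Hm).
  - exact (is_series_scal (V := R_NormedModule) K2 _ _ H2).
  - intros h Hh. apply is_Cseries_scal_r. now apply H3.
Qed.

Lemma An_scal R0 K c f : 0 <= R0 -> An R0 K f -> An R0 (Cmod c * K) (fun h => c * f h)%C.
Proof. intros HR Hf. apply An_mult; auto. now apply An_const. Qed.

Lemma An_opp R0 K f : 0 <= R0 -> An R0 K f -> An R0 K (fun h => - f h)%C.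
Proof.
  intros HR Hf. apply An_ext with (fun h => (- (1)) * f h)%C.
  - intros h _. ring.
  - eapply An_weaken; [|apply (An_scal R0 K); auto]. rewrite Cmod_opp, Cmod_1. lra.
Qed.

Lemma An_minus R0 K1 K2 f g : 0 <= R0 -> An R0 K1 f -> An R0 K2 g ->
  An R0 (K1 + K2) (fun h => f h - g h)%C.
Proof. intros HR Hf Hg. apply An_plus; auto. now apply An_opp. Qed.

Lemma An_pow R0 K f n : 0 <= R0 -> An R0 K f -> An R0 (K ^ n) (fun h => f h ^ n)%C.
Proof.
  intros HR Hf. induction n as [|n IH]; cbn [pow Cpow].
  - apply An_weaken with (Cmod 1); [rewrite Cmod_1; lra|]. now apply An_const.
  - now apply An_mult.
Qed.

(* Sums the Neumann series. *)
Lemma An_inv R0 K c f : 0 <= R0 -> An R0 K f -> K < Cmod c ->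
  An R0 (/ (Cmod c - K)) (fun h => / (c + f h))%C.
Proof.
  intros HR Hf HK. assert (HK0 := An_nonneg _ _ _ HR Hf).
  assert (Hc : c <> 0%C). { intros ->. rewrite Cmod_0 in HK. lra. }
  apply (An_series R0 (fun n => / Cmod c * (K / Cmod c) ^ n) _
    (fun n h => / c * (- / c * f h) ^ n)%C _ HR).
  - intros n. apply An_ext with (fun h => / c * (- / c) ^ n * f h ^ n)%C.
    { intros h _. rewrite Cpow_mult_l. ring. }
    eapply An_weaken; [|apply An_scal, An_pow; eauto].
    rewrite Cmod_mult, Cmod_pow, Cmod_opp, Cmod_inv by auto.
    unfold Rdiv. rewrite Rpow_mult_distr. apply Req_le. ring.
  - replace (/ (Cmod c - K)) with (/ Cmod c * / (1 - K / Cmod c)) by (field; lra).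
    apply (is_series_scal (V := R_NormedModule)).
    apply is_series_geom. rewrite Rabs_pos_eq.
    + apply Rmult_lt_reg_r with (Cmod c); [lra|]. unfold Rdiv. rewrite Rmult_assoc, Rinv_l; lra.
    + apply Rmult_le_pos; [lra|]. left. apply Rinv_0_lt_compat. lra.
  - intros h Hh. assert (Hfh := An_bound _ _ _ _ Hf Hh).
    set (q := (- / c * f h)%C).
    assert (Hq : Cmod q < 1).
    { unfold q. rewrite Cmod_mult, Cmod_opp, Cmod_inv by auto.
      apply Rmult_lt_reg_l with (Cmod c); [lra|].
      rewrite <- Rmult_assoc, Rinv_r by lra. lra. }
    assert (Hcf : (c + f h)%C <> 0%C).
    { intros H. assert (H' : f h = (- c)%C).
      { replace (f h) with ((c + f h) - c)%C by ring. rewrite H. ring. }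
      rewrite H', Cmod_opp in Hfh. lra. }
    assert (Hsum : is_Cseries (fun n => q ^ n)%C (CSeries (fun n => q ^ n)%C)).
    { apply is_Cseries_abs. exists (/ (1 - Cmod q)).
      eapply is_series_ext; [|apply is_series_geom].
      - intros n. symmetry. apply Cmod_pow.
      - rewrite Rabs_pos_eq; [exact Hq|apply Cmod_ge_0]. }
    set (Sq := CSeries (fun n => q ^ n)%C) in Hsum.
    assert (Hs : (Sq = 1 + q * Sq)%C).
    { apply (is_Cseries_unique (fun n => q ^ n)%C); [exact Hsum|].
      apply (is_Cseries_decr (fun n => q ^ n)%C). cbn [Cpow].
      now apply is_Cseries_scal. }
    replace (/ (c + f h))%C with (/ c * Sq)%C.
    + now apply is_Cseries_scal.
    + assert (Hone : ((1 - q) * Sq = 1)%C).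
      { replace ((1 - q) * Sq)%C with (Sq - q * Sq)%C by ring. rewrite Hs at 1. ring. }
      assert (Hcq : (c + f h = c * (1 - q))%C). { unfold q. field. exact Hc. }
      assert (Hq1 : (1 - q)%C <> 0%C).
      { intros H. rewrite H, Cmult_0_l in Hone. injection Hone. lra. }
      rewrite Hcq. replace Sq with (/ (1 - q))%C.
      * field; auto.
      * replace Sq with (/ (1 - q) * ((1 - q) * Sq))%C by (field; exact Hq1).
        rewrite Hone. ring.
Qed.

(** * Complex-valued functions of a real variable *)

Definition is_Cderive (f : R -> C) (t : R) (l : C) : Prop :=
  is_derive (fun x => Re (f x)) t (Re l) /\ is_derive (fun x => Im (f x)) t (Im l).

Definition is_CRInt (f : R -> C) (a b : R) (l : C) : Prop :=
  is_RInt (fun x => Re (f x)) a b (Re l) /\ is_RInt (fun x => Im (f x)) a b (Im l).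

Definition Ccont (f : R -> C) (t : R) : Prop :=
  continuous (fun x => Re (f x)) t /\ continuous (fun x => Im (f x)) t.

Lemma is_Cderive_ext f g t l : (forall x, f x = g x) -> is_Cderive f t l -> is_Cderive g t l.
Proof.
  intros H [A B]; split.
  - apply is_derive_ext with (2 := A). intros x; now rewrite H.
  - apply is_derive_ext with (2 := B). intros x; now rewrite H.
Qed.

Lemma is_Cderive_ext_loc f g t l : locally t (fun x => f x = g x) ->
  is_Cderive f t l -> is_Cderive g t l.
Proof.
  intros H [A B]; split.
  - apply is_derive_ext_loc with (2 := A). apply filter_imp with (2 := H). intros x Hx; now rewrite Hx.
  - apply is_derive_ext_loc with (2 := B). apply filter_imp with (2 := H). intros x Hx; now rewrite Hx.
Qed.

Lemma is_Cderive_unique f t l m : is_Cderive f t l -> is_Cderive f t m -> l = m.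
Proof.
  intros [A B] [A' B']. apply C_ext.
  - rewrite <- (is_derive_unique _ _ _ A). now apply is_derive_unique.
  - rewrite <- (is_derive_unique _ _ _ B). now apply is_derive_unique.
Qed.

Lemma is_Cderive_const c t : is_Cderive (fun _ => c) t 0%C.
Proof. split; apply @is_derive_const. Qed.

Lemma is_Cderive_plus f g t l m : is_Cderive f t l -> is_Cderive g t m ->
  is_Cderive (fun x => f x + g x)%C t (l + m)%C.
Proof. intros [A B] [A' B']; split; now apply @is_derive_plus. Qed.

Lemma is_Cderive_opp f t l : is_Cderive f t l -> is_Cderive (fun x => - f x)%C t (- l)%C.
Proof. intros [A B]; split; now apply @is_derive_opp. Qed.

Lemma is_Cderive_minus f g t l m : is_Cderive f t l -> is_Cderive g t m ->
  is_Cderive (fun x => f x - g x)%C t (l - m)%C.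
Proof. intros A B. apply is_Cderive_plus; [exact A|now apply is_Cderive_opp]. Qed.

Lemma is_Cderive_mult f g t l m : is_Cderive f t l -> is_Cderive g t m ->
  is_Cderive (fun x => f x * g x)%C t (l * g t + f t * m)%C.
Proof.
  intros [A B] [A' B']; split.
  - replace (Re (l * g t + f t * m)%C) with
      ((Re l * Re (g t) + Re (f t) * Re m) - (Im l * Im (g t) + Im (f t) * Im m))
      by (rewrite Re_plus, !Re_mult; ring).
    apply @is_derive_minus; apply @is_derive_mult; auto; intros; apply Rmult_comm.
  - replace (Im (l * g t + f t * m)%C) with
      ((Re l * Im (g t) + Re (f t) * Im m) + (Im l * Re (g t) + Im (f t) * Re m))
      by (rewrite Im_plus, !Im_mult; ring).
    apply @is_derive_plus; apply @is_derive_mult; auto; intros; apply Rmult_comm.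
Qed.

Lemma is_Cderive_eq f t l m : is_Cderive f t l -> l = m -> is_Cderive f t m.
Proof. intros H <-; exact H. Qed.

Lemma is_Cderive_RtoC (f : R -> R) (t l : R) : is_derive f t l -> is_Cderive (fun x => RtoC (f x)) t (RtoC l).
Proof. intros H; split; [exact H|exact (is_derive_const (K := R_AbsRing) (V := R_NormedModule) 0 t)]. Qed.

Lemma is_Cderive_comp (f : R -> C) (g : R -> R) t l m : is_Cderive f (g t) l -> is_derive g t m ->
  is_Cderive (fun x => f (g x)) t (m * l)%C.
Proof.
  intros [A B] H; split.
  - rewrite Re_mult, Re_RtoC, Im_RtoC, Rmult_0_l, Rminus_0_r.
    exact (is_derive_comp (fun x => Re (f x)) g t _ _ A H).
  - rewrite Im_mult, Re_RtoC, Im_RtoC, Rmult_0_l, Rplus_0_r.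
    exact (is_derive_comp (fun x => Im (f x)) g t _ _ B H).
Qed.

Lemma Ccont_derive f t l : is_Cderive f t l -> Ccont f t.
Proof.
  intros [A B]; split; apply @ex_derive_continuous; eexists; eassumption.
Qed.

Lemma is_CRInt_derive f df a b : a <= b ->
  (forall x, a <= x <= b -> is_Cderive f x (df x)) -> (forall x, a <= x <= b -> Ccont df x) ->
  is_CRInt df a b (f b - f a)%C.
Proof.
  intros Hab H1 H2. split.
  - apply (is_RInt_derive (V := R_CompleteNormedModule) (fun x => Re (f x)) (fun x => Re (df x)));
      intros x; rewrite Rmin_left, Rmax_right by exact Hab; intros Hx;
      [apply (H1 x Hx)|apply (H2 x Hx)].
  - apply (is_RInt_derive (V := R_CompleteNormedModule) (fun x => Im (f x)) (fun x => Im (df x)));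
      intros x; rewrite Rmin_left, Rmax_right by exact Hab; intros Hx;
      [apply (H1 x Hx)|apply (H2 x Hx)].
Qed.

(** The norm of the product module R * R is exactly [Cmod], so the triangle inequality for
    vector-valued integrals applies without loss of a constant. *)
Lemma is_CRInt_bound f (g : R -> R) a b l m : a <= b -> is_CRInt f a b l -> is_RInt g a b m ->
  (forall x, a <= x <= b -> Cmod (f x) <= g x) -> Cmod l <= m.
Proof.
  intros Hab [A B] Hm Hg.
  assert (H := is_RInt_fct_extend_pair (U := R_NormedModule) (V := R_NormedModule) f a b (Re l) (Im l) A B).
  assert (Hn : forall x : C, norm (x : prod_NormedModule R_AbsRing R_NormedModule R_NormedModule) = Cmod x).
  { intros x. change (sqrt (Rabs (fst x) ^ 2 + Rabs (snd x) ^ 2) = Cmod x).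
    now rewrite !pow2_abs. }
  assert (H' := norm_RInt_le _ g a b _ m Hab (fun x Hx => Rle_trans _ _ _ (Req_le _ _ (Hn (f x))) (Hg x Hx)) H Hm).
  rewrite Hn in H'. replace l with (Re l, Im l) by (destruct l; reflexivity). exact H'.
Qed.

(** * The complex exponential and its Taylor series *)

Lemma Cexp_0 : Cexp 0 = 1%C.
Proof. unfold Cexp; simpl. rewrite exp_0, cos_0, sin_0. apply C_ext; simpl; ring. Qed.

Lemma Cexp_plus x y : Cexp (x + y) = (Cexp x * Cexp y)%C.
Proof.
  unfold Cexp. rewrite Re_plus, Im_plus, exp_plus, cos_plus, sin_plus.
  apply C_ext; simpl; ring.
Qed.

Lemma Cmod_Cexp z : Cmod (Cexp z) = exp (Re z).
Proof.
  unfold Cexp, Cmod; simpl fst; simpl snd.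
  replace ((exp (Re z) * cos (Im z)) ^ 2 + (exp (Re z) * sin (Im z)) ^ 2) with
    (exp (Re z) ^ 2 * ((sin (Im z))² + (cos (Im z))²)) by (unfold Rsqr; ring).
  rewrite sin2_cos2, Rmult_1_r. apply sqrt_pow2. left. apply exp_pos.
Qed.

Lemma Cexp_neq_0 z : Cexp z <> 0%C.
Proof.
  intros H. assert (H' := Cmod_Cexp z). rewrite H, Cmod_0 in H'.
  assert (H2 := exp_pos (Re z)). lra.
Qed.

Lemma Cexp_opp z : Cexp (- z) = (/ Cexp z)%C.
Proof.
  assert (H := Cexp_plus z (- z)). replace (z + - z)%C with (RtoC 0) in H by ring.
  rewrite Cexp_0 in H. assert (H' := Cexp_neq_0 z).
  replace (Cexp (- z)) with (/ Cexp z * (Cexp z * Cexp (- z)))%C by (field; exact H').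
  rewrite <- H. ring.
Qed.

Lemma is_Cderive_Cexp z t : is_Cderive (fun x => Cexp (RtoC x * z)) t (z * Cexp (RtoC t * z))%C.
Proof.
  destruct z as [a b]. split; unfold Cexp; simpl.
  - auto_derive; [exact I|]. unfold Rminus. ring.
  - auto_derive; [exact I|]. unfold Rminus. ring.
Qed.

Fixpoint exp_partial (n : nat) (z : C) : C :=
  match n with
  | O => 1
  | S m => exp_partial m z + z ^ n / RtoC (INR (fact n))
  end%C.

Lemma INR_fact_neq_0_C n : RtoC (INR (fact n)) <> 0%C.
Proof. intros H. apply (INR_fact_neq_0 n). now injection H. Qed.

Lemma is_Cderive_id t : is_Cderive RtoC t 1%C.
Proof.
  split; [exact (is_derive_id t)|exact (is_derive_const (K := R_AbsRing) (V := R_NormedModule) 0 t)].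
Qed.

Lemma is_Cderive_pow t n : is_Cderive (fun x => RtoC x ^ S n)%C t (RtoC (INR (S n)) * RtoC t ^ n)%C.
Proof.
  induction n as [|n IH].
  - apply is_Cderive_ext with RtoC; [intros x; simpl; ring|].
    eapply is_Cderive_eq; [apply is_Cderive_id|]. simpl. ring.
  - eapply is_Cderive_eq; [exact (is_Cderive_mult RtoC _ t _ _ (is_Cderive_id t) IH)|].
    rewrite (S_INR (S n)), RtoC_plus. simpl Cpow. ring.
Qed.

Lemma is_Cderive_exp_partial n z t :
  is_Cderive (fun x => exp_partial (S n) (RtoC x * z)) t (z * exp_partial n (RtoC t * z))%C.
Proof.
  induction n as [|n IH].
  - apply is_Cderive_ext with (fun x => 1 + RtoC x * z)%C.
    { intros x. simpl. field. }
    eapply is_Cderive_eq.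
    + apply is_Cderive_plus; [apply is_Cderive_const|].
      apply is_Cderive_mult; [apply is_Cderive_id|apply is_Cderive_const].
    + simpl. ring.
  - set (k := S n) in *.
    apply is_Cderive_ext with (fun x => exp_partial k (RtoC x * z) +
      RtoC x ^ S k * (z ^ S k / RtoC (INR (fact (S k)))))%C.
    { intros x. cbn [exp_partial]. rewrite Cpow_mult_l. unfold Cdiv. ring. }
    eapply is_Cderive_eq.
    + apply is_Cderive_plus; [exact IH|].
      apply is_Cderive_mult; [apply is_Cderive_pow|apply is_Cderive_const].
    + change (exp_partial k (RtoC t * z)) with
        (exp_partial n (RtoC t * z) + (RtoC t * z) ^ k / RtoC (INR (fact k)))%C.
      rewrite Cpow_mult_l. rewrite fact_simpl, mult_INR, RtoC_mult.
      cbn [Cpow]. field. split; [apply INR_fact_neq_0_C|].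
      intros H. injection H as H. apply (not_0_INR (S k)) in H; [exact H|lia].
Qed.

(** Induction on the order: the derivative in t of the error of order n + 1 is z times the error of
    order n, and the error vanishes at t = 0, so each bound follows by integrating the previous one.
    The start is |exp(t z)| <= exp |z| on [0, 1]. *)
Lemma exp_partial_error n z t : 0 <= t <= 1 ->
  Cmod (Cexp (RtoC t * z) - exp_partial n (RtoC t * z)) <=
  exp (Cmod z) * Cmod z ^ S n * (t ^ S n / INR (fact (S n))).
Proof.
  assert (Hexp : forall x, 0 <= x <= 1 -> Cmod (Cexp (RtoC x * z)) <= exp (Cmod z)).
  { intros x Hx. rewrite Cmod_Cexp. rewrite Re_mult, Re_RtoC, Im_RtoC.
    assert (H1 : x * Re z <= Cmod z).
    { assert (H := re_le_Cmod z). assert (H2 := Rle_abs (Re z)). assert (H3 := Cmod_ge_0 z).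
      destruct (Rle_lt_dec 0 (Re z)); nra. }
    destruct H1 as [H1|H1].
    - left. apply exp_increasing. lra.
    - right. f_equal. lra. }
  assert (Hpow : forall k c x, 0 <= x -> is_RInt (fun y => c * (y ^ k / INR (fact k))) 0 x
     (c * (x ^ S k / INR (fact (S k))))).
  { intros k c x Hx.
    assert (HF : INR (fact (S k)) = INR (S k) * INR (fact k)) by (rewrite fact_simpl; apply mult_INR).
    assert (HF0 := INR_fact_neq_0 (S k)). assert (Hf0 := INR_fact_neq_0 k).
    assert (Hk0 : INR (S k) <> 0) by (apply not_0_INR; lia).
    set (F := INR (fact (S k))) in *. set (F' := INR (fact k)) in *.
    replace (c * (x ^ S k / F)) with (minus (c * (x ^ S k / F)) (c * (0 ^ S k / F))).
    2:{ unfold minus, plus, opp; simpl. eqR. field. exact HF0. }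
    apply (is_RInt_derive (fun y => c * (y ^ S k / F))).
    - intros y _. auto_derive; [exact I|].
      rewrite HF. change (pred (S k)) with k. change (match k with O => 1 | S _ => INR k + 1 end) with (INR (S k)). eqR. field. auto.
    - intros y _. apply @ex_derive_continuous. auto_derive. exact I. }
  revert t. induction n as [|n IH]; intros t Ht.
  - assert (H : (forall x, 0 <= x <= t -> Ccont (fun x => z * Cexp (RtoC x * z))%C x) ->
      is_CRInt (fun x => z * Cexp (RtoC x * z))%C 0 t (Cexp (RtoC t * z) - exp_partial 0 (RtoC t * z))).
    { replace (exp_partial 0 (RtoC t * z)) with (Cexp (RtoC 0 * z))
        by (simpl; rewrite Cmult_0_l, Cexp_0; reflexivity).
      apply (is_CRInt_derive (fun x => Cexp (RtoC x * z))); [apply Ht|].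
      intros x _; apply is_Cderive_Cexp. }
    eapply is_CRInt_bound; [apply (proj1 Ht)|apply H| |].
    + intros x _. eapply Ccont_derive. apply is_Cderive_mult; [apply is_Cderive_const|apply is_Cderive_Cexp].
    + apply (Hpow 0%nat (exp (Cmod z) * Cmod z ^ 1)); apply (proj1 Ht).
    + intros x Hx. cbv beta. rewrite Cmod_mult. simpl. assert (H1 := Hexp x ltac:(lra)).
      assert (H2 := Cmod_ge_0 z). unfold Rdiv. rewrite Rinv_1. nra.
  - assert (H := is_CRInt_derive (fun x => Cexp (RtoC x * z) - exp_partial (S n) (RtoC x * z))%C
      (fun x => z * (Cexp (RtoC x * z) - exp_partial n (RtoC x * z)))%C 0 t (proj1 Ht)).
    assert (Hd : forall x, is_Cderive (fun x => Cexp (RtoC x * z) - exp_partial (S n) (RtoC x * z))%C x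
      (z * (Cexp (RtoC x * z) - exp_partial n (RtoC x * z)))%C).
    { intros x. eapply is_Cderive_eq.
      - apply is_Cderive_minus; [apply is_Cderive_Cexp|apply is_Cderive_exp_partial].
      - ring. }
    replace (Cexp (RtoC t * z) - exp_partial (S n) (RtoC t * z))%C with
      ((Cexp (RtoC t * z) - exp_partial (S n) (RtoC t * z)) -
       (Cexp (RtoC 0 * z) - exp_partial (S n) (RtoC 0 * z)))%C.
    2:{ assert (H0 : forall k, exp_partial k (RtoC 0 * z) = 1%C).
        { rewrite Cmult_0_l. induction k as [|k IHk]; [reflexivity|].
          cbn [exp_partial Cpow]. rewrite IHk. unfold Cdiv. ring. }
        rewrite H0, Cmult_0_l, Cexp_0. ring. }
    eapply is_CRInt_bound; [apply (proj1 Ht)|apply H; [intros x _; apply Hd|]| |].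
    + intros x _.
      assert (Hex : exists l, is_Cderive (fun x => exp_partial n (RtoC x * z)) x l).
      { destruct n as [|n]; eexists; [exact (is_Cderive_const 1 x)|apply is_Cderive_exp_partial]. }
      destruct Hex as (l & Hl). eapply Ccont_derive.
      apply is_Cderive_mult; [apply is_Cderive_const|].
      exact (is_Cderive_minus _ _ _ _ _ (is_Cderive_Cexp z x) Hl).
    + apply (Hpow (S n) (exp (Cmod z) * Cmod z ^ S (S n))); apply (proj1 Ht).
    + intros x Hx. cbv beta. rewrite Cmod_mult. specialize (IH x ltac:(lra)).
      replace (exp (Cmod z) * Cmod z ^ S (S n) * (x ^ S n / INR (fact (S n)))) with
        (Cmod z * (exp (Cmod z) * Cmod z ^ S n * (x ^ S n / INR (fact (S n))))) by (simpl; ring).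
      apply Rmult_le_compat_l; [apply Cmod_ge_0|exact IH].
Qed.

Lemma is_Cseries_Cexp z : is_Cseries (fun n => z ^ n / RtoC (INR (fact n)))%C (Cexp z).
Proof.
  assert (Hs : forall n, Re (exp_partial n z) = sum_n (fun n => Re (z ^ n / RtoC (INR (fact n)))%C) n /\
     Im (exp_partial n z) = sum_n (fun n => Im (z ^ n / RtoC (INR (fact n)))%C) n).
  { induction n as [|n [IH1 IH2]].
    - rewrite !sum_O. replace (z ^ 0 / RtoC (INR (fact 0)))%C with (RtoC 1).
      + split; reflexivity.
      + simpl. field.
    - rewrite !sum_n_succ, <- IH1, <- IH2. split; reflexivity. }
  assert (Hlim : is_lim_seq (fun n => exp (Cmod z) * (Cmod z ^ S n / INR (fact (S n)))) 0).
  { replace (Finite 0) with (Rbar_mult (exp (Cmod z)) 0) by (simpl; f_equal; ring).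
    apply is_lim_seq_scal_l.
    apply (is_lim_seq_incr_1 (fun n => Cmod z ^ n / INR (fact n))).
    apply is_lim_seq_Reals. apply cv_speed_pow_fact. }
  assert (Hz := Cmult_1_l z).
  assert (Hle : forall n, Cmod (exp_partial n z - Cexp z) <= exp (Cmod z) * (Cmod z ^ S n / INR (fact (S n)))).
  { intros n. assert (H := exp_partial_error n z 1 ltac:(lra)). rewrite Cmult_1_l in H.
    replace (exp_partial n z - Cexp z)%C with (- (Cexp z - exp_partial n z))%C by ring.
    rewrite Cmod_opp. rewrite pow1 in H. unfold Rdiv in *. lra. }
  assert (Hgen : forall (a : nat -> R) l, (forall n, Rabs (a n - l) <=
     exp (Cmod z) * (Cmod z ^ S n / INR (fact (S n)))) -> is_lim_seq a l).
  { intros a l H. apply is_lim_seq_ext with (fun n => (a n - l) + l); [intros n; ring|].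
    replace (Finite l) with (Finite (0 + l)) by (f_equal; ring).
    apply is_lim_seq_plus'; [|apply is_lim_seq_const].
    apply is_lim_seq_abs_0.
    apply is_lim_seq_le_le with (2 := is_lim_seq_const 0) (3 := Hlim).
    intros n; split; [apply Rabs_pos|apply H]. }
  split.
  - apply (Hgen (sum_n _)). intros n. rewrite <- (proj1 (Hs n)).
    eapply Rle_trans; [|apply Hle]. apply (re_le_Cmod (exp_partial n z - Cexp z)%C).
  - apply (Hgen (sum_n _)). intros n. rewrite <- (proj2 (Hs n)).
    eapply Rle_trans; [|apply Hle]. apply (im_le_Cmod (exp_partial n z - Cexp z)%C).
Qed.

Lemma is_Cseries_incr (u : nat -> C) l : is_Cseries u l ->
  is_Cseries (fun n => u (S n)) (l - u 0%nat)%C.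
Proof.
  intros [A B]; split.
  - apply (is_series_incr_1 (V := R_NormedModule) (fun n => Re (u n))).
    match goal with |- is_series _ ?x => replace x with (Re l) end; [exact A|].
    change (Re l = Re l - Re (u 0%nat) + Re (u 0%nat)). ring.
  - apply (is_series_incr_1 (V := R_NormedModule) (fun n => Im (u n))).
    match goal with |- is_series _ ?x => replace x with (Im l) end; [exact B|].
    change (Im l = Im l - Im (u 0%nat) + Im (u 0%nat)). ring.
Qed.

Lemma An_Cexp R0 K f : 0 <= R0 -> An R0 K f -> An R0 (exp K) (fun h => Cexp (f h)).
Proof.
  intros HR Hf. assert (HK := An_nonneg _ _ _ HR Hf).
  apply (An_series R0 (fun n => / INR (fact n) * K ^ n) _
    (fun n h => f h ^ n / RtoC (INR (fact n)))%C); auto.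
  - intros n. apply An_ext with (fun h => / RtoC (INR (fact n)) * f h ^ n)%C.
    { intros h _. unfold Cdiv. ring. }
    eapply An_weaken; [|apply An_scal, An_pow; eauto].
    rewrite Cmod_inv by apply INR_fact_neq_0_C. rewrite Cmod_R, Rabs_pos_eq by apply pos_INR. lra.
  - assert (H := is_exp_Reals K). unfold is_pseries in H.
    eapply is_series_ext; [|exact H]. intros n. rewrite pow_n_pow. apply Rmult_comm.
  - intros h _. apply is_Cseries_Cexp.
Qed.

Lemma fact_ge_pow2 n : 2 ^ S n <= INR (fact (S (S n))).
Proof.
  induction n as [|n IH]; [simpl; lra|].
  rewrite fact_simpl, mult_INR. assert (H : 2 <= INR (S (S (S n)))).
  { apply (le_INR 2). lia. }
  assert (0 < 2 ^ S n) by (apply pow_lt; lra).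
  change (2 ^ S (S n)) with (2 * 2 ^ S n). apply Rmult_le_compat; lra.
Qed.

(** The tail of the exponential series from order 2 on. Since K <= 1 and (n + 2)! >= 2^(n + 1), the
    term of order n + 2 has norm at most K^2 / 2^(n + 1), and these sum to K^2. *)
Lemma An_Cexp_taylor R0 K f : 0 <= R0 -> An R0 K f -> K <= 1 ->
  An R0 (K ^ 2) (fun h => Cexp (f h) - 1 - f h)%C.
Proof.
  intros HR Hf HK1. assert (HK := An_nonneg _ _ _ HR Hf).
  apply (An_series R0 (fun n => K ^ 2 * / 2 * (/ 2) ^ n) _
    (fun n h => f h ^ (S (S n)) / RtoC (INR (fact (S (S n)))))%C); auto.
  - intros n. set (m := S (S n)). apply An_ext with (fun h => / RtoC (INR (fact m)) * f h ^ m)%C.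
    { intros h _. unfold Cdiv. ring. }
    eapply An_weaken; [|apply An_scal, An_pow; eauto].
    rewrite Cmod_inv by apply INR_fact_neq_0_C. rewrite Cmod_R, Rabs_pos_eq by apply pos_INR.
    assert (H2 : 0 < 2 ^ S n) by (apply pow_lt; lra). assert (H3 := fact_ge_pow2 n).
    rewrite pow_inv. rewrite Rmult_assoc. rewrite <- Rinv_mult. change (2 * 2 ^ n) with (2 ^ S n).
    rewrite Rmult_comm. apply Rmult_le_compat.
    + now apply pow_le.
    + left. apply Rinv_0_lt_compat. unfold m. lra.
    + unfold m. change (K ^ S (S n)) with (K * (K * K ^ n)). change (K ^ 2) with (K * (K * 1)).
      assert (0 <= K ^ n <= 1). { split; [now apply pow_le|]. rewrite <- (pow1 n). now apply pow_incr. }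
      assert (0 <= K * K) by nra. nra.
    + apply Rinv_le_contravar; [exact H2|exact H3].
  - assert (Hq : Rabs (/ 2) < 1) by (rewrite Rabs_pos_eq; lra).
    assert (H := is_series_scal (V := R_NormedModule) (K ^ 2 * / 2) _ _ (is_series_geom _ Hq)).
    match type of H with is_series _ ?x => replace x with (K ^ 2) in H; [exact H|] end.
    change (K ^ 2 = K ^ 2 * / 2 * / (1 - / 2)). field.
  - intros h _. assert (H := is_Cseries_incr _ _ (is_Cseries_incr _ _ (is_Cseries_Cexp (f h)))).
    replace (Cexp (f h) - 1 - f h)%C with
      (Cexp (f h) - f h ^ 0 / INR (fact 0) - f h ^ 1 / INR (fact 1))%C; [exact H|].
    simpl. field.
Qed.

(** * Complex differentiability in six variables *)

(** The nested product structure over C that [holomorphic_near] uses on [C6]. Taking C as the ring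
    of scalars is what makes the differentials complex linear. *)
Definition V6 : NormedModule C_AbsRing :=
  prod_NormedModule C_AbsRing
    (prod_NormedModule C_AbsRing
      (prod_NormedModule C_AbsRing
        (prod_NormedModule C_AbsRing
          (prod_NormedModule C_AbsRing C_NormedModule C_NormedModule)
          C_NormedModule)
        C_NormedModule)
      C_NormedModule)
    C_NormedModule.

Lemma crd_plus i (x y : V6) : crd i (plus x y) = (crd i x + crd i y)%C.
Proof.
  destruct x as [[[[[x0 x1] x2] x3] x4] x5], y as [[[[[y0 y1] y2] y3] y4] y5].
  destruct i as [|[|[|[|[|i]]]]]; reflexivity.
Qed.

Lemma crd_scal i k (x : V6) : crd i (scal k x) = (k * crd i x)%C.
Proof.
  destruct x as [[[[[x0 x1] x2] x3] x4] x5].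
  destruct i as [|[|[|[|[|i]]]]]; reflexivity.
Qed.

Lemma crd_zero i : crd i (zero : V6) = 0%C.
Proof. destruct i as [|[|[|[|[|i]]]]]; reflexivity. Qed.

Lemma crd_norm i (x : V6) : Cmod (crd i x) <= norm x.
Proof.
  assert (Hp : forall (U V : NormedModule C_AbsRing) (p : prod_NormedModule C_AbsRing U V),
    norm (fst p) <= norm p /\ norm (snd p) <= norm p).
  { intros U V p. unfold norm at 2 4; simpl. unfold prod_norm.
    assert (H1 := norm_ge_0 (fst p)). assert (H2 := norm_ge_0 (snd p)).
    split; rewrite <- sqrt_pow2 at 1 by assumption; apply sqrt_le_1_alt; nra. }
  assert (H5 : Cmod (snd x) <= norm x) by apply (Hp _ _ x).
  assert (K5 : norm (fst x) <= norm x) by apply (Hp _ _ x).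
  assert (H4 : Cmod (snd (fst x)) <= norm (fst x)) by apply (Hp _ _ (fst x)).
  assert (K4 : norm (fst (fst x)) <= norm (fst x)) by apply (Hp _ _ (fst x)).
  assert (H3 : Cmod (snd (fst (fst x))) <= norm (fst (fst x))) by apply (Hp _ _ (fst (fst x))).
  assert (K3 : norm (fst (fst (fst x))) <= norm (fst (fst x))) by apply (Hp _ _ (fst (fst x))).
  assert (H2 : Cmod (snd (fst (fst (fst x)))) <= norm (fst (fst (fst x))))
    by apply (Hp _ _ (fst (fst (fst x)))).
  assert (K2 : norm (fst (fst (fst (fst x)))) <= norm (fst (fst (fst x))))
    by apply (Hp _ _ (fst (fst (fst x)))).
  assert (H1 : Cmod (snd (fst (fst (fst (fst x))))) <= norm (fst (fst (fst (fst x)))))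
    by apply (Hp _ _ (fst (fst (fst (fst x))))).
  assert (H0 : Cmod (fst (fst (fst (fst (fst x))))) <= norm (fst (fst (fst (fst x)))))
    by apply (Hp _ _ (fst (fst (fst (fst x))))).
  destruct x as [[[[[x0 x1] x2] x3] x4] x5]; cbn [fst snd] in *.
  destruct i as [|[|[|[|[|i]]]]]; cbn [crd]; lra.
Qed.

Lemma small_norm (x : V6) : small (norm x) x.
Proof. intros i. apply crd_norm. Qed.

Lemma small_weaken r1 r2 h : r1 <= r2 -> small r1 h -> small r2 h.
Proof. intros H Hh i. eapply Rle_trans; [apply Hh|exact H]. Qed.

(** A factor q_i + h_i of a translated monomial has norm at most R1 + R2, so the translated
    monomials obey the majorant of the original expansion, and [An_series] sums them. *)
Lemma An_translate R1 R2 K f (q : V6) : 0 <= R2 -> small R1 q -> An (R1 + R2) K f ->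
  An R2 K (fun h => f (plus q (h : V6))).
Proof.
  intros HR Hq (c & w & K' & H1 & H2 & H3). apply An_weaken with (1 := H1).
  assert (HR1 := small_pos _ _ Hq).
  apply (An_series R2 _ _ (fun j h => c j * mono (w j) (plus q (h : V6)))%C _ HR) with (2 := H2).
  - intros n. apply An_scal; [exact HR|].
    induction (w n) as [|i v IH]; cbn [mono fold_right length pow].
    + apply An_weaken with (Cmod 1); [rewrite Cmod_1; lra|]. now apply An_const.
    + apply An_mult; auto.
      apply An_ext with (fun h => crd i q + crd i h)%C.
      { intros h _. symmetry. apply crd_plus. }
      apply An_plus; auto; [|now apply An_crd].
      eapply An_weaken; [apply Hq|]. now apply An_const.
  - intros h Hh. apply H3. intros i. rewrite crd_plus.
    eapply Rle_trans; [apply Cmod_triangle|]. specialize (Hq i); specialize (Hh i). lra.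
Qed.

(** The linear part collects the words of length one and the words of length zero cancel. A word of
    length at least two is at most (r / R0)^2 times its bound on the full polydisc, which makes the
    remainder quadratic. *)
Lemma An_taylor R0 K f : 0 < R0 -> An R0 K f ->
  exists l : V6 -> C_NormedModule, is_linear l /\
    (forall h r, 0 <= r -> small r h -> Cmod (l h) <= K * (r / R0)) /\
    (forall h r, r <= R0 -> small r h ->
       Cmod (f h - f (zero : V6) - l h)%C <= K * (r / R0) ^ 2).
Proof.
  intros HR (c & w & K' & H1 & H2 & H3).
  set (u := fun (j : nat) (h : V6) =>
    match w j with [i] => (c j * crd i h)%C | _ => RtoC 0 end).
  assert (Hu : forall j h r, 0 <= r -> small r h ->
    Cmod (u j h) <= (r / R0) * (Cmod (c j) * R0 ^ length (w j))).
  { intros j h r Hr Hh. unfold u. destruct (w j) as [|i [|i' v]].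
    - rewrite Cmod_0. repeat apply Rmult_le_pos; try apply Cmod_ge_0; try lra.
      left; now apply Rinv_0_lt_compat. simpl; lra.
    - rewrite Cmod_mult. simpl. replace (r / R0 * (Cmod (c j) * (R0 * 1))) with (Cmod (c j) * r)
        by (field; lra).
      apply Rmult_le_compat_l; [apply Cmod_ge_0|apply Hh].
    - rewrite Cmod_0. repeat apply Rmult_le_pos; try apply Cmod_ge_0; try lra.
      + left; now apply Rinv_0_lt_compat.
      + apply pow_le; lra. }
  assert (HK' : 0 <= K').
  { eapply Rle_trans; [|apply (sum_n_le_is_series _ _ 0) with (2 := H2)].
    - rewrite sum_O. apply Rmult_le_pos; [apply Cmod_ge_0|apply pow_le; lra].
    - intros k. apply Rmult_le_pos; [apply Cmod_ge_0|apply pow_le; lra]. }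
  assert (Hs : forall h, is_Cseries (fun j => u j h) (CSeries (fun j => u j h))).
  { intros h. apply is_Cseries_abs.
    apply (ex_series_le_pos _ (fun j => (norm h / R0) * (Cmod (c j) * R0 ^ length (w j)))).
    - intros n; split; [apply Cmod_ge_0|]. apply Hu; [apply norm_ge_0|apply small_norm].
    - eexists. exact (is_series_scal (V := R_NormedModule) (norm h / R0) _ _ H2). }
  set (l := fun h : V6 => CSeries (fun j => u j h)).
  assert (Hlb : forall h r, 0 <= r -> small r h -> Cmod (l h) <= K * (r / R0)).
  { intros h r Hr Hh. apply Rle_trans with ((r / R0) * K').
    - apply (is_Cseries_le _ _ _ _ (Hs h) (fun n => Hu n h r Hr Hh)).
      exact (is_series_scal (V := R_NormedModule) (r / R0) _ _ H2).
    - rewrite Rmult_comm. apply Rmult_le_compat_r; [|exact H1].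
      apply Rmult_le_pos; [exact Hr|left; now apply Rinv_0_lt_compat]. }
  exists l. split; [|split].
  - split.
    + intros x y. apply (is_Cseries_unique (fun j => u j (plus x y))); [apply Hs|].
      eapply is_Cseries_ext; [|apply (is_Cseries_plus _ _ _ _ (Hs x) (Hs y))].
      intros n. unfold u. destruct (w n) as [|i [|i' v]]; [ring|rewrite crd_plus; ring|ring].
    + intros k x. apply (is_Cseries_unique (fun j => u j (scal k x))); [apply Hs|].
      eapply is_Cseries_ext; [|apply (is_Cseries_scal k _ _ (Hs x))].
      intros n. unfold u. destruct (w n) as [|i [|i' v]]; [ring|rewrite crd_scal; ring|ring].
    + exists (K / R0 + 1). split.
      * assert (0 <= K / R0). { apply Rmult_le_pos; [lra|left; now apply Rinv_0_lt_compat]. } lra.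
      * intros x. assert (H := Hlb x (norm x) (norm_ge_0 x) (small_norm x)).
        change (norm (l x)) with (Cmod (l x)). assert (Hn := norm_ge_0 x).
        replace ((K / R0 + 1) * norm x) with (K * (norm x / R0) + norm x) by (field; lra). lra.
  - exact Hlb.
  - intros h r Hr Hh. assert (Hr0 := small_pos _ _ Hh).
    assert (Hz : small R0 (zero : V6)). { intros i. rewrite crd_zero, Cmod_0. lra. }
    assert (HD : is_Cseries (fun j => c j * mono (w j) h + - (1) * (c j * mono (w j) (zero : V6)) + - (1) * u j h)%C
       (f h + - (1) * f (zero : V6) + - (1) * l h)%C).
    { apply is_Cseries_plus; [apply is_Cseries_plus|].
      - apply H3. now apply small_weaken with r.
      - apply is_Cseries_scal. now apply H3.
      - apply is_Cseries_scal. apply Hs. }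
    replace (f h - f (zero : V6) - l h)%C with (f h + - (1) * f (zero : V6) + - (1) * l h)%C by ring.
    assert (Hrr : 0 <= r / R0). { apply Rmult_le_pos; [lra|left; now apply Rinv_0_lt_compat]. }
    assert (Hr1 : r / R0 <= 1).
    { apply Rmult_le_reg_r with R0; [lra|]. unfold Rdiv. rewrite Rmult_assoc, Rinv_l; lra. }
    apply Rle_trans with ((r / R0) ^ 2 * K').
    2:{ rewrite Rmult_comm. apply Rmult_le_compat_r; [now apply pow_le|exact H1]. }
    apply (is_Cseries_le _ _ (fun j => (r / R0) ^ 2 * (Cmod (c j) * R0 ^ length (w j))) _ HD).
    + intros n. unfold u. destruct (w n) as [|i [|i' v]].
      * replace (c n * mono [] h + - (1) * (c n * mono [] (zero : V6)) + - (1) * RtoC 0)%C with (RtoC 0)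
          by (unfold mono; simpl; ring).
        rewrite Cmod_0. apply Rmult_le_pos; [now apply pow_le|].
        apply Rmult_le_pos; [apply Cmod_ge_0|apply pow_le; lra].
      * replace (c n * mono [i] h + - (1) * (c n * mono [i] (zero : V6)) + - (1) * (c n * crd i h))%C
          with (RtoC 0).
        2:{ unfold mono; cbn [fold_right]. rewrite crd_zero. ring. }
        rewrite Cmod_0. apply Rmult_le_pos; [now apply pow_le|].
        apply Rmult_le_pos; [apply Cmod_ge_0|apply pow_le; lra].
      * set (m := i' :: v). replace (c n * mono (i :: m) h + - (1) * (c n * mono (i :: m) (zero : V6)) + - (1) * RtoC 0)%C
          with (c n * mono (i :: m) h)%C.
        2:{ unfold mono; cbn [fold_right]. rewrite crd_zero. ring. }
        rewrite Cmod_mult, <- Rmult_assoc, (Rmult_comm _ (Cmod (c n))), Rmult_assoc.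
        apply Rmult_le_compat_l; [apply Cmod_ge_0|].
        eapply Rle_trans; [apply mono_bound, Hh|]. unfold m; cbn [length].
        replace r with ((r / R0) * R0) at 1 by (field; lra).
        rewrite Rpow_mult_distr. apply Rmult_le_compat_r; [apply pow_le; lra|].
        cbn [pow]. set (p := (r / R0) ^ length v).
        assert (0 <= p <= 1).
        { unfold p. split; [now apply pow_le|]. rewrite <- (pow1 (length v)). now apply pow_incr. }
        assert (0 <= r / R0 * (r / R0)) by nra. nra.
    + exact (is_series_scal (V := R_NormedModule) ((r / R0) ^ 2) _ _ H2).
Qed.

(** The expansion is recentred at q, where a margin R2 is left, and the quadratic remainder of
    [An_taylor] is negligible against h. *)
Lemma An_ex_filterdiff R1 R2 K f (p q : V6) : 0 < R2 -> small R1 (minus q p) -> An (R1 + R2) K f ->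
  ex_filterdiff (K := C_AbsRing) (U := V6) (V := C_NormedModule)
    (fun y => f (minus y p)) (locally q).
Proof.
  intros HR Hq Hf.
  assert (Ht := An_translate R1 R2 K f (minus q p) (Rlt_le _ _ HR) Hq Hf).
  assert (HK := An_nonneg _ _ _ (Rlt_le _ _ HR) Ht).
  destruct (An_taylor R2 K _ HR Ht) as (l & Hl & _ & Hb).
  exists l. split; [exact Hl|].
  intros x Hx. apply is_filter_lim_locally_unique in Hx. subst x.
  intros eps.
  (* Below the second bound the remainder K |h|^2 / R2^2 is at most eps |h|; K + 1 in place of K
     keeps the denominator positive. *)
  assert (Hd : 0 < Rmin R2 (eps * R2 ^ 2 / (K + 1))).
  { apply Rmin_pos; [exact HR|]. apply Rdiv_lt_0_compat; [|lra].
    apply Rmult_lt_0_compat; [apply cond_pos|apply pow_lt; exact HR]. }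
  apply (locally_le_locally_norm q). exists (mkposreal _ Hd). intros y Hy.
  unfold ball_norm in Hy. set (h := minus y q) in *.
  assert (H2 : norm h <= R2). { eapply Rle_trans; [left; exact Hy|apply Rmin_l]. }
  assert (H3 : norm h * (K + 1) <= eps * R2 ^ 2).
  { assert (H := Rmin_r R2 (eps * R2 ^ 2 / (K + 1))).
    replace (eps * R2 ^ 2) with (eps * R2 ^ 2 / (K + 1) * (K + 1)) by (field; lra).
    apply Rmult_le_compat_r; [lra|]. eapply Rle_trans; [left; exact Hy|exact H]. }
  specialize (Hb h (norm h) H2 (small_norm h)).
  assert (E1 : plus (minus q p : V6) (h : V6) = minus y p).
  { unfold h. transitivity (plus (minus y q) (minus q p)); [apply plus_comm|].
    symmetry. apply (minus_trans q y p). }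
  assert (E2 : plus (minus q p : V6) (zero : V6) = minus q p) by apply plus_zero_r.
  cbv beta in Hb. rewrite E1, E2 in Hb.
  change (norm (minus (minus (f (minus y p)) (f (minus q p))) (l h))) with
    (Cmod (f (minus y p) - f (minus q p) - l h)%C).
  eapply Rle_trans; [exact Hb|]. assert (Hn := norm_ge_0 h).
  replace (K * (norm h / R2) ^ 2) with (norm h * (norm h * K) / R2 ^ 2) by (field; lra).
  assert (H4 : 0 < R2 ^ 2) by (apply pow_lt; exact HR).
  apply Rmult_le_reg_r with (R2 ^ 2); [exact H4|].
  unfold Rdiv. rewrite Rmult_assoc, Rinv_l, Rmult_1_r by lra. simpl. simpl in H3. nra.
Qed.

(** * Division of an expansion by the coordinate e - 1 *)

Definition kill_e (h : C6) : C6 := let '(a, b, c, d, e, f) := h in (a, b, c, d, RtoC 0, f).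

Fixpoint drop_e (w : list nat) : list nat :=
  match w with
  | [] => []
  | 4%nat :: v => v
  | i :: v => i :: drop_e v
  end.

Lemma crd_kill_e i h : i <> 4%nat -> crd i (kill_e h) = crd i h.
Proof.
  destruct h as [[[[[x0 x1] x2] x3] x4] x5]. intros Hi.
  destruct i as [|[|[|[|[|i]]]]]; try reflexivity. now elim Hi.
Qed.

Lemma mono_drop_e w h :
  (In 4%nat w -> mono w h = (crd 4 h * mono (drop_e w) h)%C /\ length w = S (length (drop_e w)) /\
     mono w (kill_e h) = 0%C) /\
  (~ In 4%nat w -> mono w (kill_e h) = mono w h).
Proof.
  induction w as [|i w [IH1 IH2]].
  - split; [intros []|reflexivity].
  - destruct (Nat.eq_dec i 4) as [->|Hi].
    + split.
      * intros _. split; [reflexivity|split; [reflexivity|]].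
        unfold mono; cbn [fold_right].
        replace (crd 4 (kill_e h)) with (RtoC 0); [ring|].
        destruct h as [[[[[x0 x1] x2] x3] x4] x5]. reflexivity.
      * intros H. elim H. now left.
    + assert (Hd : drop_e (i :: w) = i :: drop_e w).
      { destruct i as [|[|[|[|[|i]]]]]; try reflexivity. now elim Hi. }
      rewrite Hd. unfold mono in *; cbn [fold_right length]. split.
      * intros [H|H]; [now elim Hi|]. destruct (IH1 H) as (E1 & E2 & E3).
        rewrite E1, E2, E3. repeat split; ring.
      * intros H. rewrite IH2 by (intros H'; apply H; now right). now rewrite crd_kill_e.
Qed.

Lemma kill_e_small R0 h : small R0 h -> small R0 (kill_e h).
Proof.
  intros H i. destruct (Nat.eq_dec i 4) as [->|Hi].
  - replace (crd 4 (kill_e h)) with (RtoC 0); [rewrite Cmod_0; apply (small_pos _ _ H)|].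
    destruct h as [[[[[x0 x1] x2] x3] x4] x5]. reflexivity.
  - rewrite crd_kill_e by exact Hi. apply H.
Qed.

(** A word containing the letter 4 is h_4 times the word with one such letter removed, at the price
    of a factor 1 / R0 in the norm, and it vanishes on h_4 = 0. The other words do not change under
    [kill_e]. *)
Lemma An_div_e R0 K f : 0 < R0 -> An R0 K f ->
  exists g, An R0 (K / R0) g /\
    forall h, small R0 h -> f h = (f (kill_e h) + crd 4 h * g h)%C.
Proof.
  intros HR (c & w & K' & H1 & H2 & H3).
  set (c' := fun j => if in_dec Nat.eq_dec 4%nat (w j) then c j else RtoC 0).
  set (b := fun j => Cmod (c' j) * R0 ^ length (drop_e (w j))).
  assert (Hb : forall j, 0 <= b j <= / R0 * (Cmod (c j) * R0 ^ length (w j))).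
  { intros j. split; [apply Rmult_le_pos; [apply Cmod_ge_0|apply pow_le; lra]|].
    unfold b, c'. destruct (in_dec Nat.eq_dec 4%nat (w j)) as [Hin|Hin].
    - destruct (proj1 (mono_drop_e (w j) (zero : V6)) Hin) as (_ & E & _). rewrite E. cbn [pow].
      apply Req_le. field. lra.
    - rewrite Cmod_0, Rmult_0_l. repeat apply Rmult_le_pos; [|apply Cmod_ge_0|apply pow_le; lra].
      left; now apply Rinv_0_lt_compat. }
  assert (Hsc := is_series_scal (V := R_NormedModule) (/ R0) _ _ H2).
  assert (Hbs : is_series b (Series b)).
  { apply Series_correct. apply (ex_series_le_pos _ _ Hb). eexists. exact Hsc. }
  assert (Hg : forall h, small R0 h -> is_Cseries (fun j => c' j * mono (drop_e (w j)) h)%C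
     (CSeries (fun j => c' j * mono (drop_e (w j)) h)%C)).
  { intros h Hh. apply is_Cseries_abs. apply (ex_series_le_pos _ b); [|now exists (Series b)].
    intros n; split; [apply Cmod_ge_0|]. rewrite Cmod_mult.
    apply Rmult_le_compat_l; [apply Cmod_ge_0|now apply mono_bound]. }
  exists (fun h => CSeries (fun j => c' j * mono (drop_e (w j)) h)%C). split.
  - exists c', (fun j => drop_e (w j)), (Series b). split; [|split; [exact Hbs|exact Hg]].
    apply Rle_trans with (/ R0 * K').
    + apply (is_series_R_le _ _ _ _ (fun j => proj2 (Hb j)) Hbs). exact Hsc.
    + unfold Rdiv. rewrite Rmult_comm. apply Rmult_le_compat_r; [|exact H1].
      left; now apply Rinv_0_lt_compat.
  - intros h Hh. apply (is_Cseries_unique (fun j => c j * mono (w j) h)%C); [now apply H3|].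
    eapply is_Cseries_ext; [|apply is_Cseries_plus;
      [apply H3, kill_e_small, Hh|apply is_Cseries_scal, Hg, Hh]].
    intros n. cbv beta. unfold c'. destruct (in_dec Nat.eq_dec 4%nat (w n)) as [Hin|Hin].
    + destruct (proj1 (mono_drop_e (w n) h) Hin) as (E1 & _ & E3). rewrite E1, E3. ring.
    + rewrite (proj2 (mono_drop_e (w n) h) Hin). ring.
Qed.

(** * The Gamma function *)

Definition is_Clim (u : nat -> C) (l : C) : Prop :=
  is_lim_seq (fun n => Re (u n)) (Re l) /\ is_lim_seq (fun n => Im (u n)) (Im l).

Lemma CLim_seq_unique u (l : C) : is_Clim u l -> CLim_seq u = l.
Proof.
  intros [A B]. unfold CLim_seq. rewrite (is_lim_seq_unique _ _ A), (is_lim_seq_unique _ _ B).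
  now destruct l.
Qed.

Lemma is_Clim_unique u l m : is_Clim u l -> is_Clim u m -> l = m.
Proof. intros A B. rewrite <- (CLim_seq_unique _ _ A). now apply CLim_seq_unique. Qed.

Lemma is_Clim_ext_loc u v l : eventually (fun n => u n = v n) -> is_Clim u l -> is_Clim v l.
Proof.
  intros H [A B]; split.
  - apply is_lim_seq_ext_loc with (2 := A). apply filter_imp with (2 := H). intros n Hn; now rewrite Hn.
  - apply is_lim_seq_ext_loc with (2 := B). apply filter_imp with (2 := H). intros n Hn; now rewrite Hn.
Qed.

Lemma is_Clim_ext u v l : (forall n, u n = v n) -> is_Clim u l -> is_Clim v l.
Proof. intros H. apply is_Clim_ext_loc. exists 0%nat. intros n _; apply H. Qed.

Lemma is_Clim_eq u (l m : C) : is_Clim u l -> l = m -> is_Clim u m.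
Proof. intros H <-; exact H. Qed.

Lemma is_Clim_const c : is_Clim (fun _ => c) c.
Proof. split; apply is_lim_seq_const. Qed.

Lemma is_Clim_RtoC (a : nat -> R) (l : R) : is_lim_seq a l -> is_Clim (fun n => RtoC (a n)) (RtoC l).
Proof. intros H; split; [exact H|apply is_lim_seq_const]. Qed.

Lemma is_Clim_plus u v l m : is_Clim u l -> is_Clim v m -> is_Clim (fun n => u n + v n)%C (l + m)%C.
Proof. intros [A B] [A' B']; split; now apply is_lim_seq_plus'. Qed.

Lemma is_Clim_mult u v l m : is_Clim u l -> is_Clim v m -> is_Clim (fun n => u n * v n)%C (l * m)%C.
Proof.
  intros [A B] [A' B']; split.
  - apply (is_lim_seq_minus' (fun n => Re (u n) * Re (v n)) (fun n => Im (u n) * Im (v n))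
      (Re l * Re m) (Im l * Im m)); now apply is_lim_seq_mult'.
  - apply (is_lim_seq_plus' (fun n => Re (u n) * Im (v n)) (fun n => Im (u n) * Re (v n))
      (Re l * Im m) (Im l * Re m)); now apply is_lim_seq_mult'.
Qed.

Lemma is_Clim_inv u (l : C) : l <> 0%C -> is_Clim u l -> is_Clim (fun n => / u n)%C (/ l)%C.
Proof.
  intros Hl [A B].
  assert (Hd : Re l ^ 2 + Im l ^ 2 <> 0).
  { intros H. apply Hl. apply C_ext; simpl; nra. }
  assert (D : is_lim_seq (fun n => Re (u n) ^ 2 + Im (u n) ^ 2) (Re l ^ 2 + Im l ^ 2)).
  { apply (is_lim_seq_plus' (fun n => Re (u n) ^ 2) (fun n => Im (u n) ^ 2) (Re l ^ 2) (Im l ^ 2)).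
    - apply is_lim_seq_ext with (fun n => Re (u n) * Re (u n)); [intros n; ring|].
      replace (Re l ^ 2) with (Re l * Re l) by ring. now apply is_lim_seq_mult'.
    - apply is_lim_seq_ext with (fun n => Im (u n) * Im (u n)); [intros n; ring|].
      replace (Im l ^ 2) with (Im l * Im l) by ring. now apply is_lim_seq_mult'. }
  split.
  - apply (is_lim_seq_div' (fun n => Re (u n)) _ (Re l) _ A D Hd).
  - apply (is_lim_seq_div' (fun n => - Im (u n)) _ (- Im l) _); [|exact D|exact Hd].
    exact (proj1 (is_lim_seq_opp (fun n => Im (u n)) (Im l)) B).
Qed.

Lemma is_Clim_subseq_inv u l k : is_Clim (fun n => u (n + k)%nat) l -> is_Clim u l.
Proof.
  intros [A B]; split.
  - exact (proj2 (is_lim_seq_incr_n (fun n => Re (u n)) k (Re l)) A).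
  - exact (proj2 (is_lim_seq_incr_n (fun n => Im (u n)) k (Im l)) B).
Qed.

Lemma is_Clim_abs u l (b : nat -> R) : (forall n, Cmod (u n - l) <= b n) -> is_lim_seq b 0 -> is_Clim u l.
Proof.
  intros Hb H0.
  assert (Hgen : forall (a : nat -> R) x, (forall n, Rabs (a n - x) <= b n) -> is_lim_seq a x).
  { intros a x H. apply is_lim_seq_ext with (fun n => (a n - x) + x); [intros n; ring|].
    replace (Finite x) with (Finite (0 + x)) by (f_equal; ring).
    apply is_lim_seq_plus'; [|apply is_lim_seq_const]. apply is_lim_seq_abs_0.
    apply is_lim_seq_le_le with (2 := is_lim_seq_const 0) (3 := H0).
    intros n; split; [apply Rabs_pos|apply H]. }
  split; apply Hgen; intros n; eapply Rle_trans; try apply Hb.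
  - apply (re_le_Cmod (u n - l)%C).
  - apply (im_le_Cmod (u n - l)%C).
Qed.

Lemma is_Clim_Cseries u l : is_Cseries u l ->
  is_Clim (fun n => (sum_n (fun k => Re (u k)) n, sum_n (fun k => Im (u k)) n)) l.
Proof. intros [A B]; split; [exact A|exact B]. Qed.

(** Gauss's product turned upside down: for each n it is a polynomial times an exponential in z, so
    its limit 1 / Gamma can be handled on any polydisc. *)
Definition rgauss (z : C) (n : nat) : C :=
  (poch z (S n) / (RtoC (INR (fact n)) * Rcpow (INR n) z))%C.

Definition RGamma (z : C) : C := CLim_seq (rgauss z).

(** The ratio of consecutive products, (1 + z / (n + 1)) ((n + 1) / n)^(-z), which is 1 + O(1 /
    n^2). *)
Definition gauss_step (n : nat) (z : C) : C :=
  ((1 + RtoC (/ (INR n + 1)) * z) * Cexp (- RtoC (ln (INR n + 1) - ln (INR n)) * z))%C.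

Lemma RtoC_neq_0 (x : R) : x <> 0 -> RtoC x <> 0%C.
Proof. intros H H'. apply H. now injection H'. Qed.

Lemma C_inv_neq_0 (z : C) : z <> 0%C -> (/ z)%C <> 0%C.
Proof.
  intros Hz H. assert (H1 := Cinv_r z Hz). rewrite H, Cmult_0_r in H1. injection H1. lra.
Qed.

Lemma rgauss_succ z n : rgauss z (S n) = (rgauss z n * gauss_step n z)%C.
Proof.
  assert (Hn1 : INR n + 1 <> 0). { assert (H := pos_INR n). lra. }
  unfold rgauss, gauss_step, Rcpow. set (k := S n). change (poch z (S k)) with (poch z k * (z + INR k))%C.
  replace (- RtoC (ln (INR n + 1) - ln (INR n)) * z)%C with
    (z * RtoC (ln (INR n)) + - (z * RtoC (ln (INR k))))%C.
  2:{ unfold k. rewrite S_INR, RtoC_minus. ring. }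
  rewrite Cexp_plus, Cexp_opp. unfold k at 3. rewrite fact_simpl, mult_INR, RtoC_mult.
  replace (INR (S n)) with (INR n + 1) by (symmetry; apply S_INR).
  replace (INR k) with (INR n + 1) by (symmetry; apply S_INR).
  rewrite RtoC_inv by exact Hn1. field.
  repeat split; try apply Cexp_neq_0; try apply INR_fact_neq_0_C. now apply RtoC_neq_0.
Qed.

Lemma ln_succ_bounds n : (0 < n)%nat ->
  / (INR n + 1) <= ln (INR n + 1) - ln (INR n) <= / INR n.
Proof.
  intros Hn. assert (H : 0 < INR n) by now apply lt_0_INR.
  assert (Hle : forall x, 0 < x -> ln x <= x - 1).
  { intros x Hx. destruct (exp_ineq1_le (ln x)) as [H1|H1]; rewrite exp_ln in * by exact Hx; lra. }
  split.
  - assert (H1 := Hle (INR n / (INR n + 1)) ltac:(apply Rdiv_lt_0_compat; lra)).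
    rewrite ln_div in H1 by lra.
    replace (INR n / (INR n + 1) - 1) with (- / (INR n + 1)) in H1 by (field; lra). lra.
  - assert (H1 := Hle ((INR n + 1) / INR n) ltac:(apply Rdiv_lt_0_compat; lra)).
    rewrite ln_div in H1 by lra.
    replace ((INR n + 1) / INR n - 1) with (/ INR n) in H1 by (field; lra). lra.
Qed.

(** The three summands bound, in this order, the linear part, the quadratic part and the Taylor
    remainder of [gauss_step n - 1]. *)
Definition gauss_cst (A : R) : R := A + A * A + 2 * (1 + A) * (A * A).

(** With m = 1 / (n + 1) and lam = ln((n + 1) / n), both between 1 / (n + 1) and 1 / n, the first
    order terms of the two factors cancel up to (m - lam) f. Everything is measured by 1 / n - 1 /
    (n + 1), because these differences telescope when summed. *)
Lemma An_gauss_step R0 A f n : 0 <= R0 -> An R0 A f -> (0 < n)%nat -> A <= INR n ->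
  An R0 (gauss_cst A * (/ INR n - / (INR n + 1))) (fun h => gauss_step n (f h) - 1)%C.
Proof.
  intros HR Hf Hn HA. assert (HA0 := An_nonneg _ _ _ HR Hf).
  assert (H : 0 < INR n) by now apply lt_0_INR.
  assert (HN : 1 <= INR n) by (apply (le_INR 1); lia).
  destruct (ln_succ_bounds n Hn) as [L1 L2].
  set (lam := ln (INR n + 1) - ln (INR n)) in *. set (m := / (INR n + 1)).
  assert (Hm : 0 < m) by (apply Rinv_0_lt_compat; lra).
  assert (Hm1 : m <= 1). { unfold m. rewrite <- Rinv_1. apply Rinv_le_contravar; lra. }
  assert (Hi : 0 < / INR n) by now apply Rinv_0_lt_compat.
  assert (Hw : An R0 (A * lam) (fun h => - RtoC lam * f h)%C).
  { eapply An_weaken; [|apply (An_scal R0 A); eauto].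
    rewrite Cmod_opp, Cmod_R, Rabs_pos_eq by (fold m in L1; lra). lra. }
  assert (Hw1 : A * lam <= 1).
  { apply Rle_trans with (INR n * / INR n); [apply Rmult_le_compat; fold m in L1; lra|].
    rewrite Rinv_r; lra. }
  assert (Hrho := An_Cexp_taylor R0 _ _ HR Hw Hw1).
  set (rho := fun h => (Cexp (- RtoC lam * f h) - 1 - - RtoC lam * f h)%C) in Hrho.
  apply An_ext with (fun h => RtoC (m - lam) * f h + - RtoC (m * lam) * (f h * f h) +
    (1 + RtoC m * f h) * rho h)%C.
  { intros h _. unfold rho, gauss_step. fold lam m. rewrite RtoC_minus, RtoC_mult. ring. }
  assert (H1 : An R0 (A * (/ INR n - m)) (fun h => RtoC (m - lam) * f h)%C).
  { eapply An_weaken; [|apply (An_scal R0 A); eauto].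
    rewrite Cmod_R, Rabs_left1 by (fold m in L1; lra). rewrite Rmult_comm.
    apply Rmult_le_compat_l; lra. }
  assert (H2 : An R0 (A * A * (/ INR n - m)) (fun h => - RtoC (m * lam) * (f h * f h))%C).
  { eapply An_weaken; [|apply (An_scal R0 (A * A)); [exact HR|now apply An_mult]].
    rewrite Cmod_opp, Cmod_R, Rabs_pos_eq by (fold m in L1; nra). rewrite Rmult_comm.
    apply Rmult_le_compat_l; [nra|].
    replace (/ INR n - m) with (m * / INR n) by (unfold m; field; lra).
    apply Rmult_le_compat_l; lra. }
  assert (H3 : An R0 (1 + A) (fun h => 1 + RtoC m * f h)%C).
  { apply An_plus; [exact HR| |].
    - apply An_weaken with (Cmod 1); [rewrite Cmod_1; lra|now apply An_const].
    - eapply An_weaken; [|apply (An_scal R0 A); eauto]. rewrite Cmod_R, Rabs_pos_eq by lra. nra. }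
  assert (H4 := An_mult _ _ _ _ _ HR H3 Hrho).
  eapply An_weaken; [|exact (An_plus _ _ _ _ _ HR (An_plus _ _ _ _ _ HR H1 H2) H4)].
  assert (H5 : (A * lam) ^ 2 <= 2 * (A * A) * (/ INR n - m)).
  { replace (/ INR n - m) with (m * / INR n) by (unfold m; field; lra).
    assert (/ INR n <= 2 * m).
    { replace (/ INR n) with (2 * / (2 * INR n)) by (field; lra).
      apply Rmult_le_compat_l; [lra|]. unfold m. apply Rinv_le_contravar; lra. }
    assert (0 <= A * A) by nra.
    replace ((A * lam) ^ 2) with (A * A * (lam * lam)) by ring.
    replace (2 * (A * A) * (m * / INR n)) with (A * A * ((2 * m) * / INR n)) by ring.
    apply Rmult_le_compat_l; [lra|]. fold m in L1. apply Rmult_le_compat; lra. }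
  unfold gauss_cst. fold m.
  assert (0 <= (1 + A)) by lra.
  assert ((1 + A) * (A * lam) ^ 2 <= (1 + A) * (2 * (A * A) * (/ INR n - m)))
    by (apply Rmult_le_compat_l; lra). lra.
Qed.

Lemma gauss_cst_pos A : 0 <= A -> 0 <= gauss_cst A.
Proof. intros H. unfold gauss_cst. assert (0 <= A * A) by nra. assert (0 <= A * (A * A)) by nra. lra. Qed.

Lemma An_poch R0 K f n : 0 <= R0 -> An R0 K f -> exists K', An R0 K' (fun h => poch (f h) n).
Proof.
  intros HR Hf. induction n as [|n (K' & IH)]; cbn [poch].
  - exists (Cmod 1). now apply An_const.
  - eexists. apply An_mult; [exact HR|exact IH|]. apply An_plus; [exact HR|exact Hf|].
    now apply An_const.
Qed.

Lemma An_rgauss R0 K f n : 0 <= R0 -> An R0 K f -> exists K', An R0 K' (fun h => rgauss (f h) n).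
Proof.
  intros HR Hf. destruct (An_poch R0 K f (S n) HR Hf) as (K1 & H1). eexists.
  apply An_ext with (fun h => / RtoC (INR (fact n)) * (poch (f h) (S n) * Cexp (- RtoC (ln (INR n)) * f h)))%C.
  - intros h _. unfold rgauss, Rcpow.
    replace (- RtoC (ln (INR n)) * f h)%C with (- (f h * RtoC (ln (INR n))))%C by ring.
    rewrite Cexp_opp. field. split; [apply Cexp_neq_0|apply INR_fact_neq_0_C].
  - apply An_scal; [exact HR|]. apply An_mult; [exact HR|exact H1|].
    apply An_Cexp; [exact HR|]. apply An_scal; [exact HR|exact Hf].
Qed.

Lemma is_series_inv_telescope N : (0 < N)%nat ->
  is_series (fun m => / INR (N + m) - / (INR (N + m) + 1)) (/ INR N).
Proof.
  intros HN. set (a := fun m => / INR (N + m)).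
  assert (Hs : forall m, sum_n (fun m => / INR (N + m) - / (INR (N + m) + 1)) m = / INR N - a (S m)).
  { induction m as [|m IH].
    - rewrite sum_O. unfold a. rewrite Nat.add_0_r, <- S_INR. do 3 f_equal. lia.
    - rewrite sum_n_succ, IH. unfold a. rewrite <- (S_INR (N + S m)).
      replace (N + S (S m))%nat with (S (N + S m)) by lia. eqR. ring. }
  change (is_lim_seq (sum_n (fun m => / INR (N + m) - / (INR (N + m) + 1))) (/ INR N)).
  apply is_lim_seq_ext with (fun m => / INR N - a (S m)); [intros m; symmetry; apply Hs|].
  replace (Finite (/ INR N)) with (Finite (/ INR N - 0)) by (f_equal; ring).
  apply is_lim_seq_minus'; [apply is_lim_seq_const|].
  apply (is_lim_seq_inv _ p_infty); [|discriminate].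
  apply is_lim_seq_ext with (fun m => INR (m + S N)); [intros m; f_equal; lia|].
  apply (is_lim_seq_incr_n INR). apply is_lim_seq_INR.
Qed.

(** The products are kept below a fixed norm, so their increments are dominated by a multiple of 1 /
    n - 1 / (n + 1). The limit is then a summable series of expansions, and the same series gives
    the pointwise convergence. *)
Lemma An_RGamma_aux R0 K f : 0 <= R0 -> An R0 K f -> exists K' g,
  An R0 K' g /\ forall h, small R0 h -> is_Clim (rgauss (f h)) (g h).
Proof.
  intros HR Hf. assert (HK := An_nonneg _ _ _ HR Hf).
  (* [An_gauss_step] is available from the index N >= K on; the finite product before it is bounded
     as it stands. *)
  destruct (INR_unbounded (K + 1)) as (N & HN). assert (HN0 : (0 < N)%nat).
  { destruct N; [simpl in HN; lra|lia]. }
  set (D := gauss_cst K). assert (HD : 0 <= D) by now apply gauss_cst_pos.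
  assert (Hpos : forall m, 0 < INR (N + m)) by (intros m; apply lt_0_INR; lia).
  set (x := fun m => / INR (N + m) - / (INR (N + m) + 1)).
  assert (Hx : forall m, 0 <= x m).
  { intros m. unfold x. assert (/ (INR (N + m) + 1) <= / INR (N + m)).
    { apply Rinv_le_contravar; [apply Hpos|lra]. } lra. }
  assert (Hstep : forall m, An R0 (D * x m) (fun h => gauss_step (N + m) (f h) - 1)%C).
  { intros m. apply An_gauss_step; auto; [lia|]. rewrite plus_INR. assert (H := pos_INR m). lra. }
  destruct (An_rgauss R0 K f N HR Hf) as (B & HB). assert (HB0 := An_nonneg _ _ _ HR HB).
  assert (Hr : forall m, An R0 (B * exp (D * (/ INR N - / INR (N + m)))) (fun h => rgauss (f h) (N + m))).
  { induction m as [|m IH].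
    - rewrite Nat.add_0_r. replace (D * (/ INR N - / INR N)) with 0 by ring. rewrite exp_0, Rmult_1_r.
      exact HB.
    - rewrite Nat.add_succ_r. apply An_ext with (fun h => rgauss (f h) (N + m) * (1 + (gauss_step (N + m) (f h) - 1)))%C.
      { intros h _. rewrite rgauss_succ. ring. }
      eapply An_weaken; [|apply An_mult; [exact HR|exact IH|]; apply An_plus;
        [exact HR|now apply An_const|apply Hstep]].
      rewrite Cmod_1, Rmult_assoc. apply Rmult_le_compat_l; [exact HB0|].
      replace (D * (/ INR N - / INR (S (N + m)))) with (D * (/ INR N - / INR (N + m)) + D * x m).
      + rewrite exp_plus. apply Rmult_le_compat_l; [left; apply exp_pos|]. apply exp_ineq1_le.
      + unfold x. rewrite S_INR. ring. }
  (* By 1 + x <= exp x the product of the norms is at most the exponential of a telescoping sum, and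
     that sum is at most D. *)
  set (E := B * exp D).
  assert (Hr' : forall m, An R0 E (fun h => rgauss (f h) (N + m))).
  { intros m. apply An_weaken with (2 := Hr m). unfold E. apply Rmult_le_compat_l; [exact HB0|].
    assert (H1 : D * (/ INR N - / INR (N + m)) <= D * 1).
    { apply Rmult_le_compat_l; [exact HD|].
      assert (0 < / INR (N + m)) by (apply Rinv_0_lt_compat, Hpos).
      assert (/ INR N <= 1). { rewrite <- Rinv_1. apply Rinv_le_contravar; [lra|]. apply (le_INR 1). lia. }
      lra. }
    rewrite Rmult_1_r in H1. destruct H1 as [H1|H1]; [left; now apply exp_increasing|rewrite H1; lra]. }
  set (u := fun m h => (rgauss (f h) (N + S m) - rgauss (f h) (N + m))%C).
  assert (Hu : forall m, An R0 (E * D * x m) (u m)).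
  { intros m. apply An_ext with (fun h => rgauss (f h) (N + m) * (gauss_step (N + m) (f h) - 1))%C.
    { intros h _. unfold u. rewrite Nat.add_succ_r, rgauss_succ. ring. }
    rewrite Rmult_assoc. now apply An_mult. }
  assert (Hxs : is_series (fun m => E * D * x m) (E * D * / INR N)).
  { exact (is_series_scal (V := R_NormedModule) (E * D) _ _ (is_series_inv_telescope N HN0)). }
  assert (Hsum : forall h, small R0 h -> is_Cseries (fun m => u m h) (CSeries (fun m => u m h))).
  { intros h Hh. apply is_Cseries_abs. apply (ex_series_le_pos _ (fun m => E * D * x m)).
    - intros n; split; [apply Cmod_ge_0|]. now apply (An_bound R0).
    - eexists; exact Hxs. }
  exists (B + E * D * / INR N), (fun h => rgauss (f h) N + CSeries (fun m => u m h))%C. split.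
  - apply An_plus; [exact HR|exact HB|].
    now apply (An_series R0 (fun m => E * D * x m) _ u).
  (* The increments up to n lead from the product of index N to that of index N + n + 1, hence the
     shift by [S N]. *)
  - intros h Hh. apply (is_Clim_subseq_inv _ _ (S N)).
    apply is_Clim_ext with (fun n => rgauss (f h) N +
       (sum_n (fun k => Re (u k h)) n, sum_n (fun k => Im (u k h)) n))%C.
    { induction n as [|n IH].
      - rewrite !sum_O. unfold u. rewrite Nat.add_0_r.
        replace (0 + S N)%nat with (N + 1)%nat by lia.
        apply C_ext; simpl; ring.
      - rewrite !sum_n_succ. replace (S n + S N)%nat with (N + S (S n))%nat by lia.
        replace (n + S N)%nat with (N + S n)%nat in IH by lia.
        replace (rgauss (f h) (N + S (S n))) with (rgauss (f h) (N + S n) + u (S n) h)%C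
          by (unfold u; ring).
        rewrite <- IH. apply C_ext; simpl; ring. }
    apply is_Clim_plus; [apply is_Clim_const|]. apply is_Clim_Cseries. now apply Hsum.
Qed.

Lemma is_Clim_RGamma z : is_Clim (rgauss z) (RGamma z).
Proof.
  destruct (An_RGamma_aux 0 (Cmod z) (fun _ => z) (Rle_refl 0) (An_const 0 z (Rle_refl 0)))
    as (K & g & _ & H).
  assert (H0 := H (zero : V6) ltac:(intros i; rewrite crd_zero, Cmod_0; lra)).
  unfold RGamma. now rewrite (CLim_seq_unique _ _ H0).
Qed.

Lemma An_RGamma R0 K f : 0 <= R0 -> An R0 K f -> exists K', An R0 K' (fun h => RGamma (f h)).
Proof.
  intros HR Hf. destruct (An_RGamma_aux R0 K f HR Hf) as (K' & g & H1 & H2).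
  exists K'. apply An_ext with (2 := H1). intros h Hh.
  apply (is_Clim_unique (rgauss (f h))); [now apply H2|apply is_Clim_RGamma].
Qed.

Lemma Re_pos_poch_neq_0 z n : 0 < Re z -> poch z n <> 0%C.
Proof.
  intros Hz. induction n as [|n IH]; cbn [poch].
  - apply RtoC_neq_0. lra.
  - apply Cmult_neq_0; [exact IH|]. intros H. assert (H' : Re (z + RtoC (INR n))%C = 0) by now rewrite H.
    rewrite Re_plus, Re_RtoC in H'. assert (H1 := pos_INR n). lra.
Qed.

(* Weierstrass's inequality for products bounds Gauss's products away from 0. *)
Lemma RGamma_neq_0 z : 0 < Re z -> RGamma z <> 0%C.
Proof.
  intros Hz H0.
  assert (Hlim := is_Clim_RGamma z). rewrite H0 in Hlim.
  set (K := Cmod z). assert (HK : 0 <= K) by apply Cmod_ge_0.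
  set (D := gauss_cst K). assert (HD : 0 <= D) by now apply gauss_cst_pos.
  (* The summand 2 D gives D / N <= 1/2, so that the factors after N can at most halve the
     product. *)
  destruct (INR_unbounded (K + 1 + 2 * D)) as (N & HN).
  assert (HN0 : (0 < N)%nat). { destruct N; [simpl in HN; lra|lia]. }
  assert (Hpos : forall m, 0 < INR (N + m)) by (intros m; apply lt_0_INR; lia).
  assert (Hstep : forall m, 1 - D * (/ INR (N + m) - / (INR (N + m) + 1)) <= Cmod (gauss_step (N + m) z)).
  { intros m.
    assert (H : An 0 (D * (/ INR (N + m) - / (INR (N + m) + 1))) (fun _ => gauss_step (N + m) z - 1)%C).
    { apply (An_gauss_step 0 K (fun _ => z)); [lra|apply An_const; lra|lia|].
      rewrite plus_INR. assert (H := pos_INR m). lra. }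
    assert (H1 := An_bound _ _ _ (zero : V6) H ltac:(intros i; rewrite crd_zero, Cmod_0; lra)).
    cbv beta in H1.
    assert (H2 := Cmod_triangle (gauss_step (N + m) z) (- (gauss_step (N + m) z - 1))).
    rewrite Cmod_opp in H2.
    replace (gauss_step (N + m) z + - (gauss_step (N + m) z - 1))%C with (RtoC 1) in H2 by ring.
    rewrite Cmod_1 in H2. lra. }
  assert (Hhalf : D * / INR N <= / 2).
  { assert (H : 0 < INR N) by (apply lt_0_INR; lia).
    apply Rmult_le_reg_r with (INR N); [exact H|]. rewrite Rmult_assoc, Rinv_l by lra. lra. }
  set (r := Cmod (rgauss z N)).
  assert (Hr : 0 < r).
  { apply Cmod_gt_0. unfold rgauss, Cdiv. apply Cmult_neq_0; [now apply Re_pos_poch_neq_0|].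
    apply C_inv_neq_0. apply Cmult_neq_0; [apply INR_fact_neq_0_C|apply Cexp_neq_0]. }
  assert (Hlow : forall m, r * (1 - D * (/ INR N - / INR (N + m))) <= Cmod (rgauss z (N + m))).
  { induction m as [|m IH].
    - rewrite Nat.add_0_r. fold r. apply Req_le. ring.
    - rewrite Nat.add_succ_r, rgauss_succ, Cmod_mult.
      assert (Hx : 0 <= / INR (N + m) - / (INR (N + m) + 1)).
      { assert (/ (INR (N + m) + 1) <= / INR (N + m)) by (apply Rinv_le_contravar; [apply Hpos|lra]). lra. }
      set (y := / INR (N + m) - / (INR (N + m) + 1)) in *.
      set (a := / INR N - / INR (N + m)) in *.
      replace (/ INR N - / INR (S (N + m))) with (a + y) by (unfold a, y; rewrite S_INR; ring).
      assert (Ha : 0 <= a).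
      { unfold a. assert (/ INR (N + m) <= / INR N).
        { apply Rinv_le_contravar; [apply lt_0_INR; lia|apply le_INR; lia]. } lra. }
      assert (Ha2 : D * a <= / 2).
      { apply Rle_trans with (2 := Hhalf). apply Rmult_le_compat_l; [exact HD|]. unfold a.
        assert (0 < / INR (N + m)) by (apply Rinv_0_lt_compat, Hpos). lra. }
      assert (Hy2 : D * y <= / 2).
      { apply Rle_trans with (2 := Hhalf). apply Rmult_le_compat_l; [exact HD|]. unfold y.
        assert (0 < / (INR (N + m) + 1)) by (apply Rinv_0_lt_compat; specialize (Hpos m); lra).
        assert (/ INR (N + m) <= / INR N).
        { apply Rinv_le_contravar; [apply lt_0_INR; lia|apply le_INR; lia]. } lra. }
      apply Rle_trans with (r * (1 - D * a) * (1 - D * y)).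
      + assert (0 <= D * a) by nra. assert (0 <= D * y) by nra.
        rewrite Rmult_assoc. apply Rmult_le_compat_l; nra.
      + apply Rmult_le_compat; [apply Rmult_le_pos; lra|lra|exact IH|apply Hstep]. }
  destruct Hlim as [L1 L2]. apply is_lim_seq_spec in L1. apply is_lim_seq_spec in L2.
  assert (Hr4 : 0 < r / 4) by lra.
  destruct (L1 (mkposreal _ Hr4)) as (N1 & HN1). destruct (L2 (mkposreal _ Hr4)) as (N2 & HN2).
  specialize (HN1 (N + (N1 + N2))%nat ltac:(lia)). specialize (HN2 (N + (N1 + N2))%nat ltac:(lia)).
  rewrite Re_RtoC, Rminus_0_r in HN1. rewrite Im_RtoC, Rminus_0_r in HN2.
  change (pos (mkposreal _ Hr4)) with (r / 4) in HN1, HN2.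
  assert (Hc := Cmod_le_Re_Im (rgauss z (N + (N1 + N2)))).
  specialize (Hlow (N1 + N2)%nat).
  assert (Hge : r * / 2 <= r * (1 - D * (/ INR N - / INR (N + (N1 + N2))))).
  { apply Rmult_le_compat_l; [lra|].
    assert (Hi : 0 < / INR (N + (N1 + N2))) by (apply Rinv_0_lt_compat, Hpos).
    assert (Hi2 : 0 <= D * / INR (N + (N1 + N2))) by (apply Rmult_le_pos; [exact HD|left; exact Hi]).
    rewrite Rmult_minus_distr_l. lra. }
  lra.
Qed.

Lemma CGamma_RGamma z : 0 < Re z -> CGamma z = (/ RGamma z)%C.
Proof.
  intros Hz. apply CLim_seq_unique.
  apply is_Clim_ext with (fun n => / rgauss z n)%C.
  - intros n. unfold rgauss. field.
    repeat split; first [now apply Re_pos_poch_neq_0|apply Cexp_neq_0|apply INR_fact_neq_0_C].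
  - apply is_Clim_inv; [now apply RGamma_neq_0|apply is_Clim_RGamma].
Qed.

Lemma CGamma_neq_0 z : 0 < Re z -> CGamma z <> 0%C.
Proof.
  intros Hz. rewrite CGamma_RGamma by exact Hz. apply C_inv_neq_0. now apply RGamma_neq_0.
Qed.

Lemma poch_shift z n : poch z (S n) = (z * poch (z + 1) n)%C.
Proof.
  induction n as [|n IH]; [simpl; ring|].
  change (poch z (S (S n))) with (poch z (S n) * (z + INR (S n)))%C. rewrite IH.
  change (poch (z + 1) (S n)) with (poch (z + 1) n * (z + 1 + INR n))%C.
  rewrite S_INR, RtoC_plus. ring.
Qed.

(** The products at z and z + 1 differ by the factor z and by (z + 1 + n) / n, which tends to 1. *)
Lemma RGamma_succ z : RGamma z = (z * RGamma (z + 1))%C.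
Proof.
  assert (H1 : is_Clim (fun n => rgauss z n * (1 + (z + 1) * RtoC (/ INR n)))%C (RGamma z * 1)%C).
  { apply is_Clim_mult; [apply is_Clim_RGamma|].
    apply is_Clim_eq with (1 + (z + 1) * RtoC 0)%C; [|ring].
    apply is_Clim_plus; [apply is_Clim_const|]. apply is_Clim_mult; [apply is_Clim_const|].
    apply is_Clim_RtoC. apply (is_lim_seq_inv _ p_infty); [apply is_lim_seq_INR|discriminate]. }
  rewrite Cmult_1_r in H1. apply (is_Clim_unique _ _ _ H1).
  apply is_Clim_ext_loc with (fun n => z * rgauss (z + 1) n)%C.
  2:{ apply is_Clim_mult; [apply is_Clim_const|apply is_Clim_RGamma]. }
  exists 1%nat. intros n Hn. assert (Hn0 : INR n <> 0) by (apply not_0_INR; lia).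
  unfold rgauss, Rcpow. rewrite (poch_shift z).
  change (poch (z + 1) (S n)) with (poch (z + 1) n * (z + 1 + INR n))%C.
  replace ((z + 1) * RtoC (ln (INR n)))%C with (z * RtoC (ln (INR n)) + RtoC (ln (INR n)))%C by ring.
  rewrite Cexp_plus. replace (Cexp (RtoC (ln (INR n)))) with (RtoC (INR n)).
  2:{ unfold Cexp. simpl. rewrite cos_0, sin_0, exp_ln by (apply lt_0_INR; lia).
      apply C_ext; simpl; ring. }
  rewrite RtoC_inv by exact Hn0. field.
  repeat split; try apply Cexp_neq_0; try apply INR_fact_neq_0_C. now apply RtoC_neq_0.
Qed.

Lemma CGamma_succ z : 0 < Re z -> CGamma (z + 1) = (z * CGamma z)%C.
Proof.
  intros Hz. assert (Hz1 : 0 < Re (z + 1)%C) by (rewrite Re_plus, Re_RtoC; lra).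
  rewrite !CGamma_RGamma by assumption. rewrite (RGamma_succ z). field.
  split; [now apply RGamma_neq_0|]. intros ->. simpl in Hz. lra.
Qed.

Lemma CGamma_1 : CGamma 1 = 1%C.
Proof.
  rewrite CGamma_RGamma by (simpl; lra).
  replace (RGamma 1) with (RtoC 1); [field|].
  apply (is_Clim_unique (rgauss 1)); [|apply is_Clim_RGamma].
  apply is_Clim_ext_loc with (fun n => 1 + RtoC (/ INR n))%C.
  - exists 1%nat. intros n Hn. assert (Hn0 : INR n <> 0) by (apply not_0_INR; lia).
    unfold rgauss, Rcpow.
    assert (Hp : forall k, poch 1 k = RtoC (INR (fact k))).
    { induction k as [|k IH]; [reflexivity|]. cbn [poch]. rewrite IH, fact_simpl, mult_INR, S_INR.
      rewrite RtoC_mult, RtoC_plus. ring. }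
    rewrite Hp, fact_simpl, mult_INR, S_INR.
    replace (Cexp (1 * RtoC (ln (INR n)))) with (RtoC (INR n)).
    2:{ rewrite Cmult_1_l. unfold Cexp. simpl. rewrite cos_0, sin_0, exp_ln by (apply lt_0_INR; lia).
        apply C_ext; simpl; ring. }
    rewrite RtoC_mult, RtoC_plus, RtoC_inv by exact Hn0. field.
    split; [now apply RtoC_neq_0|apply INR_fact_neq_0_C].
  - apply is_Clim_eq with (1 + RtoC 0)%C; [|ring].
    apply is_Clim_plus; [apply is_Clim_const|].
    apply is_Clim_RtoC. apply (is_lim_seq_inv _ p_infty); [apply is_lim_seq_INR|discriminate].
Qed.

Lemma CGamma_poch z n : 0 < Re z -> CGamma (z + RtoC (INR n)) = (poch z n * CGamma z)%C.
Proof.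
  intros Hz. induction n as [|n IH].
  - simpl. rewrite Cplus_0_r. ring.
  - rewrite S_INR, RtoC_plus, Cplus_assoc, CGamma_succ, IH.
    + cbn [poch]. ring.
    + rewrite Re_plus, Re_RtoC. assert (H := pos_INR n). lra.
Qed.

(** * Raabe's test and the hypergeometric series *)

Lemma ex_series_bounded (a : nat -> R) M : (forall n, 0 <= a n) -> (forall n, sum_n a n <= M) -> ex_series a.
Proof.
  intros Ha HM. destruct (ex_finite_lim_seq_incr (sum_n a) M) as (l & Hl).
  - intros n. rewrite sum_n_succ. specialize (Ha (S n)). lra.
  - exact HM.
  - now exists l.
Qed.

(** With d half of the margin -1 - x, eventually d t(n) <= n t(n) - (n + 1) t(n + 1); the right-hand
    side telescopes and bounds the partial sums. *)
Lemma raabe (t rho : nat -> R) (x : R) : (forall n, 0 < t n) -> (forall n, t (S n) = t n * rho n) ->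
  is_lim_seq (fun n => INR n * (rho n - 1)) x -> x < -1 -> ex_series t.
Proof.
  intros Ht Hrec Hlim Hx. apply is_lim_seq_spec in Hlim.
  set (d := (-1 - x) / 2). assert (Hd : 0 < d) by (unfold d; lra).
  destruct (Hlim (mkposreal d Hd)) as (N & HN).
  set (m := S N). assert (HS : forall n, (m <= n)%nat -> INR n * (rho n - 1) <= - 1 - d).
  { intros n Hn. specialize (HN n ltac:(lia)). simpl in HN. apply Rabs_def2 in HN.
    unfold d in *. lra. }
  assert (Hstep : forall n, (m <= n)%nat -> d * t n <= INR n * t n - INR (S n) * t (S n)).
  { intros n Hn. specialize (HS n Hn). rewrite Hrec, S_INR.
    assert (Hn0 : 0 < INR n) by (apply lt_0_INR; lia).
    assert (H1 : rho n - 1 <= (- 1 - d) / INR n).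
    { apply Rmult_le_reg_l with (INR n); [exact Hn0|].
      replace (INR n * ((- 1 - d) / INR n)) with (- 1 - d) by (field; lra). exact HS. }
    assert (H2 : (- 1 - d) / INR n <= 0).
    { apply Rmult_le_reg_r with (INR n); [exact Hn0|].
      unfold Rdiv. rewrite Rmult_assoc, Rinv_l by lra. lra. }
    assert (Hr : INR n * rho n + rho n <= INR n - d) by lra.
    specialize (Ht n). nra. }
  apply (ex_series_incr_n (V := R_NormedModule) t m).
  apply (ex_series_bounded _ (INR m * t m / d)).
  - intros n. left; apply Ht.
  - intros n0.
    assert (Hs : forall n, d * sum_n (fun k => t (m + k)%nat) n <= INR m * t m - INR (S (m + n)) * t (S (m + n))).
    { induction n as [|n' IH].
      - rewrite sum_O, Nat.add_0_r. apply Hstep. lia.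
      - rewrite sum_n_succ. assert (H := Hstep (m + S n')%nat ltac:(lia)).
        replace (S (m + n')) with (m + S n')%nat in IH by lia. lra. }
    specialize (Hs n0). assert (H1 : 0 <= INR (S (m + n0)) * t (S (m + n0))).
    { apply Rmult_le_pos; [apply pos_INR|left; apply Ht]. }
    apply Rmult_le_reg_l with d; [exact Hd|].
    replace (d * (INR m * t m / d)) with (INR m * t m) by (field; lra). lra.
Qed.

(* [rho n = 1 + x / n + o(1 / n)] *)
Definition ratio_asympt (rho : nat -> R) (x : R) : Prop :=
  is_lim_seq (fun n => INR n * (rho n - 1)) x.

Lemma is_lim_seq_inv_INR : is_lim_seq (fun n => / INR n) 0.
Proof. apply (is_lim_seq_inv _ p_infty); [apply is_lim_seq_INR|discriminate]. Qed.

Lemma ratio_asympt_lim rho x : ratio_asympt rho x -> is_lim_seq rho 1.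
Proof.
  intros H. apply is_lim_seq_ext_loc with (fun n => (INR n * (rho n - 1)) * / INR n + 1).
  - exists 1%nat. intros n Hn. field. apply not_0_INR. lia.
  - replace (Finite 1) with (Finite (x * 0 + 1)) by (f_equal; ring).
    apply is_lim_seq_plus'; [|apply is_lim_seq_const].
    apply is_lim_seq_mult'; [exact H|apply is_lim_seq_inv_INR].
Qed.

Lemma ratio_asympt_mult r1 r2 x y : ratio_asympt r1 x -> ratio_asympt r2 y ->
  ratio_asympt (fun n => r1 n * r2 n) (x + y).
Proof.
  intros H1 H2. unfold ratio_asympt.
  apply is_lim_seq_ext with (fun n => INR n * (r1 n - 1) * r2 n + INR n * (r2 n - 1)).
  { intros n. ring. }
  replace (x + y) with (x * 1 + y) by ring.
  apply is_lim_seq_plus'; [|exact H2].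
  apply is_lim_seq_mult'; [exact H1|]. now apply ratio_asympt_lim with y.
Qed.

Lemma ratio_asympt_inv r x : (forall n, r n <> 0) -> ratio_asympt r x -> ratio_asympt (fun n => / r n) (- x).
Proof.
  intros H0 H. unfold ratio_asympt.
  apply is_lim_seq_ext with (fun n => - (INR n * (r n - 1)) / r n).
  { intros n. field. apply H0. }
  replace (- x) with (- x / 1) by field.
  apply is_lim_seq_div'; [|now apply ratio_asympt_lim with x|lra].
  exact (proj1 (is_lim_seq_opp _ x) H).
Qed.

Lemma ratio_asympt_ext_loc r1 r2 x : eventually (fun n => r1 n = r2 n) ->
  ratio_asympt r1 x -> ratio_asympt r2 x.
Proof.
  intros H. apply is_lim_seq_ext_loc. apply filter_imp with (2 := H).
  intros n Hn; now rewrite Hn.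
Qed.

(** For X = n + Re z > 0 the modulus lies between X and X + (Im z)^2 / (2 X), since the square of
    the latter exceeds X^2 + (Im z)^2. *)
Lemma Cmod_plus_INR_asympt (z : C) : is_lim_seq (fun n => Cmod (z + RtoC (INR n)) - INR n) (Re z).
Proof.
  apply is_lim_seq_le_le_loc with (u := fun _ => Re z)
    (w := fun n => Re z + Im z ^ 2 * / (2 * (INR n + Re z))).
  - destruct (INR_unbounded (Rabs (Re z) + 1)) as (N & HN). exists N. intros n Hn.
    apply le_INR in Hn. assert (Ha := Rle_abs (- Re z)). rewrite Rabs_Ropp in Ha.
    assert (Hx : 0 < INR n + Re z) by lra. split.
    + assert (H := re_le_Cmod (z + RtoC (INR n))). rewrite Re_plus, Re_RtoC in H.
      assert (H2 := Rle_abs (Re z + INR n)). lra.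
    + set (X := INR n + Re z) in *.
      assert (H : Cmod (z + RtoC (INR n)) <= X + Im z ^ 2 * / (2 * X)).
      { unfold Cmod. replace (X + Im z ^ 2 * / (2 * X)) with (sqrt ((X + Im z ^ 2 * / (2 * X)) ^ 2)).
        2:{ apply sqrt_pow2. assert (0 <= Im z ^ 2 * / (2 * X)).
            { apply Rmult_le_pos; [nra|left; apply Rinv_0_lt_compat; lra]. } lra. }
        apply sqrt_le_1_alt. simpl fst. simpl snd.
        replace ((X + Im z ^ 2 * / (2 * X)) ^ 2) with (X ^ 2 + Im z ^ 2 + (Im z ^ 2 * / (2 * X)) ^ 2)
          by (field; lra).
        assert (0 <= (Im z ^ 2 * / (2 * X)) ^ 2) by apply pow2_ge_0.
        unfold X, Re, Im in *. simpl. simpl in H. nra. }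
      unfold X in *. lra.
  - apply is_lim_seq_const.
  - replace (Finite (Re z)) with (Finite (Re z + Im z ^ 2 * 0)) by (f_equal; ring).
    apply is_lim_seq_plus'; [apply is_lim_seq_const|].
    apply is_lim_seq_mult'; [apply is_lim_seq_const|].
    apply is_lim_seq_ext with (fun n => / 2 * / (INR n + Re z)); [intros n; symmetry; apply Rinv_mult|].
    replace (Finite 0) with (Finite (/ 2 * 0)) by (f_equal; ring).
    apply is_lim_seq_mult'; [apply is_lim_seq_const|].
    apply (is_lim_seq_inv _ p_infty); [|discriminate].
    apply (is_lim_seq_plus _ _ p_infty (Re z) p_infty); [apply is_lim_seq_INR|apply is_lim_seq_const|reflexivity].
Qed.

(* The junk value at [n = 0] is chosen nonzero so that the sequence can be inverted. *)
Lemma ratio_asympt_Cmod (z : C) k :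
  ratio_asympt (fun n => match n with O => 1 | _ => (Cmod (z + RtoC (INR n)) + k) / INR n end) (Re z + k).
Proof.
  unfold ratio_asympt.
  apply is_lim_seq_ext_loc with (fun n => (Cmod (z + RtoC (INR n)) - INR n) + k).
  - exists 1%nat. intros n Hn. destruct n as [|n]; [lia|]. field. apply not_0_INR. lia.
  - apply is_lim_seq_plus'; [apply Cmod_plus_INR_asympt|apply is_lim_seq_const].
Qed.

Definition hyp_term (la lb : list C) (n : nat) : C :=
  (poch_prod la n / poch_prod lb n * (1 ^ n / RtoC (INR (fact n))))%C.

Lemma hyp_term_succ a b c d e f g n :
  poch e (S n) <> 0%C -> poch f (S n) <> 0%C -> poch g (S n) <> 0%C ->
  hyp_term [a; b; c; d] [e; f; g] (S n) =
  (hyp_term [a; b; c; d] [e; f; g] n *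
   (((a + RtoC (INR n)) * (b + RtoC (INR n)) * ((c + RtoC (INR n)) * (d + RtoC (INR n)))) *
    (/ (e + RtoC (INR n)) * / (f + RtoC (INR n)) * / (g + RtoC (INR n)) * RtoC (/ INR (S n)))))%C.
Proof.
  intros He Hf Hg. unfold hyp_term, poch_prod. cbn [fold_right]. cbn [poch] in *.
  assert (Hz : forall x y : C, (x * y)%C <> 0%C -> x <> 0%C /\ y <> 0%C).
  { intros x y H; split; intros ->; apply H; ring. }
  apply Hz in He. apply Hz in Hf. apply Hz in Hg.
  assert (Hn : INR (S n) <> 0) by (apply not_0_INR; lia).
  rewrite !Cpow_1_l, fact_simpl, mult_INR, RtoC_mult, RtoC_inv by exact Hn.
  field. repeat split; first [tauto|now apply RtoC_neq_0|apply INR_fact_neq_0_C].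
Qed.

Lemma Re_pos_plus_INR_lt (e : C) k n : k < Re e -> k < Cmod (e + RtoC (INR n)).
Proof.
  intros H. assert (H1 := re_le_Cmod (e + RtoC (INR n))). rewrite Re_plus, Re_RtoC in H1.
  assert (H2 := Rle_abs (Re e + INR n)). assert (H3 := pos_INR n). lra.
Qed.

Lemma An_Re_pos R0 k e le h : An R0 k le -> small R0 h -> k < Re e -> 0 < Re (e + le h)%C.
Proof.
  intros H Hh Hk. rewrite Re_plus. assert (H1 := An_bound _ _ _ _ H Hh).
  assert (H2 := re_le_Cmod (le h)). assert (H3 := Rle_abs (- Re (le h))). rewrite Rabs_Ropp in H3. lra.
Qed.

Lemma An_plus_INR R0 k (a : C) la n : 0 <= R0 -> An R0 k la ->
  An R0 (Cmod (a + RtoC (INR n)) + k) (fun h => a + la h + RtoC (INR n))%C.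
Proof.
  intros HR H. apply An_ext with (fun h => (a + RtoC (INR n)) + la h)%C; [intros h _; ring|].
  apply An_plus; [exact HR|now apply An_const|exact H].
Qed.

Lemma An_inv_plus_INR R0 k (a : C) la n : 0 <= R0 -> An R0 k la -> k < Re a ->
  An R0 (/ (Cmod (a + RtoC (INR n)) - k)) (fun h => / (a + la h + RtoC (INR n)))%C.
Proof.
  intros HR H Hk.
  apply An_ext with (fun h => / ((a + RtoC (INR n)) + la h))%C; [intros h _; f_equal; ring|].
  apply An_inv; [exact HR|exact H|now apply Re_pos_plus_INR_lt].
Qed.

(** A bound for the ratio of consecutive terms that is uniform when each parameter moves by at most
    k: the numerators grow by k and the denominators shrink by k. *)
Definition hyp_ratio (k : R) (a b c d e f g : C) (n : nat) : R :=
  ((Cmod (a + RtoC (INR n)) + k) * (Cmod (b + RtoC (INR n)) + k) *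
   ((Cmod (c + RtoC (INR n)) + k) * (Cmod (d + RtoC (INR n)) + k))) *
  (/ (Cmod (e + RtoC (INR n)) - k) * / (Cmod (f + RtoC (INR n)) - k) *
   / (Cmod (g + RtoC (INR n)) - k) * / INR (S n)).

Fixpoint hyp_bound (k : R) (a b c d e f g : C) (n : nat) : R :=
  match n with
  | O => 1
  | S m => hyp_bound k a b c d e f g m * hyp_ratio k a b c d e f g m
  end.

(** The ratio is 1 + x / n + o(1 / n), where x + 1 is the sum of the upper minus the sum of the
    lower real parts plus 7 k, one k for each of the seven parameters. Raabe's test asks for x <
    -1. *)
Lemma hyp_bound_summable k a b c d e f g :
  0 < k -> k < Re e -> k < Re f -> k < Re g ->
  Re (a + b + c + d)%C - Re (e + f + g)%C + 7 * k < 0 ->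
  ex_series (hyp_bound k a b c d e f g).
Proof.
  intros Hk He Hf Hg Hs.
  assert (Hrp : forall n, 0 < hyp_ratio k a b c d e f g n).
  { intros n. unfold hyp_ratio.
    assert (Hnum : forall x : C, 0 < Cmod (x + RtoC (INR n)) + k).
    { intros x. assert (H := Cmod_ge_0 (x + RtoC (INR n))). lra. }
    assert (Hden : forall x : C, k < Re x -> 0 < / (Cmod (x + RtoC (INR n)) - k)).
    { intros x Hx. apply Rinv_0_lt_compat. assert (H := Re_pos_plus_INR_lt x k n Hx). lra. }
    repeat apply Rmult_lt_0_compat; auto. apply Rinv_0_lt_compat. apply lt_0_INR. lia. }
  apply (raabe _ (hyp_ratio k a b c d e f g)
    ((Re a + k) + (Re b + k) + ((Re c + k) + (Re d + k)) +
     (- (Re e + - k) + - (Re f + - k) + - (Re g + - k) + - (Re 1 + 0)))).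
  - induction n as [|n IH]; cbn [hyp_bound]; [lra|]. now apply Rmult_lt_0_compat.
  - reflexivity.
  (* Four numerators face four denominators, the factor n + 1 of the factorial being read as |1 +
     n|. Dividing each by n makes every factor a ratio of the form 1 + x / n. *)
  - apply (ratio_asympt_ext_loc (fun n =>
      let r (z : C) (k : R) := match n with O => 1 | _ => (Cmod (z + RtoC (INR n)) + k) / INR n end in
      (r a k * r b k * (r c k * r d k)) * (/ r e (- k) * / r f (- k) * / r g (- k) * / r (RtoC 1) 0))).
    + exists 1%nat. intros n Hn. destruct n as [|n]; [lia|]. cbv zeta.
      unfold hyp_ratio. replace (Cmod (RtoC 1 + RtoC (INR (S n)))) with (INR (S (S n))).
      2:{ assert (H := pos_INR (S n)).
          rewrite <- RtoC_plus, Cmod_R, Rabs_pos_eq by lra. rewrite (S_INR (S n)). ring. }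
      assert (Hn0 : INR (S n) <> 0) by (apply not_0_INR; lia).
      assert (Hn1 : INR (S (S n)) <> 0) by (apply not_0_INR; lia).
      assert (H1 := Re_pos_plus_INR_lt e k (S n) He). assert (H2 := Re_pos_plus_INR_lt f k (S n) Hf).
      assert (H3 := Re_pos_plus_INR_lt g k (S n) Hg).
      set (N1 := INR (S n)) in *. set (N2 := INR (S (S n))) in *.
      field. repeat split; try assumption; lra.
    + assert (Hnz : forall z k', k' = 0 \/ k' = - k -> k < Re z \/ k' = 0 /\ 0 < Re z -> forall n,
        match n with O => 1 | _ => (Cmod (z + RtoC (INR n)) + k') / INR n end <> 0).
      { intros z k' Hk' Hz [|n]; [lra|]. apply Rgt_not_eq. apply Rdiv_lt_0_compat; [|apply lt_0_INR; lia].
        destruct Hz as [Hz|[-> Hz]].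
        - assert (H := Re_pos_plus_INR_lt z k (S n) Hz). destruct Hk'; lra.
        - assert (H := Re_pos_plus_INR_lt z 0 (S n) Hz). lra. }
      cbv zeta. repeat apply ratio_asympt_mult; try apply ratio_asympt_Cmod;
        apply ratio_asympt_inv; try apply ratio_asympt_Cmod; apply Hnz; auto.
      right; split; [reflexivity|]. simpl; lra.
  - rewrite !Re_plus in Hs. simpl (Re 1). lra.
Qed.

Lemma An_hyp R0 k a b c d e f g la lb lc ld le lf lg :
  0 <= R0 -> 0 < k -> k < Re e -> k < Re f -> k < Re g ->
  An R0 k la -> An R0 k lb -> An R0 k lc -> An R0 k ld -> An R0 k le -> An R0 k lf -> An R0 k lg ->
  forall n, An R0 (hyp_bound k a b c d e f g n)
    (fun h => hyp_term [(a + la h)%C; (b + lb h)%C; (c + lc h)%C; (d + ld h)%C]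
                       [(e + le h)%C; (f + lf h)%C; (g + lg h)%C] n).
Proof.
  intros HR Hk He Hf Hg Aa Ab Ac Ad Ae Af Ag. induction n as [|n IH].
  - apply An_ext with (fun _ => RtoC 1).
    { intros h _. unfold hyp_term, poch_prod; simpl. field. }
    cbn [hyp_bound]. apply An_weaken with (Cmod 1); [rewrite Cmod_1; lra|]. now apply An_const.
  - cbn [hyp_bound].
    eapply An_ext.
    { intros h Hh. symmetry. apply hyp_term_succ; apply Re_pos_poch_neq_0; eapply An_Re_pos; eassumption. }
    apply An_mult; [exact HR|exact IH|]. unfold hyp_ratio.
    repeat apply An_mult; try exact HR; try (apply An_plus_INR; assumption);
      try (apply An_inv_plus_INR; assumption).
    apply An_weaken with (Cmod (RtoC (/ INR (S n)))); [|now apply An_const].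
    rewrite Cmod_R, Rabs_pos_eq; [lra|]. left. apply Rinv_0_lt_compat, lt_0_INR. lia.
Qed.

(** * The continuation of L at the point of the theorem *)

Lemma is_derive_quadratic (f : R -> R) (l B r : R) : 0 < r ->
  (forall t, Rabs t <= r -> Rabs (f t - f 0 - t * l) <= B * t ^ 2) -> is_derive f 0 l.
Proof.
  intros Hr H. apply is_derive_Reals. intros eps Heps.
  assert (HB : 0 <= B).
  { specialize (H r ltac:(rewrite Rabs_pos_eq; lra)). assert (H1 := Rabs_pos (f r - f 0 - r * l)).
    assert (0 < r ^ 2) by (apply pow_lt; lra).
    apply Rmult_le_reg_r with (r ^ 2); [assumption|]. rewrite Rmult_0_l. lra. }
  assert (Hd : 0 < Rmin r (eps / (B + 1))).
  { apply Rmin_pos; [exact Hr|]. apply Rdiv_lt_0_compat; lra. }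
  exists (mkposreal _ Hd). intros h Hh Hhd. simpl in Hhd.
  assert (H1 : Rabs h <= r). { assert (H1 := Rmin_l r (eps / (B + 1))). lra. }
  assert (H2 : Rabs h < eps / (B + 1)). { assert (H2 := Rmin_r r (eps / (B + 1))). lra. }
  specialize (H h H1). rewrite Rplus_0_l.
  replace ((f h - f 0) / h - l) with ((f h - f 0 - h * l) / h) by (field; exact Hh).
  unfold Rdiv. rewrite Rabs_mult, Rabs_inv.
  assert (Hp : 0 < Rabs h) by now apply Rabs_pos_lt.
  apply Rle_lt_trans with (B * Rabs h).
  - apply Rmult_le_reg_r with (Rabs h); [exact Hp|]. rewrite Rmult_assoc, Rinv_l, Rmult_1_r by lra.
    rewrite <- (pow2_abs h) in H. lra.
  - apply Rle_lt_trans with (Rabs h * (B + 1)); [nra|].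
    apply Rmult_lt_reg_r with (/ (B + 1)); [apply Rinv_0_lt_compat; lra|].
    rewrite Rmult_assoc, Rinv_r, Rmult_1_r by lra. exact H2.
Qed.

Lemma is_Cderive_quadratic (f : R -> C) (l : C) (B r : R) : 0 < r ->
  (forall t, Rabs t <= r -> Cmod (f t - f 0 - RtoC t * l)%C <= B * t ^ 2) -> is_Cderive f 0 l.
Proof.
  intros Hr H. split; apply (is_derive_quadratic _ _ B r Hr); intros t Ht; eapply Rle_trans.
  2, 4: apply (H t Ht).
  - eapply Rle_trans; [|apply re_le_Cmod]. right. f_equal.
    unfold Cminus. rewrite !Re_plus, !Re_opp, Re_mult, Re_RtoC, Im_RtoC. ring.
  - eapply Rle_trans; [|apply im_le_Cmod]. right. f_equal.
    unfold Cminus. rewrite !Im_plus, !Im_opp, Im_mult, Re_RtoC, Im_RtoC. ring.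
Qed.

(** * Expansions along a real line *)

Definition line (v : C6) (t : R) : C6 := scal (RtoC t) (v : V6).

Lemma crd_line i v t : crd i (line v t) = (RtoC t * crd i v)%C.
Proof. exact (crd_scal i (RtoC t) v). Qed.

Lemma line_0 v : line v 0 = (zero : V6).
Proof. exact (scal_zero_l (v : V6)). Qed.

Lemma line_small v t : small 1 v -> small (Rabs t) (line v t).
Proof.
  intros Hv i. rewrite crd_line, Cmod_mult, Cmod_R.
  rewrite <- (Rmult_1_r (Rabs t)) at 2. apply Rmult_le_compat_l; [apply Rabs_pos|apply Hv].
Qed.

Lemma An_line r K f (v : C6) : 0 < r -> small 1 v -> An r K f ->
  exists l : C, Cmod l <= K / r /\ forall t, Rabs t <= r ->
    Cmod (f (line v t) - f (line v 0) - RtoC t * l)%C <= K / r ^ 2 * t ^ 2.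
Proof.
  intros Hr Hv Hf. destruct (An_taylor r K f Hr Hf) as (l & Hl & H1 & H2).
  exists (l v). split.
  - assert (H := H1 v 1 Rle_0_1 Hv). unfold Rdiv in *. rewrite Rmult_1_l in H. exact H.
  - intros t Ht.
    assert (E : l (line v t) = (RtoC t * l v)%C) by exact (linear_scal l Hl (RtoC t) v).
    rewrite <- E, line_0.
    replace (K / r ^ 2 * t ^ 2) with (K * (Rabs t / r) ^ 2).
    2:{ rewrite <- (pow2_abs t). field. lra. }
    apply H2; [exact Ht|now apply line_small].
Qed.

Lemma An_line_derive r K f (v : C6) : 0 < r -> small 1 v -> An r K f ->
  exists l : C, is_Cderive (fun t => f (line v t)) 0 l.
Proof.
  intros Hr Hv Hf. destruct (An_line r K f v Hr Hv Hf) as (l & _ & H).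
  exists l. exact (is_Cderive_quadratic _ _ (K / r ^ 2) r Hr H).
Qed.

(** Termwise differentiation: the remainder of the n-th term is at most K(n) t^2 / r^2, so the
    remainder of the sum is still quadratic in t. *)
Lemma An_line_derive_series r (K : nat -> R) (T : R) (f : nat -> C6 -> C) (F : C6 -> C) (v : C6)
  (z : nat -> C) :
  0 < r -> small 1 v -> (forall n, An r (K n) (f n)) -> is_series K T ->
  (forall h, small r h -> is_Cseries (fun n => f n h) (F h)) ->
  (forall n, is_Cderive (fun t => f n (line v t)) 0 (z n)) ->
  is_Cseries z (CSeries z) /\ is_Cderive (fun t => F (line v t)) 0 (CSeries z).
Proof.
  intros Hr Hv Hf HK HF Hz.
  assert (Hl : forall n, Cmod (z n) <= / r * K n /\ forall t, Rabs t <= r ->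
    Cmod (f n (line v t) - f n (line v 0) - RtoC t * z n)%C <= t ^ 2 / r ^ 2 * K n).
  { intros n. destruct (An_line r (K n) (f n) v Hr Hv (Hf n)) as (l & H1 & H2).
    assert (Hlz : l = z n).
    { apply (is_Cderive_unique (fun t => f n (line v t)) 0); [|apply Hz].
      exact (is_Cderive_quadratic _ _ (K n / r ^ 2) r Hr H2). }
    subst l. split; [unfold Rdiv in H1; lra|]. intros t Ht. specialize (H2 t Ht). unfold Rdiv in *. lra. }
  assert (Hs : is_Cseries z (CSeries z)).
  { apply is_Cseries_abs. apply (ex_series_le_pos _ (fun n => / r * K n)).
    - intros n; split; [apply Cmod_ge_0|apply Hl].
    - eexists. exact (is_series_scal (V := R_NormedModule) (/ r) _ _ HK). }
  split; [exact Hs|].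
  apply (is_Cderive_quadratic _ _ (T / r ^ 2) r Hr). intros t Ht.
  assert (Hsm : forall t, Rabs t <= r -> small r (line v t)).
  { intros t' Ht'. apply small_weaken with (1 := Ht'). now apply line_small. }
  assert (H0 : Rabs 0 <= r) by (rewrite Rabs_R0; lra).
  replace (T / r ^ 2 * t ^ 2) with (t ^ 2 / r ^ 2 * T) by (field; lra).
  apply (is_Cseries_le (fun n => f n (line v t) + - (1) * f n (line v 0) + (- RtoC t) * z n)%C
    _ (fun n => t ^ 2 / r ^ 2 * K n)).
  - replace (F (line v t) - F (line v 0) - RtoC t * CSeries z)%C with
      (F (line v t) + - (1) * F (line v 0) + (- RtoC t) * CSeries z)%C by ring.
    apply is_Cseries_plus; [apply is_Cseries_plus|].
    + now apply HF, Hsm.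
    + apply is_Cseries_scal. now apply HF, Hsm.
    + now apply is_Cseries_scal.
  - intros n. destruct (Hl n) as [_ H]. specialize (H t Ht).
    replace (f n (line v t) + - (1) * f n (line v 0) + (- RtoC t) * z n)%C with
      (f n (line v t) - f n (line v 0) - RtoC t * z n)%C by ring. exact H.
  - exact (is_series_scal (V := R_NormedModule) (t ^ 2 / r ^ 2) _ _ HK).
Qed.

Lemma ball_small (p q : V6) (eps : posreal) r : r < eps -> small r (minus q p) -> ball p eps q.
Proof.
  intros Hr H.
  assert (Hb : forall x y : C, Cmod (y - x) <= r -> @ball C_UniformSpace x eps y).
  { intros x y Hxy. apply C_NormedModule_mixin_compat1. eapply Rle_lt_trans; [exact Hxy|exact Hr]. }
  destruct p as [[[[[p0 p1] p2] p3] p4] p5], q as [[[[[q0 q1] q2] q3] q4] q5].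
  exact (conj (conj (conj (conj (conj (Hb p0 q0 (H 0%nat)) (Hb p1 q1 (H 1%nat)))
    (Hb p2 q2 (H 2%nat))) (Hb p3 q3 (H 3%nat))) (Hb p4 q4 (H 4%nat))) (Hb p5 q5 (H 5%nat))).
Qed.

(** A ball of C is a square in the real and imaginary parts, whence the factor 2. *)
Lemma small_ball (p q : V6) (eps : posreal) : ball p eps q -> small (2 * eps) (minus q p).
Proof.
  intros H.
  assert (Hb : forall x y : C, @ball C_UniformSpace x eps y -> Cmod (y - x) <= 2 * eps).
  { intros x y [H1 H2]. eapply Rle_trans; [apply Cmod_le_Re_Im|].
    assert (H3 : Rabs (Re (y - x)%C) < eps) by exact H1.
    assert (H4 : Rabs (Im (y - x)%C) < eps) by exact H2. lra. }
  destruct p as [[[[[p0 p1] p2] p3] p4] p5], q as [[[[[q0 q1] q2] q3] q4] q5].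
  destruct H as [[[[[H0 H1] H2] H3] H4] H5].
  intros [|[|[|[|[|i]]]]].
  - exact (Hb p0 q0 H0).
  - exact (Hb p1 q1 H1).
  - exact (Hb p2 q2 H2).
  - exact (Hb p3 q3 H3).
  - exact (Hb p4 q4 H4).
  - exact (Hb p5 q5 H5).
Qed.

Lemma Cexp_i_PI : Cexp (Ci * RtoC PI) = (- (1))%C.
Proof.
  unfold Cexp. rewrite Re_mult, Im_mult. simpl.
  replace (0 * PI - 1 * 0) with 0 by ring. replace (0 * 0 + 1 * PI) with PI by ring.
  rewrite exp_0, cos_PI, sin_PI. apply C_ext; simpl; ring.
Qed.

Lemma Ci_neq_0 : Ci <> 0%C.
Proof. intros H. injection H. lra. Qed.

Lemma Csin_PI_shift x : Csin (RtoC PI * (1 + x)) =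
  (- (Cexp (Ci * (RtoC PI * x)) - Cexp (- (Ci * (RtoC PI * x)))) / (2 * Ci))%C.
Proof.
  unfold Csin. replace (Ci * (RtoC PI * (1 + x)))%C with (Ci * RtoC PI + Ci * (RtoC PI * x))%C by ring.
  replace (- (Ci * RtoC PI + Ci * (RtoC PI * x)))%C with (- (Ci * RtoC PI) + - (Ci * (RtoC PI * x)))%C by ring.
  rewrite !Cexp_plus, !(Cexp_opp (Ci * RtoC PI)), Cexp_i_PI. field. exact Ci_neq_0.
Qed.

Lemma Csin_PI_real (t : R) : Csin (RtoC PI * (1 + RtoC (- t))) = RtoC (sin (PI * t)).
Proof.
  unfold Csin. replace (RtoC PI * (1 + RtoC (- t)))%C with (RtoC (PI - PI * t)).
  2:{ apply C_ext; simpl; ring. }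
  set (x := PI - PI * t). rewrite <- sin_PI_x. fold x. rewrite Cexp_opp. unfold Cexp.
  rewrite Re_mult, Im_mult. simpl Re. simpl Im.
  replace (0 * x - 1 * 0) with 0 by ring. replace (0 * 0 + 1 * x) with x by ring.
  rewrite exp_0, !Rmult_1_l.
  assert (H : (/ (cos x, sin x))%C = (cos x, - sin x)).
  { assert (H1 := sin2_cos2 x). unfold Rsqr in H1. unfold Cinv; simpl.
    replace (cos x * (cos x * 1) + sin x * (sin x * 1)) with 1 by lra.
    f_equal; field. }
  rewrite H. replace (Cminus (cos x, sin x) (cos x, - sin x)) with (RtoC (sin x) * (2 * Ci))%C.
  2:{ apply C_ext; simpl; ring. }
  field. exact Ci_neq_0.
Qed.

(* On a small polydisc sin (pi (1 + h_4)) = h_4 * sigma with sigma = - pi - tau. *)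
Lemma An_sin_factor r : 0 < r -> PI * r < 1 -> exists tau,
  An r (PI ^ 2 * r) tau /\
  forall h, small r h -> Csin (RtoC PI * (1 + crd 4 h)) = (crd 4 h * (- RtoC PI + - tau h))%C.
Proof.
  intros Hr Hr1. assert (HPI := PI_RGT_0). assert (Hr0 : 0 <= r) by lra.
  set (w := fun h => (Ci * (RtoC PI * crd 4 h))%C).
  assert (HCi : Cmod Ci = 1).
  { unfold Cmod, Ci; simpl. replace (0 * (0 * 1) + 1 * (1 * 1)) with 1 by ring. apply sqrt_1. }
  assert (Hw : An r (PI * r) w).
  { apply An_weaken with (Cmod Ci * (Cmod (RtoC PI) * r)).
    - rewrite HCi, Cmod_R, Rabs_pos_eq; lra.
    - apply An_scal; [exact Hr0|]. apply An_scal; [exact Hr0|]. now apply An_crd. }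
  assert (Hw' : An r (PI * r) (fun h => - w h)%C) by now apply An_opp.
  assert (H1 := An_Cexp_taylor r _ _ Hr0 Hw ltac:(lra)).
  assert (H2 := An_Cexp_taylor r _ _ Hr0 Hw' ltac:(lra)).
  set (rho := fun h => (/ (2 * Ci) * ((Cexp (w h) - 1 - w h) - (Cexp (- w h) - 1 - - w h)))%C).
  assert (H3 : An r ((PI * r) ^ 2) rho).
  { apply An_weaken with (Cmod (/ (2 * Ci)) * ((PI * r) ^ 2 + (PI * r) ^ 2)).
    - rewrite Cmod_inv, Cmod_mult, HCi, Cmod_R, Rabs_pos_eq by
        (try lra; intros H; injection H; lra). lra.
    - apply An_scal; [exact Hr0|]. now apply An_minus. }
  destruct (An_div_e r _ _ Hr H3) as (tau & Ht & Htau).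
  exists tau. split.
  - apply An_weaken with (2 := Ht). right. field. lra.
  - intros h Hh. specialize (Htau h Hh).
    assert (Hk : rho (kill_e h) = 0%C).
    { unfold rho, w. replace (crd 4 (kill_e h)) with (RtoC 0).
      2:{ destruct h as [[[[[x0 x1] x2] x3] x4] x5]. reflexivity. }
      replace (- (Ci * (RtoC PI * RtoC 0)))%C with (Ci * (RtoC PI * RtoC 0))%C by ring. ring. }
    rewrite Hk, Cplus_0_l in Htau.
    replace (crd 4 h * (- RtoC PI + - tau h))%C with (- RtoC PI * crd 4 h - crd 4 h * tau h)%C by ring.
    rewrite <- Htau, Csin_PI_shift. fold (w h).
    replace (- RtoC PI * crd 4 h)%C with (- (2 * w h) / (2 * Ci))%C.
    + unfold rho. field. exact Ci_neq_0.
    + unfold w. field. exact Ci_neq_0.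
Qed.

(** * The parameters of L near the point of the theorem *)

Definition pA (s : C) (h : C6) : C := (s + 2 + crd 0 h)%C.
Definition pB (s : C) (h : C6) : C := (s + crd 1 h)%C.
Definition pC (s : C) (h : C6) : C := (1 / 2 + crd 2 h)%C.
Definition pD (s : C) (h : C6) : C := (1 / 2 + crd 3 h)%C.
Definition pE (s : C) (h : C6) : C := (1 + crd 4 h)%C.
Definition pF (s : C) (h : C6) : C := (s + 3 / 2 + crd 5 h)%C.
(** The base values satisfy the Saalschütz relation, so on the hyperplane g moves by the linear part
    of [hyp_g]. *)
Definition pG (s : C) (h : C6) : C :=
  (s + 3 / 2 + (crd 0 h + crd 1 h + crd 2 h + crd 3 h - crd 4 h - crd 5 h))%C.

Definition base_point (s : C) : C6 := (s + 2, s, 1 / 2, 1 / 2, RtoC 1, s + 3 / 2)%C.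

(* [sin (pi e)] times the two terms of [L_formula]. *)
Definition num_fst (a b c d e f g : C) : C :=
  (pFq [a; b; c; d] [e; f; g] 1 *
   (RGamma e * RGamma f * RGamma g *
    (RGamma (1 + a - e) * RGamma (1 + b - e) * RGamma (1 + c - e) * RGamma (1 + d - e))))%C.

Definition num_snd (a b c d e f g : C) : C :=
  (pFq [1 + a - e; 1 + b - e; 1 + c - e; 1 + d - e] [1 + f - e; 1 + g - e; 2 - e] 1 *
   (RGamma a * RGamma b * RGamma c * RGamma d *
    RGamma (1 + f - e) * RGamma (1 + g - e) * RGamma (2 - e)))%C.

Lemma L_formula_num a b c d e f g : Csin (RtoC PI * e) <> 0%C ->
  0 < Re a -> 0 < Re b -> 0 < Re c -> 0 < Re d -> 0 < Re e -> 0 < Re f -> 0 < Re g ->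
  0 < Re (1 + a - e)%C -> 0 < Re (1 + b - e)%C -> 0 < Re (1 + c - e)%C -> 0 < Re (1 + d - e)%C ->
  0 < Re (1 + f - e)%C -> 0 < Re (1 + g - e)%C -> 0 < Re (2 - e)%C ->
  L_formula a b c d e f g =
  ((num_fst a b c d e f g - num_snd a b c d e f g) / Csin (RtoC PI * e))%C.
Proof.
  intros Hsin Ha Hb Hc Hd He Hf Hg Ha' Hb' Hc' Hd' Hf' Hg' He'.
  unfold L_formula, num_fst, num_snd. rewrite !CGamma_RGamma by assumption.
  generalize (RGamma_neq_0 _ Ha) (RGamma_neq_0 _ Hb) (RGamma_neq_0 _ Hc) (RGamma_neq_0 _ Hd)
    (RGamma_neq_0 _ He) (RGamma_neq_0 _ Hf) (RGamma_neq_0 _ Hg)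
    (RGamma_neq_0 _ Ha') (RGamma_neq_0 _ Hb') (RGamma_neq_0 _ Hc') (RGamma_neq_0 _ Hd')
    (RGamma_neq_0 _ Hf') (RGamma_neq_0 _ Hg') (RGamma_neq_0 _ He').
  generalize (RGamma a) (RGamma b) (RGamma c) (RGamma d) (RGamma e) (RGamma f) (RGamma g)
    (RGamma (1 + a - e)) (RGamma (1 + b - e)) (RGamma (1 + c - e)) (RGamma (1 + d - e))
    (RGamma (1 + f - e)) (RGamma (1 + g - e)) (RGamma (2 - e)).
  generalize (pFq [a; b; c; d] [e; f; g] 1)
    (pFq [1 + a - e; 1 + b - e; 1 + c - e; 1 + d - e]%C [1 + f - e; 1 + g - e; 2 - e]%C 1)
    (Csin (RtoC PI * e)) Hsin.
  clear. intros F1 F2 S HS ra rb rc rd re rf rg ra' rb' rc' rd' rf' rg' re'. intros.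
  field. repeat split; assumption.
Qed.

Lemma is_Cseries_hyp r k a b c d e f g la lb lc ld le lf lg h :
  0 <= r -> 0 < k -> k < Re e -> k < Re f -> k < Re g ->
  Re (a + b + c + d)%C - Re (e + f + g)%C + 7 * k < 0 ->
  An r k la -> An r k lb -> An r k lc -> An r k ld -> An r k le -> An r k lf -> An r k lg ->
  small r h ->
  is_Cseries (hyp_term [(a + la h)%C; (b + lb h)%C; (c + lc h)%C; (d + ld h)%C]
                       [(e + le h)%C; (f + lf h)%C; (g + lg h)%C])
    (pFq [(a + la h)%C; (b + lb h)%C; (c + lc h)%C; (d + ld h)%C]
         [(e + le h)%C; (f + lf h)%C; (g + lg h)%C] 1).
Proof.
  intros Hr Hk He Hf Hg Hs Aa Ab Ac Ad Ae Af Ag Hh. apply is_Cseries_abs.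
  apply (ex_series_le_pos _ (hyp_bound k a b c d e f g)); [|now apply hyp_bound_summable].
  intros n; split; [apply Cmod_ge_0|].
  exact (An_bound _ _ _ _ (An_hyp r k a b c d e f g la lb lc ld le lf lg Hr Hk He Hf Hg
    Aa Ab Ac Ad Ae Af Ag n) Hh).
Qed.

Lemma An_pFq r k a b c d e f g la lb lc ld le lf lg :
  0 <= r -> 0 < k -> k < Re e -> k < Re f -> k < Re g ->
  Re (a + b + c + d)%C - Re (e + f + g)%C + 7 * k < 0 ->
  An r k la -> An r k lb -> An r k lc -> An r k ld -> An r k le -> An r k lf -> An r k lg ->
  An r (Series (hyp_bound k a b c d e f g))
    (fun h => pFq [(a + la h)%C; (b + lb h)%C; (c + lc h)%C; (d + ld h)%C]
         [(e + le h)%C; (f + lf h)%C; (g + lg h)%C] 1).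
Proof.
  intros Hr Hk He Hf Hg Hs Aa Ab Ac Ad Ae Af Ag.
  eapply An_series; [exact Hr| | |].
  - exact (An_hyp r k a b c d e f g la lb lc ld le lf lg Hr Hk He Hf Hg Aa Ab Ac Ad Ae Af Ag).
  - apply Series_correct. now apply hyp_bound_summable.
  - intros h Hh. now apply (is_Cseries_hyp r k).
Qed.

Lemma An_RGamma_shift r k z l : 0 <= r -> An r k l -> exists K, An r K (fun h => RGamma (z + l h)).
Proof.
  intros Hr Hl. apply (An_RGamma r (Cmod z + k)); [exact Hr|].
  apply An_plus; [exact Hr|now apply An_const|exact Hl].
Qed.

Lemma An_mult_ex r f g : 0 <= r -> (exists K, An r K f) -> (exists K, An r K g) ->
  exists K, An r K (fun h => f h * g h)%C.
Proof. intros Hr (K1 & H1) (K2 & H2). eexists. apply An_mult; eassumption. Qed.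

Ltac An_product :=
  repeat match goal with
  | Hr : 0 <= ?r |- exists K, An ?r K (fun h => Cmult (@?f h) (@?g h)) => apply (An_mult_ex r f g Hr)
  end.

(** The bound k <= 1/8 keeps the convergence condition, -1 + 7 k < 0 for a Saalschützian series, and
    keeps the parameters at 1/2 and 1 in the right half-plane; k < Re s does the same for the
    parameter s. *)
Definition radius_cond (s : C) (k : R) : Prop := 0 < k /\ k <= 1 / 8 /\ k < Re s.

Lemma radius_exists s : 0 < Re s -> exists k, radius_cond s k.
Proof.
  intros Hs. exists (Rmin (1 / 8) (Re s / 2)).
  assert (H1 := Rmin_l (1 / 8) (Re s / 2)). assert (H2 := Rmin_r (1 / 8) (Re s / 2)).
  assert (0 < Rmin (1 / 8) (Re s / 2)) by (apply Rmin_pos; lra).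
  repeat split; lra.
Qed.

(** Origin of the radius k / 8: each offset of a parameter is a signed sum of at most seven
    coordinates. The longest is that of 1 + g - e, in which coordinate 4 occurs twice. *)
Lemma An_coord_combination k : 0 < k -> forall l : C6 -> C,
  (exists K, K <= 7 * (k / 8) /\ An (k / 8) K l) -> An (k / 8) k l.
Proof. intros Hk l (K & H1 & H2). apply An_weaken with (2 := H2). lra. Qed.

Ltac An_linear_step :=
  match goal with
  | |- An ?r _ (fun h => Cminus (@?f h) (@?g h)) => eapply (An_minus r _ _ f g); [lra| |]
  | |- An ?r _ (fun h => Cplus (@?f h) (@?g h)) => eapply (An_plus r _ _ f g); [lra| |]
  | |- An ?r _ (fun h => Copp (@?f h)) => eapply (An_opp r _ f); [lra|]
  | |- An ?r _ (fun h => crd ?i h) => apply (An_crd r i); lra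
  | |- An ?r _ (crd ?i) => apply (An_crd r i); lra
  end.

Ltac An_linear :=
  match goal with
  | Hk : 0 < ?k |- An (?k / 8) ?k _ =>
    apply (An_coord_combination k Hk); eexists; split; [|repeat An_linear_step]; lra
  end.

Lemma pF_shift s h : (1 + pF s h - pE s h = s + 3 / 2 + (crd 5 h - crd 4 h))%C.
Proof. unfold pF, pE. ring. Qed.
Lemma pG_shift s h : (1 + pG s h - pE s h = s + 3 / 2 +
  (crd 0 h + crd 1 h + crd 2 h + crd 3 h - crd 4 h - crd 5 h - crd 4 h))%C.
Proof. unfold pG, pE. ring. Qed.
Lemma pE_shift s h : (2 - pE s h = 1 + (- crd 4 h))%C.
Proof. unfold pE. ring. Qed.
Lemma pA_shift s h : (1 + pA s h - pE s h = s + 2 + (crd 0 h - crd 4 h))%C.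
Proof. unfold pA, pE. ring. Qed.
Lemma pB_shift s h : (1 + pB s h - pE s h = s + (crd 1 h - crd 4 h))%C.
Proof. unfold pB, pE. ring. Qed.
Lemma pC_shift s h : (1 + pC s h - pE s h = 1 / 2 + (crd 2 h - crd 4 h))%C.
Proof. unfold pC, pE. ring. Qed.
Lemma pD_shift s h : (1 + pD s h - pE s h = 1 / 2 + (crd 3 h - crd 4 h))%C.
Proof. unfold pD, pE. ring. Qed.

Lemma C_half : (1 / 2)%C = RtoC (/ 2).
Proof. rewrite RtoC_inv by lra. field. Qed.

Lemma C_three_half : (3 / 2)%C = RtoC (3 / 2).
Proof. unfold Rdiv. rewrite RtoC_mult, RtoC_inv by lra. reflexivity. Qed.

Lemma Re_base (s : C) :
  Re (s + 2)%C = Re s + 2 /\ Re (s + 3 / 2)%C = Re s + 3 / 2 /\ Re (1 / 2)%C = / 2 /\ Re 1 = 1.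
Proof. rewrite C_half, C_three_half, !Re_plus, !Re_RtoC. repeat split. Qed.

Lemma base_saalschutz s k : radius_cond s k ->
  Re (s + 2 + s + 1 / 2 + 1 / 2)%C - Re (1 + (s + 3 / 2) + (s + 3 / 2))%C + 7 * k < 0.
Proof.
  intros (H1 & H2 & H3). rewrite C_half, C_three_half, !Re_plus, !Re_RtoC. lra.
Qed.

Definition num_fst_at (s : C) (h : C6) : C :=
  num_fst (pA s h) (pB s h) (pC s h) (pD s h) (pE s h) (pF s h) (pG s h).
Definition num_snd_at (s : C) (h : C6) : C :=
  num_snd (pA s h) (pB s h) (pC s h) (pD s h) (pE s h) (pF s h) (pG s h).

Lemma An_gamma_factors s k : radius_cond s k -> exists K, An (k / 8) K
  (fun h => RGamma (pE s h) * RGamma (pF s h) * RGamma (pG s h) *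
    (RGamma (1 + pA s h - pE s h) * RGamma (1 + pB s h - pE s h) *
     RGamma (1 + pC s h - pE s h) * RGamma (1 + pD s h - pE s h)))%C.
Proof.
  intros (Hk & Hk8 & Hks). assert (Hr : 0 <= k / 8) by lra.
  An_product.
  - apply (An_RGamma_shift (k / 8) k 1%C (crd 4)); [exact Hr|An_linear].
  - apply (An_RGamma_shift (k / 8) k (s + 3 / 2)%C (crd 5)); [exact Hr|An_linear].
  - apply (An_RGamma_shift (k / 8) k (s + 3 / 2)%C
      (fun h => crd 0 h + crd 1 h + crd 2 h + crd 3 h - crd 4 h - crd 5 h)%C); [exact Hr|]. An_linear.
  - destruct (An_RGamma_shift (k / 8) k (s + 2)%C (fun h => crd 0 h - crd 4 h)%C Hr) as (K & HK); [An_linear|].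
    exists K. apply An_ext with (2 := HK). intros h _. now rewrite pA_shift.
  - destruct (An_RGamma_shift (k / 8) k s (fun h => crd 1 h - crd 4 h)%C Hr) as (K & HK); [An_linear|].
    exists K. apply An_ext with (2 := HK). intros h _. now rewrite pB_shift.
  - destruct (An_RGamma_shift (k / 8) k (1 / 2)%C (fun h => crd 2 h - crd 4 h)%C Hr) as (K & HK); [An_linear|].
    exists K. apply An_ext with (2 := HK). intros h _. now rewrite pC_shift.
  - destruct (An_RGamma_shift (k / 8) k (1 / 2)%C (fun h => crd 3 h - crd 4 h)%C Hr) as (K & HK); [An_linear|].
    exists K. apply An_ext with (2 := HK). intros h _. now rewrite pD_shift.
Qed.

Lemma An_hyp_at s k : radius_cond s k -> forall n,
  An (k / 8) (hyp_bound k (s + 2) s (1 / 2) (1 / 2) 1 (s + 3 / 2) (s + 3 / 2) n)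
    (fun h => hyp_term [pA s h; pB s h; pC s h; pD s h] [pE s h; pF s h; pG s h] n).
Proof.
  intros (Hk & Hk8 & Hks). destruct (Re_base s) as (E1 & E2 & E3 & E4). assert (Hr : 0 <= k / 8) by lra.
  unfold pA, pB, pC, pD, pE, pF, pG.
  apply (An_hyp (k / 8) k (s + 2)%C s (1 / 2)%C (1 / 2)%C 1%C (s + 3 / 2)%C (s + 3 / 2)%C
      (crd 0) (crd 1) (crd 2) (crd 3) (crd 4) (crd 5)
      (fun h => crd 0 h + crd 1 h + crd 2 h + crd 3 h - crd 4 h - crd 5 h)%C);
    rewrite ?E1, ?E2, ?E3, ?E4; try lra; An_linear.
Qed.

Lemma is_Cseries_hyp_at s k h : radius_cond s k -> small (k / 8) h ->
  is_Cseries (hyp_term [pA s h; pB s h; pC s h; pD s h] [pE s h; pF s h; pG s h])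
    (pFq [pA s h; pB s h; pC s h; pD s h] [pE s h; pF s h; pG s h] 1).
Proof.
  intros Hc Hh. assert (Hs := base_saalschutz s k Hc). destruct Hc as (Hk & Hk8 & Hks).
  destruct (Re_base s) as (E1 & E2 & E3 & E4). assert (Hr : 0 <= k / 8) by lra.
  unfold pA, pB, pC, pD, pE, pF, pG.
  apply (is_Cseries_hyp (k / 8) k (s + 2)%C s (1 / 2)%C (1 / 2)%C 1%C (s + 3 / 2)%C (s + 3 / 2)%C
      (crd 0) (crd 1) (crd 2) (crd 3) (crd 4) (crd 5)
      (fun h => crd 0 h + crd 1 h + crd 2 h + crd 3 h - crd 4 h - crd 5 h)%C);
    rewrite ?E1, ?E2, ?E3, ?E4; try exact Hs; try exact Hh; try lra; An_linear.
Qed.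

Lemma An_num_fst s k : radius_cond s k -> exists K, An (k / 8) K (num_fst_at s).
Proof.
  intros Hc. assert (Hr : 0 <= k / 8) by (destruct Hc; lra).
  unfold num_fst_at, num_fst. apply (An_mult_ex (k / 8)
    (fun h => pFq [pA s h; pB s h; pC s h; pD s h] [pE s h; pF s h; pG s h] 1) _ Hr);
    [|exact (An_gamma_factors s k Hc)].
  eexists. eapply An_series; [exact Hr|exact (An_hyp_at s k Hc)| |].
  - apply Series_correct. assert (Hs := base_saalschutz s k Hc). destruct Hc as (Hk & Hk8 & Hks).
    destruct (Re_base s) as (E1 & E2 & E3 & E4).
    apply hyp_bound_summable; rewrite ?E1, ?E2, ?E3, ?E4; try exact Hs; lra.
  - intros h Hh. exact (is_Cseries_hyp_at s k h Hc Hh).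
Qed.

Lemma An_num_snd s k : radius_cond s k -> exists K, An (k / 8) K (num_snd_at s).
Proof.
  intros Hc. assert (Hs := base_saalschutz s k Hc). destruct Hc as (Hk & Hk8 & Hks).
  destruct (Re_base s) as (E1 & E2 & E3 & E4). assert (Hr : 0 <= k / 8) by lra.
  unfold num_snd_at, num_snd.
  An_product.
  - assert (HP := An_pFq (k / 8) k (s + 2)%C s (1 / 2)%C (1 / 2)%C (s + 3 / 2)%C (s + 3 / 2)%C 1%C
      (fun h => crd 0 h - crd 4 h)%C (fun h => crd 1 h - crd 4 h)%C (fun h => crd 2 h - crd 4 h)%C
      (fun h => crd 3 h - crd 4 h)%C (fun h => crd 5 h - crd 4 h)%C
      (fun h => crd 0 h + crd 1 h + crd 2 h + crd 3 h - crd 4 h - crd 5 h - crd 4 h)%C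
      (fun h => - crd 4 h)%C).
    rewrite E2, E4 in HP. eexists. eapply An_ext.
    2:{ apply HP; try lra; try An_linear.
        replace (s + 3 / 2 + (s + 3 / 2) + 1)%C with (1 + (s + 3 / 2) + (s + 3 / 2))%C by ring. exact Hs. }
    intros h _. cbv beta. now rewrite pA_shift, pB_shift, pC_shift, pD_shift, pF_shift, pG_shift, pE_shift.
  - apply (An_RGamma_shift (k / 8) k (s + 2)%C (crd 0)); [exact Hr|An_linear].
  - apply (An_RGamma_shift (k / 8) k s (crd 1)); [exact Hr|An_linear].
  - apply (An_RGamma_shift (k / 8) k (1 / 2)%C (crd 2)); [exact Hr|An_linear].
  - apply (An_RGamma_shift (k / 8) k (1 / 2)%C (crd 3)); [exact Hr|An_linear].
  - destruct (An_RGamma_shift (k / 8) k (s + 3 / 2)%C (fun h => crd 5 h - crd 4 h)%C Hr) as (K & HK); [An_linear|].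
    exists K. apply An_ext with (2 := HK). intros h _. now rewrite pF_shift.
  - destruct (An_RGamma_shift (k / 8) k (s + 3 / 2)%C
      (fun h => crd 0 h + crd 1 h + crd 2 h + crd 3 h - crd 4 h - crd 5 h - crd 4 h)%C Hr) as (K & HK);
      [An_linear|].
    exists K. apply An_ext with (2 := HK). intros h _. now rewrite pG_shift.
  - destruct (An_RGamma_shift (k / 8) k 1%C (fun h => - crd 4 h)%C Hr) as (K & HK); [An_linear|].
    exists K. apply An_ext with (2 := HK). intros h _. now rewrite pE_shift.
Qed.

Lemma poch_prod_rotate x y z n : poch_prod [x; y; z] n = poch_prod [y; z; x] n.
Proof. unfold poch_prod; simpl. ring. Qed.

(** In the second series of [L_formula] the lower parameter 2 - e, which corresponds to e, stands
    last; the rotation brings the two lists into the same order. *)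
Lemma pFq_rotate l x y z w : pFq l [x; y; z] w = pFq l [y; z; x] w.
Proof.
  unfold pFq. f_equal. apply functional_extensionality. intros n. now rewrite poch_prod_rotate.
Qed.

(* This makes the pole of [L_formula] at [e = 1] removable. *)
Lemma num_kill_e s h : num_fst_at s (kill_e h) = num_snd_at s (kill_e h).
Proof.
  assert (HE : pE s (kill_e h) = 1%C).
  { unfold pE. destruct h as [[[[[x0 x1] x2] x3] x4] x5]. simpl. ring. }
  unfold num_fst_at, num_snd_at, num_fst, num_snd. rewrite HE.
  assert (Ha : forall z, (1 + z - 1)%C = z) by (intros z; ring). rewrite !Ha.
  replace (2 - 1)%C with (RtoC 1) by ring.
  rewrite pFq_rotate. ring.
Qed.

Definition Re_pos_params (s : C) (h : C6) : Prop :=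
  (0 < Re (pA s h) /\ 0 < Re (pB s h) /\ 0 < Re (pC s h) /\ 0 < Re (pD s h) /\
   0 < Re (pE s h) /\ 0 < Re (pF s h) /\ 0 < Re (pG s h)) /\
  (0 < Re (1 + pA s h - pE s h)%C /\ 0 < Re (1 + pB s h - pE s h)%C /\
   0 < Re (1 + pC s h - pE s h)%C /\ 0 < Re (1 + pD s h - pE s h)%C /\
   0 < Re (1 + pF s h - pE s h)%C /\ 0 < Re (1 + pG s h - pE s h)%C /\ 0 < Re (2 - pE s h)%C).

Lemma Re_pos_params_small s k h : radius_cond s k -> small (k / 8) h -> Re_pos_params s h.
Proof.
  intros (Hk & Hk8 & Hks) Hh. destruct (Re_base s) as (E1 & E2 & E3 & E4).
  assert (Hp : forall l z, An (k / 8) k l -> k < Re z -> 0 < Re (z + l h)%C).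
  { intros l z H1 H2. now apply (An_Re_pos (k / 8) k). }
  unfold Re_pos_params.
  rewrite pA_shift, pB_shift, pC_shift, pD_shift, pF_shift, pG_shift, pE_shift.
  repeat split.
  - apply (Hp (crd 0)); [An_linear|lra].
  - apply (Hp (crd 1)); [An_linear|lra].
  - apply (Hp (crd 2)); [An_linear|lra].
  - apply (Hp (crd 3)); [An_linear|lra].
  - apply (Hp (crd 4)); [An_linear|lra].
  - apply (Hp (crd 5)); [An_linear|lra].
  - apply (Hp (fun h => crd 0 h + crd 1 h + crd 2 h + crd 3 h - crd 4 h - crd 5 h)%C); [An_linear|lra].
  - apply (Hp (fun h => crd 0 h - crd 4 h)%C); [An_linear|lra].
  - apply (Hp (fun h => crd 1 h - crd 4 h)%C); [An_linear|lra].
  - apply (Hp (fun h => crd 2 h - crd 4 h)%C); [An_linear|lra].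
  - apply (Hp (fun h => crd 3 h - crd 4 h)%C); [An_linear|lra].
  - apply (Hp (fun h => crd 5 h - crd 4 h)%C); [An_linear|lra].
  - apply (Hp (fun h => crd 0 h + crd 1 h + crd 2 h + crd 3 h - crd 4 h - crd 5 h - crd 4 h)%C); [An_linear|lra].
  - apply (Hp (fun h => - crd 4 h)%C); [An_linear|lra].
Qed.

(** The numerator is h_4 times an expansion because it vanishes at h_4 = 0, and the sine is h_4 (-
    pi - tau). The continuation is the quotient of the cofactors. *)
Lemma An_continuation s k : radius_cond s k -> exists K M,
  An (k / 8) K M /\
  forall h, small (k / 8) h ->
    (num_fst_at s h - num_snd_at s h = M h * Csin (RtoC PI * pE s h))%C /\
    (crd 4 h <> 0%C -> Csin (RtoC PI * pE s h) <> 0%C).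
Proof.
  intros Hc. destruct (An_num_fst s k Hc) as (K1 & H1). destruct (An_num_snd s k Hc) as (K2 & H2).
  destruct Hc as (Hk & Hk8 & Hks). assert (Hr : 0 < k / 8) by lra. assert (Hr0 : 0 <= k / 8) by lra.
  assert (HPI := PI_RGT_0). assert (HPI4 := PI_4).
  assert (HPIr : PI * (k / 8) < 1) by nra.
  destruct (An_div_e _ _ _ Hr (An_minus _ _ _ _ _ Hr0 H1 H2)) as (G & HG & HG2).
  destruct (An_sin_factor (k / 8) Hr HPIr) as (tau & Ht & Ht2).
  (* The perturbation tau is smaller than pi, as pi k / 8 < 1; hence the cofactor of the sine is
     invertible by a Neumann series. *)
  assert (Hbig : PI ^ 2 * (k / 8) < Cmod (- RtoC PI)).
  { rewrite Cmod_opp, Cmod_R, Rabs_pos_eq by lra. simpl. nra. }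
  assert (Hinv := An_inv _ _ _ _ Hr0 (An_opp _ _ _ Hr0 Ht) Hbig).
  eexists. exists (fun h => G h * / (- RtoC PI + - tau h))%C. split.
  - apply An_mult; [exact Hr0|exact HG|exact Hinv].
  - intros h Hh.
    assert (Hnz : (- RtoC PI + - tau h)%C <> 0%C).
    { intros H. assert (Hb := An_bound _ _ _ _ Ht Hh).
      assert (E : tau h = (- RtoC PI)%C).
      { replace (tau h) with (- RtoC PI - (- RtoC PI + - tau h))%C by ring. rewrite H. ring. }
      rewrite E in Hb. lra. }
    unfold pE at 1 2. rewrite Ht2 by exact Hh. split.
    + specialize (HG2 h Hh). cbv beta in HG2. rewrite (num_kill_e s h) in HG2. rewrite HG2. field. exact Hnz.
    + intros H4. now apply Cmult_neq_0.
Qed.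

(** * Existence and uniqueness of the value of L *)

Lemma minus_base_point s (a b c d e f : C) (h : C6) :
  (minus ((a, b, c, d, e, f) : V6) (base_point s : V6) : C6) = h ->
  a = pA s h /\ b = pB s h /\ c = pC s h /\ d = pD s h /\ e = pE s h /\ f = pF s h /\
  hyp_g a b c d e f = pG s h.
Proof.
  intros Hh.
  assert (H0 : crd 0 h = (a - (s + 2))%C) by (rewrite <- Hh; reflexivity).
  assert (H1 : crd 1 h = (b - s)%C) by (rewrite <- Hh; reflexivity).
  assert (H2 : crd 2 h = (c - 1 / 2)%C) by (rewrite <- Hh; reflexivity).
  assert (H3 : crd 3 h = (d - 1 / 2)%C) by (rewrite <- Hh; reflexivity).
  assert (H4 : crd 4 h = (e - 1)%C) by (rewrite <- Hh; reflexivity).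
  assert (H5 : crd 5 h = (f - (s + 3 / 2))%C) by (rewrite <- Hh; reflexivity).
  unfold pA, pB, pC, pD, pE, pF, pG, hyp_g. rewrite H0, H1, H2, H3, H4, H5.
  repeat split; field.
Qed.

Lemma L_formula_small s k h : radius_cond s k -> small (k / 8) h -> Csin (RtoC PI * pE s h) <> 0%C ->
  L_formula (pA s h) (pB s h) (pC s h) (pD s h) (pE s h) (pF s h) (pG s h) =
  ((num_fst_at s h - num_snd_at s h) / Csin (RtoC PI * pE s h))%C.
Proof.
  intros Hc Hh Hsin. destruct (Re_pos_params_small s k h Hc Hh) as
    ((H1 & H2 & H3 & H4 & H5 & H6 & H7) & H8 & H9 & H10 & H11 & H12 & H13 & H14).
  now apply L_formula_num.
Qed.

(** The coordinate f moves at speed -1/2 like the upper parameters, and then so does g. As e moves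
    at speed -1, each 1 + x - e equals x with t replaced by -t, and 2 - e equals e with t replaced
    by -t. *)
Definition approach : C6 :=
  (RtoC (- / 2), RtoC (- / 2), RtoC (- / 2), RtoC (- / 2), RtoC (- (1)), RtoC (- / 2)).

Lemma approach_small : small 1 approach.
Proof.
  intros [|[|[|[|[|i]]]]]; cbn [crd approach]; rewrite Cmod_R, Rabs_left by lra; lra.
Qed.

Lemma not_nonpos_integer z : 0 < Re z -> ~ nonpos_integer z.
Proof.
  intros Hz (n & ->). rewrite Re_opp, Re_RtoC in Hz. assert (H := pos_INR n). lra.
Qed.

Lemma pE_line s t : pE s (line approach t) = (1 + RtoC (- t))%C.
Proof. unfold pE. rewrite crd_line. cbn [crd approach]. apply C_ext; simpl; ring. Qed.

Lemma L_generic_line s k t : radius_cond s k -> 0 < t <= k / 8 ->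
  L_generic (pE s (line approach t)) (pF s (line approach t)) (pG s (line approach t)).
Proof.
  intros Hc Ht.
  assert (Hsm : small (k / 8) (line approach t)).
  { apply small_weaken with (Rabs t); [rewrite Rabs_pos_eq; lra|]. apply line_small, approach_small. }
  destruct (Re_pos_params_small s k _ Hc Hsm) as
    ((H1 & H2 & H3 & H4 & H5 & H6 & H7) & H8 & H9 & H10 & H11 & H12 & H13 & H14).
  split; [|now repeat split; apply not_nonpos_integer].
  intros n Hn. rewrite pE_line in Hn. assert (Hr : 1 + - t = IZR n).
  { assert (H := f_equal Re Hn). exact H. }
  destruct Hc as (Hk & Hk8 & _).
  assert (H15 : (0 < n)%Z) by (apply lt_IZR; lra).
  assert (H16 : (n < 1)%Z) by (apply lt_IZR; lra). lia.
Qed.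

Lemma minus_plus_l {G : AbelianGroup} (p h : G) : minus (plus p h) p = h.
Proof.
  unfold minus. transitivity (plus h (plus p (opp p))).
  - transitivity (plus (plus h p) (opp p)); [f_equal; apply plus_comm|].
    symmetry. apply plus_assoc.
  - transitivity (plus h zero); [f_equal; apply plus_opp_r|apply plus_zero_r].
Qed.

Lemma minus_plus_V6 (p h : V6) : minus (plus p h) p = h.
Proof. exact (minus_plus_l p h). Qed.

Lemma filterlim_line s (P : C6 -> Prop) : locally (base_point s : V6) P ->
  locally 0 (fun t => P (plus (base_point s : V6) (line approach t : V6))).
Proof.
  intros (eps & HP). exists eps. intros t Ht. apply HP.
  assert (Ht' : Rabs t < eps).
  { assert (H : Rabs (minus t 0) < eps) by exact Ht. unfold minus, plus, opp in H; simpl in H.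
    now rewrite Ropp_0, Rplus_0_r in H. }
  apply (ball_small _ _ eps (Rabs t) Ht').
  apply (eq_ind_r (small (Rabs t)) (line_small _ t approach_small)).
  apply (minus_plus_V6 (base_point s : V6) (line approach t : V6)).
Qed.

(** Reads the value off a derivative: on the line the numerator is the continuation times sin(pi t),
    so its derivative at 0 is pi times the value of L, and the second half of the proof can work
    with the two series alone. *)
Lemma L_at_base s : 0 < Re s -> exists l : C,
  L (s + 2) s (1 / 2) (1 / 2) 1 (s + 3 / 2) (s + 3 / 2) = l /\
  is_Cderive (fun t => num_fst_at s (line approach t) - num_snd_at s (line approach t))%C 0
    (RtoC PI * l)%C.
Proof.
  intros Hs. destruct (radius_exists s Hs) as (k & Hc).
  destruct (An_continuation s k Hc) as (K & M & HM & HMN).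
  assert (Hk := Hc). destruct Hk as (Hk & Hk8 & Hks).
  set (p := base_point s : V6).
  set (l := M (zero : V6)).
  assert (Hform : forall q : C6, small (k / 8) (minus (q : V6) p : V6) ->
    extends_L_formula_at (fun y : C6 => M (minus (y : V6) p)) q).
  { intros [[[[[a b] c] d] e] f] Hq. unfold extends_L_formula_at.
    set (h := (minus ((a, b, c, d, e, f) : V6) p : C6)) in *.
    destruct (minus_base_point s a b c d e f h eq_refl) as (E1 & E2 & E3 & E4 & E5 & E6 & E7).
    destruct (HMN h Hq) as (H1 & H2). intros (Hg & _).
    assert (H4 : crd 4 h <> 0%C).
    { intros H. apply (Hg 1%Z). rewrite E5. unfold pE. rewrite H. ring. }
    specialize (H2 H4).
    transitivity (M h); [reflexivity|].
    transitivity (L_formula (pA s h) (pB s h) (pC s h) (pD s h) (pE s h) (pF s h) (pG s h));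
      [|rewrite <- E1, <- E2, <- E3, <- E4, <- E5, <- E6, <- E7; reflexivity].
    rewrite (L_formula_small s k h Hc Hq H2), H1. field. exact H2. }
  (* A ball of radius k / 32 lies in the polydisc of radius k / 16, which leaves k / 16 of the
     radius k / 8 for differentiating at its points. *)
  assert (Hloc : locally (p : V6) (fun q => small (k / 16) (minus q p))).
  { assert (H : 0 < k / 32) by lra. exists (mkposreal _ H). intros q Hq.
    apply small_ball in Hq. apply small_weaken with (2 := Hq). simpl. lra. }
  assert (HisL : is_L (s + 2) s (1 / 2) (1 / 2) 1 (s + 3 / 2) (s + 3 / 2) l).
  { split; [unfold hyp_g; field|].
    exists (fun y : C6 => M (minus (y : V6) p)). split; [|split].
    - unfold holomorphic_near. apply filter_imp with (2 := Hloc). intros q Hq.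
      apply (An_ex_filterdiff (k / 16) (k / 16) K M p q); [lra|exact Hq|].
      replace (k / 16 + k / 16) with (k / 8) by field. exact HM.
    - apply filter_imp with (2 := Hloc). intros q Hq. apply Hform.
      apply small_weaken with (2 := Hq). lra.
    - unfold l. f_equal. apply (minus_eq_zero p). }
  destruct (An_line_derive (k / 8) K M approach ltac:(lra) approach_small HM) as (m & Hm).
  assert (Hl0 : M (line approach 0) = l) by (unfold l; now rewrite line_0).
  exists l. split.
  - apply (iota_unique (V := C_R_CompleteNormedModule)); [|exact HisL].
    (* Uniqueness: for small t > 0 the points of the line are generic, since e = 1 - t is not an
       integer there. A competing M' agrees with M at them, and both are continuous at the base
       point. *)
    intros l' (_ & M' & Hhol & Hext & Hl').
    assert (Hc1 : filterlim (fun t => M' (plus p (line approach t : V6))) (at_right 0) (locally l')).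
    { unfold holomorphic_near in Hhol. apply locally_singleton in Hhol.
      assert (Hcont := filterdiff_continuous _ _ Hhol).
      intros P HP. unfold filtermap, at_right, within.
      assert (HQ : locally 0 (fun t => P (M' (plus p (line approach t : V6))))).
      { apply (filterlim_line s (fun q => P (M' q))). apply Hcont. now rewrite <- Hl' in HP. }
      apply filter_imp with (2 := HQ). intros t Ht _. exact Ht. }
    assert (Hc2 : filterlim (fun t => M' (plus p (line approach t : V6))) (at_right 0) (locally l)).
    { apply (filterlim_ext_loc (fun t => M (line approach t))).
      - assert (Hev := filterlim_line s _ Hext).
        assert (Hk0 : 0 < k / 8) by lra.
        destruct Hev as (eps & Hev).
        assert (Hd : 0 < Rmin eps (k / 8)) by (apply Rmin_pos; [apply cond_pos|lra]).
        exists (mkposreal _ Hd). intros t Ht Ht0.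
        assert (Ht1 : Rabs (minus t 0) < Rmin eps (k / 8)) by exact Ht.
        assert (Hmt : minus t 0 = t).
        { unfold minus, plus, opp; simpl. ring. }
        rewrite Hmt, Rabs_pos_eq in Ht1 by lra.
        assert (Hte : ball 0 eps t).
        { assert (H : Rabs (minus t 0) < eps).
          { rewrite Hmt, Rabs_pos_eq by lra. eapply Rlt_le_trans; [exact Ht1|apply Rmin_l]. }
          exact H. }
        assert (Htk : t <= k / 8).
        { left. eapply Rlt_le_trans; [exact Ht1|apply Rmin_r]. }
        specialize (Hev t Hte).
        assert (Hq : small (k / 8) (minus (plus p (line approach t : V6)) p : V6)).
        { rewrite minus_plus_V6. apply small_weaken with (Rabs t); [rewrite Rabs_pos_eq; lra|].
          apply line_small, approach_small. }
        specialize (Hform _ Hq).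
        assert (Hmp : minus (plus p (line approach t : V6)) p = (line approach t : V6)) by apply minus_plus_V6.
        fold p in Hev. revert Hev Hform.
        destruct (plus p (line approach t : V6)) as [[[[[a b] c] d] e] f] eqn:Eq.
        unfold extends_L_formula_at. intros Hev Hform.
        destruct (minus_base_point s a b c d e f _ Hmp) as (E1 & E2 & E3 & E4 & E5 & E6 & E7).
        assert (Hg : L_generic e f (hyp_g a b c d e f)).
        { rewrite E7, E5, E6. now apply (L_generic_line s k). }
        rewrite (Hev Hg), <- (Hform Hg). f_equal. symmetry. exact Hmp.
      - destruct Hm as [Hm1 Hm2].
        assert (C1 := ex_derive_continuous _ _ (ex_intro _ _ Hm1)).
        assert (C2 := ex_derive_continuous _ _ (ex_intro _ _ Hm2)).
        intros P (eps & HP). unfold filtermap, at_right, within.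
        assert (B1 := C1 (ball (Re (M (line approach 0))) eps) (locally_ball _ eps)).
        assert (B2 := C2 (ball (Im (M (line approach 0))) eps) (locally_ball _ eps)).
        assert (HPc : locally 0 (fun t : R =>
          ball (Re (M (line approach 0))) eps (Re (M (line approach t))) /\
          ball (Im (M (line approach 0))) eps (Im (M (line approach t)))))
          by (apply filter_and; [exact B1|exact B2]).
        apply filter_imp with (2 := HPc).
        intros t [Ht1 Ht2] _. apply HP. rewrite <- Hl0. split; assumption. }
    exact (filterlim_locally_unique (V := C_R_NormedModule) _ _ _ Hc1 Hc2).
  (* As sin(pi (1 - t)) = sin(pi t) vanishes at 0, the product rule leaves only pi M(0). *)
  - apply is_Cderive_ext_loc with (fun t => M (line approach t) * RtoC (sin (PI * t)))%C.
    + assert (Hk0 : 0 < k / 8) by lra. exists (mkposreal _ Hk0). intros t Ht.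
      assert (Ht' : Rabs t < k / 8).
      { assert (H : Rabs (minus t 0) < k / 8) by exact Ht. unfold minus, plus, opp in H; simpl in H.
        now rewrite Ropp_0, Rplus_0_r in H. }
      destruct (HMN (line approach t)) as (H & _).
      { apply small_weaken with (Rabs t); [lra|]. apply line_small, approach_small. }
      rewrite H, pE_line, Csin_PI_real. reflexivity.
    + eapply is_Cderive_eq.
      * apply is_Cderive_mult; [exact Hm|]. apply (is_Cderive_RtoC _ 0 PI).
        auto_derive; [exact I|]. rewrite Rmult_0_r, cos_0. ring.
      * cbv beta. rewrite Hl0, Rmult_0_r, sin_0. ring.
Qed.

(** * Derivatives of Gamma and of the hypergeometric terms along the line *)

Lemma is_Cderive_inv (f : R -> C) (t : R) (l : C) : f t <> 0%C -> is_Cderive f t l ->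
  is_Cderive (fun x => / f x)%C t (- l / (f t * f t))%C.
Proof.
  intros H0 [A B].
  assert (Hn : Re (f t) ^ 2 + Im (f t) ^ 2 <> 0).
  { intros H. apply H0. apply C_ext; simpl; nra. }
  set (N := fun x => Re (f x) * Re (f x) + Im (f x) * Im (f x)).
  assert (HN : is_derive N t ((Re l * Re (f t) + Re (f t) * Re l) + (Im l * Im (f t) + Im (f t) * Im l))).
  { apply @is_derive_plus; apply @is_derive_mult; auto; intros; apply Rmult_comm. }
  assert (HN0 : N t <> 0) by (unfold N; simpl in Hn; lra).
  assert (HRe : Re (- l / (f t * f t))%C = (Re l * N t - ((Re l * Re (f t) + Re (f t) * Re l) +
    (Im l * Im (f t) + Im (f t) * Im l)) * Re (f t)) / N t ^ 2).
  { unfold N in *. destruct (f t) as [x y], l as [u v]. simpl in *. field.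
    split; [exact HN0|].
    match goal with |- ?d <> 0 => replace d with ((x * x + y * y) ^ 2) by ring end.
    now apply pow_nonzero. }
  assert (HIm : Im (- l / (f t * f t))%C = (- Im l * N t - ((Re l * Re (f t) + Re (f t) * Re l) +
    (Im l * Im (f t) + Im (f t) * Im l)) * - Im (f t)) / N t ^ 2).
  { unfold N in *. destruct (f t) as [x y], l as [u v]. simpl in *. field.
    split; [exact HN0|].
    match goal with |- ?d <> 0 => replace d with ((x * x + y * y) ^ 2) by ring end.
    now apply pow_nonzero. }
  split.
  - rewrite HRe. apply is_derive_ext with (fun x => Re (f x) / N x).
    { intros x. change (Re (f x) / N x = Re (f x) / (Re (f x) ^ 2 + Im (f x) ^ 2)).
      f_equal. unfold N. ring. }
    replace ((Re l * Re (f t) + Re (f t) * Re l + (Im l * Im (f t) + Im (f t) * Im l)) * Re (f t))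
      with (Re (f t) * (Re l * Re (f t) + Re (f t) * Re l + (Im l * Im (f t) + Im (f t) * Im l))) by ring.
    apply is_derive_div; assumption.
  - rewrite HIm. apply is_derive_ext with (fun x => - Im (f x) / N x).
    { intros x. change (- Im (f x) / N x = - Im (f x) / (Re (f x) ^ 2 + Im (f x) ^ 2)).
      f_equal. unfold N. ring. }
    replace ((Re l * Re (f t) + Re (f t) * Re l + (Im l * Im (f t) + Im (f t) * Im l)) * - Im (f t))
      with (- Im (f t) * (Re l * Re (f t) + Re (f t) * Re l + (Im l * Im (f t) + Im (f t) * Im l))) by ring.
    exact (is_derive_div (fun x => - Im (f x)) N t _ _ (is_derive_opp _ _ _ B) HN HN0).
Qed.

Definition dGamma (z : C) : C :=
  (Derive (fun t => Re (CGamma (z + RtoC t))) 0, Derive (fun t => Im (CGamma (z + RtoC t))) 0).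

Lemma is_Cderive_CGamma_0 z : 0 < Re z -> is_Cderive (fun t => CGamma (z + RtoC t)) 0 (dGamma z).
Proof.
  intros Hz.
  assert (Hex : exists l, is_Cderive (fun t => CGamma (z + RtoC t)) 0 l).
  (* One-variable differentiability is obtained from the six-variable expansion of 1 / Gamma by
     moving along the first coordinate. *)
  { assert (Hsm : small 1 (RtoC 1, RtoC 0, RtoC 0, RtoC 0, RtoC 0, RtoC 0)).
    { intros [|[|[|[|[|i]]]]]; cbn [crd]; rewrite ?Cmod_1, ?Cmod_0; lra. }
    destruct (An_RGamma_shift 1 1 z (crd 0) Rle_0_1 (An_crd 1 0 Rle_0_1)) as (K & HK).
    destruct (An_line_derive 1 K _ _ Rlt_0_1 Hsm HK) as (l & Hl).
    assert (Hl' : is_Cderive (fun t => RGamma (z + RtoC t)) 0 l).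
    { apply is_Cderive_ext with (2 := Hl). intros t. rewrite crd_line. cbn [crd].
      now rewrite Cmult_1_r. }
    eexists. apply is_Cderive_ext_loc with (2 := is_Cderive_inv _ 0 _ (RGamma_neq_0 (z + RtoC 0)
      ltac:(rewrite Cplus_0_r; exact Hz)) Hl').
    exists (mkposreal _ Hz). intros t Ht.
    assert (Ht' : Rabs t < Re z).
    { assert (H : Rabs (minus t 0) < Re z) by exact Ht. unfold minus, plus, opp in H; simpl in H.
      now rewrite Ropp_0, Rplus_0_r in H. }
    symmetry. apply CGamma_RGamma. rewrite Re_plus, Re_RtoC.
    assert (H := Rle_abs (- t)). rewrite Rabs_Ropp in H. lra. }
  destruct Hex as (l & [A B]). split; apply Derive_correct; eexists; eassumption.
Qed.

Lemma is_Cderive_CGamma z c x : 0 < Re (z + RtoC (c * x))%C ->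
  is_Cderive (fun t => CGamma (z + RtoC (c * t))) x (RtoC c * dGamma (z + RtoC (c * x)))%C.
Proof.
  intros Hz.
  apply is_Cderive_ext with (fun t => CGamma ((z + RtoC (c * x)) + RtoC (c * (t - x)))).
  { intros t. f_equal. apply C_ext; simpl; ring. }
  apply (is_Cderive_comp (fun t => CGamma ((z + RtoC (c * x)) + RtoC t)) (fun t => c * (t - x))).
  - replace (c * (x - x)) with 0 by ring. now apply is_Cderive_CGamma_0.
  - auto_derive; [exact I|]. ring.
Qed.

Definition Phi (s : C) (t : R) : C :=
  (CGamma (s + 2 + RtoC t) * CGamma (s + RtoC t) * (CGamma (1 / 2 + RtoC t) * CGamma (1 / 2 + RtoC t)) *
   / (CGamma (s + 3 / 2 + RtoC t) * CGamma (s + 3 / 2 + RtoC t) *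
      (CGamma (1 + RtoC t) * CGamma (1 + RtoC t))))%C.

Lemma ex_Cderive_Phi s n : 0 < Re s -> exists l, is_Cderive (Phi s) (INR n) l.
Proof.
  intros Hs. destruct (Re_base s) as (E1 & E2 & E3 & E4). assert (Hn := pos_INR n).
  assert (H : forall z, 0 < Re z -> is_Cderive (fun t => CGamma (z + RtoC t)) (INR n) (dGamma (z + RtoC (INR n)))).
  { intros z Hz. apply is_Cderive_ext with (fun t => CGamma (z + RtoC (1 * t))).
    { intros t. now rewrite Rmult_1_l. }
    eapply is_Cderive_eq; [apply is_Cderive_CGamma|].
    - rewrite Re_plus, Re_RtoC. lra.
    - rewrite Rmult_1_l. ring. }
  assert (Hnz : forall z, 0 < Re z -> CGamma (z + RtoC (INR n)) <> 0%C).
  { intros z Hz. apply CGamma_neq_0. rewrite Re_plus, Re_RtoC. lra. }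
  eexists. unfold Phi. apply is_Cderive_mult; [apply is_Cderive_mult; apply is_Cderive_mult|].
  5: apply is_Cderive_inv; [|apply is_Cderive_mult; apply is_Cderive_mult].
  all: try (apply H; lra).
  repeat apply Cmult_neq_0; apply Hnz; lra.
Qed.

Lemma Cderive_choice (f : nat -> R -> C) (x : nat -> R) :
  (forall n, exists l, is_Cderive (f n) (x n) l) -> exists l, forall n, is_Cderive (f n) (x n) (l n).
Proof. intros H. now apply choice in H. Qed.

Lemma pA_line s t : pA s (line approach t) = (s + 2 + RtoC (- / 2 * t))%C.
Proof. unfold pA. rewrite crd_line. cbn [crd approach]. apply C_ext; simpl; ring. Qed.
Lemma pB_line s t : pB s (line approach t) = (s + RtoC (- / 2 * t))%C.
Proof. unfold pB. rewrite crd_line. cbn [crd approach]. apply C_ext; simpl; ring. Qed.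
Lemma pC_line s t : pC s (line approach t) = (1 / 2 + RtoC (- / 2 * t))%C.
Proof. unfold pC. rewrite crd_line. cbn [crd approach]. f_equal. apply C_ext; simpl; ring. Qed.
Lemma pD_line s t : pD s (line approach t) = (1 / 2 + RtoC (- / 2 * t))%C.
Proof. unfold pD. rewrite crd_line. cbn [crd approach]. f_equal. apply C_ext; simpl; ring. Qed.
Lemma pE_line' s t : pE s (line approach t) = (1 + RtoC (- (1) * t))%C.
Proof. rewrite pE_line. do 2 f_equal. ring. Qed.
Lemma pF_line s t : pF s (line approach t) = (s + 3 / 2 + RtoC (- / 2 * t))%C.
Proof. unfold pF. rewrite crd_line. cbn [crd approach]. f_equal. apply C_ext; simpl; ring. Qed.
Lemma pG_line s t : pG s (line approach t) = (s + 3 / 2 + RtoC (- / 2 * t))%C.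
Proof. unfold pG. rewrite !crd_line. cbn [crd approach]. f_equal. apply C_ext; simpl; field. Qed.

Lemma num_snd_line s t : num_snd_at s (line approach t) = num_fst_at s (line approach (- t)).
Proof.
  unfold num_snd_at, num_fst_at, num_snd, num_fst.
  rewrite !pA_line, !pB_line, !pC_line, !pD_line, !pE_line', !pF_line, !pG_line.
  assert (Hr : forall z, (1 + (z + RtoC (- / 2 * t)) - (1 + RtoC (- (1) * t)) = z + RtoC (- / 2 * - t))%C).
  { intros z. apply C_ext; simpl; field. }
  assert (Hl : forall z, (1 + (z + RtoC (- / 2 * - t)) - (1 + RtoC (- (1) * - t)) = z + RtoC (- / 2 * t))%C).
  { intros z. apply C_ext; simpl; field. }
  rewrite !Hr, !Hl.
  replace (2 - (1 + RtoC (- (1) * t)))%C with (1 + RtoC (- (1) * - t))%C.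
  2:{ apply C_ext; simpl; ring. }
  rewrite (pFq_rotate _ (1 + RtoC (- (1) * - t))%C). ring.
Qed.

(** Even in t, so its derivative at 0 vanishes and it contributes to the derivative of a product
    only through its value. *)
Definition gamma_even (z : C) (t : R) : C :=
  (CGamma (z + RtoC (- / 2 * t)) * CGamma (z + RtoC (/ 2 * t)))%C.

Lemma is_Cderive_gamma_even z : 0 < Re z -> is_Cderive (gamma_even z) 0 0%C.
Proof.
  intros Hz. assert (Hz0 : forall c, (z + RtoC (c * 0))%C = z).
  { intros c. rewrite Rmult_0_r. apply Cplus_0_r. }
  eapply is_Cderive_eq.
  - apply is_Cderive_mult; apply is_Cderive_CGamma; rewrite Hz0; exact Hz.
  - cbv beta. rewrite !Hz0, RtoC_opp. ring.
Qed.

(** The denominator of the n-th term contains Gamma(1 + n - t) n!, whereas [Phi] at n - t/2 contains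
    Gamma(1 + n - t/2)^2. Their quotient is 1 to first order in t because twice t/2 is t. *)
Definition gamma_correction (n : nat) (t : R) : C :=
  (CGamma (1 + RtoC (INR n) + RtoC (- / 2 * t)) * CGamma (1 + RtoC (INR n) + RtoC (- / 2 * t)) *
   / CGamma (1 + RtoC (INR n) + RtoC (- (1) * t)) * / CGamma (1 + RtoC (INR n)))%C.

Lemma is_Cderive_gamma_correction n : gamma_correction n 0 = 1%C /\
  is_Cderive (gamma_correction n) 0 0%C.
Proof.
  set (z := (1 + RtoC (INR n))%C).
  assert (Hz : 0 < Re z). { unfold z. rewrite Re_plus, !Re_RtoC. assert (H := pos_INR n). lra. }
  assert (Hz0 : forall c, (z + RtoC (c * 0))%C = z).
  { intros c. rewrite Rmult_0_r. apply Cplus_0_r. }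
  assert (Hg := CGamma_neq_0 z Hz).
  split.
  - unfold gamma_correction. fold z. rewrite !Hz0. field. exact Hg.
  - eapply is_Cderive_eq.
    + unfold gamma_correction. fold z.
      apply is_Cderive_mult; [|apply is_Cderive_const].
      apply is_Cderive_mult; [apply is_Cderive_mult; apply is_Cderive_CGamma; rewrite Hz0; exact Hz|].
      apply is_Cderive_inv; [rewrite Hz0; exact Hg|]. apply is_Cderive_CGamma; rewrite Hz0; exact Hz.
    + cbv beta. rewrite !Hz0, !RtoC_opp, RtoC_inv by lra. field. exact Hg.
Qed.

Definition gamma_prefactor (s : C) (t : R) : C :=
  (/ (gamma_even (s + 2) t * gamma_even s t * (gamma_even (1 / 2) t * gamma_even (1 / 2) t)))%C.

Lemma is_Cderive_gamma_prefactor s : 0 < Re s -> is_Cderive (gamma_prefactor s) 0 0%C.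
Proof.
  intros Hs. destruct (Re_base s) as (E1 & E2 & E3 & E4).
  assert (Hnz : forall z, 0 < Re z -> gamma_even z 0 <> 0%C).
  { intros z Hz. unfold gamma_even. rewrite !Rmult_0_r, !Cplus_0_r.
    apply Cmult_neq_0; now apply CGamma_neq_0. }
  eapply is_Cderive_eq.
  - apply is_Cderive_inv; [|apply is_Cderive_mult; apply is_Cderive_mult; apply is_Cderive_gamma_even; lra].
    apply Cmult_neq_0; apply Cmult_neq_0; apply Hnz; lra.
  - cbv beta. unfold Cdiv. ring.
Qed.

Lemma poch_prod_4 a b c d n : poch_prod [a; b; c; d] n = (poch a n * (poch b n * (poch c n * (poch d n))))%C.
Proof. unfold poch_prod; simpl. ring. Qed.

Lemma CGamma_nat n : CGamma (1 + RtoC (INR n)) = RtoC (INR (fact n)).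
Proof.
  rewrite CGamma_poch by (simpl; lra). rewrite CGamma_1, Cmult_1_r.
  induction n as [|n IH]; [reflexivity|]. cbn [poch]. rewrite IH, fact_simpl, mult_INR, S_INR.
  rewrite RtoC_mult, RtoC_plus. ring.
Qed.

Definition num_term (s : C) (n : nat) (h : C6) : C :=
  (hyp_term [pA s h; pB s h; pC s h; pD s h] [pE s h; pF s h; pG s h] n *
   (RGamma (pE s h) * RGamma (pF s h) * RGamma (pG s h) *
    (RGamma (1 + pA s h - pE s h) * RGamma (1 + pB s h - pE s h) *
     RGamma (1 + pC s h - pE s h) * RGamma (1 + pD s h - pE s h))))%C.

(** By (x)_n = Gamma(x + n) / Gamma(x), the Gamma values shifted by n assemble to [Phi] at n - t/2.
    For each upper parameter x the factor 1 / Gamma(x - t/2) so released meets 1 / Gamma(x + t/2),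
    which gives the even prefactor. *)
Lemma num_term_line s k n t : radius_cond s k -> Rabs t <= k / 8 ->
  num_term s n (line approach t) =
  (gamma_prefactor s t * (Phi s (INR n + - / 2 * t) * gamma_correction n t))%C.
Proof.
  intros Hc Ht.
  assert (Hsm : small (k / 8) (line approach t)).
  { apply small_weaken with (1 := Ht). apply line_small, approach_small. }
  destruct (Re_pos_params_small s k _ Hc Hsm) as
    ((H1 & H2 & H3 & H4 & H5 & H6 & H7) & H8 & H9 & H10 & H11 & _).
  unfold num_term, hyp_term.
  rewrite poch_prod_4. unfold poch_prod. cbn [fold_right]. rewrite Cpow_1_l.
  rewrite pA_line, pB_line, pC_line, pD_line, pE_line', pF_line, pG_line in *.
  assert (Hr : forall z, (1 + (z + RtoC (- / 2 * t)) - (1 + RtoC (- (1) * t)) = z + RtoC (/ 2 * t))%C).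
  { intros z. apply C_ext; simpl; field. }
  rewrite !Hr in *.
  assert (Hinv : forall z, 0 < Re z -> RGamma z = (/ CGamma z)%C).
  { intros z Hz. rewrite CGamma_RGamma by exact Hz. field. now apply RGamma_neq_0. }
  rewrite !Hinv by assumption.
  unfold gamma_prefactor, gamma_even, Phi, gamma_correction.
  assert (Hsh : forall z, (z + RtoC (INR n + - / 2 * t))%C = (z + RtoC (- / 2 * t) + RtoC (INR n))%C).
  { intros z. rewrite RtoC_plus. ring. }
  assert (Hsh2 : forall x, (1 + RtoC (INR n) + RtoC x)%C = (1 + RtoC x + RtoC (INR n))%C).
  { intros x. ring. }
  rewrite !Hsh, !Hsh2. rewrite CGamma_nat.
  assert (H0 : 0 < Re (1 + RtoC (- / 2 * t))%C).
  { rewrite Re_plus, Re_RtoC in *. rewrite Re_RtoC in *. destruct Hc as (Hk & Hk8 & _).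
    assert (Ha := Rle_abs t). simpl. lra. }
  rewrite !CGamma_poch by assumption.
  assert (Hp : forall z, 0 < Re z -> poch z n <> 0%C) by (intros z Hz; now apply Re_pos_poch_neq_0).
  generalize (CGamma_neq_0 _ H1) (CGamma_neq_0 _ H2) (CGamma_neq_0 _ H3) (CGamma_neq_0 _ H5)
    (CGamma_neq_0 _ H6) (CGamma_neq_0 _ H8) (CGamma_neq_0 _ H9) (CGamma_neq_0 _ H10) (CGamma_neq_0 _ H0)
    (Hp _ H1) (Hp _ H2) (Hp _ H3) (Hp _ H5) (Hp _ H6) (Hp _ H0) (INR_fact_neq_0_C n).
  intros. field. repeat split; assumption.
Qed.

(** Each term has derivative -1/2 times the prefactor times that of [Phi] at n, the factor -1/2
    being the speed of its argument. Subtracting the same function at -t doubles this. *)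
Lemma L_value s : 0 < Re s -> exists (phi : nat -> C) (T : C),
  (forall n, is_Cderive (Phi s) (INR n) (phi n)) /\ is_Cseries phi T /\
  (RtoC PI * L (s + 2) s (1 / 2) (1 / 2) 1 (s + 3 / 2) (s + 3 / 2) = - gamma_prefactor s 0 * T)%C.
Proof.
  intros Hs. destruct (L_at_base s Hs) as (l & HL & Hl).
  destruct (radius_exists s Hs) as (k & Hc). assert (Hk := Hc). destruct Hk as (Hk & Hk8 & Hks).
  destruct (Cderive_choice (fun _ => Phi s) INR (fun n => ex_Cderive_Phi s n Hs)) as (phi & Hphi).
  set (D := gamma_prefactor s 0).
  set (z := fun n => (D * (- RtoC (/ 2) * phi n))%C).
  assert (Hz : forall n, is_Cderive (fun t => num_term s n (line approach t)) 0 (z n)).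
  { intros n.
    apply is_Cderive_ext_loc with (fun t => gamma_prefactor s t *
      (Phi s (INR n + - / 2 * t) * gamma_correction n t))%C.
    - assert (Hk0 : 0 < k / 8) by lra. exists (mkposreal _ Hk0). intros t Ht.
      assert (Ht' : Rabs t < k / 8).
      { assert (H : Rabs (minus t 0) < k / 8) by exact Ht. unfold minus, plus, opp in H; simpl in H.
        now rewrite Ropp_0, Rplus_0_r in H. }
      symmetry. apply (num_term_line s k); [exact Hc|lra].
    - destruct (is_Cderive_gamma_correction n) as (G0 & G1).
      eapply is_Cderive_eq.
      + apply is_Cderive_mult; [now apply is_Cderive_gamma_prefactor|].
        apply is_Cderive_mult; [|exact G1].
        apply (is_Cderive_comp (Phi s) (fun t => INR n + - / 2 * t)).
        * rewrite Rmult_0_r, Rplus_0_r. apply Hphi.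
        * auto_derive; [exact I|]. rewrite Rmult_1_r. reflexivity.
      + cbv beta. rewrite G0. unfold z, D. rewrite RtoC_opp. ring. }
  assert (HP : exists K, An (k / 8) K (fun h => RGamma (pE s h) * RGamma (pF s h) * RGamma (pG s h) *
    (RGamma (1 + pA s h - pE s h) * RGamma (1 + pB s h - pE s h) *
     RGamma (1 + pC s h - pE s h) * RGamma (1 + pD s h - pE s h)))%C).
  { exact (An_gamma_factors s k Hc). }
  destruct HP as (K & HP).
  assert (Hsum := hyp_bound_summable k (s + 2)%C s (1 / 2)%C (1 / 2)%C 1%C (s + 3 / 2)%C (s + 3 / 2)%C Hk
     ltac:(simpl; lra) ltac:(rewrite (proj1 (proj2 (Re_base s))); lra)
     ltac:(rewrite (proj1 (proj2 (Re_base s))); lra) (base_saalschutz s k Hc)).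
  set (b := hyp_bound k (s + 2)%C s (1 / 2)%C (1 / 2)%C 1%C (s + 3 / 2)%C (s + 3 / 2)%C) in Hsum.
  assert (Hbs := is_series_scal_r K _ _ (Series_correct _ Hsum)).
  destruct (An_line_derive_series (k / 8) (fun n => b n * K) (Series b * K) (num_term s) (num_fst_at s)
    approach z) as (Hz1 & Hz2); auto; try lra.
  - apply approach_small.
  - intros n. apply An_mult; [lra| |exact HP]. exact (An_hyp_at s k Hc n).
  - intros h Hh. apply is_Cseries_scal_r. exact (is_Cseries_hyp_at s k h Hc Hh).
  - set (S := CSeries z) in *.
    assert (Hnum : is_Cderive (fun t => num_fst_at s (line approach t) - num_snd_at s (line approach t))%C 0
      (2 * S)%C).
    { apply is_Cderive_ext with (fun t => num_fst_at s (line approach t) - num_fst_at s (line approach (-1 * t)))%C.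
      { intros t. rewrite num_snd_line. now replace (-1 * t) with (- t) by ring. }
      eapply is_Cderive_eq.
      - apply is_Cderive_minus; [exact Hz2|].
        apply (is_Cderive_comp (fun t => num_fst_at s (line approach t)) (fun t => -1 * t)).
        + rewrite Rmult_0_r. exact Hz2.
        + auto_derive; [exact I|]. rewrite Rmult_1_r. reflexivity.
      - replace (RtoC (-1)) with (- (1))%C by (apply C_ext; simpl; ring). ring. }
    assert (HPl := is_Cderive_unique _ _ _ _ Hl Hnum).
    assert (HD : D <> 0%C).
    { unfold D, gamma_prefactor, gamma_even. rewrite !Rmult_0_r, !Cplus_0_r.
      destruct (Re_base s) as (E1 & E2 & E3 & E4).
      apply C_inv_neq_0. repeat apply Cmult_neq_0; apply CGamma_neq_0; lra. }
    (* [S] sums -1/2 D phi(n), so the sum of the phi(n) is recovered by the factor -2 / D. *)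
    exists phi, (- (2) / D * S)%C. split; [exact Hphi|split].
    + eapply is_Cseries_ext; [|apply (is_Cseries_scal (- (2) / D)%C _ _ Hz1)].
      intros n. unfold z. rewrite RtoC_inv by lra. field. exact HD.
    + rewrite HL, HPl. field. exact HD.
Qed.

(** * The complete elliptic integral and its differential equation *)

(** E' as a function of w = x^2. In the form cos^2 + w sin^2 the radicand is visibly positive for
    every w > 0, so the integrand is smooth on both sides of w = 1. *)
Definition Hint (w : R) : R := RInt (fun t => sqrt (cos t ^ 2 + w * sin t ^ 2)) 0 (PI / 2).

Lemma ellipticE'_Hint x : 0 <= x <= 1 -> ellipticE' x = Hint (x ^ 2).
Proof.
  intros Hx. unfold ellipticE', ellipticE, Hint. apply RInt_ext. intros t _. f_equal.
  rewrite pow2_sqrt by nra. assert (H := sin2_cos2 t). unfold Rsqr in H.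
  replace (cos t ^ 2) with (1 - sin t * sin t) by (simpl; lra). ring.
Qed.

Definition Qf (w t : R) : R := cos t ^ 2 + w * sin t ^ 2.
Definition Qr (w t : R) : R := / sqrt (Qf w t).

Lemma Qf_pos w t : 0 < w -> 0 < Qf w t.
Proof.
  intros Hw. unfold Qf. assert (H := sin2_cos2 t). unfold Rsqr in H.
  assert (H1 := pow2_ge_0 (sin t)). assert (H2 := pow2_ge_0 (cos t)).
  destruct (Rle_lt_dec (sin t ^ 2) 0) as [H3|H3].
  - assert (sin t ^ 2 = 0) by lra. simpl in *. nra.
  - assert (0 < w * sin t ^ 2) by now apply Rmult_lt_0_compat. lra.
Qed.

Lemma Qr_pos w t : 0 < w -> 0 < Qr w t.
Proof. intros Hw. apply Rinv_0_lt_compat, sqrt_lt_R0. now apply Qf_pos. Qed.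

Lemma sqrt_Qf w t : 0 < w -> sqrt (Qf w t) = Qf w t * Qr w t.
Proof.
  intros Hw. assert (H := Qf_pos w t Hw). unfold Qr.
  rewrite <- (sqrt_sqrt (Qf w t)) at 2 by lra. field. apply Rgt_not_eq, sqrt_lt_R0, H.
Qed.

Lemma Qr_cube w t : 0 < w -> Qr w t = Qr w t ^ 3 * Qf w t.
Proof.
  intros Hw. assert (H := sqrt_Qf w t Hw). assert (Hp := Qr_pos w t Hw).
  assert (H1 : sqrt (Qf w t) * Qr w t = 1).
  { unfold Qr. apply Rinv_r, Rgt_not_eq, sqrt_lt_R0, Qf_pos, Hw. }
  replace (Qr w t ^ 3 * Qf w t) with (Qf w t * Qr w t * Qr w t * Qr w t) by ring.
  rewrite <- H, H1. ring.
Qed.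

Lemma continuous_2d_Qf w t : continuous (fun z : R * R => Qf (fst z) (snd z)) (w, t).
Proof.
  unfold Qf.
  assert (Hs : continuous (fun z : R * R => sin (snd z)) (w, t)).
  { apply (continuous_comp snd sin); [apply continuous_snd|apply continuous_sin]. }
  assert (Hc : continuous (fun z : R * R => cos (snd z)) (w, t)).
  { apply (continuous_comp snd cos); [apply continuous_snd|apply continuous_cos]. }
  apply (continuous_plus (V := R_NormedModule)).
  - apply continuous_ext with (fun z : R * R => mult (cos (snd z)) (cos (snd z))).
    { intros z. unfold mult; simpl. ring. }
    now apply (continuous_mult (K := R_AbsRing)).
  - apply continuous_ext with (fun z : R * R => mult (fst z) (mult (sin (snd z)) (sin (snd z)))).
    { intros z. unfold mult; simpl. ring. }
    apply (continuous_mult (K := R_AbsRing)); [apply continuous_fst|].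
    now apply (continuous_mult (K := R_AbsRing)).
Qed.

Lemma continuous_2d_Qr w t : 0 < w -> continuous (fun z : R * R => Qr (fst z) (snd z)) (w, t).
Proof.
  intros Hw. unfold Qr.
  apply (continuous_comp (fun z : R * R => sqrt (Qf (fst z) (snd z))) Rinv).
  - apply (continuous_comp (fun z : R * R => Qf (fst z) (snd z)) sqrt).
    + apply continuous_2d_Qf.
    + apply continuous_sqrt.
  - apply continuous_Rinv. simpl. apply Rgt_not_eq, sqrt_lt_R0, Qf_pos, Hw.
Qed.

Lemma continuous_2d_trig (p : R -> R) n w t : 0 < w -> (forall x, continuous p x) ->
  continuous (fun z : R * R => p (snd z) * Qr (fst z) (snd z) ^ n) (w, t).
Proof.
  intros Hw Hp. apply (continuous_mult (K := R_AbsRing)).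
  - apply (continuous_comp snd p); [apply continuous_snd|apply Hp].
  - apply (continuous_comp (fun z : R * R => Qr (fst z) (snd z)) (fun x => x ^ n)).
    + now apply continuous_2d_Qr.
    + apply @ex_derive_continuous. auto_derive. exact I.
Qed.

Lemma continuous_trig (p : R -> R) n w t : 0 < w -> (forall x, continuous p x) ->
  continuous (fun t => p t * Qr w t ^ n) t.
Proof.
  intros Hw Hp.
  apply (continuous_comp_2 (fun _ => w) (fun x : R => x) (fun a b => p b * Qr a b ^ n)).
  - apply continuous_const.
  - apply continuous_id.
  - exact (continuous_2d_trig p n w t Hw Hp).
Qed.

Lemma locally_pos w : 0 < w -> locally w (fun x => 0 < x).
Proof.
  intros Hw. exists (mkposreal w Hw). intros x Hx.
  assert (H : Rabs (minus x w) < w) by exact Hx. unfold minus, plus, opp in H; simpl in H.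
  apply Rabs_def2 in H. lra.
Qed.

Lemma is_derive_RInt_half_PI (f g : R -> R -> R) w : 0 < w ->
  (forall x t, 0 < x -> is_derive (fun u => f u t) x (g x t)) ->
  (forall x t, 0 < x -> continuous (fun t => f x t) t) ->
  (forall t, continuous (fun z : R * R => g (fst z) (snd z)) (w, t)) ->
  is_derive (fun w => RInt (f w) 0 (PI / 2)) w (RInt (g w) 0 (PI / 2)).
Proof.
  intros Hw Hd Hf Hg.
  rewrite <- (RInt_ext (fun t => Derive (fun u => f u t) w)).
  2:{ intros t _. apply is_derive_unique. now apply Hd. }
  apply (is_derive_RInt_param f).
  - apply filter_imp with (2 := locally_pos w Hw). intros x Hx t _. eexists. now apply Hd.
  - intros t _. apply continuity_2d_pt_ext_loc with g.
    + exists (mkposreal w Hw). simpl. intros u v Hu _. symmetry. apply is_derive_unique, Hd.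
      apply Rabs_def2 in Hu. lra.
    + apply continuity_2d_pt_filterlim. apply Hg.
  - apply filter_imp with (2 := locally_pos w Hw). intros x Hx.
    apply (ex_RInt_continuous (V := R_CompleteNormedModule)). intros t _. now apply Hf.
Qed.

Lemma is_derive_sqrt_Qf w t : 0 < w -> is_derive (fun u => sqrt (Qf u t)) w (sin t ^ 2 / 2 * Qr w t ^ 1).
Proof.
  intros Hw. assert (H := Qf_pos w t Hw). assert (Hs := sqrt_lt_R0 _ H). unfold Qr.
  unfold Qf in *. revert H Hs. generalize (cos t ^ 2) (sin t ^ 2). intros A B H Hs.
  auto_derive; [exact H|]. field. lra.
Qed.

Lemma is_derive_Qr w t : 0 < w -> is_derive (fun u => Qr u t) w (- (sin t ^ 2 / 2) * Qr w t ^ 3).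
Proof.
  intros Hw. assert (H := Qf_pos w t Hw). assert (Hs := sqrt_lt_R0 _ H). unfold Qr.
  unfold Qf in *. revert H Hs. generalize (cos t ^ 2) (sin t ^ 2). intros A B H Hs.
  auto_derive; [split; [exact H|split; [lra|exact I]]|]. field. lra.
Qed.

Definition Hint1 (w : R) : R := RInt (fun t => sin t ^ 2 / 2 * Qr w t ^ 1) 0 (PI / 2).
Definition Hint2 (w : R) : R := RInt (fun t => - (sin t ^ 4 / 4) * Qr w t ^ 3) 0 (PI / 2).

Lemma continuous_sqrt_Qf w t : 0 < w -> continuous (fun t => sqrt (Qf w t)) t.
Proof.
  intros Hw. apply @ex_derive_continuous. assert (H := Qf_pos w t Hw). unfold Qf in *.
  auto_derive. exact H.
Qed.

Lemma is_derive_Hint w : 0 < w -> is_derive Hint w (Hint1 w).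
Proof.
  intros Hw. apply (is_derive_RInt_half_PI (fun u t => sqrt (Qf u t))
    (fun u t => sin t ^ 2 / 2 * Qr u t ^ 1)); auto.
  - intros x t Hx. now apply is_derive_sqrt_Qf.
  - intros x t Hx. now apply continuous_sqrt_Qf.
  - intros t. apply (continuous_2d_trig (fun t => sin t ^ 2 / 2) 1); auto.
    intros x. apply @ex_derive_continuous. auto_derive. exact I.
Qed.

Lemma is_derive_Hint1 w : 0 < w -> is_derive Hint1 w (Hint2 w).
Proof.
  intros Hw. apply (is_derive_RInt_half_PI (fun u t => sin t ^ 2 / 2 * Qr u t ^ 1)
    (fun u t => - (sin t ^ 4 / 4) * Qr u t ^ 3)); auto.
  - intros x t Hx. apply is_derive_ext with (fun u => sin t ^ 2 / 2 * Qr u t); [intros u; simpl; ring|].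
    replace (- (sin t ^ 4 / 4) * Qr x t ^ 3) with (sin t ^ 2 / 2 * (- (sin t ^ 2 / 2) * Qr x t ^ 3)) by field.
    apply is_derive_scal. now apply is_derive_Qr.
  - intros x t Hx. apply (continuous_trig (fun t => sin t ^ 2 / 2) 1); auto.
    intros y. apply @ex_derive_continuous. auto_derive. exact I.
  - intros t. apply (continuous_2d_trig (fun t => - (sin t ^ 4 / 4)) 3); auto.
    intros x. apply @ex_derive_continuous. auto_derive. exact I.
Qed.

(* The integrand of the left-hand side, times 4 w, is the derivative of
   sin t cos t / sqrt (cos^2 t + w sin^2 t). *)
Lemma Hint_ode w : 0 < w -> (1 - w) * Hint2 w - Hint1 w + Hint w / (4 * w) = 0.
Proof.
  intros Hw.
  assert (HI : forall (p : R -> R) n, (forall x, continuous p x) ->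
    is_RInt (fun t => p t * Qr w t ^ n) 0 (PI / 2) (RInt (fun t => p t * Qr w t ^ n) 0 (PI / 2))).
  { intros p n Hp. apply (RInt_correct (V := R_CompleteNormedModule)).
    apply (ex_RInt_continuous (V := R_CompleteNormedModule)). intros t _. now apply continuous_trig. }
  assert (H2 := HI (fun t => - (sin t ^ 4 / 4)) 3%nat ltac:(intros; apply @ex_derive_continuous; auto_derive; exact I)).
  assert (H1 := HI (fun t => sin t ^ 2 / 2) 1%nat ltac:(intros; apply @ex_derive_continuous; auto_derive; exact I)).
  assert (H0 : is_RInt (fun t => sqrt (Qf w t)) 0 (PI / 2) (Hint w)).
  { apply (RInt_correct (V := R_CompleteNormedModule)).
    apply (ex_RInt_continuous (V := R_CompleteNormedModule)). intros t _. now apply continuous_sqrt_Qf. }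
  fold (Hint2 w) in H2. fold (Hint1 w) in H1.
  assert (HS := is_RInt_plus _ _ _ _ _ _ (is_RInt_minus _ _ _ _ _ _
    (is_RInt_scal _ _ _ (w * (1 - w)) _ H2) (is_RInt_scal _ _ _ w _ H1)) (is_RInt_scal _ _ _ (/ 4) _ H0)).
  set (u := fun t => / 4 * (sin t * cos t * Qr w t)).
  set (du := fun t => / 4 * ((cos t ^ 2 - sin t ^ 2) * Qr w t + sin t ^ 2 * cos t ^ 2 * (1 - w) * Qr w t ^ 3)).
  assert (Hdu : forall t, is_derive u t (du t)).
  { intros t. assert (H := Qf_pos w t Hw). assert (Hs := sqrt_lt_R0 _ H). unfold u, du, Qr, Qf in *.
    simpl in *. auto_derive; [split; [exact H|split; [lra|exact I]]|]. field. lra. }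
  assert (HF : is_RInt du 0 (PI / 2) (minus (u (PI / 2)) (u 0))).
  { apply (is_RInt_derive (V := R_CompleteNormedModule) u du).
    - intros t _. apply Hdu.
    - intros t _. apply @ex_derive_continuous. assert (H := Qf_pos w t Hw). assert (Hs := sqrt_lt_R0 _ H).
      unfold du, Qr, Qf in *. simpl in *. auto_derive. repeat split; try exact H; lra. }
  assert (HE : is_RInt du 0 (PI / 2)
    (plus (minus (scal (w * (1 - w)) (Hint2 w)) (scal w (Hint1 w))) (scal (/ 4) (Hint w)))).
  { apply is_RInt_ext with (2 := HS). intros t _. unfold du, plus, minus, scal, opp; simpl.
    unfold mult, plus; simpl. rewrite sqrt_Qf by exact Hw.
    assert (Hc : Qf w t = 1 - sin t ^ 2 + w * sin t ^ 2).
    { unfold Qf. assert (H := sin2_cos2 t). unfold Rsqr in H. simpl. lra. }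
    assert (Hc2 : cos t ^ 2 = 1 - sin t ^ 2).
    { assert (H := sin2_cos2 t). unfold Rsqr in H. simpl. lra. }
    assert (E := Qr_cube w t Hw). simpl in Hc2. rewrite Hc2. set (r3 := Qr w t ^ 3) in *.
    replace (Qr w t * (Qr w t * (Qr w t * 1))) with r3 by (unfold r3; ring).
    rewrite E, Hc. field. }
  assert (HU := is_RInt_unique _ _ _ _ HE). rewrite (is_RInt_unique _ _ _ _ HF) in HU.
  unfold u, plus, minus, scal, opp in HU; simpl in HU. unfold mult, plus in HU; simpl in HU.
  rewrite cos_PI2, sin_0 in HU.
  apply Rmult_eq_reg_l with w; [|lra]. rewrite Rmult_0_r.
  replace (w * ((1 - w) * Hint2 w - Hint1 w + Hint w / (4 * w))) with
    (w * (1 - w) * Hint2 w + - (w * Hint1 w) + / 4 * Hint w) by (field; lra).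
  rewrite <- HU. ring.
Qed.

(** The differential equation in self-adjoint form, ((1 - w) H')' = - H / (4 w); both the
    integration by parts for [mu] and the Wronskian use it in this shape. *)
Lemma is_derive_Hint1_weighted w : 0 < w ->
  is_derive (fun w => (1 - w) * Hint1 w) w (- Hint w / (4 * w)).
Proof.
  intros Hw. replace (- Hint w / (4 * w)) with ((0 - 1) * Hint1 w + (1 - w) * Hint2 w).
  - apply @is_derive_mult; [| |intros; apply Rmult_comm].
    + apply @is_derive_minus; [exact (is_derive_const (K := R_AbsRing) (V := R_NormedModule) 1 w)|exact (is_derive_id w)].
    + now apply is_derive_Hint1.
  - assert (H := Hint_ode w Hw). unfold Rdiv in *. lra.
Qed.

Lemma cos_half_PI_pos t : 0 <= t <= PI / 2 -> 0 <= cos t.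
Proof. intros Ht. apply cos_ge_0; lra. Qed.
Lemma sin_half_PI_pos t : 0 <= t <= PI / 2 -> 0 <= sin t.
Proof. intros Ht. assert (H := PI_RGT_0). apply sin_ge_0; lra. Qed.

Lemma is_RInt_half_PI (F f : R -> R) : (forall t, is_derive F t (f t)) -> (forall t, continuous f t) ->
  is_RInt f 0 (PI / 2) (F (PI / 2) - F 0).
Proof.
  intros H1 H2. exact (is_RInt_derive (V := R_CompleteNormedModule) F f 0 (PI / 2)
    (fun t _ => H1 t) (fun t _ => H2 t)).
Qed.

Lemma is_RInt_Hint w : 0 < w -> is_RInt (fun t => sqrt (Qf w t)) 0 (PI / 2) (Hint w).
Proof.
  intros Hw. apply (RInt_correct (V := R_CompleteNormedModule)).
  apply (ex_RInt_continuous (V := R_CompleteNormedModule)). intros t _. now apply continuous_sqrt_Qf.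
Qed.

Lemma is_RInt_R_le (f g : R -> R) a b (lf lg : R) : a <= b -> is_RInt f a b lf -> is_RInt g a b lg ->
  (forall x, a <= x <= b -> f x <= g x) -> lf <= lg.
Proof. intros Hab Hf Hg H. apply (is_RInt_le f g a b); auto. intros x Hx. apply H. lra. Qed.

(** The integrand lies above cos t and above w, below 1 and below cos t + sqrt w sin t. The bound 1
    + sqrt w controls the behaviour at w = 0, and the lower bound (pi/2) w that at w = 1. *)
Lemma Hint_bounds w : 0 < w <= 1 -> 1 <= Hint w <= PI / 2 /\ Hint w <= 1 + sqrt w /\ PI / 2 * w <= Hint w.
Proof.
  intros Hw. assert (HPI := PI_RGT_0). assert (Hw0 : 0 < w) by lra.
  assert (H0 := is_RInt_Hint w Hw0). assert (Hp : 0 <= PI / 2) by lra.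
  assert (Hc := is_RInt_half_PI sin cos is_derive_sin continuous_cos).
  rewrite sin_PI2, sin_0, Rminus_0_r in Hc.
  assert (Hs : is_RInt sin 0 (PI / 2) 1).
  { assert (H := is_RInt_half_PI (fun t => - cos t) sin).
    cbv beta in H. rewrite cos_PI2, cos_0 in H. replace (- 0 - - (1)) with 1 in H by ring.
    apply H; [|apply continuous_sin]. intros t. auto_derive; [exact I|]. ring. }
  assert (H1 : forall c, is_RInt (fun _ => c) 0 (PI / 2) (PI / 2 * c)).
  { intros c. assert (H := is_RInt_const (V := R_NormedModule) 0 (PI / 2) c).
    rewrite Rminus_0_r in H. exact H. }
  assert (Hsc : forall t, sin t ^ 2 + cos t ^ 2 = 1).
  { intros t. assert (H := sin2_cos2 t). unfold Rsqr in H. simpl. lra. }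
  repeat split.
  - apply (is_RInt_R_le cos _ 0 (PI / 2) _ _ Hp Hc H0). intros t Ht.
    rewrite <- (sqrt_pow2 (cos t)) by now apply cos_half_PI_pos. apply sqrt_le_1_alt.
    unfold Qf. assert (H := pow2_ge_0 (sin t)). nra.
  - replace (PI / 2) with (PI / 2 * 1) at 1 by ring.
    apply (is_RInt_R_le _ (fun _ => 1) 0 (PI / 2) _ _ Hp H0 (H1 1)). intros t Ht.
    apply Rle_trans with (sqrt 1); [|rewrite sqrt_1; lra]. apply sqrt_le_1_alt. unfold Qf. specialize (Hsc t).
    assert (H := pow2_ge_0 (sin t)). nra.
  - assert (Hb := is_RInt_plus _ _ _ _ _ _ Hc (is_RInt_scal _ _ _ (sqrt w) _ Hs)).
    assert (Hw1 := sqrt_sqrt w ltac:(lra)). assert (Hw2 := sqrt_pos w).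
    replace (1 + sqrt w) with (plus 1 (scal (sqrt w) 1)).
    2:{ unfold plus, scal; simpl. unfold mult; simpl. ring. }
    apply (is_RInt_R_le _ _ 0 (PI / 2) _ _ Hp H0 Hb). intros t Ht.
    unfold plus, scal; simpl. unfold mult; simpl.
    assert (C1 := cos_half_PI_pos t Ht). assert (C2 := sin_half_PI_pos t Ht).
    assert (C3 : 0 <= sqrt w * sin t) by now apply Rmult_le_pos.
    rewrite <- (sqrt_pow2 (cos t + sqrt w * sin t)) by lra. apply sqrt_le_1_alt. unfold Qf.
    replace ((cos t + sqrt w * sin t) ^ 2) with
      (cos t ^ 2 + (sqrt w * sqrt w) * sin t ^ 2 + 2 * (cos t * (sqrt w * sin t))) by ring.
    rewrite Hw1. assert (0 <= cos t * (sqrt w * sin t)) by now apply Rmult_le_pos. lra.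
  - apply (is_RInt_R_le (fun _ => w) _ 0 (PI / 2) _ _ Hp (H1 w) H0). intros t Ht.
    rewrite <- (sqrt_pow2 w) at 1 by lra. apply sqrt_le_1_alt. unfold Qf. specialize (Hsc t).
    assert (H := pow2_ge_0 (cos t)). nra.
Qed.

Lemma Hint1_bounds w : 0 < w -> 0 <= Hint1 w <= / (2 * sqrt w).
Proof.
  intros Hw. assert (HPI := PI_RGT_0). assert (Hp : 0 <= PI / 2) by lra.
  assert (Hsw := sqrt_lt_R0 w Hw).
  assert (Hs : is_RInt sin 0 (PI / 2) 1).
  { assert (H := is_RInt_half_PI (fun t => - cos t) sin).
    cbv beta in H. rewrite cos_PI2, cos_0 in H. replace (- 0 - - (1)) with 1 in H by ring.
    apply H; [|apply continuous_sin]. intros t. auto_derive; [exact I|]. ring. }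
  assert (H1 : is_RInt (fun t => sin t ^ 2 / 2 * Qr w t ^ 1) 0 (PI / 2) (Hint1 w)).
  { apply (RInt_correct (V := R_CompleteNormedModule)).
    apply (ex_RInt_continuous (V := R_CompleteNormedModule)). intros t _.
    apply (continuous_trig (fun t => sin t ^ 2 / 2) 1); auto.
    intros y. apply @ex_derive_continuous. auto_derive. exact I. }
  split.
  - assert (H0 : is_RInt (fun _ => 0) 0 (PI / 2) 0).
    { assert (H := is_RInt_const (V := R_NormedModule) 0 (PI / 2) 0).
      match type of H with is_RInt _ _ _ ?x => replace x with 0 in H; [exact H|] end.
      change (0 = (PI / 2 - 0) * 0). ring. }
    apply (is_RInt_R_le _ _ 0 (PI / 2) _ _ Hp H0 H1). intros t _.
    assert (H := Qr_pos w t Hw). assert (H2 := pow2_ge_0 (sin t)). simpl in *.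
    apply Rmult_le_pos; lra.
  - assert (Hb := is_RInt_scal _ _ _ (/ (2 * sqrt w)) _ Hs).
    replace (/ (2 * sqrt w)) with (scal (/ (2 * sqrt w)) 1).
    2:{ unfold scal; simpl. unfold mult; simpl. ring. }
    apply (is_RInt_R_le _ _ 0 (PI / 2) _ _ Hp H1 Hb). intros t Ht. unfold scal; simpl. unfold mult; simpl.
    assert (C2 := sin_half_PI_pos t Ht).
    assert (Hq := sqrt_lt_R0 _ (Qf_pos w t Hw)).
    assert (Hle : sqrt w * sin t <= sqrt (Qf w t)).
    { rewrite <- (sqrt_pow2 (sin t)) at 1 by exact C2. rewrite <- sqrt_mult_alt by lra.
      apply sqrt_le_1_alt. unfold Qf. assert (H := pow2_ge_0 (cos t)). lra. }
    unfold Qr. rewrite Rinv_mult.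
    apply Rmult_le_reg_r with (sqrt (Qf w t) * sqrt w * 2); [repeat apply Rmult_lt_0_compat; lra|].
    replace (sin t * (sin t * 1) / 2 * (/ sqrt (Qf w t) * 1) * (sqrt (Qf w t) * sqrt w * 2)) with
      (sin t * (sqrt w * sin t)) by (field; lra).
    replace (/ 2 * / sqrt w * sin t * (sqrt (Qf w t) * sqrt w * 2)) with (sin t * sqrt (Qf w t)) by (field; lra).
    now apply Rmult_le_compat_l.
Qed.

(** * Improper integrals over (0, 1] *)

Lemma Ccont_plus f g t : Ccont f t -> Ccont g t -> Ccont (fun x => f x + g x)%C t.
Proof.
  intros [A B] [A' B']; split.
  - exact (continuous_plus (V := R_NormedModule) _ _ t A A').
  - exact (continuous_plus (V := R_NormedModule) _ _ t B B').
Qed.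

Lemma Ccont_mult f g t : Ccont f t -> Ccont g t -> Ccont (fun x => f x * g x)%C t.
Proof.
  intros [A B] [A' B']; split.
  - exact (continuous_minus (V := R_NormedModule) _ _ t (continuous_mult (K := R_AbsRing) _ _ t A A')
      (continuous_mult (K := R_AbsRing) _ _ t B B')).
  - exact (continuous_plus (V := R_NormedModule) _ _ t (continuous_mult (K := R_AbsRing) _ _ t A B')
      (continuous_mult (K := R_AbsRing) _ _ t B A')).
Qed.

Lemma Ccont_const c t : Ccont (fun _ => c) t.
Proof. split; apply continuous_const. Qed.

Lemma Ccont_RtoC (f : R -> R) t : continuous f t -> Ccont (fun x => RtoC (f x)) t.
Proof. intros H; split; [exact H|apply continuous_const]. Qed.

Lemma Ccont_ext f g t : (forall x, f x = g x) -> Ccont f t -> Ccont g t.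
Proof.
  intros H [A B]; split.
  - apply continuous_ext with (2 := A). intros x; now rewrite H.
  - apply continuous_ext with (2 := B). intros x; now rewrite H.
Qed.

Definition CI (g : R -> C) (d : R) : C :=
  (RInt (fun x => Re (g x)) d 1, RInt (fun x => Im (g x)) d 1).

Definition Ccont_pos (g : R -> C) : Prop := forall w, 0 < w -> Ccont g w.

(** The improper integral over (0, 1] as a limit in the lower end. Continuity is included, on all of
    (0, oo), so that every proper integral that occurs exists. *)
Definition is_I (g : R -> C) (l : C) : Prop :=
  Ccont_pos g /\ forall eps, 0 < eps -> exists d, 0 < d /\
    forall x, 0 < x < d -> x <= 1 -> Cmod (CI g x - l) < eps.

Lemma ex_RInt_pos (f : R -> R) a b : 0 < a -> 0 < b -> (forall w, 0 < w -> continuous f w) -> ex_RInt f a b.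
Proof.
  intros Ha Hb H. apply (ex_RInt_continuous (V := R_CompleteNormedModule)). intros z Hz. apply H.
  assert (0 < Rmin a b) by now apply Rmin_pos. lra.
Qed.

Lemma CRInt_pos g a b : 0 < a -> 0 < b -> Ccont_pos g ->
  is_CRInt g a b (RInt (fun x => Re (g x)) a b, RInt (fun x => Im (g x)) a b).
Proof.
  intros Ha Hb Hg. split; apply (RInt_correct (V := R_CompleteNormedModule)); apply ex_RInt_pos; auto;
    intros w Hw; apply (Hg w Hw).
Qed.

Lemma is_CRInt_CI g d : 0 < d -> Ccont_pos g -> is_CRInt g d 1 (CI g d).
Proof. intros Hd Hg. apply CRInt_pos; auto. lra. Qed.

Lemma is_CRInt_unique f a b l m : is_CRInt f a b l -> is_CRInt f a b m -> l = m.
Proof.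
  intros [A B] [A' B']. apply C_ext.
  - rewrite <- (is_RInt_unique _ _ _ _ A). now apply is_RInt_unique.
  - rewrite <- (is_RInt_unique _ _ _ _ B). now apply is_RInt_unique.
Qed.

Lemma is_CRInt_plus f g a b l m : is_CRInt f a b l -> is_CRInt g a b m ->
  is_CRInt (fun x => f x + g x)%C a b (l + m)%C.
Proof.
  intros [A B] [A' B']; split.
  - exact (is_RInt_plus _ _ _ _ _ _ A A').
  - exact (is_RInt_plus _ _ _ _ _ _ B B').
Qed.

Lemma is_CRInt_scal c f a b l : is_CRInt f a b l -> is_CRInt (fun x => c * f x)%C a b (c * l)%C.
Proof.
  intros [A B]; split.
  - exact (is_RInt_minus _ _ _ _ _ _ (is_RInt_scal _ _ _ (Re c) _ A) (is_RInt_scal _ _ _ (Im c) _ B)).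
  - exact (is_RInt_plus _ _ _ _ _ _ (is_RInt_scal _ _ _ (Re c) _ B) (is_RInt_scal _ _ _ (Im c) _ A)).
Qed.

Lemma is_CRInt_ext f g a b l : a <= b -> (forall x, a <= x <= b -> f x = g x) ->
  is_CRInt f a b l -> is_CRInt g a b l.
Proof.
  intros Hab H [A B]; split.
  - apply is_RInt_ext with (2 := A). rewrite Rmin_left, Rmax_right by exact Hab.
    intros x Hx. rewrite H; [reflexivity|lra].
  - apply is_RInt_ext with (2 := B). rewrite Rmin_left, Rmax_right by exact Hab.
    intros x Hx. rewrite H; [reflexivity|lra].
Qed.

Lemma is_CRInt_Chasles f a b c l m : is_CRInt f a b l -> is_CRInt f b c m -> is_CRInt f a c (l + m)%C.
Proof.
  intros [A B] [A' B']; split.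
  - exact (is_RInt_Chasles _ _ _ _ _ _ A A').
  - exact (is_RInt_Chasles _ _ _ _ _ _ B B').
Qed.

Lemma CI_plus f g d : 0 < d -> Ccont_pos f -> Ccont_pos g -> CI (fun x => f x + g x)%C d = (CI f d + CI g d)%C.
Proof.
  intros Hd Hf Hg. apply (is_CRInt_unique (fun x => f x + g x)%C d 1).
  - apply is_CRInt_CI; auto. intros w Hw. apply Ccont_plus; auto.
  - apply is_CRInt_plus; now apply is_CRInt_CI.
Qed.

Lemma CI_scal c f d : 0 < d -> Ccont_pos f -> CI (fun x => c * f x)%C d = (c * CI f d)%C.
Proof.
  intros Hd Hf. apply (is_CRInt_unique (fun x => c * f x)%C d 1).
  - apply is_CRInt_CI; auto. intros w Hw. apply Ccont_mult; [apply Ccont_const|auto].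
  - apply is_CRInt_scal; now apply is_CRInt_CI.
Qed.

Lemma is_I_unique g l m : is_I g l -> is_I g m -> l = m.
Proof.
  intros [_ H1] [_ H2].
  destruct (Req_dec (Cmod (l - m)) 0) as [H|H].
  - apply Cmod_eq_0 in H. replace l with ((l - m) + m)%C by ring. rewrite H. ring.
  - exfalso. assert (Hp : 0 < Cmod (l - m) / 2) by (assert (H0 := Cmod_ge_0 (l - m)); lra).
    destruct (H1 _ Hp) as (d1 & D1 & E1). destruct (H2 _ Hp) as (d2 & D2 & E2).
    set (x := Rmin (Rmin d1 d2) 1 / 2).
    assert (Hx : 0 < Rmin (Rmin d1 d2) 1) by (repeat apply Rmin_pos; lra).
    assert (Hx1 := Rmin_l (Rmin d1 d2) 1). assert (Hx2 := Rmin_r (Rmin d1 d2) 1).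
    assert (Hx3 := Rmin_l d1 d2). assert (Hx4 := Rmin_r d1 d2).
    specialize (E1 x ltac:(unfold x; lra) ltac:(unfold x; lra)).
    specialize (E2 x ltac:(unfold x; lra) ltac:(unfold x; lra)).
    assert (Ht := Cmod_triangle (CI g x - m) (- (CI g x - l))). rewrite Cmod_opp in Ht.
    replace (CI g x - m + - (CI g x - l))%C with (l - m)%C in Ht by ring. lra.
Qed.

Lemma is_I_ext f g l : Ccont_pos g -> (forall w, 0 < w <= 1 -> f w = g w) -> is_I f l -> is_I g l.
Proof.
  intros Hg H [Hf HI]. split; [exact Hg|]. intros eps He. destruct (HI eps He) as (d & Hd & Hx).
  exists d. split; [exact Hd|]. intros x Hx1 Hx2. rewrite <- (is_CRInt_unique g x 1 (CI f x) (CI g x)).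
  - now apply Hx.
  - apply is_CRInt_ext with f; [exact Hx2|intros y Hy; apply H; lra|]. apply is_CRInt_CI; [lra|exact Hf].
  - apply is_CRInt_CI; [lra|exact Hg].
Qed.

Lemma is_I_plus f g l m : is_I f l -> is_I g m -> is_I (fun x => f x + g x)%C (l + m)%C.
Proof.
  intros [Hf F] [Hg G]. split; [intros w Hw; apply Ccont_plus; auto|].
  intros eps He. destruct (F (eps / 2) ltac:(lra)) as (d1 & D1 & E1).
  destruct (G (eps / 2) ltac:(lra)) as (d2 & D2 & E2).
  exists (Rmin d1 d2). split; [now apply Rmin_pos|]. intros x Hx Hx1.
  assert (Hx3 := Rmin_l d1 d2). assert (Hx4 := Rmin_r d1 d2).
  rewrite CI_plus by (auto; lra).
  replace (CI f x + CI g x - (l + m))%C with ((CI f x - l) + (CI g x - m))%C by ring.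
  eapply Rle_lt_trans; [apply Cmod_triangle|].
  specialize (E1 x ltac:(lra) Hx1). specialize (E2 x ltac:(lra) Hx1). lra.
Qed.

Lemma is_I_scal c f l : is_I f l -> is_I (fun x => c * f x)%C (c * l)%C.
Proof.
  intros [Hf F]. split; [intros w Hw; apply Ccont_mult; [apply Ccont_const|auto]|].
  intros eps He. assert (Hc := Cmod_ge_0 c).
  destruct (F (eps / (Cmod c + 1))) as (d & D & E); [apply Rdiv_lt_0_compat; lra|].
  exists d. split; [exact D|]. intros x Hx Hx1. rewrite CI_scal by (auto; lra).
  replace (c * CI f x - c * l)%C with (c * (CI f x - l))%C by ring. rewrite Cmod_mult.
  specialize (E x Hx Hx1). assert (H0 := Cmod_ge_0 (CI f x - l)).
  apply Rle_lt_trans with ((Cmod c + 1) * Cmod (CI f x - l)); [nra|].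
  apply Rmult_lt_reg_r with (/ (Cmod c + 1)); [apply Rinv_0_lt_compat; lra|].
  replace ((Cmod c + 1) * Cmod (CI f x - l) * / (Cmod c + 1)) with (Cmod (CI f x - l)) by (field; lra).
  exact E.
Qed.

(** * Complex powers and dominated integrands *)

Lemma Rcpow_plus w z z' : Rcpow w (z + z') = (Rcpow w z * Rcpow w z')%C.
Proof. unfold Rcpow. rewrite Cmult_plus_distr_r. apply Cexp_plus. Qed.

Lemma Rcpow_RtoC w (x : R) : Rcpow w (RtoC x) = RtoC (Rpower w x).
Proof.
  unfold Rcpow, Rpower, Cexp. rewrite <- RtoC_mult, Re_RtoC, Im_RtoC, cos_0, sin_0.
  apply C_ext; simpl; ring.
Qed.

Lemma Rcpow_1 w : 0 < w -> Rcpow w 1 = RtoC w.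
Proof. intros Hw. rewrite Rcpow_RtoC, Rpower_1; auto. Qed.

Lemma Cmod_Rcpow w z : Cmod (Rcpow w z) = Rpower w (Re z).
Proof.
  unfold Rcpow, Rpower. rewrite Cmod_Cexp. f_equal. rewrite Re_mult, Re_RtoC, Im_RtoC. ring.
Qed.

Lemma Rcpow_base_1 z : Rcpow 1 z = 1%C.
Proof. unfold Rcpow. rewrite ln_1, Cmult_0_r. apply Cexp_0. Qed.

Lemma is_Cderive_Rcpow w z : 0 < w -> is_Cderive (fun x => Rcpow x z) w (z * Rcpow w (z - 1))%C.
Proof.
  intros Hw. apply is_Cderive_ext with (fun x => Cexp (RtoC (ln x) * z)).
  { intros x. unfold Rcpow. now rewrite Cmult_comm. }
  eapply is_Cderive_eq.
  - apply (is_Cderive_comp (fun y => Cexp (RtoC y * z)) ln); [apply is_Cderive_Cexp|].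
    auto_derive; [exact Hw|]. rewrite Rmult_1_l. reflexivity.
  - replace (z - 1)%C with (z + RtoC (- (1)))%C by (rewrite RtoC_opp; ring).
    rewrite Rcpow_plus, Rcpow_RtoC, Rpower_Ropp, Rpower_1 by exact Hw.
    unfold Rcpow. rewrite (Cmult_comm z (RtoC (ln w))). ring.
Qed.

Lemma Ccont_Rcpow z : Ccont_pos (fun w => Rcpow w z).
Proof. intros w Hw. eapply Ccont_derive. now apply is_Cderive_Rcpow. Qed.

Lemma Rpower_pos x y : 0 < Rpower x y.
Proof. apply exp_pos. Qed.

Lemma Rpower_le_1 x a b : 0 < x <= 1 -> a <= b -> Rpower x b <= Rpower x a.
Proof.
  intros Hx Hab. unfold Rpower. assert (Hl : ln x <= 0).
  { rewrite <- ln_1. destruct (proj2 Hx) as [H|H]; [left; now apply ln_increasing|rewrite H; lra]. }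
  assert (H : b * ln x <= a * ln x) by nra.
  destruct H as [H|H]; [left; now apply exp_increasing|rewrite H; lra].
Qed.

Lemma Rpower_small sg eps : 0 < sg -> 0 < eps -> exists d, 0 < d /\ forall x, 0 < x < d -> Rpower x sg < eps.
Proof.
  intros Hs He. exists (Rpower eps (/ sg)). split; [apply Rpower_pos|]. intros x Hx.
  rewrite <- (Rpower_1 eps He). replace 1 with (/ sg * sg) by (field; lra). rewrite <- Rpower_mult.
  unfold Rpower at 1 2. apply exp_increasing. apply Rmult_lt_compat_l; [exact Hs|].
  apply ln_increasing; lra.
Qed.

Lemma is_RInt_Rpower sg a b : sg <> 0 -> 0 < a <= b ->
  is_RInt (fun w => Rpower w (sg - 1)) a b (Rpower b sg / sg - Rpower a sg / sg).
Proof.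
  intros Hs Hab.
  apply (is_RInt_derive (V := R_CompleteNormedModule) (fun w => Rpower w sg / sg) (fun w => Rpower w (sg - 1)));
    intros x; rewrite Rmin_left, Rmax_right by lra; intros Hx; assert (Hx0 : 0 < x) by lra.
  - unfold Rpower. auto_derive; [exact Hx0|].
    replace ((sg - 1) * ln x) with (sg * ln x + - ln x) by ring. rewrite exp_plus, exp_Ropp, exp_ln by exact Hx0.
    field. split; lra.
  - apply @ex_derive_continuous. unfold Rpower. auto_derive. exact Hx0.
Qed.

Definition dominated (g : R -> C) (B sg : R) : Prop :=
  Ccont_pos g /\ forall w, 0 < w <= 1 -> Cmod (g w) <= B * Rpower w (sg - 1).

(** Continuity carries the bound to w = 1. This serves the remainders of expansions whose
    convergence is known only for w < 1. *)
Lemma dominated_open g B sg : Ccont_pos g -> (forall w, 0 < w < 1 -> Cmod (g w) <= B * Rpower w (sg - 1)) ->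
  dominated g B sg.
Proof.
  intros Hg H. split; [exact Hg|]. intros w Hw.
  destruct (Rlt_dec w 1) as [Hw1|Hw1]; [apply H; lra|]. replace w with 1 by lra. apply Rnot_lt_le. intros Hlt.
  assert (Hc : continuous (fun x => B * Rpower x (sg - 1) - Cmod (g x)) 1).
  { destruct (Hg 1 Rlt_0_1) as [C1 C2]. apply (continuous_minus (V := R_NormedModule)).
    - apply (ex_derive_continuous (V := R_NormedModule)). unfold Rpower. auto_derive. lra.
    - apply (continuous_comp (fun x => Re (g x) ^ 2 + Im (g x) ^ 2) sqrt); [|apply continuous_sqrt].
      apply (continuous_plus (V := R_NormedModule)).
      + apply (continuous_comp (fun x => Re (g x)) (fun y => y ^ 2)); [exact C1|].
        apply (ex_derive_continuous (V := R_NormedModule)). now auto_derive.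
      + apply (continuous_comp (fun x => Im (g x)) (fun y => y ^ 2)); [exact C2|].
        apply (ex_derive_continuous (V := R_NormedModule)). now auto_derive. }
  assert (Hl : B * Rpower 1 (sg - 1) - Cmod (g 1) < 0) by lra.
  destruct (Hc _ (open_lt 0 _ Hl)) as [d Hd]. assert (Hdp := cond_pos d).
  set (x := 1 - Rmin (/ 2) (d / 2)).
  assert (Hm : 0 < Rmin (/ 2) (d / 2)) by (apply Rmin_pos; lra).
  assert (Hm1 := Rmin_l (/ 2) (d / 2)). assert (Hm2 := Rmin_r (/ 2) (d / 2)).
  assert (Hx := H x ltac:(unfold x; lra)).
  assert (Hb : ball 1 d x).
  { change (Rabs (x - 1) < d). unfold x. rewrite Rabs_left by lra. lra. }
  specialize (Hd x Hb). cbv beta in Hd. lra.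
Qed.

Lemma dominated_RInt g B sg a b l : 0 < sg -> dominated g B sg -> 0 < a <= b -> b <= 1 ->
  is_CRInt g a b l -> Cmod l <= B / sg * (Rpower b sg - Rpower a sg).
Proof.
  intros Hs [Hg Hb] Hab Hb1 Hl.
  assert (H := is_RInt_scal _ _ _ B _ (is_RInt_Rpower sg a b ltac:(lra) Hab)).
  replace (B / sg * (Rpower b sg - Rpower a sg)) with (scal B (Rpower b sg / sg - Rpower a sg / sg)).
  - apply (is_CRInt_bound g (fun w => scal B (Rpower w (sg - 1))) a b); [lra|exact Hl|exact H|].
    intros x Hx. apply Hb. lra.
  - unfold scal; simpl. unfold mult; simpl. field. lra.
Qed.

Lemma CI_diff g a b : 0 < a -> 0 < b -> Ccont_pos g -> is_CRInt g a b (CI g a - CI g b)%C.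
Proof.
  intros Ha Hb Hg. assert (H1 := CRInt_pos g a b Ha Hb Hg).
  assert (H2 := is_CRInt_Chasles _ _ _ _ _ _ H1 (is_CRInt_CI g b Hb Hg)).
  assert (E := is_CRInt_unique _ _ _ _ _ H2 (is_CRInt_CI g a Ha Hg)).
  rewrite <- E. set (x := (RInt (fun x => Re (g x)) a b, RInt (fun x => Im (g x)) a b) : C) in *.
  replace (x + CI g b - CI g b)%C with x by ring. exact H1.
Qed.

Lemma dominated_pos g B sg : dominated g B sg -> 0 <= B.
Proof.
  intros [_ H]. specialize (H 1 ltac:(lra)). unfold Rpower in H. rewrite ln_1, Rmult_0_r, exp_0, Rmult_1_r in H.
  eapply Rle_trans; [apply Cmod_ge_0|exact H].
Qed.

Definition Imp (g : R -> C) : C := CLim_seq (fun n => CI g (/ (INR n + 1))).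

Lemma dominated_is_I g B sg : 0 < sg -> dominated g B sg ->
  is_I g (Imp g) /\ Cmod (Imp g) <= B / sg /\
  forall d, 0 < d <= 1 -> Cmod (CI g d - Imp g) <= B / sg * Rpower d sg.
Proof.
  intros Hs Hdom. assert (Hg := proj1 Hdom). assert (HB := dominated_pos _ _ _ Hdom).
  assert (HBs : 0 <= B / sg). { apply Rmult_le_pos; [exact HB|left; now apply Rinv_0_lt_compat]. }
  assert (Hdiff : forall a b, 0 < a <= b -> b <= 1 -> Cmod (CI g a - CI g b) <= B / sg * Rpower b sg).
  { intros a b Ha Hb. eapply Rle_trans.
    - apply (dominated_RInt g B sg a b); auto. apply CI_diff; auto; lra.
    - apply Rmult_le_compat_l; [exact HBs|]. assert (H := Rpower_pos a sg). lra. }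
  set (x := fun n => / (INR n + 1)).
  assert (Hx : forall n, 0 < x n <= 1).
  { intros n. unfold x. assert (H := pos_INR n). split; [apply Rinv_0_lt_compat; lra|].
    rewrite <- Rinv_1. apply Rinv_le_contravar; lra. }
  assert (Hmono : forall n m, (n <= m)%nat -> x m <= x n).
  { intros n m Hnm. unfold x. assert (H := pos_INR n). apply le_INR in Hnm. apply Rinv_le_contravar; lra. }
  assert (Hsmall : forall d, 0 < d -> exists N, forall n, (N <= n)%nat -> x n < d).
  { intros d Hd. destruct (INR_unbounded (/ d)) as (N & HN). exists N. intros n Hn.
    apply le_INR in Hn. unfold x. rewrite <- (Rinv_inv d). apply Rinv_lt_contravar; [|lra].
    apply Rmult_lt_0_compat; [now apply Rinv_0_lt_compat|]. assert (H := pos_INR n). lra. }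
  assert (Hcauchy : forall (p : C -> R), (forall a b, Rabs (p a - p b) <= Cmod (a - b)) ->
    ex_finite_lim_seq (fun n => p (CI g (x n)))).
  { intros p Hp. apply ex_lim_seq_cauchy_corr. intros eps.
    assert (He : 0 < eps / (B / sg + 1)) by (apply Rdiv_lt_0_compat; [apply cond_pos|lra]).
    destruct (Rpower_small sg _ Hs He) as (d & Hd & Hd2). destruct (Hsmall d Hd) as (N & HN).
    assert (Hone : forall n m, (N <= n)%nat -> (n <= m)%nat -> Cmod (CI g (x m) - CI g (x n)) < eps).
    { intros n m Hn Hm. eapply Rle_lt_trans; [apply Hdiff|].
      - split; [apply Hx|now apply Hmono].
      - apply Hx.
      - specialize (Hd2 (x n) ltac:(split; [apply Hx|now apply HN])). assert (Hr := Rpower_pos (x n) sg).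
        apply Rle_lt_trans with ((B / sg + 1) * Rpower (x n) sg); [nra|].
        apply Rmult_lt_reg_r with (/ (B / sg + 1)); [apply Rinv_0_lt_compat; lra|].
        replace ((B / sg + 1) * Rpower (x n) sg * / (B / sg + 1)) with (Rpower (x n) sg) by (field; lra).
        exact Hd2. }
    exists N. intros n m Hn Hm. eapply Rle_lt_trans; [apply Hp|].
    destruct (Nat.le_ge_cases n m) as [H|H].
    - replace (CI g (x n) - CI g (x m))%C with (- (CI g (x m) - CI g (x n)))%C by ring.
      rewrite Cmod_opp. now apply Hone.
    - now apply Hone. }
  assert (Hlim : is_Clim (fun n => CI g (x n)) (Imp g)).
  { split.
    - apply Lim_seq_correct'. apply (Hcauchy Re). intros a b. apply (re_le_Cmod (a - b)%C).
    - apply Lim_seq_correct'. apply (Hcauchy Im). intros a b. apply (im_le_Cmod (a - b)%C). }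
  assert (Hest : forall d, 0 < d <= 1 -> Cmod (CI g d - Imp g) <= B / sg * Rpower d sg).
  { intros d Hd. apply Rnot_lt_le. intros Hlt.
    set (e := (Cmod (CI g d - Imp g) - B / sg * Rpower d sg) / 4). assert (He : 0 < e) by (unfold e; lra).
    destruct Hlim as [L1 L2]. apply is_lim_seq_spec in L1. apply is_lim_seq_spec in L2.
    destruct (L1 (mkposreal e He)) as (N1 & HN1). destruct (L2 (mkposreal e He)) as (N2 & HN2).
    destruct (Hsmall d ltac:(lra)) as (N3 & HN3). set (n := (N1 + N2 + N3)%nat).
    specialize (HN1 n ltac:(unfold n; lia)). specialize (HN2 n ltac:(unfold n; lia)).
    specialize (HN3 n ltac:(unfold n; lia)).
    change (pos (mkposreal e He)) with e in HN1, HN2.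
    assert (H1 := Cmod_le_Re_Im (CI g (x n) - Imp g)).
    assert (H2 : Rabs (Re (CI g (x n) - Imp g)%C) < e) by exact HN1.
    assert (H3 : Rabs (Im (CI g (x n) - Imp g)%C) < e) by exact HN2.
    assert (H4 := Hdiff (x n) d ltac:(split; [apply Hx|lra]) ltac:(lra)).
    assert (H5 := Cmod_triangle (CI g (x n) - Imp g) (- (CI g (x n) - CI g d))). rewrite Cmod_opp in H5.
    replace (CI g (x n) - Imp g + - (CI g (x n) - CI g d))%C with (CI g d - Imp g)%C in H5 by ring.
    unfold e in *. lra. }
  split; [|split; [|exact Hest]].
  - split; [exact Hg|]. intros eps He.
    assert (He' : 0 < eps / (B / sg + 1)) by (apply Rdiv_lt_0_compat; lra).
    destruct (Rpower_small sg _ Hs He') as (d & Hd & Hd2). exists d. split; [exact Hd|]. intros y Hy Hy1.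
    eapply Rle_lt_trans; [apply Hest; lra|]. specialize (Hd2 y Hy). assert (Hr := Rpower_pos y sg).
    apply Rle_lt_trans with ((B / sg + 1) * Rpower y sg); [nra|].
    apply Rmult_lt_reg_r with (/ (B / sg + 1)); [apply Rinv_0_lt_compat; lra|].
    replace ((B / sg + 1) * Rpower y sg * / (B / sg + 1)) with (Rpower y sg) by (field; lra).
    exact Hd2.
  - specialize (Hest 1 ltac:(lra)).
    assert (E : CI g 1 = 0%C) by (unfold CI; now rewrite !RInt_point).
    replace (CI g 1 - Imp g)%C with (- Imp g)%C in Hest by (rewrite E; ring).
    rewrite Cmod_opp in Hest. unfold Rpower in Hest. rewrite ln_1, Rmult_0_r, exp_0, Rmult_1_r in Hest. exact Hest.
Qed.

Lemma is_I_dominated_bound g B sg l : 0 < sg -> dominated g B sg -> is_I g l -> Cmod l <= B / sg.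
Proof.
  intros Hs Hd Hl. destruct (dominated_is_I g B sg Hs Hd) as (H1 & H2 & _).
  now rewrite (is_I_unique g l (Imp g) Hl H1).
Qed.

Lemma is_I_le g (b : R -> R) l (m : R) : is_I g l -> is_I (fun w => RtoC (b w)) (RtoC m) ->
  (forall w, 0 < w <= 1 -> Cmod (g w) <= b w) -> Cmod l <= m.
Proof.
  intros [Hg G] [Hb B] H. apply Rnot_lt_le. intros Hlt.
  set (e := (Cmod l - m) / 4). assert (He : 0 < e) by (unfold e; lra).
  destruct (G e He) as (d1 & D1 & E1). destruct (B e He) as (d2 & D2 & E2).
  set (x := Rmin (Rmin d1 d2) 1 / 2).
  assert (Hx : 0 < Rmin (Rmin d1 d2) 1) by (repeat apply Rmin_pos; lra).
  assert (Hx1 := Rmin_l (Rmin d1 d2) 1). assert (Hx2 := Rmin_r (Rmin d1 d2) 1).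
  assert (Hx3 := Rmin_l d1 d2). assert (Hx4 := Rmin_r d1 d2).
  specialize (E1 x ltac:(unfold x; lra) ltac:(unfold x; lra)).
  specialize (E2 x ltac:(unfold x; lra) ltac:(unfold x; lra)).
  assert (Hx0 : 0 < x) by (unfold x; lra).
  destruct (is_CRInt_CI _ x Hx0 Hb) as [B1 _].
  assert (H1 := is_CRInt_bound g b x 1 _ _ ltac:(unfold x; lra) (is_CRInt_CI g x Hx0 Hg) B1
    ltac:(intros y Hy; apply H; lra)).
  assert (H2 := re_le_Cmod (CI (fun w => RtoC (b w)) x - RtoC m)).
  assert (H3 : Re (CI (fun w => RtoC (b w)) x - RtoC m)%C = Re (CI (fun w => RtoC (b w)) x) - m) by reflexivity.
  rewrite H3 in H2. assert (H4 := Rle_abs (Re (CI (fun w => RtoC (b w)) x) - m)).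
  assert (H5 := Cmod_triangle (CI g x) (- (CI g x - l))). rewrite Cmod_opp in H5.
  replace (CI g x + - (CI g x - l))%C with l in H5 by ring. unfold e in *. lra.
Qed.

Lemma is_I_derive (F f : R -> C) B sg : 0 < sg -> (forall w, 0 < w -> is_Cderive F w (f w)) -> Ccont_pos f ->
  (forall w, 0 < w <= 1 -> Cmod (F w) <= B * Rpower w sg) -> is_I f (F 1).
Proof.
  intros Hs HF Hf Hb. split; [exact Hf|]. intros eps He.
  assert (HB : 0 <= B).
  { specialize (Hb 1 ltac:(lra)). unfold Rpower in Hb. rewrite ln_1, Rmult_0_r, exp_0, Rmult_1_r in Hb.
    eapply Rle_trans; [apply Cmod_ge_0|exact Hb]. }
  destruct (Rpower_small sg (eps / (B + 1)) Hs ltac:(apply Rdiv_lt_0_compat; lra)) as (d & Hd & Hd2).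
  exists d. split; [exact Hd|]. intros x Hx Hx1.
  assert (H := is_CRInt_derive F f x 1 Hx1 (fun y Hy => HF y ltac:(lra)) (fun y Hy => Hf y ltac:(lra))).
  rewrite (is_CRInt_unique _ _ _ _ _ (is_CRInt_CI f x ltac:(lra) Hf) H).
  replace (F 1 - F x - F 1)%C with (- F x)%C by ring. rewrite Cmod_opp.
  eapply Rle_lt_trans; [apply Hb; lra|]. specialize (Hd2 x Hx). assert (Hr := Rpower_pos x sg).
  apply Rle_lt_trans with ((B + 1) * Rpower x sg); [nra|].
  apply Rmult_lt_reg_r with (/ (B + 1)); [apply Rinv_0_lt_compat; lra|].
  replace ((B + 1) * Rpower x sg * / (B + 1)) with (Rpower x sg) by (field; lra). exact Hd2.
Qed.

Definition Cpartial (h : nat -> C) (n : nat) : C :=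
  (sum_n (fun k => Re (h k)) n, sum_n (fun k => Im (h k)) n).

Lemma Cpartial_0 h : Cpartial h 0 = h 0%nat.
Proof. unfold Cpartial. rewrite !sum_O. now destruct (h 0%nat). Qed.

Lemma Cpartial_succ h n : Cpartial h (S n) = (Cpartial h n + h (S n))%C.
Proof. unfold Cpartial. rewrite !sum_n_succ. reflexivity. Qed.

Lemma is_series_tail (a : nat -> R) (l : R) n : is_series a l ->
  is_series (fun k => a (S n + k)%nat) (l - sum_n a n).
Proof.
  intros H. apply (is_series_incr_n (V := R_NormedModule) a (S n)); [lia|].
  match goal with |- is_series _ ?x => replace x with l end; [exact H|].
  change (l = l - sum_n a n + sum_n a n). ring.
Qed.

Lemma is_Cseries_tail (h : nat -> C) (l : C) n : is_Cseries h l ->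
  is_Cseries (fun k => h (S n + k)%nat) (l - Cpartial h n)%C.
Proof.
  intros [A B]; split.
  - exact (is_series_tail (fun k => Re (h k)) _ n A).
  - exact (is_series_tail (fun k => Im (h k)) _ n B).
Qed.

(** The remainder after N terms is dominated by the tail of the b(n) with the same exponent, so its
    integral is at most that tail over sg, uniformly in the lower end. The finite partial sum is
    integrated directly. *)
Lemma is_I_series (g : R -> C) (f : nat -> R -> C) (b : nat -> R) (v : nat -> C) (sg T : R) :
  0 < sg -> Ccont_pos g -> (forall n, dominated (f n) (b n) sg) -> is_series b T ->
  (forall w, 0 < w < 1 -> is_Cseries (fun n => f n w) (g w)) -> (forall n, is_I (f n) (v n)) ->
  is_Cseries v (CSeries v) /\ is_I g (CSeries v).
Proof.
  intros Hs Hg Hf Hb Hsum Hv.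
  assert (Hvb : forall n, Cmod (v n) <= / sg * b n).
  { intros n. rewrite Rmult_comm. apply (is_I_dominated_bound (f n) (b n) sg); auto. }
  assert (Hsv : is_Cseries v (CSeries v)).
  { apply is_Cseries_abs. apply (ex_series_le_pos _ (fun n => / sg * b n)).
    - intros n; split; [apply Cmod_ge_0|apply Hvb].
    - eexists. exact (is_series_scal (V := R_NormedModule) (/ sg) _ _ Hb). }
  split; [exact Hsv|].
  assert (Hb0 : forall n, 0 <= b n) by (intros n; apply (dominated_pos _ _ _ (Hf n))).
  assert (Htail : forall (h : nat -> C) (l : C) c n, 0 <= c -> (forall k, Cmod (h k) <= c * b k) ->
    is_Cseries h l -> Cmod (l - Cpartial h n) <= c * (T - sum_n b n)).
  { intros h l c n Hc Hh Hl.
    apply (is_Cseries_le _ _ (fun k => c * b (S n + k)%nat) _ (is_Cseries_tail h l n Hl)).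
    - intros k. apply Hh.
    - exact (is_series_scal (V := R_NormedModule) c _ _ (is_series_tail b T n Hb)). }
  split; [exact Hg|]. intros eps He.
  assert (HbT : is_lim_seq (sum_n b) T) by exact Hb. apply is_lim_seq_spec in HbT.
  assert (He3 : 0 < eps * sg / 4) by nra.
  destruct (HbT (mkposreal _ He3)) as (N & HN). specialize (HN N (le_n _)).
  change (pos (mkposreal _ He3)) with (eps * sg / 4) in HN. apply Rabs_def2 in HN.
  assert (HNs : is_I (fun w => Cpartial (fun n => f n w) N) (Cpartial v N)).
  { clear HN. induction N as [|N IH].
    - apply is_I_ext with (f 0%nat); [|intros w _; now rewrite Cpartial_0|rewrite Cpartial_0; apply Hv].
      intros w Hw. apply Ccont_ext with (f 0%nat); [intros y; now rewrite Cpartial_0|now apply Hf].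
    - assert (H := is_I_plus _ _ _ _ IH (Hv (S N))). rewrite <- Cpartial_succ in H.
      apply is_I_ext with (3 := H); [|intros w _; now rewrite Cpartial_succ].
      intros w Hw. apply Ccont_ext with (fun x => Cpartial (fun n => f n x) N + f (S N) x)%C.
      + intros y. now rewrite Cpartial_succ.
      + now apply H. }
  destruct HNs as [HNc HNs]. destruct (HNs (eps / 4) ltac:(lra)) as (d & Hd & Hd2).
  exists d. split; [exact Hd|]. intros x Hx Hx1. specialize (Hd2 x Hx Hx1).
  set (tl := T - sum_n b N) in *.
  assert (Htl0 : 0 <= tl) by (unfold tl; assert (H := sum_n_le_is_series b T N Hb0 Hb); lra).
  assert (H1 : Cmod (CSeries v - Cpartial v N) <= / sg * tl).
  { apply Htail; auto. left. now apply Rinv_0_lt_compat. }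
  assert (Hdom : dominated (fun w => g w - Cpartial (fun n => f n w) N)%C tl sg).
  { apply dominated_open.
    - intros w Hw. apply Ccont_ext with (fun w => g w + - (1) * Cpartial (fun n => f n w) N)%C; [intros y; ring|].
      apply Ccont_plus; [now apply Hg|]. apply Ccont_mult; [apply Ccont_const|now apply HNc].
    - intros w Hw. rewrite Rmult_comm. apply Htail.
      + left; apply Rpower_pos.
      + intros k. rewrite Rmult_comm. apply (Hf k). lra.
      + now apply Hsum. }
  assert (H2 : Cmod (CI g x - CI (fun w => Cpartial (fun n => f n w) N) x) <= tl / sg).
  { replace (CI g x - CI (fun w => Cpartial (fun n => f n w) N) x)%C with (CI (fun w => g w - Cpartial (fun n => f n w) N)%C x).
    - eapply Rle_trans.
      + apply (dominated_RInt (fun w => g w - Cpartial (fun n => f n w) N)%C tl sg x 1); [exact Hs|exact Hdom|lra|lra|].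
        apply is_CRInt_CI; [lra|apply Hdom].
      + unfold Rpower at 1. rewrite ln_1, Rmult_0_r, exp_0. assert (H := Rpower_pos x sg).
        assert (Hts : 0 <= tl / sg). { apply Rmult_le_pos; [exact Htl0|left; now apply Rinv_0_lt_compat]. }
        nra.
    - apply (is_CRInt_unique (fun w => g w - Cpartial (fun n => f n w) N)%C x 1).
      + apply is_CRInt_CI; [lra|apply Hdom].
      + apply is_CRInt_ext with (fun w => g w + - (1) * Cpartial (fun n => f n w) N)%C; [exact Hx1|intros y _; ring|].
        replace (CI g x - CI (fun w => Cpartial (fun n => f n w) N) x)%C with
          (CI g x + - (1) * CI (fun w => Cpartial (fun n => f n w) N) x)%C by ring.
        apply is_CRInt_plus; [apply is_CRInt_CI; [lra|exact Hg]|].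
        apply is_CRInt_scal. apply is_CRInt_CI; [lra|exact HNc]. }
  replace (CI g x - CSeries v)%C with
    ((CI g x - CI (fun w => Cpartial (fun n => f n w) N) x) +
     ((CI (fun w => Cpartial (fun n => f n w) N) x - Cpartial v N) + - (CSeries v - Cpartial v N)))%C by ring.
  eapply Rle_lt_trans; [apply Cmod_triangle|].
  assert (H3 := Cmod_triangle (CI (fun w => Cpartial (fun n => f n w) N) x - Cpartial v N) (- (CSeries v - Cpartial v N))).
  rewrite Cmod_opp in H3.
  assert (H4 : / sg * tl <= eps / 4).
  { apply Rmult_le_reg_l with sg; [exact Hs|]. rewrite <- Rmult_assoc, Rinv_r, Rmult_1_l by lra. unfold tl. lra. }
  unfold Rdiv in *. lra.
Qed.

(** * The Mellin transform of the elliptic integral *)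

Definition gmu (u : C) (w : R) : C := (Rcpow w (u - 1) * RtoC (Hint w))%C.
Definition gmu1 (u : C) (w : R) : C := (Rcpow w (u - 1) * RtoC (ln w * Hint w))%C.
Definition mu (u : C) : C := Imp (gmu u).
Definition mu1 (u : C) : C := Imp (gmu1 u).

Lemma continuous_Hint w : 0 < w -> continuous Hint w.
Proof. intros Hw. apply @ex_derive_continuous. eexists. now apply is_derive_Hint. Qed.

Lemma continuous_ln w : 0 < w -> continuous ln w.
Proof. intros Hw. apply @ex_derive_continuous. auto_derive. exact Hw. Qed.

Lemma Ccont_gmu u : Ccont_pos (gmu u).
Proof.
  intros w Hw. apply Ccont_mult; [now apply Ccont_Rcpow|]. apply Ccont_RtoC. now apply continuous_Hint.
Qed.

Lemma Ccont_gmu1 u : Ccont_pos (gmu1 u).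
Proof.
  intros w Hw. apply Ccont_mult; [now apply Ccont_Rcpow|]. apply Ccont_RtoC.
  apply (continuous_mult (K := R_AbsRing)); [now apply continuous_ln|now apply continuous_Hint].
Qed.

Lemma Rabs_Hint w : 0 < w <= 1 -> Rabs (Hint w) <= PI / 2.
Proof.
  intros Hw. destruct (Hint_bounds w Hw) as ((H1 & H2) & _). rewrite Rabs_pos_eq; lra.
Qed.

Lemma Rabs_ln_le w eta : 0 < w <= 1 -> 0 < eta -> Rabs (ln w) <= / eta * Rpower w (- eta).
Proof.
  intros Hw He. assert (Hl : ln w <= 0).
  { rewrite <- ln_1. destruct (proj2 Hw) as [H|H]; [left; now apply ln_increasing|rewrite H; lra]. }
  rewrite Rabs_left1 by exact Hl. apply Rmult_le_reg_l with eta; [exact He|].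
  rewrite <- Rmult_assoc, Rinv_r, Rmult_1_l by lra. unfold Rpower.
  assert (H := exp_ineq1_le (- eta * ln w)). lra.
Qed.

Lemma Re_minus_1 (u : C) : Re (u - 1)%C = Re u - 1.
Proof. reflexivity. Qed.

Lemma dominated_gmu u : 0 < Re u -> dominated (gmu u) (PI / 2) (Re u).
Proof.
  intros Hu. split; [apply Ccont_gmu|]. intros w Hw. unfold gmu.
  rewrite Cmod_mult, Cmod_Rcpow, Cmod_R, Re_minus_1, Rmult_comm.
  apply Rmult_le_compat_r; [left; apply Rpower_pos|now apply Rabs_Hint].
Qed.

(** Half of the exponent is spent on the logarithm: |ln w| <= (2 / Re u) w^(- Re u / 2). *)
Lemma dominated_gmu1 u : 0 < Re u -> dominated (gmu1 u) (PI / 2 * (2 / Re u)) (Re u / 2).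
Proof.
  intros Hu. split; [apply Ccont_gmu1|]. intros w Hw. unfold gmu1.
  rewrite Cmod_mult, Cmod_Rcpow, Cmod_R, Re_minus_1, Rabs_mult.
  assert (H1 := Rabs_Hint w Hw). assert (H2 := Rabs_ln_le w (Re u / 2) Hw ltac:(lra)).
  replace (Re u / 2 - 1) with ((Re u - 1) + - (Re u / 2)) by field. rewrite Rpower_plus.
  assert (H3 := Rpower_pos w (Re u - 1)). assert (H4 := Rpower_pos w (- (Re u / 2))).
  replace (PI / 2 * (2 / Re u) * (Rpower w (Re u - 1) * Rpower w (- (Re u / 2)))) with
    (Rpower w (Re u - 1) * (/ (Re u / 2) * Rpower w (- (Re u / 2)) * (PI / 2))) by (field; lra).
  apply Rmult_le_compat_l; [lra|]. apply Rmult_le_compat; try apply Rabs_pos; assumption.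
Qed.

Lemma is_I_mu u : 0 < Re u -> is_I (gmu u) (mu u).
Proof. intros Hu. apply (dominated_is_I _ _ _ Hu (dominated_gmu u Hu)). Qed.

Lemma is_I_mu1 u : 0 < Re u -> is_I (gmu1 u) (mu1 u).
Proof. intros Hu. assert (H2 : 0 < Re u / 2) by lra. apply (dominated_is_I _ _ _ H2 (dominated_gmu1 u Hu)). Qed.

Lemma mu_bound u : 0 < Re u -> Cmod (mu u) <= PI / 2 / Re u.
Proof. intros Hu. apply (dominated_is_I _ _ _ Hu (dominated_gmu u Hu)). Qed.

Lemma mu1_bound u : 0 < Re u -> Cmod (mu1 u) <= 2 * PI / Re u ^ 2.
Proof.
  intros Hu. assert (H2 : 0 < Re u / 2) by lra.
  destruct (dominated_is_I _ _ _ H2 (dominated_gmu1 u Hu)) as (_ & H & _).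
  replace (2 * PI / Re u ^ 2) with (PI / 2 * (2 / Re u) / (Re u / 2)) by (field; lra). exact H.
Qed.

Lemma exp_taylor_error y : Rabs (exp y - 1 - y) <= exp (Rabs y) * (y ^ 2).
Proof.
  assert (H := exp_partial_error 1 (RtoC y) 1 ltac:(lra)).
  rewrite Cmult_1_l, Cmod_R in H.
  assert (E : (Cexp (RtoC y) - exp_partial 1 (RtoC y))%C = RtoC (exp y - 1 - y)).
  { unfold Cexp. rewrite Re_RtoC, Im_RtoC, cos_0, sin_0. simpl exp_partial.
    rewrite !RtoC_minus. replace (exp y * 1, exp y * 0) with (RtoC (exp y)) by (apply C_ext; simpl; ring).
    field. }
  rewrite E, Cmod_R in H. eapply Rle_trans; [exact H|].
  rewrite pow2_abs. rewrite pow1. assert (H1 := pow2_ge_0 y). assert (H2 := exp_pos (Rabs y)).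
  replace (INR (fact 2)) with 2 by (simpl; ring).
  apply Rle_trans with (exp (Rabs y) * y ^ 2 * 1); [|lra].
  apply Rmult_le_compat_l; [|lra]. apply Rmult_le_pos; [left; exact H2|exact H1].
Qed.

(** Differentiation under the integral sign, with the remainder w^t - 1 - t ln w bounded by w^(-
    |t|) (t ln w)^2 for w <= 1. *)
Lemma is_Cderive_mu_0 u : 0 < Re u -> is_Cderive (fun t => mu (u + RtoC t)) 0 (mu1 u).
Proof.
  intros Hu. set (sg := Re u) in *.
  (* The exponential and each of the two logarithms cost a factor w^(- sg / 4), so a quarter of the
     exponent sg remains; this also fixes the range |t| <= sg / 4. *)
  apply (is_Cderive_quadratic _ _ (PI / 2 * (4 / sg) ^ 2 / (sg / 4)) (sg / 4)); [lra|]. intros t Ht.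
  rewrite Cplus_0_r. assert (Ht2 := Ht). apply Rabs_le_between in Ht2.
  assert (Hut : 0 < Re (u + RtoC t)%C) by (rewrite Re_plus, Re_RtoC; fold sg; lra).
  assert (HI := is_I_plus _ _ _ _ (is_I_plus _ _ _ _ (is_I_mu _ Hut) (is_I_scal (- (1)) _ _ (is_I_mu u Hu)))
    (is_I_scal (- RtoC t) _ _ (is_I_mu1 u Hu))).
  replace (mu (u + RtoC t) - mu u - RtoC t * mu1 u)%C with
    (mu (u + RtoC t) + - (1) * mu u + - RtoC t * mu1 u)%C by ring.
  replace (PI / 2 * (4 / sg) ^ 2 / (sg / 4) * t ^ 2) with (PI / 2 * (4 / sg) ^ 2 * t ^ 2 / (sg / 4)) by (field; lra).
  assert (Hsg4 : 0 < sg / 4) by lra.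
  apply (is_I_dominated_bound _ (PI / 2 * (4 / sg) ^ 2 * t ^ 2) (sg / 4) _ Hsg4) with (2 := HI).
  split; [apply HI|]. intros w Hw. unfold gmu, gmu1.
  assert (E : (u + RtoC t - 1)%C = ((u - 1) + RtoC t)%C) by ring.
  rewrite E, Rcpow_plus, Rcpow_RtoC.
  replace (Rcpow w (u - 1) * RtoC (Rpower w t) * RtoC (Hint w) + - (1) * (Rcpow w (u - 1) * RtoC (Hint w)) +
    - RtoC t * (Rcpow w (u - 1) * RtoC (ln w * Hint w)))%C with
    (Rcpow w (u - 1) * RtoC (Hint w * (Rpower w t - 1 - t * ln w)))%C.
  2:{ rewrite !RtoC_mult, !RtoC_minus, RtoC_mult. ring. }
  rewrite Cmod_mult, Cmod_Rcpow, Cmod_R, Re_minus_1, Rabs_mult. fold sg.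
  assert (H1 := Rabs_Hint w Hw). assert (H2 := Rabs_ln_le w (sg / 4) Hw ltac:(lra)).
  assert (H3 := exp_taylor_error (t * ln w)). fold (Rpower w t) in H3.
  assert (Hl : ln w <= 0).
  { rewrite <- ln_1. destruct (proj2 Hw) as [H|H]; [left; now apply ln_increasing|rewrite H; lra]. }
  set (P := Rpower w (- (sg / 4))) in *. assert (HP : 0 < P) by apply Rpower_pos.
  assert (H4 : exp (Rabs (t * ln w)) <= P).
  { unfold P, Rpower. rewrite Rabs_mult, (Rabs_left1 (ln w)) by exact Hl.
    assert (H : Rabs t * - ln w <= - (sg / 4) * ln w) by nra.
    destruct H as [H|H]; [left; now apply exp_increasing|rewrite H; lra]. }
  assert (H5 : (t * ln w) ^ 2 <= t ^ 2 * ((4 / sg) ^ 2 * (P * P))).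
  { rewrite Rpow_mult_distr. apply Rmult_le_compat_l; [apply pow2_ge_0|].
    rewrite <- (pow2_abs (ln w)).
    replace ((4 / sg) ^ 2 * (P * P)) with ((/ (sg / 4) * P) ^ 2) by (field; lra).
    apply pow_incr. split; [apply Rabs_pos|exact H2]. }
  assert (H6 : Rpower w (sg / 4 - 1) = Rpower w (sg - 1) * (P * (P * P))).
  { unfold P. rewrite <- !Rpower_plus. f_equal. field. }
  rewrite H6. assert (H7 := Rpower_pos w (sg - 1)).
  replace (PI / 2 * (4 / sg) ^ 2 * t ^ 2 * (Rpower w (sg - 1) * (P * (P * P)))) with
    (Rpower w (sg - 1) * (PI / 2 * (P * (t ^ 2 * ((4 / sg) ^ 2 * (P * P)))))) by ring.
  apply Rmult_le_compat_l; [lra|]. apply Rmult_le_compat; try apply Rabs_pos; [exact H1|].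
  eapply Rle_trans; [exact H3|]. apply Rmult_le_compat; [left; apply exp_pos|apply pow2_ge_0|exact H4|exact H5].
Qed.

Lemma is_Cderive_mu u x : 0 < Re (u + RtoC x)%C ->
  is_Cderive (fun t => mu (u + RtoC t)) x (mu1 (u + RtoC x)).
Proof.
  intros Hu. apply is_Cderive_ext with (fun t => mu ((u + RtoC x) + RtoC (t - x))).
  { intros t. f_equal. rewrite RtoC_minus. ring. }
  eapply is_Cderive_eq.
  - apply (is_Cderive_comp (fun t => mu ((u + RtoC x) + RtoC t)) (fun t => t - x)).
    + rewrite Rminus_diag. now apply is_Cderive_mu_0.
    + auto_derive; [exact I|]. reflexivity.
  - apply Cmult_1_l.
Qed.

(** The boundary form F = (1 - w) (w^u H' - u w^(u - 1) H) has derivative (u^2 - 1/4) w^(u - 1) H -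
    u (u - 1) w^(u - 2) H by the self-adjoint equation. It vanishes at 1 through its factor 1 - w,
    and at 0 because Re u > 1. *)
Lemma mu_rec u : 1 < Re u -> ((u * u - 1 / 4) * mu u = u * (u - 1) * mu (u - 1))%C.
Proof.
  intros Hu. set (sg := Re u) in *.
  assert (Hu1 : 0 < Re (u - 1)%C) by (rewrite Re_minus_1; fold sg; lra).
  assert (HI := is_I_plus _ _ _ _ (is_I_scal (u * u - 1 / 4)%C _ _ (is_I_mu u ltac:(fold sg; lra)))
    (is_I_scal (- (u * (u - 1)))%C _ _ (is_I_mu (u - 1)%C Hu1))).
  set (F := fun w => (Rcpow w u * RtoC ((1 - w) * Hint1 w) +
    - u * (Rcpow w (u - 1) * RtoC ((1 - w) * Hint w)))%C).
  assert (HF : is_I (fun x => (u * u - 1 / 4) * gmu u x + - (u * (u - 1)) * gmu (u - 1) x)%C (F 1)).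
  { apply (is_I_derive F _ (/ 2 + Cmod u * (PI / 2)) (sg - 1)); [lra| |apply HI|].
    - intros w Hw. unfold F. eapply is_Cderive_eq.
      + apply is_Cderive_plus.
        * apply is_Cderive_mult; [now apply is_Cderive_Rcpow|].
          apply is_Cderive_RtoC. now apply is_derive_Hint1_weighted.
        * apply is_Cderive_mult; [apply is_Cderive_const|].
          apply is_Cderive_mult; [now apply is_Cderive_Rcpow|].
          apply (is_Cderive_RtoC (fun w => (1 - w) * Hint w) w ((0 - 1) * Hint w + (1 - w) * Hint1 w)).
          apply @is_derive_mult; [| |intros; apply Rmult_comm].
          -- apply @is_derive_minus;
               [exact (is_derive_const (K := R_AbsRing) (V := R_NormedModule) 1 w)|exact (is_derive_id w)].
          -- now apply is_derive_Hint.
      + cbv beta. unfold gmu. set (P := Rcpow w (u - 1 - 1)).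
        assert (E1 : Rcpow w (u - 1) = (P * RtoC w)%C).
        { unfold P. rewrite <- (Rcpow_1 w Hw), <- Rcpow_plus. f_equal. ring. }
        assert (E2 : Rcpow w u = (P * RtoC w * RtoC w)%C).
        { rewrite <- E1, <- (Rcpow_1 w Hw), <- Rcpow_plus. f_equal. ring. }
        rewrite E1, E2. unfold Rdiv. rewrite !RtoC_mult, !RtoC_plus, !RtoC_mult, !RtoC_minus, RtoC_opp, RtoC_inv by lra.
        rewrite RtoC_mult. field. apply RtoC_neq_0. lra.
    - intros w Hw. unfold F. eapply Rle_trans; [apply Cmod_triangle|].
      rewrite !Cmod_mult, !Cmod_Rcpow, !Cmod_R, Cmod_opp, Re_minus_1, !Rabs_mult. fold sg.
      rewrite (Rabs_pos_eq (1 - w)) by lra.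
      assert (H1 := Rabs_Hint w Hw). destruct (Hint1_bounds w ltac:(lra)) as (H2 & H3).
      rewrite (Rabs_pos_eq (Hint1 w)) by lra.
      assert (H4 := Rpower_pos w (sg - 1)). assert (Hc := Cmod_ge_0 u).
      assert (E : Rpower w sg = Rpower w (sg - 1) * w).
      { rewrite <- (Rpower_1 w) at 3 by lra. rewrite <- Rpower_plus. f_equal. ring. }
      rewrite E. assert (Hs := sqrt_lt_R0 w ltac:(lra)). assert (Hs2 := sqrt_sqrt w ltac:(lra)).
      assert (Hs1 : sqrt w <= 1). { rewrite <- sqrt_1. apply sqrt_le_1_alt. lra. }
      assert (H5 : w * ((1 - w) * Hint1 w) <= / 2).
      { apply Rle_trans with (w * (1 * / (2 * sqrt w))).
        - apply Rmult_le_compat_l; [lra|]. apply Rmult_le_compat; lra.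
        - rewrite <- Hs2 at 1. replace (sqrt w * sqrt w * (1 * / (2 * sqrt w))) with (sqrt w / 2) by (field; lra). lra. }
      assert (H6 : (1 - w) * Rabs (Hint w) <= PI / 2).
      { assert (Ha := Rabs_pos (Hint w)). nra. }
      rewrite Rmult_plus_distr_r. apply Rplus_le_compat.
      + rewrite Rmult_assoc, Rmult_comm. rewrite (Rmult_comm (/ 2)). rewrite Rmult_comm.
        apply Rmult_le_compat_l; lra.
      + replace (Cmod u * (PI / 2) * Rpower w (sg - 1)) with (Cmod u * (Rpower w (sg - 1) * (PI / 2))) by ring.
        apply Rmult_le_compat_l; [lra|]. apply Rmult_le_compat_l; lra. }
  assert (E := is_I_unique _ _ _ HI HF).
  assert (EF : F 1 = 0%C).
  { unfold F. replace (1 - 1) with 0 by ring. rewrite !Rmult_0_l. ring. }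
  rewrite EF in E.
  replace ((u * u - 1 / 4) * mu u)%C with (((u * u - 1 / 4) * mu u + - (u * (u - 1)) * mu (u - 1)) + u * (u - 1) * mu (u - 1))%C by ring.
  rewrite E. ring.
Qed.

Lemma is_I_Rcpow u : 0 < Re u -> is_I (fun w => Rcpow w (u - 1)) (/ u)%C.
Proof.
  intros Hu. assert (Hu0 : u <> 0%C). { intros ->. simpl in Hu. lra. }
  set (F := fun w => (/ u * Rcpow w u)%C).
  replace (/ u)%C with (F 1) by (unfold F; rewrite Rcpow_base_1; ring).
  apply (is_I_derive F _ (/ Cmod u) (Re u) Hu).
  - intros w Hw. eapply is_Cderive_eq.
    + apply is_Cderive_mult; [apply is_Cderive_const|now apply is_Cderive_Rcpow].
    + cbv beta. field. exact Hu0.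
  - apply Ccont_Rcpow.
  - intros w Hw. unfold F. rewrite Cmod_mult, Cmod_Rcpow, Cmod_inv by exact Hu0. lra.
Qed.

(** For large u the weight w^(u - 1) concentrates at w = 1, where H = pi/2. The error follows from 0
    <= pi/2 - H <= (pi/2) (1 - w) and the integral of w^(sg - 1) (1 - w), which is 1 / (sg (sg +
    1)). *)
Lemma mu_large u : 0 < Re u -> Cmod (u * mu u - RtoC (PI / 2)) <= PI / 2 * Cmod u / (Re u * (Re u + 1)).
Proof.
  intros Hu. assert (Hu0 : u <> 0%C). { intros ->. simpl in Hu. lra. }
  set (sg := Re u) in *.
  assert (HI := is_I_plus _ _ _ _ (is_I_mu u Hu) (is_I_scal (- RtoC (PI / 2)) _ _ (is_I_Rcpow u Hu))).
  assert (Hp : forall a, 0 < a -> is_I (fun w => Rcpow w (RtoC a - 1)) (RtoC (/ a))).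
  { intros a Ha. rewrite RtoC_inv by lra. apply is_I_Rcpow. exact Ha. }
  assert (HB := is_I_plus _ _ _ _ (is_I_scal (RtoC (PI / 2)) _ _ (Hp sg Hu))
    (is_I_scal (- RtoC (PI / 2)) _ _ (Hp (sg + 1) ltac:(lra)))).
  assert (HB' : is_I (fun w => RtoC (PI / 2 * (Rpower w (sg - 1) * (1 - w)))) (RtoC (PI / 2 / (sg * (sg + 1))))).
  { replace (RtoC (PI / 2 / (sg * (sg + 1)))) with
      (RtoC (PI / 2) * RtoC (/ sg) + - RtoC (PI / 2) * RtoC (/ (sg + 1)))%C.
    2:{ rewrite <- RtoC_opp, <- !RtoC_mult, <- RtoC_plus. f_equal. field. lra. }
    apply is_I_ext with (3 := HB).
    - intros w Hw. apply Ccont_RtoC. apply @ex_derive_continuous. unfold Rpower. auto_derive. exact Hw.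
    - intros w Hw. replace (RtoC (sg + 1) - 1)%C with ((RtoC sg - 1) + 1)%C by (rewrite RtoC_plus; ring).
      rewrite Rcpow_plus, Rcpow_1 by lra. replace (RtoC sg - 1)%C with (RtoC (sg - 1)) by apply RtoC_minus.
      rewrite Rcpow_RtoC. rewrite !RtoC_mult, RtoC_minus. ring. }
  assert (H : Cmod (mu u + - RtoC (PI / 2) * / u) <= PI / 2 / (sg * (sg + 1))).
  { apply (is_I_le _ _ _ _ HI HB'). intros w Hw. unfold gmu.
    replace (Rcpow w (u - 1) * RtoC (Hint w) + - RtoC (PI / 2) * Rcpow w (u - 1))%C with
      (Rcpow w (u - 1) * RtoC (Hint w - PI / 2))%C by (rewrite RtoC_minus; ring).
    rewrite Cmod_mult, Cmod_Rcpow, Cmod_R, Re_minus_1. fold sg.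
    destruct (Hint_bounds w Hw) as ((_ & H2) & _ & H3). rewrite Rabs_left1 by lra.
    replace (PI / 2 * (Rpower w (sg - 1) * (1 - w))) with (Rpower w (sg - 1) * (PI / 2 * (1 - w))) by ring.
    apply Rmult_le_compat_l; [left; apply Rpower_pos|]. lra. }
  replace (u * mu u - RtoC (PI / 2))%C with (u * (mu u + - RtoC (PI / 2) * / u))%C by (field; exact Hu0).
  rewrite Cmod_mult. assert (Hc := Cmod_ge_0 u).
  replace (PI / 2 * Cmod u / (sg * (sg + 1))) with (Cmod u * (PI / 2 / (sg * (sg + 1)))) by (field; lra).
  now apply Rmult_le_compat_l.
Qed.

(** For small x the weight concentrates at w = 0, and 0 <= H - 1 <= sqrt w contributes at most the
    integral of w^(x - 1/2). *)
Lemma mu_near_0 x : 0 < x -> Cmod (RtoC x * mu (RtoC x) - 1) <= x / (x + / 2).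
Proof.
  intros Hx. assert (Hu : 0 < Re (RtoC x)) by exact Hx.
  assert (Hx0 : RtoC x <> 0%C) by (apply RtoC_neq_0; lra).
  assert (HI := is_I_plus _ _ _ _ (is_I_mu _ Hu) (is_I_scal (- (1)) _ _ (is_I_Rcpow _ Hu))).
  assert (H : Cmod (mu (RtoC x) + - (1) * / RtoC x) <= 1 / (x + / 2)).
  { assert (Hx2 : 0 < x + / 2) by lra.
    apply (is_I_dominated_bound _ 1 (x + / 2) _ Hx2) with (2 := HI). split; [apply HI|].
    intros w Hw. unfold gmu.
    replace (Rcpow w (RtoC x - 1) * RtoC (Hint w) + - (1) * Rcpow w (RtoC x - 1))%C with
      (Rcpow w (RtoC x - 1) * RtoC (Hint w - 1))%C by (rewrite RtoC_minus; ring).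
    rewrite Cmod_mult, Cmod_Rcpow, Cmod_R, Re_minus_1, Re_RtoC.
    destruct (Hint_bounds w Hw) as ((H1 & _) & H2 & _). rewrite Rabs_pos_eq by lra.
    replace (x + / 2 - 1) with ((x - 1) + / 2) by ring. rewrite Rpower_plus, Rpower_sqrt by lra.
    assert (H3 := Rpower_pos w (x - 1)). nra. }
  replace (RtoC x * mu (RtoC x) - 1)%C with (RtoC x * (mu (RtoC x) + - (1) * / RtoC x))%C by (field; exact Hx0).
  rewrite Cmod_mult, Cmod_R, Rabs_pos_eq by lra.
  replace (x / (x + / 2)) with (x * (1 / (x + / 2))) by (field; lra).
  apply Rmult_le_compat_l; lra.
Qed.

Lemma Imp_real (g : R -> C) : (forall w, Im (g w) = 0) -> Im (Imp g) = 0.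
Proof.
  intros H. unfold Imp, CLim_seq. simpl.
  rewrite (Lim_seq_ext _ (fun _ => 0)); [now rewrite Lim_seq_const|].
  intros n. unfold CI. simpl. rewrite (RInt_ext _ (fun _ => 0)) by (intros; apply H).
  rewrite RInt_const. unfold scal; simpl. unfold mult; simpl. ring.
Qed.

Lemma Im_Rcpow_real w x : Im (Rcpow w (RtoC x - 1)) = 0.
Proof. replace (RtoC x - 1)%C with (RtoC (x - 1)) by apply RtoC_minus. rewrite Rcpow_RtoC. reflexivity. Qed.

Lemma mu_real x : mu (RtoC x) = RtoC (Re (mu (RtoC x))).
Proof.
  apply C_ext; [reflexivity|]. apply Imp_real. intros w. unfold gmu.
  rewrite Im_mult, Im_Rcpow_real, Im_RtoC. ring.
Qed.

Lemma mu1_real x : mu1 (RtoC x) = RtoC (Re (mu1 (RtoC x))).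
Proof.
  apply C_ext; [reflexivity|]. apply Imp_real. intros w. unfold gmu1.
  rewrite Im_mult, Im_Rcpow_real, Im_RtoC. ring.
Qed.

Lemma mu_poch u n : 0 < Re u ->
  (mu u * (poch u n * poch (u + 1) n) = poch (u + 1 / 2) n * poch (u + 3 / 2) n * mu (u + RtoC (INR n)))%C.
Proof.
  intros Hu. induction n as [|n IH].
  - simpl. rewrite Cplus_0_r. ring.
  - cbn [poch].
    assert (Hn := pos_INR n).
    assert (H := mu_rec (u + RtoC (INR (S n)))%C ltac:(rewrite Re_plus, Re_RtoC, S_INR; lra)).
    rewrite S_INR in *. rewrite RtoC_plus in *. set (N := RtoC (INR n)) in *.
    replace (u + (N + 1) - 1)%C with (u + N)%C in H by ring.
    replace (mu u * (poch u n * (u + N) * (poch (u + 1) n * (u + 1 + N))))%C with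
      ((mu u * (poch u n * poch (u + 1) n)) * ((u + N) * (u + 1 + N)))%C by ring.
    rewrite IH.
    replace (poch (u + 1 / 2) n * poch (u + 3 / 2) n * mu (u + N) * ((u + N) * (u + 1 + N)))%C with
      (poch (u + 1 / 2) n * poch (u + 3 / 2) n * ((u + (N + 1)) * (u + N) * mu (u + N)))%C by ring.
    rewrite <- H. field.
Qed.

Lemma mu_shift_lim u : 0 < Re u -> is_Clim (fun n => RtoC (INR n) * mu (u + RtoC (INR (S n))))%C (RtoC (PI / 2)).
Proof.
  intros Hu.
  set (v := fun n => (u + RtoC (INR (S n)))%C).
  assert (Hv : forall n, Re (v n) = Re u + INR n + 1).
  { intros n. unfold v. rewrite Re_plus, Re_RtoC, S_INR. ring. }
  assert (Hn := pos_INR).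
  assert (Hinv : is_lim_seq (fun n => / (Re u + INR n + 1)) 0).
  { apply (is_lim_seq_inv _ p_infty); [|discriminate].
    apply is_lim_seq_ext with (fun n => INR n + (Re u + 1)); [intros n; ring|].
    apply (is_lim_seq_plus _ _ p_infty (Re u + 1) p_infty); [apply is_lim_seq_INR|apply is_lim_seq_const|reflexivity]. }
  apply is_Clim_abs with (fun n => PI / 2 * (Cmod u + 1) * / (Re u + INR n + 1) + (Cmod u + 1) * (PI / 2 * / (Re u + INR n + 1))).
  - intros n. assert (Hp : 0 < Re u + INR n + 1) by (specialize (Hn n); lra).
    assert (H1 := mu_large (v n) ltac:(rewrite Hv; exact Hp)).
    assert (H2 := mu_bound (v n) ltac:(rewrite Hv; exact Hp)). rewrite Hv in H1, H2.
    assert (HPI := PI_RGT_0). assert (Hc := Cmod_ge_0 u).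
    replace (RtoC (INR n) * mu (u + RtoC (INR (S n))) - RtoC (PI / 2))%C with
      ((v n * mu (v n) - RtoC (PI / 2)) + - ((u + 1) * mu (v n)))%C.
    2:{ unfold v. rewrite S_INR, RtoC_plus. ring. }
    eapply Rle_trans; [apply Cmod_triangle|]. apply Rplus_le_compat.
    + eapply Rle_trans; [exact H1|].
      assert (H3 : Cmod (v n) <= (Cmod u + 1) * (Re u + INR n + 1 + 1)).
      { unfold v. eapply Rle_trans; [apply Cmod_triangle|].
        rewrite Cmod_R, S_INR, Rabs_pos_eq by (specialize (Hn n); lra). specialize (Hn n). nra. }
      set (X := Re u + INR n + 1) in *.
      replace (PI / 2 * Cmod (v n) / (X * (X + 1))) with (PI / 2 * (Cmod (v n) * / (X + 1)) * / X) by (field; lra).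
      apply Rmult_le_compat_r; [left; now apply Rinv_0_lt_compat|]. apply Rmult_le_compat_l; [lra|].
      apply Rmult_le_reg_r with (X + 1); [lra|]. rewrite Rmult_assoc, Rinv_l by lra. lra.
    + rewrite Cmod_opp, Cmod_mult. apply Rmult_le_compat; try apply Cmod_ge_0; [|exact H2].
      eapply Rle_trans; [apply Cmod_triangle|]. rewrite Cmod_1. lra.
  - replace (Finite 0) with (Finite (PI / 2 * (Cmod u + 1) * 0 + (Cmod u + 1) * (PI / 2 * 0))) by (f_equal; ring).
    apply is_lim_seq_plus'; apply is_lim_seq_mult'; try apply is_lim_seq_const; [exact Hinv|].
    apply is_lim_seq_mult'; [apply is_lim_seq_const|exact Hinv].
Qed.

(** The recurrence iterated n + 1 times turns the Gauss products on one side into those on the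
    other. The powers n^(u + 1/2) n^(u + 3/2) exceed n^u n^(u + 1) by one factor n, which is
    absorbed by n mu(u + n + 1), of limit pi/2. *)
Lemma mu_RGamma u : 0 < Re u ->
  (mu u * (RGamma u * RGamma (u + 1)) = RtoC (PI / 2) * (RGamma (u + 1 / 2) * RGamma (u + 3 / 2)))%C.
Proof.
  intros Hu.
  apply (is_Clim_unique (fun n => mu u * (rgauss u n * rgauss (u + 1) n))%C).
  { apply is_Clim_mult; [apply is_Clim_const|apply is_Clim_mult; apply is_Clim_RGamma]. }
  apply is_Clim_ext_loc with (fun n => RtoC (INR n) * mu (u + RtoC (INR (S n))) *
    (rgauss (u + 1 / 2) n * rgauss (u + 3 / 2) n))%C.
  2:{ apply is_Clim_mult; [now apply mu_shift_lim|apply is_Clim_mult; apply is_Clim_RGamma]. }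
  exists 1%nat. intros n Hn. assert (Hn0 : 0 < INR n) by (apply lt_0_INR; lia).
  assert (H := mu_poch u (S n) Hu). unfold rgauss.
  set (X := Rcpow (INR n) (u + 1 / 2)).
  assert (E1 : (Rcpow (INR n) u * Rcpow (INR n) (u + 1) = X * X)%C).
  { unfold X. rewrite <- !Rcpow_plus. f_equal. field. }
  assert (E2 : Rcpow (INR n) (u + 3 / 2) = (X * RtoC (INR n))%C).
  { unfold X. rewrite <- (Rcpow_1 (INR n)) by exact Hn0. rewrite <- Rcpow_plus. f_equal. field. }
  assert (HX : X <> 0%C) by apply Cexp_neq_0.
  assert (HN : RtoC (INR n) <> 0%C) by (apply RtoC_neq_0; lra).
  assert (HF := INR_fact_neq_0_C n). set (Fn := RtoC (INR (fact n))) in *.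
  rewrite E2.
  transitivity (poch (u + 1 / 2) (S n) * poch (u + 3 / 2) (S n) * mu (u + RtoC (INR (S n))) / (Fn * Fn * (X * X)))%C.
  - field. auto.
  - rewrite <- H, <- E1. field. repeat split; try exact HF; apply Cexp_neq_0.
Qed.

Lemma mu_CGamma u : 0 < Re u ->
  (mu u = RtoC (PI / 2) * (CGamma u * CGamma (u + 1)) * / (CGamma (u + 1 / 2) * CGamma (u + 3 / 2)))%C.
Proof.
  intros Hu.
  assert (H1 : 0 < Re (u + 1)%C) by (rewrite Re_plus, Re_RtoC; lra).
  assert (H2 : 0 < Re (u + 1 / 2)%C) by (rewrite C_half, Re_plus, Re_RtoC; lra).
  assert (H3 : 0 < Re (u + 3 / 2)%C) by (rewrite C_three_half, Re_plus, Re_RtoC; lra).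
  rewrite !CGamma_RGamma by assumption. assert (H := mu_RGamma u Hu).
  apply RGamma_neq_0 in Hu. apply RGamma_neq_0 in H1. apply RGamma_neq_0 in H2. apply RGamma_neq_0 in H3.
  transitivity (mu u * (RGamma u * RGamma (u + 1)) * / (RGamma u * RGamma (u + 1)))%C; [field; auto|].
  rewrite H. field. auto.
Qed.

Lemma is_Clim_Cderive f l (x : nat -> R) : is_Cderive f 0 l -> is_lim_seq x 0 ->
  is_Clim (fun n => f (x n)) (f 0).
Proof.
  intros [A B] Hx.
  assert (C1 := ex_derive_continuous _ _ (ex_intro _ _ A)).
  assert (C2 := ex_derive_continuous _ _ (ex_intro _ _ B)).
  split.
  - exact (filterlim_comp _ _ _ _ _ _ _ _ Hx C1).
  - exact (filterlim_comp _ _ _ _ _ _ _ _ Hx C2).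
Qed.

(* Compares both sides of [mu_CGamma] as u -> 0, where u mu(u) -> 1. *)
Lemma CGamma_half_sq : (CGamma (1 / 2) * CGamma (1 / 2) = RtoC PI)%C.
Proof.
  set (x := fun n => / (INR n + 1)).
  assert (Hxp : forall n, 0 < x n). { intros n. unfold x. apply Rinv_0_lt_compat. assert (H := pos_INR n). lra. }
  assert (Hx : is_lim_seq x 0).
  { apply (is_lim_seq_inv _ p_infty); [|discriminate].
    apply (is_lim_seq_plus _ _ p_infty 1 p_infty); [apply is_lim_seq_INR|apply is_lim_seq_const|reflexivity]. }
  assert (Hg : forall z, 0 < Re z -> is_Clim (fun n => CGamma (z + RtoC (x n))) (CGamma z)).
  { intros z Hz. assert (H := is_Clim_Cderive _ _ x (is_Cderive_CGamma_0 z Hz) Hx).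
    cbv beta in H. rewrite Cplus_0_r in H. exact H. }
  assert (E3 : 0 < Re (3 / 2)%C) by (rewrite C_three_half, Re_RtoC; lra).
  assert (E2 : 0 < Re (1 / 2)%C) by (rewrite C_half, Re_RtoC; lra).
  assert (E1 : 0 < Re 1) by (simpl; lra).
  assert (HL : is_Clim (fun n => RtoC (x n) * mu (RtoC (x n)))%C 1%C).
  { apply is_Clim_abs with (fun n => x n * 2).
    - intros n. eapply Rle_trans; [apply mu_near_0, Hxp|]. specialize (Hxp n).
      unfold Rdiv. apply Rmult_le_compat_l; [lra|].
      replace 2 with (/ / 2) by field. apply Rinv_le_contravar; lra.
    - replace (Finite 0) with (Finite (0 * 2)) by (f_equal; ring).
      apply is_lim_seq_mult'; [exact Hx|apply is_lim_seq_const]. }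
  assert (HR : is_Clim (fun n => RtoC (PI / 2) * (CGamma (1 + RtoC (x n)) * CGamma (1 + RtoC (x n))) *
    / (CGamma (1 / 2 + RtoC (x n)) * CGamma (3 / 2 + RtoC (x n))))%C
    (RtoC (PI / 2) * (CGamma 1 * CGamma 1) * / (CGamma (1 / 2) * CGamma (3 / 2)))%C).
  { apply is_Clim_mult; [apply is_Clim_mult; [apply is_Clim_const|apply is_Clim_mult; now apply Hg]|].
    apply is_Clim_inv; [apply Cmult_neq_0; now apply CGamma_neq_0|]. apply is_Clim_mult; now apply Hg. }
  assert (E : RtoC 1 = (RtoC (PI / 2) * (CGamma 1 * CGamma 1) * / (CGamma (1 / 2) * CGamma (3 / 2)))%C).
  { apply (is_Clim_unique _ _ _ HL). apply is_Clim_ext with (2 := HR). intros n.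
    assert (Hu : 0 < Re (RtoC (x n))) by apply Hxp.
    rewrite mu_CGamma by exact Hu. rewrite (CGamma_succ (RtoC (x n)) Hu).
    rewrite (Cplus_comm 1), (Cplus_comm (1 / 2)), (Cplus_comm (3 / 2)), (CGamma_succ (RtoC (x n)) Hu).
    ring. }
  replace (3 / 2)%C with (1 / 2 + 1)%C in E by field.
  rewrite (CGamma_succ _ E2), CGamma_1 in E. assert (Hh := CGamma_neq_0 _ E2).
  set (g := CGamma (1 / 2)) in *.
  replace (g * g)%C with (RtoC 1 * (g * g))%C by ring. rewrite E.
  unfold Rdiv. rewrite RtoC_mult, RtoC_inv by lra. field. exact Hh.
Qed.

(** * The expansion at 0 of the elliptic integral *)

Lemma mu1_rec u : 1 < Re u ->
  (2 * u * mu u + (u * u - 1 / 4) * mu1 u = (2 * u - 1) * mu (u - 1) + u * (u - 1) * mu1 (u - 1))%C.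
Proof.
  intros Hu.
  assert (Hid : forall z : C, is_Cderive (fun t => z + RtoC t)%C 0 1%C).
  { intros z. eapply is_Cderive_eq; [apply is_Cderive_plus; [apply is_Cderive_const|apply is_Cderive_id]|ring]. }
  assert (Hm : forall z, 0 < Re z -> is_Cderive (fun t => mu (z + RtoC t)) 0 (mu1 z)) by (intros; now apply is_Cderive_mu_0).
  assert (H1 : is_Cderive (fun t => ((u + RtoC t) * (u + RtoC t) - 1 / 4) * mu (u + RtoC t))%C 0
     (2 * u * mu u + (u * u - 1 / 4) * mu1 u)%C).
  { eapply is_Cderive_eq.
    - apply is_Cderive_mult; [|apply Hm; lra].
      apply is_Cderive_minus; [apply is_Cderive_mult; apply Hid|apply is_Cderive_const].
    - cbv beta. rewrite Cplus_0_r. ring. }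
  assert (H2 : is_Cderive (fun t => (u + RtoC t) * (u - 1 + RtoC t) * mu (u - 1 + RtoC t))%C 0
     ((2 * u - 1) * mu (u - 1) + u * (u - 1) * mu1 (u - 1))%C).
  { eapply is_Cderive_eq.
    - apply is_Cderive_mult; [apply is_Cderive_mult; apply Hid|].
      apply Hm. rewrite Re_minus_1. lra.
    - cbv beta. rewrite !Cplus_0_r. ring. }
  apply (is_Cderive_unique _ _ _ _ H1). apply is_Cderive_ext_loc with (2 := H2).
  assert (Hd : 0 < Re u - 1) by lra. exists (mkposreal _ Hd). intros t Ht.
  assert (Ht' : Rabs t < Re u - 1).
  { assert (H : Rabs (minus t 0) < Re u - 1) by exact Ht. unfold minus, plus, opp in H; simpl in H.
    now rewrite Ropp_0, Rplus_0_r in H. }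
  assert (Hr := Rle_abs (- t)). rewrite Rabs_Ropp in Hr.
  rewrite mu_rec by (rewrite Re_plus, Re_RtoC; lra).
  replace (u + RtoC t - 1)%C with (u - 1 + RtoC t)%C by ring. reflexivity.
Qed.

(* Coefficients of the solution [sum (alp n + bet n * ln w) * w ^ n]; [alp 0] is what [alp_rec] requires. *)
Definition bet (n : nat) : R := match n with O => 0 | S _ => Re (mu (RtoC (INR n - / 2))) end.
Definition alp (n : nat) : R :=
  match n with O => - 4 * Re (mu (RtoC (/ 2))) | S _ => Re (mu1 (RtoC (INR n - / 2))) end.

(** This is [mu_rec] at u = n + 1/2, where u^2 - 1/4 = n (n + 1) and u (u - 1) = n^2 - 1/4. At n = 0
    both sides vanish, as [bet 0] is 0. *)
Lemma bet_rec n : INR n * (INR n + 1) * bet (S n) = (INR n ^ 2 - / 4) * bet n.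
Proof.
  destruct n as [|n]; [simpl; ring|].
  unfold bet. set (N := INR (S n)). rewrite (S_INR (S n)). fold N.
  assert (HN : 1 <= N) by (apply (le_INR 1); lia).
  replace (N + 1 - / 2) with (N + / 2) by field.
  assert (H := mu_rec (RtoC (N + / 2)) ltac:(rewrite Re_RtoC; lra)).
  replace (RtoC (N + / 2) - 1)%C with (RtoC (N - / 2)) in H by (rewrite <- RtoC_minus; f_equal; field).
  rewrite (mu_real (N + / 2)), (mu_real (N - / 2)) in H.
  replace (1 / 4)%C with (RtoC (/ 4)) in H by (rewrite RtoC_inv by lra; field).
  rewrite <- !RtoC_mult, <- RtoC_minus, <- RtoC_mult in H. apply (f_equal Re) in H. rewrite !Re_RtoC in H.
  replace (N * (N + 1)) with ((N + / 2) * (N + / 2) - / 4) by field. rewrite H. field.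
Qed.

Lemma alp_rec n : INR n * (INR n + 1) * alp (S n) + (2 * INR n + 1) * bet (S n) =
  (INR n ^ 2 - / 4) * alp n + 2 * INR n * bet n.
Proof.
  destruct n as [|n].
  - unfold alp, bet. simpl INR. replace (1 - / 2) with (/ 2) by field. field.
  - unfold alp, bet. set (N := INR (S n)). rewrite (S_INR (S n)). fold N.
    assert (HN : 1 <= N) by (apply (le_INR 1); lia).
    replace (N + 1 - / 2) with (N + / 2) by field.
    assert (H := mu1_rec (RtoC (N + / 2)) ltac:(rewrite Re_RtoC; lra)).
    replace (RtoC (N + / 2) - 1)%C with (RtoC (N - / 2)) in H by (rewrite <- RtoC_minus; f_equal; field).
    rewrite (mu_real (N + / 2)), (mu_real (N - / 2)), (mu1_real (N + / 2)), (mu1_real (N - / 2)) in H.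
    replace (1 / 4)%C with (RtoC (/ 4)) in H by (rewrite RtoC_inv by lra; field).
    rewrite <- ?RtoC_mult, <- ?RtoC_minus, <- ?RtoC_mult, <- ?RtoC_plus in H. apply (f_equal Re) in H. rewrite !Re_RtoC in H.
    replace (N * (N + 1)) with ((N + / 2) * (N + / 2) - / 4) by field.
    replace (2 * N + 1) with (2 * (N + / 2)) by field.
    rewrite Rplus_comm, H. field.
Qed.

Lemma half_index n : (0 < n)%nat -> INR n / 2 <= INR n - / 2.
Proof. intros Hn. assert (1 <= INR n) by (apply (le_INR 1); lia). lra. Qed.

Lemma bet_bound n : (0 < n)%nat -> Rabs (bet n) <= PI / INR n.
Proof.
  intros Hn. destruct n as [|n]; [lia|]. unfold bet. set (N := INR (S n)).
  assert (Hh := half_index (S n) Hn). fold N in Hh. assert (HN : 0 < N) by (apply lt_0_INR; lia).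
  eapply Rle_trans; [apply re_le_Cmod|].
  eapply Rle_trans; [apply mu_bound; rewrite Re_RtoC; lra|]. rewrite Re_RtoC.
  replace (PI / N) with (PI / 2 * / (N / 2)) by (field; lra). assert (H := PI_RGT_0).
  apply Rmult_le_compat_l; [lra|]. apply Rinv_le_contravar; lra.
Qed.

Lemma alp_bound n : (0 < n)%nat -> Rabs (alp n) <= 8 * PI / INR n ^ 2.
Proof.
  intros Hn. destruct n as [|n]; [lia|]. unfold alp. set (N := INR (S n)).
  assert (Hh := half_index (S n) Hn). fold N in Hh. assert (HN : 0 < N) by (apply lt_0_INR; lia).
  eapply Rle_trans; [apply re_le_Cmod|].
  eapply Rle_trans; [apply mu1_bound; rewrite Re_RtoC; lra|]. rewrite Re_RtoC.
  replace (8 * PI / N ^ 2) with (2 * PI * / (N / 2) ^ 2) by (field; lra). assert (H := PI_RGT_0).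
  apply Rmult_le_compat_l; [lra|]. apply Rinv_le_contravar; [apply pow_lt; lra|]. apply pow_incr. lra.
Qed.

Lemma CV_radius_ge_1 (a : nat -> R) M : (forall n, Rabs (a n) <= M) ->
  forall w, Rabs w < 1 -> Rbar_lt (Rabs w) (CV_radius a).
Proof.
  intros H w Hw. apply Rbar_lt_le_trans with 1; [exact Hw|].
  apply (proj1 (CV_radius_bounded a)). exists M. intros n. rewrite pow1, Rmult_1_r. apply H.
Qed.

Lemma bet_CV w : Rabs w < 1 -> Rbar_lt (Rabs w) (CV_radius bet).
Proof.
  apply (CV_radius_ge_1 bet PI). intros [|n].
  - unfold bet. rewrite Rabs_R0. assert (H := PI_RGT_0). lra.
  - eapply Rle_trans; [apply bet_bound; lia|]. assert (H := PI_RGT_0).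
    assert (HN : 1 <= INR (S n)) by (apply (le_INR 1); lia).
    apply Rmult_le_reg_r with (INR (S n)); [lra|]. unfold Rdiv. rewrite Rmult_assoc, Rinv_l by lra.
    apply Rmult_le_compat_l; lra.
Qed.

Lemma alp_CV w : Rabs w < 1 -> Rbar_lt (Rabs w) (CV_radius alp).
Proof.
  apply (CV_radius_ge_1 alp (8 * PI + Rabs (alp 0))). intros [|n].
  - assert (H := PI_RGT_0). lra.
  - eapply Rle_trans; [apply alp_bound; lia|]. assert (H := PI_RGT_0).
    assert (HN : 1 <= INR (S n)) by (apply (le_INR 1); lia).
    assert (HN2 : 1 <= INR (S n) ^ 2) by (rewrite <- (pow1 2); apply pow_incr; lra).
    assert (H1 : 8 * PI / INR (S n) ^ 2 <= 8 * PI).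
    { apply Rmult_le_reg_r with (INR (S n) ^ 2); [lra|]. unfold Rdiv. rewrite Rmult_assoc, Rinv_l by lra.
      apply Rmult_le_compat_l; lra. }
    assert (H2 := Rabs_pos (alp 0)). lra.
Qed.

Definition Apow (k : nat) (w : R) : R := PSeries (Nat.iter k PS_derive alp) w.
Definition Bpow (k : nat) (w : R) : R := PSeries (Nat.iter k PS_derive bet) w.
(** B(w) / w as a power series, possible because [bet 0] is 0; differentiating B(w) ln w produces
    this quotient. *)
Definition Bquot (w : R) : R := PSeries (PS_decr_1 bet) w.

Lemma CV_iter (a : nat -> R) k w : Rbar_lt (Rabs w) (CV_radius a) ->
  Rbar_lt (Rabs w) (CV_radius (Nat.iter k PS_derive a)).
Proof. intros H. induction k as [|k IH]; [exact H|]. simpl. now rewrite CV_radius_derive. Qed.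

Lemma is_derive_iter (a : nat -> R) k w : Rbar_lt (Rabs w) (CV_radius a) ->
  is_derive (PSeries (Nat.iter k PS_derive a)) w (PSeries (Nat.iter (S k) PS_derive a) w).
Proof. intros H. apply is_derive_PSeries. now apply CV_iter. Qed.

Lemma is_pseries_iter (a : nat -> R) k w : Rbar_lt (Rabs w) (CV_radius a) ->
  is_pseries (Nat.iter k PS_derive a) w (PSeries (Nat.iter k PS_derive a) w).
Proof. intros H. apply PSeries_correct. apply CV_radius_inside. now apply CV_iter. Qed.

Lemma is_pseries_zero (a : nat -> R) w l : (forall n, a n = 0) -> is_pseries a w l -> l = 0.
Proof.
  intros H Hl. rewrite <- (is_pseries_unique _ _ _ Hl).
  rewrite (PSeries_ext a (fun _ => 0)) by exact H. apply PSeries_const_0.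
Qed.

Lemma Bpow_quot w : Rabs w < 1 -> Bpow 0 w = w * Bquot w.
Proof.
  intros Hw. unfold Bpow, Bquot. simpl.
  rewrite (PSeries_decr_1 bet w (CV_radius_inside _ _ (bet_CV w Hw))). simpl (bet 0). ring.
Qed.

Lemma pseries_ops (a : nat -> R) w l : is_pseries a w l -> forall c, is_pseries (PS_scal c a) w (c * l).
Proof. intros H c. apply (is_pseries_scal (V := R_NormedModule) c a w l); [apply Rmult_comm|exact H]. Qed.

(** The operator w (1 - w) y'' - w y' + y / 4, that is w times the equation of H, acts on a power
    series by the two-term recurrence satisfied by [bet]. *)
Lemma pseries_ode (a : nat -> R) w : Rbar_lt (Rabs w) (CV_radius a) ->
  is_pseries (fun n => INR n * (INR n + 1) * a (S n) - (INR n ^ 2 - / 4) * a n) w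
    (w * (1 - w) * PSeries (Nat.iter 2 PS_derive a) w - w * PSeries (Nat.iter 1 PS_derive a) w + PSeries a w / 4).
Proof.
  intros Hc.
  assert (H0 := is_pseries_iter a 0 w Hc). assert (H1 := is_pseries_iter a 1 w Hc).
  assert (H2 := is_pseries_iter a 2 w Hc).
  set (P0 := PSeries (Nat.iter 0 PS_derive a) w) in H0. set (P1 := PSeries (Nat.iter 1 PS_derive a) w) in *.
  set (P2 := PSeries (Nat.iter 2 PS_derive a) w) in *.
  assert (X2 := is_pseries_incr_1 (V := R_NormedModule) _ _ _ H2).
  assert (X22 := is_pseries_incr_1 (V := R_NormedModule) _ _ _ X2).
  assert (X1 := is_pseries_incr_1 (V := R_NormedModule) _ _ _ H1).
  assert (HS := is_pseries_plus _ _ _ _ _ (is_pseries_plus _ _ _ _ _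
    (is_pseries_plus _ _ _ _ _ X2 (pseries_ops _ _ _ X22 (-1))) (pseries_ops _ _ _ X1 (-1)))
    (pseries_ops _ _ _ H0 (/ 4))).
  match type of HS with is_pseries _ _ ?x =>
    replace (w * (1 - w) * P2 - w * P1 + PSeries a w / 4) with x end.
  - eapply is_pseries_ext; [|exact HS].
    intros n. unfold PS_plus, PS_scal, PS_incr_1, plus, scal, zero; simpl. unfold mult; simpl.
    unfold PS_derive. destruct n as [|[|n]].
    + simpl. eqR. field.
    + simpl. eqR. field.
    + rewrite !S_INR. eqR. field.
  - change (PSeries a w) with P0.
    change (w * P2 + -1 * (w * (w * P2)) + -1 * (w * P1) + / 4 * P0 = w * (1 - w) * P2 - w * P1 + P0 / 4). field.
Qed.

Lemma Bpow_ode w : Rabs w < 1 -> w * (1 - w) * Bpow 2 w - w * Bpow 1 w + Bpow 0 w / 4 = 0.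
Proof.
  intros Hw. apply (is_pseries_zero _ w _) with (2 := pseries_ode bet w (bet_CV w Hw)).
  intros n. rewrite bet_rec. ring.
Qed.

(** The terms in B are what the operator produces on B ln w besides ln w times its value on B: w (1
    - w) (2 B' / w - B / w^2) - B. *)
Lemma Apow_ode w : Rabs w < 1 ->
  w * (1 - w) * Apow 2 w - w * Apow 1 w + Apow 0 w / 4 + (1 - w) * (2 * Bpow 1 w - Bquot w) - Bpow 0 w = 0.
Proof.
  intros Hw. assert (Hc := bet_CV w Hw).
  assert (HA := pseries_ode alp w (alp_CV w Hw)).
  assert (H0 := is_pseries_iter bet 0 w Hc). assert (H1 := is_pseries_iter bet 1 w Hc).
  fold (Bpow 0 w) in H0. fold (Bpow 1 w) in H1.
  assert (HQ : is_pseries (PS_decr_1 bet) w (Bquot w)).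
  { apply PSeries_correct. apply ex_pseries_decr_1.
    + destruct (Req_dec w 0) as [Hw0|Hw0]; [left; exact Hw0|].
      right. exists (/ w). now apply Rinv_l.
    + apply CV_radius_inside. exact Hc. }
  assert (X1 := is_pseries_incr_1 (V := R_NormedModule) _ _ _ H1).
  assert (XQ := is_pseries_incr_1 (V := R_NormedModule) _ _ _ HQ).
  assert (HS := is_pseries_plus _ _ _ _ _ (is_pseries_plus _ _ _ _ _ (is_pseries_plus _ _ _ _ _
    (is_pseries_plus _ _ _ _ _ (is_pseries_plus _ _ _ _ _ HA (pseries_ops _ _ _ H1 2)) (pseries_ops _ _ _ X1 (-2)))
    (pseries_ops _ _ _ HQ (-1))) XQ) (pseries_ops _ _ _ H0 (-1))).
  apply is_pseries_zero in HS.
  - fold (Apow 2 w) in HS. fold (Apow 1 w) in HS. change (PSeries alp w) with (Apow 0 w) in HS.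
    assert (HS' : w * (1 - w) * Apow 2 w - w * Apow 1 w + Apow 0 w / 4 + 2 * Bpow 1 w + -2 * (w * Bpow 1 w) +
      -1 * Bquot w + w * Bquot w + -1 * Bpow 0 w = 0) by exact HS. lra.
  - intros n. assert (H := alp_rec n). assert (Hb := eq_refl : bet 0 = 0). revert H Hb.
    generalize alp bet. intros a b H Hb.
    unfold PS_plus, PS_scal, PS_incr_1, PS_decr_1, plus, scal, zero; simpl.
    unfold mult; simpl. unfold PS_derive. destruct n as [|n].
    + simpl in H |- *. eqR. lra.
    + rewrite !(S_INR (S n)). eqR. lra.
Qed.

Definition Sser (w : R) : R := Apow 0 w + Bpow 0 w * ln w.
Definition Sser1 (w : R) : R := Apow 1 w + Bpow 1 w * ln w + Bquot w.

Lemma Rabs_lt_1 w : 0 < w < 1 -> Rabs w < 1.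
Proof. intros Hw. rewrite Rabs_pos_eq; lra. Qed.

Lemma is_derive_eq (f : R -> R) (x l m : R) : is_derive f x l -> l = m -> is_derive f x m.
Proof. intros H <-. exact H. Qed.

Lemma is_derive_ln w : 0 < w -> is_derive ln w (/ w).
Proof. intros Hw. auto_derive; [exact Hw|]. ring. Qed.

Lemma is_derive_Rmult (f g : R -> R) (x l m : R) : is_derive f x l -> is_derive g x m ->
  is_derive (fun t => f t * g t) x (l * g x + f x * m).
Proof. intros Hf Hg. apply @is_derive_mult; auto. intros; apply Rmult_comm. Qed.

Lemma is_derive_Rplus (f g : R -> R) (x l m : R) : is_derive f x l -> is_derive g x m ->
  is_derive (fun t => f t + g t) x (l + m).
Proof. intros Hf Hg. now apply @is_derive_plus. Qed.

Lemma is_derive_Rminus (f g : R -> R) (x l m : R) : is_derive f x l -> is_derive g x m ->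
  is_derive (fun t => f t - g t) x (l - m).
Proof. intros Hf Hg. now apply @is_derive_minus. Qed.

Lemma is_derive_Sser w : 0 < w < 1 -> is_derive Sser w (Sser1 w).
Proof.
  intros Hw. assert (Hr := Rabs_lt_1 w Hw). eapply is_derive_eq.
  - apply is_derive_Rplus; [apply (is_derive_iter alp 0 w (alp_CV w Hr))|].
    apply is_derive_Rmult; [apply (is_derive_iter bet 0 w (bet_CV w Hr))|apply is_derive_ln; lra].
  - fold (Apow 1 w). fold (Bpow 1 w). change (PSeries (Nat.iter 0 PS_derive bet) w) with (Bpow 0 w).
    rewrite Bpow_quot by exact Hr. unfold Sser1. field. lra.
Qed.

Lemma is_derive_Bquot w : 0 < w < 1 -> is_derive Bquot w ((Bpow 1 w - Bquot w) / w).
Proof.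
  intros Hw. assert (Hr := Rabs_lt_1 w Hw).
  apply is_derive_ext_loc with (fun x => Bpow 0 x * / x).
  - assert (Hd : 0 < Rmin w (1 - w)) by (apply Rmin_pos; lra).
    exists (mkposreal _ Hd). intros x Hx.
    assert (H : Rabs (minus x w) < Rmin w (1 - w)) by exact Hx. unfold minus, plus, opp in H; simpl in H.
    assert (H1 := Rmin_l w (1 - w)). assert (H2 := Rmin_r w (1 - w)). apply Rabs_def2 in H.
    rewrite Bpow_quot by (apply Rabs_lt_1; lra). eqR. field. lra.
  - eapply is_derive_eq.
    + apply is_derive_Rmult; [apply (is_derive_iter bet 0 w (bet_CV w Hr))|].
      apply (is_derive_inv (fun x => x) w 1); [exact (is_derive_id w)|lra].
    + fold (Bpow 1 w). rewrite Bpow_quot by exact Hr. field. lra.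
Qed.

Lemma is_derive_Sser1_weighted w : 0 < w < 1 ->
  is_derive (fun w => (1 - w) * Sser1 w) w (- Sser w / (4 * w)).
Proof.
  intros Hw. assert (Hr := Rabs_lt_1 w Hw). eapply is_derive_eq.
  - apply is_derive_Rmult.
    + apply is_derive_Rminus; [exact (is_derive_const (K := R_AbsRing) (V := R_NormedModule) 1 w)|exact (is_derive_id w)].
    + apply is_derive_Rplus; [|apply is_derive_Bquot; exact Hw].
      apply is_derive_Rplus; [apply (is_derive_iter alp 1 w (alp_CV w Hr))|].
      apply is_derive_Rmult; [apply (is_derive_iter bet 1 w (bet_CV w Hr))|apply is_derive_ln; lra].
  - fold (Apow 2 w). fold (Bpow 2 w). fold (Bpow 1 w).
    assert (HA := Apow_ode w Hr). assert (HB := Bpow_ode w Hr). assert (HQ := Bpow_quot w Hr).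
    unfold Sser1, Sser. change (zero : R) with 0. change (one : R) with 1.
    apply Rmult_eq_reg_r with w; [|lra].
    replace (- (Apow 0 w + Bpow 0 w * ln w) / (4 * w) * w) with (- (Apow 0 w / 4) - Bpow 0 w / 4 * ln w) by (field; lra).
    replace (Apow 0 w / 4) with (- (w * (1 - w) * Apow 2 w - w * Apow 1 w + (1 - w) * (2 * Bpow 1 w - Bquot w) - Bpow 0 w)) by lra.
    replace (Bpow 0 w / 4) with (- (w * (1 - w) * Bpow 2 w - w * Bpow 1 w)) by lra.
    rewrite HQ. field. lra.
Qed.

(** * Convergence of the logarithmic expansion up to w = 1 *)

Lemma ex_series_inv_sq : ex_series (fun n => / INR (S n) ^ 2).
Proof.
  apply (ex_series_bounded _ 2).
  - intros n. apply Rlt_le, Rinv_0_lt_compat, pow_lt, lt_0_INR. lia.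
  - assert (H : forall n, sum_n (fun n => / INR (S n) ^ 2) n <= 2 - / INR (S n)).
    { induction n as [|n IH].
      - rewrite sum_O. simpl. lra.
      - rewrite sum_n_succ. rewrite (S_INR (S n)). assert (H0 : 1 <= INR (S n)) by (apply (le_INR 1); lia).
        set (N := INR (S n)) in *. assert (E : / (N + 1) ^ 2 <= / N - / (N + 1)).
        { replace (/ N - / (N + 1)) with (/ (N * (N + 1))) by (field; lra). apply Rinv_le_contravar; nra. }
        lra. }
    intros n. assert (H1 := H n). assert (H2 : 0 < / INR (S n)) by (apply Rinv_0_lt_compat, lt_0_INR; lia). lra.
Qed.

Definition Sbound (n : nat) : R := match n with O => Rabs (alp 0) | S _ => 10 * PI / INR n ^ 2 end.

Lemma ex_series_Sbound : ex_series Sbound.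
Proof.
  apply ex_series_incr_1. eapply ex_series_ext; [|exact (ex_series_scal (K := R_AbsRing) (10 * PI) _ ex_series_inv_sq)].
  intros n. reflexivity.
Qed.

Definition Sterm (n : nat) (w : R) : R := (alp n + bet n * ln w) * w ^ n.

(** [bet n] is only O(1 / n), but |ln w| <= w^(-(n - 1/2)) / (n - 1/2) gains a second factor 1 / n
    and turns w^n into sqrt w. The constant 10 pi is 8 pi from [alp] plus 2 pi from the logarithmic
    part. *)
Lemma Sterm_bound n w : 0 < w <= 1 -> (0 < n)%nat -> Rabs (Sterm n w) <= Sbound n * sqrt w.
Proof.
  intros Hw Hn. unfold Sterm. assert (Ha := alp_bound n Hn). assert (Hb := bet_bound n Hn).
  assert (Hh := half_index n Hn). assert (HN : 1 <= INR n) by (apply (le_INR 1); lia).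
  assert (Hpi := PI_RGT_0).
  assert (Hwn : 0 < w ^ n) by now apply pow_lt.
  assert (Hs : 0 < sqrt w) by now apply sqrt_lt_R0.
  assert (H1 : w ^ n <= sqrt w).
  { rewrite <- Rpower_pow by lra. rewrite <- Rpower_sqrt by lra. apply Rpower_le_1; [exact Hw|lra]. }
  assert (H2 : Rabs (ln w) * w ^ n <= 2 / INR n * sqrt w).
  { eapply Rle_trans; [apply Rmult_le_compat_r; [lra|apply (Rabs_ln_le w (INR n - / 2) Hw); lra]|].
    rewrite Rmult_assoc. rewrite <- (Rpower_pow n w) by lra. rewrite <- Rpower_plus.
    replace (- (INR n - / 2) + INR n) with (/ 2) by field. rewrite Rpower_sqrt by lra.
    apply Rmult_le_compat_r; [lra|]. replace (2 / INR n) with (/ (INR n / 2)) by (field; lra).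
    apply Rinv_le_contravar; lra. }
  rewrite Rabs_mult, (Rabs_pos_eq (w ^ n)) by lra.
  eapply Rle_trans; [apply Rmult_le_compat_r; [lra|apply Rabs_triang]|]. rewrite Rabs_mult, Rmult_plus_distr_r.
  assert (E1 : Rabs (alp n) * w ^ n <= 8 * PI / INR n ^ 2 * sqrt w).
  { apply Rmult_le_compat; auto; try lra. apply Rabs_pos. }
  assert (E2 : Rabs (bet n) * (Rabs (ln w) * w ^ n) <= PI / INR n * (2 / INR n * sqrt w)).
  { apply Rmult_le_compat; auto; [apply Rabs_pos|]. apply Rmult_le_pos; [apply Rabs_pos|lra]. }
  destruct n as [|n]; [lia|]. cbv beta iota delta [Sbound]. set (N := INR (S n)) in *.
  replace (10 * PI / N ^ 2 * sqrt w) with (8 * PI / N ^ 2 * sqrt w + PI / N * (2 / N * sqrt w)) by (field; lra).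
  lra.
Qed.

Lemma Sterm_0 w : Sterm 0 w = alp 0.
Proof. unfold Sterm. change (bet 0) with 0. change (w ^ 0) with 1. ring. Qed.

Lemma is_series_Sser w : 0 < w < 1 -> is_series (fun n => Sterm n w) (Sser w).
Proof.
  intros Hw. assert (Hr := Rabs_lt_1 w Hw).
  assert (HA := proj1 (is_pseries_R _ _ _) (is_pseries_iter alp 0 w (alp_CV w Hr))).
  assert (HB := proj1 (is_pseries_R _ _ _) (is_pseries_iter bet 0 w (bet_CV w Hr))).
  fold (Apow 0 w) in HA. fold (Bpow 0 w) in HB.
  assert (H := is_series_plus _ _ _ _ HA (is_series_scal (ln w) _ _ HB)).
  match type of H with is_series _ ?x => replace (Sser w) with x by exact (f_equal (Rplus (Apow 0 w)) (Rmult_comm _ _)) end.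
  eapply is_series_ext; [|exact H]. intros n. unfold Sterm. cbv beta.
  change (Nat.iter 0 PS_derive alp n) with (alp n). change (Nat.iter 0 PS_derive bet n) with (bet n).
  change (alp n * w ^ n + ln w * (bet n * w ^ n) = (alp n + bet n * ln w) * w ^ n). ring.
Qed.

Lemma Sser_near_0 : exists M, forall w, 0 < w < 1 -> Rabs (Sser w - alp 0) <= M * sqrt w.
Proof.
  assert (Hex := proj1 (ex_series_incr_1 Sbound) ex_series_Sbound). destruct Hex as [M HM].
  exists M. intros w Hw.
  assert (H := is_series_tail _ _ 0 (is_series_Sser w Hw)). rewrite sum_O, Sterm_0 in H.
  assert (H' : is_series (fun n => Sterm (S n) w) (Sser w - alp 0)) by exact H.
  assert (HM' := is_series_scal (sqrt w) _ _ HM).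
  assert (HM1 : is_series (fun n => Sbound (S n) * sqrt w) (M * sqrt w)).
  { rewrite (Rmult_comm M). eapply is_series_ext; [|exact HM']. intros n. apply Rmult_comm. }
  assert (B : forall n, Rabs (Sterm (S n) w) <= Sbound (S n) * sqrt w).
  { intros n. apply Sterm_bound; [lra|lia]. }
  apply Rabs_le. split.
  - assert (HM2 := is_series_opp _ _ HM1). eapply is_series_R_le; [|exact HM2|exact H']. intros n. apply (proj1 (Rabs_le_between _ _) (B n)).
  - eapply is_series_R_le; [|exact H'|exact HM1]. intros n. apply (proj1 (Rabs_le_between _ _) (B n)).
Qed.

Lemma alp_0 : alp 0 = - PI ^ 2.
Proof.
  unfold alp. assert (H := mu_CGamma (RtoC (/ 2)) ltac:(rewrite Re_RtoC; lra)).
  assert (E1 : (RtoC (/ 2) + 1 / 2)%C = RtoC 1).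
  { rewrite C_half, <- RtoC_plus. f_equal. field. }
  assert (E2 : (RtoC (/ 2) + 3 / 2)%C = (RtoC 1 + 1)%C).
  { rewrite C_three_half, <- !RtoC_plus. f_equal. field. }
  rewrite E1, E2 in H. rewrite !CGamma_succ in H by (rewrite Re_RtoC; lra). rewrite CGamma_1 in H.
  assert (G := CGamma_half_sq). rewrite C_half in G.
  replace (RtoC (PI / 2) * (CGamma (RtoC (/ 2)) * (RtoC (/ 2) * CGamma (RtoC (/ 2)))) * / (1 * (RtoC 1 * 1)))%C
    with (RtoC (PI / 2) * RtoC (/ 2) * (CGamma (RtoC (/ 2)) * CGamma (RtoC (/ 2))))%C in H.
  2: { field. }
  rewrite G in H. rewrite H, <- !RtoC_mult, Re_RtoC. field.
Qed.

(** * Identification of the elliptic integral with its expansion *)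

Lemma MVT_open (F f : R -> R) a b : 0 < a <= b -> b < 1 -> (forall w, 0 < w < 1 -> is_derive F w (f w)) ->
  exists c, 0 < c < 1 /\ F b - F a = f c * (b - a).
Proof.
  intros Hab Hb H. destruct (MVT_gen F a b f) as (c & Hc & E).
  - rewrite Rmin_left, Rmax_right by lra. intros x Hx. apply H. lra.
  - rewrite Rmin_left, Rmax_right by lra. intros x Hx. apply continuity_pt_filterlim.
    apply (ex_derive_continuous (V := R_NormedModule)). exists (f x). apply H. lra.
  - rewrite Rmin_left, Rmax_right in Hc by lra. exists c. split; [lra|exact E].
Qed.

(** If k were positive, F + k ln(1 - w) would be nondecreasing, so F would grow at least like - k
    ln(1 - w) near 1. *)
Lemma bounded_log_growth (F f : R -> R) K k : (forall w, 0 < w < 1 -> is_derive F w (f w)) ->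
  (forall w, 0 < w < 1 -> k / (1 - w) <= f w) -> (forall w, 0 < w < 1 -> Rabs (F w) <= K) -> k <= 0.
Proof.
  intros HF Hf HK. apply Rnot_lt_le. intros Hk.
  assert (HK0 : 0 <= K) by (eapply Rle_trans; [apply Rabs_pos|apply (HK (/ 2)); lra]).
  set (m := (2 * K + 1) / k). assert (Hm : 0 < m) by (apply Rdiv_lt_0_compat; lra).
  (* Between 1/2 and b the function k ln(1 - w) drops by k m = 2 K + 1, more than the range 2 K
     allowed to F. *)
  set (b := 1 - / 2 * exp (- m)).
  assert (He : 0 < exp (- m) < 1) by (split; [apply exp_pos|rewrite <- exp_0; apply exp_increasing; lra]).
  destruct (MVT_open (fun w => F w + k * ln (1 - w)) (fun w => f w - k / (1 - w)) (/ 2) b) as (c & Hc & E);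
    [unfold b; lra|unfold b; lra| |].
  - intros w Hw. eapply is_derive_eq.
    + apply is_derive_Rplus; [apply HF; exact Hw|].
      apply (is_derive_scal (fun w => ln (1 - w)) w k (- / (1 - w))). auto_derive; [lra|]. field. lra.
    + field. lra.
  - assert (H0 : 0 <= (f c - k / (1 - c)) * (b - / 2)).
    { apply Rmult_le_pos; [assert (H1 := Hf c Hc); lra|unfold b; lra]. }
    rewrite <- E in H0. replace (1 - b) with (/ 2 * exp (- m)) in H0 by (unfold b; ring).
    rewrite ln_mult, ln_exp in H0 by lra. replace (1 - / 2) with (/ 2) in H0 by field.
    assert (Em : k * m = 2 * K + 1) by (unfold m; field; lra).
    assert (B1 := Rabs_le_between' (F b) 0 K). assert (Kb := HK b ltac:(unfold b; lra)).
    assert (Ka := HK (/ 2) ltac:(lra)). apply Rabs_le_between in Kb. apply Rabs_le_between in Ka.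
    assert (k * (ln (/ 2) + - m) = k * ln (/ 2) - k * m) by ring. lra.
Qed.

Lemma derive_0_const (F : R -> R) a b : (forall w, 0 < w < 1 -> is_derive F w 0) -> 0 < a < 1 -> 0 < b < 1 ->
  F a = F b.
Proof.
  intros H Ha Hb. destruct (Rle_dec a b) as [Hab|Hab].
  - destruct (MVT_open F (fun _ => 0) a b) as (c & _ & E); [lra|lra|exact H|lra].
  - destruct (MVT_open F (fun _ => 0) b a) as (c & _ & E); [lra|lra|exact H|lra].
Qed.

Lemma sqrt_bound_0 (k M : R) : (forall w, 0 < w < 1 -> Rabs k <= M * sqrt w) -> k = 0.
Proof.
  intros H. destruct (Req_dec k 0) as [|Hk]; [assumption|exfalso].
  assert (Hk' := Rabs_pos_lt k Hk). assert (HM : 0 < M).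
  { assert (H1 := H (/ 2) ltac:(lra)). assert (H2 : 0 < sqrt (/ 2)) by (apply sqrt_lt_R0; lra). nra. }
  set (r := Rmin (/ 2) (Rabs k / (2 * M))).
  assert (Hr : 0 < r) by (apply Rmin_pos; [lra|apply Rdiv_lt_0_compat; lra]).
  assert (Hr1 : r <= / 2) by apply Rmin_l. assert (Hr2 : r <= Rabs k / (2 * M)) by apply Rmin_r.
  assert (H1 := H (r * r) ltac:(nra)). rewrite sqrt_square in H1 by lra.
  assert (M * r <= Rabs k / 2); [|lra].
  replace (Rabs k / 2) with (M * (Rabs k / (2 * M))) by (field; lra). apply Rmult_le_compat_l; lra.
Qed.

(* Both sides solve the same second order equation; the Wronskian is [C / (1 - w)], and [C <> 0] would force a
   logarithmic divergence at [w = 1], where both solutions are bounded. *)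
Lemma Hint_Sser w : 0 < w < 1 -> Hint w = Sser w / alp 0.
Proof.
  assert (Hpi := PI_RGT_0). assert (Hc0 : alp 0 <> 0) by (rewrite alp_0; nra).
  set (c0 := alp 0) in *. set (D := fun w => Hint w - Sser w / c0). set (D1 := fun w => Hint1 w - Sser1 w / c0).
  (* Both functions are 1 + O(sqrt w) at 0: H by its bounds, the series by division by its constant
     term [alp 0]. *)
  assert (HB : exists M, forall w, 0 < w < 1 -> Rabs (D w) <= M * sqrt w).
  { destruct Sser_near_0 as [M HM]. exists (1 + M / Rabs c0). intros x Hx. unfold D.
    replace (Hint x - Sser x / c0) with ((Hint x - 1) + - ((Sser x - c0) / c0)) by (field; exact Hc0).
    eapply Rle_trans; [apply Rabs_triang|]. rewrite Rabs_Ropp. unfold Rdiv at 1. rewrite Rabs_mult, Rabs_inv.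
    destruct (Hint_bounds x ltac:(lra)) as (H1 & H2 & _).
    rewrite Rmult_plus_distr_r, Rmult_1_l. apply Rplus_le_compat; [rewrite Rabs_pos_eq; lra|].
    unfold Rdiv. rewrite Rmult_assoc, (Rmult_comm (/ Rabs c0)), <- Rmult_assoc.
    apply Rmult_le_compat_r; [apply Rlt_le, Rinv_0_lt_compat, Rabs_pos_lt, Hc0|]. apply HM. exact Hx. }
  destruct HB as [M HM].
  assert (HM0 : 0 <= M).
  { assert (H1 := HM (/ 2) ltac:(lra)). assert (H2 : 0 < sqrt (/ 2)) by (apply sqrt_lt_R0; lra).
    assert (H3 := Rabs_pos (D (/ 2))). nra. }
  assert (dD : forall x, 0 < x < 1 -> is_derive D x (D1 x)).
  { intros x Hx. apply is_derive_Rminus; [apply is_derive_Hint; lra|].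
    eapply is_derive_eq; [apply is_derive_Rmult; [apply is_derive_Sser; exact Hx|apply (is_derive_const (V := R_NormedModule))]|].
    change (zero : R) with 0. unfold Rdiv. ring. }
  assert (dD1 : forall x, 0 < x < 1 -> is_derive (fun x => (1 - x) * D1 x) x (- D x / (4 * x))).
  { intros x Hx. apply is_derive_ext with (fun x => (1 - x) * Hint1 x - (1 - x) * Sser1 x * / c0).
    { intros t. unfold D1. eqR. field. exact Hc0. }
    eapply is_derive_eq.
    - apply is_derive_Rminus; [apply is_derive_Hint1_weighted; lra|].
      apply is_derive_Rmult; [apply is_derive_Sser1_weighted; exact Hx|apply (is_derive_const (V := R_NormedModule))].
    - change (zero : R) with 0. unfold D. field. split; [exact Hc0|lra]. }
  set (W := fun x => (1 - x) * D1 x * Hint x - (1 - x) * Hint1 x * D x).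
  assert (dW : forall x, 0 < x < 1 -> is_derive W x 0).
  { intros x Hx. eapply is_derive_eq.
    - apply is_derive_Rminus; apply is_derive_Rmult; [apply dD1; exact Hx|apply is_derive_Hint; lra|
        apply is_derive_Hint1_weighted; lra|apply dD; exact Hx].
    - cbv beta. field. lra. }
  set (C := W (/ 2)).
  assert (EW : forall x, 0 < x < 1 -> W x = C) by (intros x Hx; apply derive_0_const; auto; lra).
  (* Reduction of order: the derivative of D / H is the weighted Wronskian [W], constant by now,
     over (1 - w) H^2. *)
  set (G := fun x => D x * / Hint x).
  assert (HH : forall x, 0 < x < 1 -> 1 <= Hint x <= 2).
  { intros x Hx. destruct (Hint_bounds x ltac:(lra)) as (H1 & _). assert (H := PI_4). lra. }
  assert (dG : forall x, 0 < x < 1 -> is_derive G x (C / ((1 - x) * Hint x ^ 2))).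
  { intros x Hx. assert (Hh := HH x Hx). eapply is_derive_eq.
    - apply is_derive_Rmult; [apply dD; exact Hx|].
      apply (is_derive_inv Hint x (Hint1 x)); [apply is_derive_Hint; lra|lra].
    - rewrite <- (EW x Hx). unfold W. field. lra. }
  assert (GB : forall x, 0 < x < 1 -> Rabs (G x) <= M * sqrt x).
  { intros x Hx. unfold G. rewrite Rabs_mult, Rabs_inv. assert (Hh := HH x Hx). rewrite (Rabs_pos_eq (Hint x)) by lra.
    eapply Rle_trans; [|apply (HM x Hx)]. rewrite <- (Rmult_1_r (Rabs (D x))) at 2.
    apply Rmult_le_compat_l; [apply Rabs_pos|]. rewrite <- Rinv_1. apply Rinv_le_contravar; lra. }
  assert (HC : C = 0).
  (* The extra factor C makes the growth rate nonnegative whatever the sign of C, and H <= 2 gives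
     the constant 1/4. *)
  { assert (H := bounded_log_growth (fun x => C * G x) (fun x => C * (C / ((1 - x) * Hint x ^ 2)))
      (Rabs C * M) (C ^ 2 / 4)).
    assert (C ^ 2 / 4 <= 0); [apply H|nra].
    - intros x Hx. apply (is_derive_scal G x C). apply dG. exact Hx.
    - intros x Hx. assert (Hh := HH x Hx).
      replace (C * (C / ((1 - x) * Hint x ^ 2))) with (C ^ 2 / (1 - x) * / Hint x ^ 2) by (field; lra).
      replace (C ^ 2 / 4 / (1 - x)) with (C ^ 2 / (1 - x) * / 4) by (field; lra).
      apply Rmult_le_compat_l; [apply Rmult_le_pos; [apply pow2_ge_0|apply Rlt_le, Rinv_0_lt_compat; lra]|].
      apply Rinv_le_contravar; nra.
    - intros x Hx. rewrite Rabs_mult. apply Rmult_le_compat_l; [apply Rabs_pos|].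
      eapply Rle_trans; [apply GB; exact Hx|]. rewrite <- (Rmult_1_r M) at 2. apply Rmult_le_compat_l; [exact HM0|].
      rewrite <- sqrt_1. apply sqrt_le_1; lra. }
  intros Hw.
  (* With C = 0 the quotient is constant, and its bound by a multiple of sqrt w at 0 leaves only the
     constant 0. *)
  assert (HG : G w = 0).
  { apply (sqrt_bound_0 _ M). intros x Hx. rewrite (derive_0_const G w x); auto.
    intros y Hy. eapply is_derive_eq; [apply dG; exact Hy|]. rewrite HC. unfold Rdiv. ring. }
  assert (Hh := HH w Hw). assert (HD : D w = G w * Hint w) by (unfold G; field; lra).
  rewrite HG, Rmult_0_l in HD. unfold D in HD. lra.
Qed.

(** * The moments of the squared integral *)

(** For n >= 1 this is the derivative at t = n of mu(t - 1/2) mu(s + t). At n = 0 it is that of the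
    continuation: by the recurrence mu(t - 1/2) = t (t + 1) mu(t + 1/2) / (t^2 - 1/4), which
    vanishes at 0 with slope -4 mu(1/2). *)
Definition moment_term (s : C) (n : nat) : C :=
  (RtoC (alp n) * mu (s + RtoC (INR n)) + RtoC (bet n) * mu1 (s + RtoC (INR n)))%C.

Lemma Sterm_le_Sbound n w : 0 < w <= 1 -> Rabs (Sterm n w) <= Sbound n.
Proof.
  intros Hw. destruct n as [|n].
  - rewrite Sterm_0. apply Rle_refl.
  - eapply Rle_trans; [apply Sterm_bound; [exact Hw|lia]|].
    rewrite <- (Rmult_1_r (Sbound (S n))) at 2. apply Rmult_le_compat_l.
    + unfold Sbound. apply Rmult_le_pos; [assert (H := PI_RGT_0); lra|].
      apply Rlt_le, Rinv_0_lt_compat, pow_lt, lt_0_INR. lia.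
    + rewrite <- sqrt_1. apply sqrt_le_1; lra.
Qed.

Lemma Ccont_Hint_sq s : Ccont_pos (fun w => Rcpow w (s - 1) * RtoC (Hint w * Hint w))%C.
Proof.
  intros w Hw. apply Ccont_mult; [now apply Ccont_Rcpow|]. apply Ccont_RtoC.
  apply (continuous_mult (K := R_AbsRing)); now apply continuous_Hint.
Qed.

Lemma is_I_Hint_sq s : 0 < Re s -> is_Cseries (moment_term s) (CSeries (moment_term s)) /\
  is_I (fun w => Rcpow w (s - 1) * RtoC (Hint w * Hint w))%C (RtoC (/ alp 0) * CSeries (moment_term s))%C.
Proof.
  intros Hs. assert (Hpi := PI_RGT_0). assert (Hc0 : alp 0 <> 0) by (rewrite alp_0; nra).
  set (h := fun w => (Rcpow w (s - 1) * RtoC (Hint w * Hint w))%C).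
  assert (Hh : Ccont_pos h) by apply Ccont_Hint_sq.
  destruct ex_series_Sbound as [T HT].
  set (f := fun n w => (Rcpow w (s - 1) * RtoC (Hint w * Sterm n w))%C).
  assert (Hf : forall n, Ccont_pos (f n)).
  { intros n w Hw. apply Ccont_mult; [now apply Ccont_Rcpow|]. apply Ccont_RtoC.
    apply (continuous_mult (K := R_AbsRing)); [now apply continuous_Hint|].
    apply (ex_derive_continuous (V := R_NormedModule)). unfold Sterm. auto_derive. exact Hw. }
  destruct (is_I_series (fun w => RtoC (alp 0) * h w)%C f (fun n => PI / 2 * Sbound n) (moment_term s) (Re s) (PI / 2 * T))
    as [H1 H2].
  - exact Hs.
  - intros w Hw. apply Ccont_mult; [apply Ccont_const|now apply Hh].
  - intros n. split; [apply Hf|]. intros w Hw. unfold f.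
    rewrite Cmod_mult, Cmod_Rcpow, Cmod_R, Re_minus_1, Rmult_comm, Rabs_mult.
    apply Rmult_le_compat_r; [left; apply Rpower_pos|].
    apply Rmult_le_compat; try apply Rabs_pos; [now apply Rabs_Hint|now apply Sterm_le_Sbound].
  - exact (is_series_scal (V := R_NormedModule) (PI / 2) _ _ HT).
  - intros w Hw. unfold h. rewrite (Hint_Sser w Hw) at 2.
    replace (RtoC (alp 0) * (Rcpow w (s - 1) * RtoC (Hint w * (Sser w / alp 0))))%C with
      (Rcpow w (s - 1) * RtoC (Hint w) * RtoC (Sser w))%C.
    2: { unfold Rdiv. rewrite !RtoC_mult, RtoC_inv by exact Hc0. field. now apply RtoC_neq_0. }
    apply is_Cseries_ext with (fun n => Rcpow w (s - 1) * RtoC (Hint w) * RtoC (Sterm n w))%C.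
    { intros n. unfold f. rewrite RtoC_mult. ring. }
    apply is_Cseries_scal. split.
    + exact (is_series_Sser w Hw).
    + assert (Z := is_series_finite (fun _ => 0) 0 (fun _ _ => eq_refl)). rewrite sum_O in Z. exact Z.
  - intros n.
    assert (H := is_I_plus _ _ _ _ (is_I_scal (RtoC (alp n)) _ _ (is_I_mu (s + RtoC (INR n)) ltac:(rewrite Re_plus, Re_RtoC; assert (H := pos_INR n); lra)))
      (is_I_scal (RtoC (bet n)) _ _ (is_I_mu1 (s + RtoC (INR n)) ltac:(rewrite Re_plus, Re_RtoC; assert (H := pos_INR n); lra)))).
    refine (is_I_ext _ _ _ (Hf n) _ H). intros w Hw. cbv beta. unfold gmu, gmu1, f, Sterm.
    replace (s + RtoC (INR n) - 1)%C with (s - 1 + RtoC (INR n))%C by ring.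
    rewrite Rcpow_plus, Rcpow_RtoC, Rpower_pow, !RtoC_mult, RtoC_plus, RtoC_mult by lra. ring.
  - split; [exact H1|]. apply is_I_ext with (3 := is_I_scal (RtoC (/ alp 0)) _ _ H2); [exact Hh|].
    intros w Hw. rewrite RtoC_inv by exact Hc0. field. now apply RtoC_neq_0.
Qed.

(** * Comparison with the series for L *)

(** The shape in which [field] asks for the nonvanishing of z + 1/2 once denominators are
    cleared. *)
Lemma half_shift_neq_0 (z : C) : (z + 1 / 2)%C <> 0%C -> (z * 2 + 1)%C <> 0%C.
Proof.
  intros N E. apply N. replace (z + 1 / 2)%C with ((z * 2 + 1) / 2)%C by field. rewrite E. field.
Qed.

(** The Gamma formula for the two values of [mu] and the functional equation reduce both sides to
    the same Gamma values. Using mu(t + 1/2) instead of mu(t - 1/2) keeps the identity valid around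
    t = 0. *)
Lemma Phi_mu s (t : R) : - / 2 < t -> 0 < Re s + t ->
  (RtoC (PI / 2) * RtoC (PI / 2) * Phi s t * ((RtoC t + 1 / 2) * (s + RtoC t + 1 / 2)) =
   mu (RtoC (/ 2) + RtoC t) * mu (s + RtoC t) * ((RtoC t + 1) * (s + RtoC t + 1)))%C.
Proof.
  intros Ht Hst.
  assert (R1 : 0 < Re (1 / 2 + RtoC t)%C) by (rewrite C_half, Re_plus, !Re_RtoC; lra).
  assert (R2 : 0 < Re (s + RtoC t)%C) by (rewrite Re_plus, !Re_RtoC; lra).
  assert (R3 : 0 < Re (RtoC t + 1)%C) by (rewrite Re_plus, !Re_RtoC; lra).
  assert (R4 : 0 < Re (s + RtoC t + 1)%C) by (rewrite !Re_plus, !Re_RtoC; lra).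
  assert (R5 : 0 < Re (s + RtoC t + 1 / 2)%C) by (rewrite C_half, !Re_plus, !Re_RtoC; lra).
  rewrite <- C_half, (mu_CGamma (1 / 2 + RtoC t)), (mu_CGamma (s + RtoC t)) by assumption.
  unfold Phi.
  replace (1 / 2 + RtoC t + 1 / 2)%C with (RtoC t + 1)%C by field.
  replace (1 / 2 + RtoC t + 3 / 2)%C with (RtoC t + 1 + 1)%C by field.
  replace (s + RtoC t + 3 / 2)%C with (s + RtoC t + 1 / 2 + 1)%C by field.
  replace (s + 2 + RtoC t)%C with (s + RtoC t + 1 + 1)%C by ring.
  replace (s + 3 / 2 + RtoC t)%C with (s + RtoC t + 1 / 2 + 1)%C by field.
  replace (1 + RtoC t)%C with (RtoC t + 1)%C by ring.
  rewrite (CGamma_succ (1 / 2 + RtoC t)), (CGamma_succ (RtoC t + 1)), (CGamma_succ (s + RtoC t + 1)),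
    (CGamma_succ (s + RtoC t + 1 / 2)) by assumption.
  assert (G3 := CGamma_neq_0 _ R3). assert (G5 := CGamma_neq_0 _ R5).
  assert (Hnz : forall z, 0 < Re z -> z <> 0%C) by (intros z Hz E; rewrite E, Re_RtoC in Hz; lra).
  assert (N3 := Hnz _ R3). assert (N5 := Hnz _ R5).
  set (g := CGamma (1 / 2 + RtoC t)). set (G := CGamma (s + RtoC t)). set (G1 := CGamma (s + RtoC t + 1)).
  set (K := CGamma (s + RtoC t + 1 / 2)) in *. set (h := CGamma (RtoC t + 1)) in *.
  set (T := RtoC t) in *. set (p := RtoC (PI / 2)).
  assert (N5' := half_shift_neq_0 _ N5).
  clearbody g G G1 K h T p. field. repeat split; try assumption.
Qed.

Lemma Re_pos_neq_0 (z : C) : 0 < Re z -> z <> 0%C.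
Proof. intros Hz E. rewrite E, Re_RtoC in Hz. lra. Qed.

Definition tele (s : C) (t : R) : C :=
  (RtoC t * (s + RtoC t + 1 / 2) * (mu (RtoC (- / 2) + RtoC t) * mu (s + RtoC t)))%C.

Definition dtele (s : C) (t : R) : C :=
  ((s + 2 * RtoC t + 1 / 2) * (mu (RtoC (- / 2) + RtoC t) * mu (s + RtoC t)) +
   RtoC t * (s + RtoC t + 1 / 2) *
     (mu1 (RtoC (- / 2) + RtoC t) * mu (s + RtoC t) + mu (RtoC (- / 2) + RtoC t) * mu1 (s + RtoC t)))%C.

Lemma is_Cderive_tele s t : / 2 < t -> 0 < Re s -> is_Cderive (tele s) t (dtele s t).
Proof.
  intros Ht Hs. unfold tele. eapply is_Cderive_eq.
  - apply is_Cderive_mult.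
    + apply is_Cderive_mult; [apply is_Cderive_id|].
      apply is_Cderive_plus; [apply is_Cderive_plus; [apply is_Cderive_const|apply is_Cderive_id]|apply is_Cderive_const].
    + apply is_Cderive_mult; apply is_Cderive_mu; rewrite Re_plus, !Re_RtoC; lra.
  - unfold dtele. cbv beta. ring.
Qed.

Lemma is_Cderive_tele_succ s t : - / 2 < t -> 0 < Re s -> is_Cderive (fun t => tele s (t + 1)) t (dtele s (t + 1)).
Proof.
  intros Ht Hs. eapply is_Cderive_eq.
  - apply (is_Cderive_comp (tele s) (fun t => t + 1) t (dtele s (t + 1)) 1); [apply is_Cderive_tele; lra|].
    auto_derive; [exact I|]. ring.
  - ring.
Qed.

(** At u = s + t + 1 the factor u^2 - 1/4 is (s + t + 1/2) (s + t + 3/2). The second factor is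
    already in [tele] at t + 1, so multiplying by the first makes [mu_rec] applicable. *)
Lemma tele_succ s t : - / 2 < t -> 0 < Re s + t ->
  (tele s (t + 1) * (s + RtoC t + 1 / 2) =
   (RtoC t + 1) * (s + RtoC t) * (s + RtoC t + 1) * (mu (RtoC (/ 2) + RtoC t) * mu (s + RtoC t)))%C.
Proof.
  intros Ht Hst. assert (H := mu_rec (s + RtoC t + 1) ltac:(rewrite !Re_plus, !Re_RtoC; lra)).
  replace (s + RtoC t + 1 - 1)%C with (s + RtoC t)%C in H by ring.
  unfold tele. rewrite RtoC_plus.
  replace (RtoC (- / 2) + (RtoC t + RtoC 1))%C with (RtoC (/ 2) + RtoC t)%C.
  2: { replace (- / 2) with (/ 2 - 1) by field. rewrite RtoC_minus. ring. }
  replace (s + (RtoC t + RtoC 1))%C with (s + RtoC t + 1)%C by ring.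
  set (T := RtoC t) in *. set (M := mu (s + T)) in *. set (A := mu (s + T + 1)) in *.
  transitivity ((T + 1) * mu (RtoC (/ 2) + T) * (((s + T + 1) * (s + T + 1) - 1 / 4) * A))%C.
  - field.
  - rewrite H. ring.
Qed.

(** [Phi] at t and [tele] at t + 1 are both rational multiples of mu(t - 1/2) mu(s + t); after
    substitution an identity of rational functions in s and t remains. *)
Lemma tele_eq s t : / 2 < t -> 0 < Re s ->
  ((s + 1) * (mu (RtoC (- / 2) + RtoC t) * mu (s + RtoC t)) - s * (RtoC (PI / 2) * RtoC (PI / 2) * Phi s t) =
   2 * (tele s t - tele s (t + 1)))%C.
Proof.
  intros Ht Hs. assert (H1 := Phi_mu s t ltac:(lra) ltac:(lra)). assert (H2 := tele_succ s t ltac:(lra) ltac:(lra)).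
  assert (H3 := mu_rec (RtoC (/ 2) + RtoC t) ltac:(rewrite !Re_plus, !Re_RtoC; lra)).
  replace (RtoC (/ 2) + RtoC t - 1)%C with (RtoC (- / 2) + RtoC t)%C in H3.
  2: { replace (- / 2) with (/ 2 - 1) by field. rewrite RtoC_minus. ring. }
  assert (N1 : RtoC t <> 0%C) by (apply RtoC_neq_0; lra).
  assert (N2 : (RtoC t + 1)%C <> 0%C) by (rewrite <- RtoC_plus; apply RtoC_neq_0; lra).
  assert (N3 : (s + RtoC t + 1 / 2)%C <> 0%C) by (apply Re_pos_neq_0; rewrite C_half, !Re_plus, !Re_RtoC; lra).
  assert (N4 : (RtoC t + 1 / 2)%C <> 0%C) by (rewrite C_half, <- RtoC_plus; apply RtoC_neq_0; lra).
  rewrite <- C_half in H3. unfold tele at 1.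
  assert (E0 : RtoC (- / 2) = (- (1 / 2))%C) by (rewrite C_half; apply RtoC_opp).
  rewrite <- C_half in H1, H2. rewrite E0 in *.
  set (T := RtoC t) in *. set (M := mu (s + T)) in *. set (m := mu (- (1 / 2) + T)) in *.
  set (a := mu (1 / 2 + T)) in *. set (P := (RtoC (PI / 2) * RtoC (PI / 2) * Phi s t)%C) in *.
  set (Q := tele s (t + 1)) in *. clearbody T M m a P Q.
  assert (N3' := half_shift_neq_0 _ N3). assert (N4' := half_shift_neq_0 _ N4).
  assert (Ea : a = ((T + 1 / 2) * (T - 1 / 2) * m / (T * (T + 1)))%C).
  { transitivity (((1 / 2 + T) * (1 / 2 + T) - 1 / 4) * a / (T * (T + 1)))%C.
    - field. repeat split; assumption.
    - rewrite H3. field. repeat split; assumption. }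
  assert (EP : P = (a * M * ((T + 1) * (s + T + 1)) / ((T + 1 / 2) * (s + T + 1 / 2)))%C).
  { rewrite <- H1. field. repeat split; assumption. }
  assert (EQ : Q = ((T + 1) * (s + T) * (s + T + 1) * (a * M) / (s + T + 1 / 2))%C).
  { rewrite <- H2. field. repeat split; assumption. }
  rewrite EP, EQ, Ea. field. repeat split; assumption.
Qed.

(* [tele_eq] with [mu (t - 1/2)] eliminated by its recurrence, since it has a pole at [t = 0]. *)
Lemma tele_eq_0 s t : - / 2 < t -> 0 < Re s + t -> 0 < Re s ->
  ((s + 1) * (RtoC t * (RtoC t + 1) * (mu (RtoC (/ 2) + RtoC t) * mu (s + RtoC t))) -
   (RtoC t * RtoC t - 1 / 4) * (s * (RtoC (PI / 2) * RtoC (PI / 2) * Phi s t)) =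
   2 * (RtoC t * (RtoC t * ((RtoC t + 1) * (s + RtoC t + 1 / 2) * (mu (RtoC (/ 2) + RtoC t) * mu (s + RtoC t))))) -
   2 * ((RtoC t * RtoC t - 1 / 4) * tele s (t + 1)))%C.
Proof.
  intros Ht Hst Hs. assert (H1 := Phi_mu s t Ht Hst). assert (H2 := tele_succ s t Ht Hst).
  assert (N3 : (s + RtoC t + 1 / 2)%C <> 0%C) by (apply Re_pos_neq_0; rewrite C_half, !Re_plus, !Re_RtoC; lra).
  assert (N4 : (RtoC t + 1 / 2)%C <> 0%C) by (rewrite C_half, <- RtoC_plus; apply RtoC_neq_0; lra).
  set (T := RtoC t) in *. set (Y := (mu (RtoC (/ 2) + T) * mu (s + T))%C) in *.
  set (P := (RtoC (PI / 2) * RtoC (PI / 2) * Phi s t)%C) in *.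
  set (Q := tele s (t + 1)) in *. clearbody T Y P Q.
  assert (N3' := half_shift_neq_0 _ N3). assert (N4' := half_shift_neq_0 _ N4).
  assert (EP : P = (Y * ((T + 1) * (s + T + 1)) / ((T + 1 / 2) * (s + T + 1 / 2)))%C).
  { rewrite <- H1. field. repeat split; assumption. }
  assert (EQ : Q = ((T + 1) * (s + T) * (s + T + 1) * Y / (s + T + 1 / 2))%C).
  { rewrite <- H2. field. repeat split; assumption. }
  rewrite EP, EQ. field. repeat split; assumption.
Qed.

(** The value 0 at n = 0 is the derivative of the continuation of [tele]: its explicit factor t and
    the zero of mu(t - 1/2) give a double zero at t = 0. *)
Definition tele_deriv (s : C) (n : nat) : C := match n with O => RtoC 0 | S _ => dtele s (INR n) end.

Lemma moment_term_succ s n : moment_term s (S n) =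
  (mu1 (RtoC (- / 2) + RtoC (INR (S n))) * mu (s + RtoC (INR (S n))) +
   mu (RtoC (- / 2) + RtoC (INR (S n))) * mu1 (s + RtoC (INR (S n))))%C.
Proof.
  unfold moment_term, alp, bet. rewrite <- RtoC_plus, (Rplus_comm (- / 2)).
  rewrite (mu_real (INR (S n) + - / 2)), (mu1_real (INR (S n) + - / 2)). reflexivity.
Qed.

Lemma moment_term_0 s : moment_term s 0 = (- (4) * (mu (RtoC (/ 2)) * mu s))%C.
Proof.
  unfold moment_term, alp, bet. simpl INR. rewrite (mu_real (/ 2)) at 2. rewrite Cplus_0_r, RtoC_mult.
  replace (RtoC (-4)) with (- (4))%C by (rewrite <- RtoC_opp; f_equal; ring). ring.
Qed.

(** For n >= 1 this is [tele_eq] differentiated at n. At n = 0 it is [tele_eq_0] differentiated at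
    0, where the factor t^2 of its first right-hand term makes that term disappear. *)
Lemma moment_Phi s n p : 0 < Re s -> is_Cderive (Phi s) (INR n) p ->
  ((s + 1) * moment_term s n - s * (RtoC (PI / 2) * RtoC (PI / 2) * p) =
   2 * (tele_deriv s n - tele_deriv s (S n)))%C.
Proof.
  intros Hs Hp. destruct n as [|n].
  - unfold tele_deriv. simpl INR in *. rewrite moment_term_0.
    assert (Hid : forall z : C, is_Cderive (fun t => RtoC t + z)%C 0 1%C).
    { intros z. eapply is_Cderive_eq; [apply is_Cderive_plus; [apply is_Cderive_id|apply is_Cderive_const]|ring]. }
    assert (Hid2 : is_Cderive (fun t => RtoC t * RtoC t - 1 / 4)%C 0 0%C).
    { eapply is_Cderive_eq; [apply is_Cderive_minus; [apply is_Cderive_mult; apply is_Cderive_id|apply is_Cderive_const]|ring]. }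
    assert (HY : exists y, is_Cderive (fun t => mu (RtoC (/ 2) + RtoC t) * mu (s + RtoC t))%C 0 y).
    { eexists. apply is_Cderive_mult; apply is_Cderive_mu; rewrite Re_plus, !Re_RtoC; lra. }
    destruct HY as [y HY].
    assert (HL : is_Cderive (fun t => (s + 1) * (RtoC t * (RtoC t + 1) * (mu (RtoC (/ 2) + RtoC t) * mu (s + RtoC t))) -
      (RtoC t * RtoC t - 1 / 4) * (s * (RtoC (PI / 2) * RtoC (PI / 2) * Phi s t)))%C 0
      ((s + 1) * (mu (RtoC (/ 2)) * mu s) + / 4 * (s * (RtoC (PI / 2) * RtoC (PI / 2) * p)))%C).
    { eapply is_Cderive_eq.
      - apply is_Cderive_minus.
        + apply is_Cderive_mult; [apply is_Cderive_const|].
          apply is_Cderive_mult; [apply is_Cderive_mult; [apply is_Cderive_id|apply Hid]|exact HY].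
        + apply is_Cderive_mult; [exact Hid2|]. apply is_Cderive_mult; [apply is_Cderive_const|].
          apply is_Cderive_mult; [apply is_Cderive_const|exact Hp].
      - cbv beta. rewrite !Cplus_0_r. field. }
    assert (HR : is_Cderive (fun t => 2 * (RtoC t * (RtoC t * ((RtoC t + 1) * (s + RtoC t + 1 / 2) *
      (mu (RtoC (/ 2) + RtoC t) * mu (s + RtoC t))))) - 2 * ((RtoC t * RtoC t - 1 / 4) * tele s (t + 1)))%C 0
      (/ 2 * dtele s (0 + 1))%C).
    { eapply is_Cderive_eq.
      - apply is_Cderive_minus.
        + apply is_Cderive_mult; [apply is_Cderive_const|].
          apply is_Cderive_mult; [apply is_Cderive_id|]. apply is_Cderive_mult; [apply is_Cderive_id|].
          apply is_Cderive_mult; [|exact HY]. apply is_Cderive_mult; [apply Hid|].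
          apply is_Cderive_plus; [apply is_Cderive_plus; [apply is_Cderive_const|apply is_Cderive_id]|apply is_Cderive_const].
        + apply is_Cderive_mult; [apply is_Cderive_const|].
          apply is_Cderive_mult; [exact Hid2|]. apply is_Cderive_tele_succ; [lra|exact Hs].
      - cbv beta. field. }
    assert (E : ((s + 1) * (mu (RtoC (/ 2)) * mu s) + / 4 * (s * (RtoC (PI / 2) * RtoC (PI / 2) * p)))%C =
      (/ 2 * dtele s (0 + 1))%C).
    { apply (is_Cderive_unique _ _ _ _ HL). apply is_Cderive_ext_loc with (2 := HR).
      assert (Hd : 0 < Rmin (/ 2) (Re s)) by (apply Rmin_pos; lra).
      exists (mkposreal _ Hd). intros t Ht.
      assert (Ht' : Rabs (t - 0) < Rmin (/ 2) (Re s)) by exact Ht. rewrite Rminus_0_r in Ht'. apply Rabs_def2 in Ht'.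
      assert (B1 := Rmin_l (/ 2) (Re s)). assert (B2 := Rmin_r (/ 2) (Re s)).
      symmetry. apply tele_eq_0; lra. }
    rewrite Rplus_0_l in E.
    (* [tele_eq_0] carries the factor t^2 - 1/4, equal to -1/4 at t = 0 and of derivative 0 there;
       multiplying by -4 undoes it. *)
    transitivity (- (4) * ((s + 1) * (mu (RtoC (/ 2)) * mu s) + / 4 * (s * (RtoC (PI / 2) * RtoC (PI / 2) * p))))%C;
      [field|].
    rewrite E. field.
  - set (x := INR (S n)) in *. assert (Hx : 1 <= x) by (apply (le_INR 1); lia).
    assert (HL : is_Cderive (fun t => (s + 1) * (mu (RtoC (- / 2) + RtoC t) * mu (s + RtoC t)) -
      s * (RtoC (PI / 2) * RtoC (PI / 2) * Phi s t))%C x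
      ((s + 1) * moment_term s (S n) - s * (RtoC (PI / 2) * RtoC (PI / 2) * p))%C).
    { eapply is_Cderive_eq.
      - apply is_Cderive_minus.
        + apply is_Cderive_mult; [apply is_Cderive_const|].
          apply is_Cderive_mult; apply is_Cderive_mu; rewrite Re_plus, !Re_RtoC; lra.
        + apply is_Cderive_mult; [apply is_Cderive_const|].
          apply is_Cderive_mult; [apply is_Cderive_const|exact Hp].
      - cbv beta. rewrite moment_term_succ. fold x. ring. }
    assert (HR : is_Cderive (fun t => 2 * (tele s t - tele s (t + 1)))%C x (2 * (dtele s x - dtele s (x + 1)))%C).
    { eapply is_Cderive_eq.
      - apply is_Cderive_mult; [apply is_Cderive_const|]. apply is_Cderive_minus.
        + apply is_Cderive_tele; lra.
        + apply is_Cderive_tele_succ; lra.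
      - cbv beta. ring. }
    unfold tele_deriv. rewrite (S_INR (S n)). fold x.
    apply (is_Cderive_unique _ _ _ _ HL). apply is_Cderive_ext_loc with (2 := HR).
    assert (Hd : 0 < / 2) by lra. exists (mkposreal _ Hd). intros t Ht.
    assert (Ht' : Rabs (t - x) < / 2) by exact Ht. apply Rabs_def2 in Ht'.
    symmetry. apply tele_eq; lra.
Qed.

Lemma Cmod_mult_le (x y : C) a b : Cmod x <= a -> Cmod y <= b -> Cmod (x * y)%C <= a * b.
Proof. intros Hx Hy. rewrite Cmod_mult. apply Rmult_le_compat; auto; apply Cmod_ge_0. Qed.

Lemma Cmod_plus_le (x y : C) a b : Cmod x <= a -> Cmod y <= b -> Cmod (x + y)%C <= a + b.
Proof. intros Hx Hy. eapply Rle_trans; [apply Cmod_triangle|]. lra. Qed.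

(** With mu = O(1 / N) and mu' = O(1 / N^2), a linear factor meets N^(-2) and a quadratic one
    N^(-3), so 1 / N is left. The constant 17 is 1 + 8 + 8. *)
Lemma dtele_bound s N : 0 < Re s -> 1 <= N -> Cmod (dtele s N) <= 17 * PI ^ 2 * (Cmod s + 3) / N.
Proof.
  intros Hs HN. assert (Hpi := PI_RGT_0). assert (Hcs := Cmod_ge_0 s).
  assert (Hmu : forall u, N / 2 <= Re u -> Cmod (mu u) <= PI / N /\ Cmod (mu1 u) <= 8 * PI / N ^ 2).
  { intros u Hu. assert (Hu0 : 0 < Re u) by lra. split.
    - eapply Rle_trans; [apply mu_bound; exact Hu0|].
      replace (PI / N) with (PI / 2 / (N / 2)) by (field; lra).
      apply Rmult_le_compat_l; [lra|]. apply Rinv_le_contravar; lra.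
    - eapply Rle_trans; [apply mu1_bound; exact Hu0|].
      replace (8 * PI / N ^ 2) with (2 * PI * / (N / 2) ^ 2) by (field; lra).
      apply Rmult_le_compat_l; [lra|]. apply Rinv_le_contravar; [apply pow_lt; lra|]. apply pow_incr. lra. }
  destruct (Hmu (RtoC (- / 2) + RtoC N)%C) as [A1 A2]; [rewrite Re_plus, !Re_RtoC; lra|].
  destruct (Hmu (s + RtoC N)%C) as [B1 B2]; [rewrite Re_plus, !Re_RtoC; lra|].
  assert (C1 : Cmod (s + 2 * RtoC N + 1 / 2)%C <= (Cmod s + 3) * N).
  { apply Rle_trans with (Cmod s + 2 * N + / 2); [|nra].
    apply Cmod_plus_le; [apply Cmod_plus_le; [apply Rle_refl|]|].
    - apply Cmod_mult_le; rewrite Cmod_R, Rabs_pos_eq; lra.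
    - rewrite C_half, Cmod_R, Rabs_pos_eq; lra. }
  assert (C2 : Cmod (RtoC N * (s + RtoC N + 1 / 2))%C <= N * ((Cmod s + 3) * N)).
  { apply Cmod_mult_le; [rewrite Cmod_R, Rabs_pos_eq; lra|]. apply Rle_trans with (Cmod s + N + / 2); [|nra].
    apply Cmod_plus_le; [apply Cmod_plus_le; [apply Rle_refl|rewrite Cmod_R, Rabs_pos_eq; lra]|].
    rewrite C_half, Cmod_R, Rabs_pos_eq; lra. }
  apply Rle_trans with ((Cmod s + 3) * N * (PI / N * (PI / N)) +
    N * ((Cmod s + 3) * N) * (8 * PI / N ^ 2 * (PI / N) + PI / N * (8 * PI / N ^ 2))).
  - unfold dtele. apply Cmod_plus_le; apply Cmod_mult_le; auto.
    + now apply Cmod_mult_le.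
    + apply Cmod_plus_le; now apply Cmod_mult_le.
  - apply Req_le. field. lra.
Qed.

Lemma tele_deriv_lim s : 0 < Re s -> is_Clim (fun n => tele_deriv s (S n)) (RtoC 0).
Proof.
  intros Hs. apply is_Clim_abs with (fun n => 17 * PI ^ 2 * (Cmod s + 3) * / INR (S n)).
  - intros n. replace (tele_deriv s (S n) - RtoC 0)%C with (dtele s (INR (S n))) by (unfold tele_deriv; ring).
    apply dtele_bound; [exact Hs|]. apply (le_INR 1). lia.
  - replace (Finite 0) with (Rbar_mult (17 * PI ^ 2 * (Cmod s + 3)) 0) by (simpl; f_equal; ring).
    apply is_lim_seq_scal_l. apply (is_lim_seq_incr_1 (fun n => / INR n)). apply is_lim_seq_inv_INR.
Qed.

Lemma is_Cseries_telescope (d : nat -> C) l : is_Clim (fun n => d (S n)) (RtoC 0) ->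
  is_Cseries (fun n => d n - d (S n))%C l -> l = d O.
Proof.
  intros Hd Hl. assert (H := is_Clim_Cseries _ _ Hl).
  apply (is_Clim_unique _ _ _ H). apply is_Clim_ext with (fun n => d O + RtoC (-1) * d (S n))%C.
  - intros n. apply C_ext.
    + induction n as [|n IH].
      * rewrite Re_plus, Re_mult, Re_RtoC, Im_RtoC. cbn [fst Re]. rewrite sum_O. unfold Cminus. rewrite Re_plus, Re_opp. ring.
      * cbn [fst Re] in IH |- *. rewrite sum_n_succ, <- IH. unfold Cminus. rewrite !Re_plus, !Re_opp, !Re_mult, !Re_RtoC, !Im_RtoC. ring.
    + induction n as [|n IH].
      * rewrite Im_plus, Im_mult, Re_RtoC, Im_RtoC. cbn [snd Im]. rewrite sum_O. unfold Cminus. rewrite Im_plus, Im_opp. ring.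
      * cbn [snd Im] in IH |- *. rewrite sum_n_succ, <- IH. unfold Cminus. rewrite !Im_plus, !Im_opp, !Im_mult, !Re_RtoC, !Im_RtoC. ring.
  - apply is_Clim_eq with (d O + RtoC (-1) * RtoC 0)%C; [|ring].
    apply is_Clim_plus; [apply is_Clim_const|]. apply is_Clim_mult; [apply is_Clim_const|exact Hd].
Qed.

Lemma moment_series_Phi s (phi : nat -> C) T : 0 < Re s -> (forall n, is_Cderive (Phi s) (INR n) (phi n)) ->
  is_Cseries phi T ->
  ((s + 1) * CSeries (moment_term s) = s * (RtoC (PI / 2) * RtoC (PI / 2) * T))%C.
Proof.
  intros Hs Hphi HT. destruct (is_I_Hint_sq s Hs) as [HV _].
  set (V := CSeries (moment_term s)) in *.
  assert (H : is_Cseries (fun n => tele_deriv s n - tele_deriv s (S n))%C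
    (/ 2 * ((s + 1) * V) + - / 2 * (s * (RtoC (PI / 2) * RtoC (PI / 2)) * T))%C).
  { apply is_Cseries_ext with (fun n => / 2 * ((s + 1) * moment_term s n) +
      - / 2 * (s * (RtoC (PI / 2) * RtoC (PI / 2)) * phi n))%C.
    - intros n. transitivity (/ 2 * ((s + 1) * moment_term s n - s * (RtoC (PI / 2) * RtoC (PI / 2) * phi n)))%C; [ring|].
      rewrite (moment_Phi s n (phi n) Hs (Hphi n)). field.
    - apply is_Cseries_plus; apply is_Cseries_scal; [now apply is_Cseries_scal|now apply is_Cseries_scal]. }
  apply is_Cseries_telescope in H; [|now apply tele_deriv_lim].
  change (tele_deriv s 0) with (RtoC 0) in H.
  transitivity (2 * (/ 2 * ((s + 1) * V) + - / 2 * (s * (RtoC (PI / 2) * RtoC (PI / 2)) * T)) +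
    s * (RtoC (PI / 2) * RtoC (PI / 2) * T))%C; [field|]. rewrite H. ring.
Qed.

(** * The substitution w = x^2 and the comparison of constants *)

Lemma is_RInt_square (f : R -> R) x : 0 < x < 1 -> (forall w, 0 < w -> continuous f w) ->
  is_RInt (fun y => y * f (y ^ 2)) x 1 (/ 2 * RInt f (x ^ 2) 1).
Proof.
  intros Hx Hf.
  assert (H : is_RInt (fun y => scal (2 * y) (f (y ^ 2))) x 1 (RInt f (x ^ 2) (1 ^ 2))).
  { apply (is_RInt_comp (V := R_CompleteNormedModule) f (fun y => y ^ 2) (fun y => 2 * y)).
    - rewrite Rmin_left, Rmax_right by lra. intros y Hy. apply Hf. apply pow_lt. lra.
    - intros y _. split.
      + auto_derive; [exact I|]. ring.
      + apply (ex_derive_continuous (V := R_NormedModule)). now auto_derive. }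
  rewrite pow1 in H. apply (is_RInt_scal _ _ _ (/ 2)) in H.
  apply is_RInt_ext with (2 := H). intros y _. unfold scal; simpl. unfold mult; simpl. eqR. field.
Qed.

Lemma is_CRInt_square s x : 0 < x < 1 ->
  is_CRInt (fun y => Rcpow y (2 * s - 1) * RtoC (ellipticE' y) ^ 2)%C x 1
    (RtoC (/ 2) * CI (fun w => Rcpow w (s - 1) * RtoC (Hint w * Hint w)) (x ^ 2)%R)%C.
Proof.
  intros Hx. set (g := fun w => (Rcpow w (s - 1) * RtoC (Hint w * Hint w))%C).
  assert (Hg : Ccont_pos g) by apply Ccont_Hint_sq.
  apply is_CRInt_ext with (fun y => RtoC y * g (y ^ 2)%R)%C; [lra| |].
  - intros y Hy. unfold g. rewrite (ellipticE'_Hint y) by lra.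
    assert (E : Rcpow (y ^ 2) (s - 1) = Rcpow y (2 * (s - 1))).
    { unfold Rcpow. f_equal. rewrite ln_pow by lra. rewrite RtoC_mult. simpl INR.
      replace (RtoC (1 + 1)) with (RtoC 2) by (f_equal; ring). ring. }
    rewrite E. replace (2 * s - 1)%C with (2 * (s - 1) + 1)%C by ring. rewrite Rcpow_plus, Rcpow_1 by lra.
    rewrite RtoC_mult. ring.
  - assert (H1 := is_RInt_square (fun w => Re (g w)) x Hx (fun w Hw => proj1 (Hg w Hw))).
    assert (H2 := is_RInt_square (fun w => Im (g w)) x Hx (fun w Hw => proj2 (Hg w Hw))).
    split.
    + replace (Re (RtoC (/ 2) * CI g (x ^ 2)%R)%C) with (/ 2 * RInt (fun w => Re (g w)) (x ^ 2) 1).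
      * apply is_RInt_ext with (2 := H1). intros y _. rewrite Re_mult, Re_RtoC, Im_RtoC. eqR. ring.
      * rewrite Re_mult, Re_RtoC, Im_RtoC. unfold CI. cbn [fst snd Re Im]. ring.
    + replace (Im (RtoC (/ 2) * CI g (x ^ 2)%R)%C) with (/ 2 * RInt (fun w => Im (g w)) (x ^ 2) 1).
      * apply is_RInt_ext with (2 := H2). intros y _. rewrite Im_mult, Re_RtoC, Im_RtoC. eqR. ring.
      * rewrite Im_mult, Re_RtoC, Im_RtoC. unfold CI. cbn [fst snd Re Im]. ring.
Qed.

Lemma is_RInt_gen_ellipticE'_sq s : 0 < Re s ->
  is_RInt_gen (V := C_R_NormedModule)
    (fun x : R => (Rcpow x (2 * s - 1) * RtoC (ellipticE' x) ^ 2)%C)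
    (at_right 0) (at_point 1) (RtoC (/ 2) * (RtoC (/ alp 0) * CSeries (moment_term s)))%C.
Proof.
  intros Hs. destruct (is_I_Hint_sq s Hs) as [_ [_ HI]].
  set (g := fun w => (Rcpow w (s - 1) * RtoC (Hint w * Hint w))%C) in *.
  set (l := (RtoC (/ alp 0) * CSeries (moment_term s))%C) in *.
  intros P [eps HP]. destruct (HI eps (cond_pos eps)) as (d & Hd & Hb).
  assert (Hm : 0 < Rmin 1 d) by (apply Rmin_pos; lra).
  assert (Hm1 := Rmin_l 1 d). assert (Hm2 := Rmin_r 1 d).
  apply (Filter_prod _ _ _ (fun x => 0 < x < Rmin 1 d) (fun y => y = 1)).
  - exists (mkposreal _ Hm). intros x Hx Hx0. assert (Hx' : Rabs (x - 0) < Rmin 1 d) by exact Hx.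
    rewrite Rminus_0_r in Hx'. apply Rabs_def2 in Hx'. lra.
  - reflexivity.
  - intros x y Hx ->. exists (RtoC (/ 2) * CI g (x ^ 2)%R)%C. split.
    + destruct (is_CRInt_square s x ltac:(lra)) as [A B].
      assert (H := is_RInt_fct_extend_pair (U := R_NormedModule) (V := R_NormedModule) _ x 1 _ _ A B).
      exact H.
    + apply HP. assert (Hx2 : 0 < x ^ 2 < d).
      { split; [apply pow_lt; lra|]. simpl. nra. }
      assert (Hc := Hb (x ^ 2) Hx2 ltac:(simpl; nra)).
      assert (Hlt : Cmod (RtoC (/ 2) * CI g (x ^ 2)%R - RtoC (/ 2) * l)%C < eps).
      { replace (RtoC (/ 2) * CI g (x ^ 2)%R - RtoC (/ 2) * l)%C with (RtoC (/ 2) * (CI g (x ^ 2)%R - l))%C by ring.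
        rewrite Cmod_mult, Cmod_R, Rabs_pos_eq by lra. assert (H := Cmod_ge_0 (CI g (x ^ 2)%R - l)). lra. }
      split.
      * eapply Rle_lt_trans; [|exact Hlt]. exact (re_le_Cmod (RtoC (/ 2) * CI g (x ^ 2)%R - RtoC (/ 2) * l)%C).
      * eapply Rle_lt_trans; [|exact Hlt]. exact (im_le_Cmod (RtoC (/ 2) * CI g (x ^ 2)%R - RtoC (/ 2) * l)%C).
Qed.

Theorem theorem3p6 :
  forall s : C, (0 < Re s)%R ->
    is_RInt_gen (V := C_R_NormedModule)
      (fun x : R => (Rcpow x (2 * s - 1) * RtoC (ellipticE' x) ^ 2)%C)
      (at_right 0) (at_point 1)
      (RtoC (PI ^ 3 / 8) *
       (CGamma s * CGamma (s + 1) ^ 2 * CGamma (s + 2)) *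
       L (s + 2) s (1 / 2) (1 / 2) 1 (s + 3 / 2) (s + 3 / 2))%C.
Proof.
  intros s Hs. destruct (L_value s Hs) as (phi & T & Hphi & HT & HL).
  assert (HV := moment_series_Phi s phi T Hs Hphi HT).
  match goal with |- is_RInt_gen _ _ _ ?v =>
    replace v with (RtoC (/ 2) * (RtoC (/ alp 0) * CSeries (moment_term s)))%C;
    [now apply is_RInt_gen_ellipticE'_sq|] end.
  set (V := CSeries (moment_term s)) in *. set (ell := L _ _ _ _ _ _ _) in *. clearbody V ell.
  assert (Hpi := PI_RGT_0).
  unfold gamma_prefactor, gamma_even in HL. rewrite !Rmult_0_r, !Cplus_0_r in HL.
  rewrite CGamma_half_sq in HL.
  assert (R1 : 0 < Re (s + 1)%C) by (rewrite Re_plus, Re_RtoC; lra).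
  replace (s + 2)%C with (s + 1 + 1)%C in * by ring.
  rewrite (CGamma_succ (s + 1)), (CGamma_succ s) in * by assumption.
  assert (G := CGamma_neq_0 s Hs). set (g := CGamma s) in *.
  assert (N0 := Re_pos_neq_0 s Hs). assert (N1 := Re_pos_neq_0 _ R1). assert (NP : RtoC PI <> 0%C) by (apply RtoC_neq_0; lra).
  clearbody g. rewrite alp_0.
  replace (RtoC (/ - PI ^ 2)) with (- / (RtoC PI * RtoC PI))%C.
  2: { rewrite RtoC_inv by nra. replace (- PI ^ 2) with (- (PI * PI)) by ring. rewrite RtoC_opp, RtoC_mult. field. exact NP. }
  replace (RtoC (PI ^ 3 / 8)) with (RtoC PI * RtoC PI * RtoC PI / 8)%C.
  2: { rewrite RtoC_div by lra. replace (PI ^ 3) with (PI * PI * PI) by ring. now rewrite !RtoC_mult. }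
  rewrite RtoC_div in HV by lra. rewrite RtoC_inv by lra.
  set (p := RtoC PI) in *. clearbody p.
  assert (EV : V = (s * (p / 2 * (p / 2) * T) / (s + 1))%C).
  { rewrite <- HV. field. exact N1. }
  (* One factor pi is set aside to form pi L, which [HL] evaluates. With Gamma(s + 2) = (s + 1) s
     Gamma(s) both sides become - s T / (8 (s + 1)). *)
  transitivity (p * p / 8 * (g * (s * g) ^ 2 * ((s + 1) * (s * g))) * (p * ell))%C; [|field].
  rewrite HL, EV. field. repeat split; assumption.
Qed.
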